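(* Let $x_0\in\Gamma$ and $r>0$ be given, and let $X_0=A_r(x_0)\in\Omega$ be a corkscrew point. Let $E,F\subset\Gamma\cap B(x_0,r)$ be two Borel subsets of $\Gamma$ such that $\omega^{X_0}(E)$ and $\omega^{X_0}(F)$ are positive. Then $$C^{-1}\frac{\omega^{X_0}(E)}{\omega^{X_0}(F)}\le\frac{\omega^X(E)}{\omega^X(F)}\le C\frac{\omega^{X_0}(E)}{\omega^{X_0}(F)}\quad\text{for }X\in\Omega\setminus B(x_0,2r),$$ where $C>0$ depends only on $n$, $d$, $C_0$ and $C_1$. In particular, with the choice $F=B(x_0,r)\cap\Gamma$, $$C^{-1}\omega^{X_0}(E)\le\frac{\omega^X(E)}{\omega^X(B(x_0,r)\cap\Gamma)}\le C\,\omega^{X_0}(E)\quad\text{for }X\in\Omega\setminus B(x_0,2r),$$ where again $C>0$ depends only on $n$, $d$, $C_0$ and $C_1$.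
   Context: Let $n\ge2$ and let $0<d<n-1$ be a real number. $\Gamma\subset\mathbb R^n$ is a nonempty closed set which is Ahlfors regular of dimension $d$: there is $C_0\ge1$ with $C_0^{-1}r^d\le\mathcal H^d(\Gamma\cap B(x,r))\le C_0r^d$ for all $x\in\Gamma$, $r>0$. Set $\Omega=\mathbb R^n\setminus\Gamma$, $\sigma=\mathcal H^d|_\Gamma$, $\delta(z)=\operatorname{dist}(z,\Gamma)$ and $w(z)=\delta(z)^{d+1-n}$. $W=\{u\in L^1_{loc}(\Omega):\nabla u\in L^2(\Omega,w)\}$ (distributional gradient in $\Omega$; $L^2(\Omega,w)=L^2(\Omega,w\,dz)$); every $u\in W$ lies in $L^1_{loc}(\mathbb R^n)$. The trace of $u\in W$ is $Tu(x)=\lim_{r\to0}\frac1{|B(x,r)|}\int_{B(x,r)}u\,dz$, which exists for $\sigma$-a.e. $x\in\Gamma$; $W_0=\{u\in W:Tu=0\}$. $H$ is the space of measurable $g$ on $\Gamma$ with $\int_\Gamma\int_\Gamma\frac{|g(x)-g(y)|^2}{|x-y|^{d+1}}\,d\sigma(x)\,d\sigma(y)<\infty$. $A:\Omega\to M_n(\mathbb R)$ is measurable and satisfies, for some $C_1\ge1$, $|A(x)\xi\cdot\zeta|\le C_1w(x)|\xi||\zeta|$ and $A(x)\xi\cdot\xi\ge C_1^{-1}w(x)|\xi|^2$ for all $x\in\Omega$, $\xi,\zeta\in\mathbb R^n$; $L=-\operatorname{div}A\nabla$. Harmonic measure: let $C_0^0(\Gamma)$ be the compactly supported continuous functions on $\Gamma$.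 For $g\in C_0^0(\Gamma)\cap H$ there is a unique $u=Ug\in W$ with $\int_\Omega A\nabla u\cdot\nabla v\,dz=0$ for all $v\in W_0$ and $Tu=g$ $\sigma$-a.e.; it has a continuous representative on $\mathbb R^n$ equal to $g$ on $\Gamma$. The map $U$ extends uniquely to a linear operator $U:C_0^0(\Gamma)\to C^0(\mathbb R^n)$ bounded for the sup norms. For $X\in\Omega$, $\omega^X$ is the unique positive regular Borel measure on $\Gamma$ with $Ug(X)=\int_\Gamma g\,d\omega^X$ for all $g\in C_0^0(\Gamma)$; it is a probability measure. Corkscrew points: there is $\epsilon>0$, depending only on $d,n,C_0$ and fixed once and for all, such that for all $x_0\in\Gamma$, $r>0$ there is a point of $\Omega$, denoted $A_r(x_0)$ (any such point may be chosen), with $|A_r(x_0)-x_0|\le r$ and $\delta(A_r(x_0))\ge\epsilon r$. *)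

(* Defs.v *)
(* MathComp-Analysis, over an abstract realType R. *)
From HB Require Import structures.
From mathcomp Require Import all_boot all_order all_algebra.
From mathcomp Require Import all_classical all_reals all_analysis.
Set Implicit Arguments.
Unset Strict Implicit.
Unset Printing Implicit Defensive.
Import Order.TTheory GRing.Theory Num.Theory.
Import numFieldNormedType.Exports.
Local Open Scope classical_set_scope.
Local Open Scope ring_scope.

(* R^n is 'rV[R]_n. The library norm on 'rV[R]_n is the sup norm: it is used  *)
(* only for the topology (open, closed, compact, continuous, derivatives);    *)
(* every distance and every ball below is Euclidean.                          *)

Section euclidean.
Context {R : realType} {n : nat}.
Implicit Types x y z : 'rV[R]_n.

Definition dot x y : R := \sum_(i < n) x 0 i * y 0 i.

Definition enorm x : R := Num.sqrt (dot x x).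

Definition eball x (r : R) : set 'rV[R]_n := [set y | enorm (y - x) < r].

Definition ediam (A : set 'rV[R]_n) : \bar R :=
  ereal_sup [set (enorm (x - y))%:E | x in A & y in A].

Definition dist_to (G : set 'rV[R]_n) z : R := inf [set enorm (z - y) | y in G].

Definition mxact (M : 'M[R]_n) x : 'rV[R]_n := (M *m x^T)^T.

End euclidean.

(* A copy of T on which every set is measurable, so that for a set function   *)
(* mu the library's mu_ext mu X is the infimum of \sum_k mu (F k) over all    *)
(* countable covers F of X. Restrictions on the sets F k are expressed by     *)
(* letting mu be +oo on the excluded sets.                                    *)
Definition allsets (T : Type) : Type := T.

HB.instance Definition _ (T : pointedType) := Pointed.on (allsets T).
HB.instance Definition _ (T : pointedType) :=
  @isMeasurable.Build default_measure_display (allsets T) setT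
    I (fun _ _ => I) (fun _ _ => I).

Section lebesgue_outer.
Context (R : realType) (n : nat).
Local Notation E := 'rV[R]_n.
Local Open Scope ereal_scope.

(* Least volume of a closed box containing A. The separate case of set0 only  *)
(* matters when n = 0.                                                        *)
Definition box_volume (A : set E) : \bar R :=
  if A == set0 then 0 else
  ereal_inf [set (\prod_(i < n) (ab.2 0%R i - ab.1 0%R i))%R%:E | ab in
    [set ab : E * E | (forall i, (ab.1 0%R i <= ab.2 0%R i)%R) /\
      forall x, A x -> forall i, (ab.1 0%R i <= x 0%R i <= ab.2 0%R i)%R]].

Lemma box_volume0 : box_volume set0 = 0.
Proof. by rewrite /box_volume eqxx. Qed.

Lemma box_volume_ge0 A : 0 <= box_volume A.
Proof.
rewrite /box_volume; case: ifP => // _.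
apply: le_ereal_inf_tmp => _ [ab [le_ab _] <-]; rewrite lee_fin.
by apply: prodr_ge0 => i _; rewrite subr_ge0.
Qed.

Definition lebesgue_outer : set E -> \bar R := @mu_ext _ (allsets E) R box_volume.

HB.instance Definition _ := isOuterMeasure.Build R E lebesgue_outer
  (@mu_ext0 _ (allsets E) R box_volume box_volume0 box_volume_ge0)
  (@mu_ext_ge0 _ (allsets E) R box_volume box_volume_ge0)
  (@le_mu_ext _ (allsets E) R box_volume)
  (@mu_ext_sigma_subadditive _ (allsets E) R box_volume box_volume_ge0).

End lebesgue_outer.

Section hausdorff_outer.
Context (R : realType) (n : nat) (d : R).
Local Notation E := 'rV[R]_n.
Local Open Scope ereal_scope.

(* The separate case of set0 only matters when d = 0.                         *)
Definition diam_gauge (delta : R) (A : set E) : \bar R :=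
  if A == set0 then 0 else
  if ediam A <= delta%:E then poweR (ediam A) d else +oo.

Lemma diam_gauge0 delta : diam_gauge delta set0 = 0.
Proof. by rewrite /diam_gauge eqxx. Qed.

Lemma diam_gauge_ge0 delta A : 0 <= diam_gauge delta A.
Proof.
rewrite /diam_gauge; case: ifP => // _; case: ifP => // _; exact: poweR_ge0.
Qed.

Definition hausdorff_pre (delta : R) : set E -> \bar R :=
  @mu_ext _ (allsets E) R (diam_gauge delta).

(* No normalising constant: the cover sums are those of (diam F_k)^d.         *)
Definition hausdorff_outer (A : set E) : \bar R :=
  ereal_sup [set hausdorff_pre delta A | delta in [set delta : R | (0 < delta)%R]].

Lemma hausdorff_outer_ge0 A : 0 <= hausdorff_outer A.
Proof.
apply: (@le_trans _ _ (hausdorff_pre 1 A)).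
  exact: (@mu_ext_ge0 _ (allsets E) R _ (diam_gauge_ge0 1)).
by apply: ereal_sup_ubound; exists 1%R => //=.
Qed.

Lemma hausdorff_outer0 : hausdorff_outer set0 = 0.
Proof.
apply/eqP; rewrite eq_le hausdorff_outer_ge0 andbT.
apply: ge_ereal_sup => _ [delta _ <-]; rewrite /hausdorff_pre.
by rewrite (@mu_ext0 _ (allsets E) R _ (diam_gauge0 delta) (diam_gauge_ge0 delta)).
Qed.

Lemma le_hausdorff_outer : {homo hausdorff_outer : A B / A `<=` B >-> A <= B}.
Proof.
move=> A B AB; apply: ge_ereal_sup => _ [delta delta0 <-].
apply: (@le_trans _ _ (hausdorff_pre delta B)).
  exact: (@le_mu_ext _ (allsets E) R).
by apply: ereal_sup_ubound; exists delta.
Qed.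

Lemma hausdorff_outer_sigma_subadditive : sigma_subadditive hausdorff_outer.
Proof.
move=> F; apply: ge_ereal_sup => _ [delta delta0 <-].
apply: (le_trans (@mu_ext_sigma_subadditive _ (allsets E) R _
  (diam_gauge_ge0 delta) F)).
apply: lee_nneseries => i _.
  by move=> _; exact: (@mu_ext_ge0 _ (allsets E) R _ (diam_gauge_ge0 delta)).
by apply: ereal_sup_ubound; exists delta.
Qed.

HB.instance Definition _ := isOuterMeasure.Build R E hausdorff_outer
  hausdorff_outer0 hausdorff_outer_ge0 le_hausdorff_outer
  hausdorff_outer_sigma_subadditive.

End hausdorff_outer.

Definition lebesgue_om (R : realType) (n : nat) :
  {outer_measure set 'rV[R]_n -> \bar R} := @lebesgue_outer R n.

Definition hausdorff_om (R : realType) (n : nat) (d : R) :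
  {outer_measure set 'rV[R]_n -> \bar R} := @hausdorff_outer R n d.

(* Three measurable structures on R^n: the Lebesgue measurable sets and the   *)
(* H^d measurable sets (both in the sense of Caratheodory), and the Borel     *)
(* sets.                                                                      *)
Notation lebT R n := (caratheodory_type (lebesgue_om R n)).
Notation hausT n d := (caratheodory_type (hausdorff_om n d)).
Notation borelT R n := (g_sigma_algebraType (@open 'rV[R]_n)).

Definition leb (R : realType) (n : nat) : {measure set (lebT R n) -> \bar R} :=
  lebesgue_om R n.

Definition haus (R : realType) (n : nat) (d : R) :
    {measure set (hausT n d) -> \bar R} :=
  hausdorff_om n d.

Section weighted_sobolev.
Context {R : realType} {n : nat}.
Local Notation E := 'rV[R]_n.

Fixpoint Ck (k : nat) (f : E -> R) : Prop :=
  if k is k'.+1 then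
    forall i : 'I_n, (forall x, derivable f x (delta_mx 0 i)) /\
      Ck k' (fun x => 'D_(delta_mx 0 i) f x)
  else continuous f.

Definition test_function (O : set E) (phi : E -> R) : Prop :=
  (forall k, Ck k phi) /\
  exists K, [/\ compact K, K `<=` O & forall x, ~ K x -> phi x = 0].

Definition L1loc (O : set E) (f : E -> R) : Prop :=
  forall K : set (lebT R n), compact (K : set E) -> K `<=` O ->
    (leb R n).-integrable K (EFin \o f).

(* g is the distributional gradient of u in O.                                *)
Definition weak_gradient (O : set E) (u : E -> R) (g : E -> E) : Prop :=
  forall i : 'I_n, L1loc O (fun x => g x 0 i) /\
    forall phi, test_function O phi ->
      \int[leb R n]_(z in O) (u z * 'D_(delta_mx 0 i) phi z) =
      - \int[leb R n]_(z in O) (g z 0 i * phi z).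

Variables (Gamma : set E) (d : R).
Local Notation Omega := (~` Gamma).

Definition weight (z : E) : R := (dist_to Gamma z) `^ (d + 1 - n%:R).

(* Elements of W are represented by functions on R^n; their values on Gamma,  *)
(* which is Lebesgue null in the situation considered, play no role.          *)
Definition in_W (u : E -> R) : Prop :=
  L1loc Omega u /\
  exists2 g, weak_gradient Omega u g &
    (\int[leb R n]_(z in Omega) (enorm (g z) ^+ 2 * weight z)%:E < +oo)%E.

Definition has_trace (u : E -> R) (x : E) (l : R) : Prop :=
  (fun r : R => (\int[leb R n]_(z in eball x r) u z) /
                fine (leb R n (eball x r))) @ 0^'+ --> l.

Definition trace_eq (u g : E -> R) : Prop :=
  {ae haus n d, forall x, Gamma x -> has_trace u x (g x)}.

Definition in_W0 (u : E -> R) : Prop := in_W u /\ trace_eq u (fun=> 0).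

(* Functions on Gamma are represented by functions on R^n; only their values  *)
(* on Gamma are ever used. The integrand is 0 on the diagonal (0 / 0 = 0).    *)
Definition in_H (g : E -> R) : Prop :=
  measurable_fun (Gamma : set (hausT n d)) g /\
  (\int[haus n d]_(x in Gamma) \int[haus n d]_(y in Gamma)
     (`|g x - g y| ^+ 2 / enorm (x - y) `^ (d + 1))%:E < +oo)%E.

Definition in_C00 (g : E -> R) : Prop :=
  {within Gamma, continuous g} /\
  exists2 K, compact K & forall x, Gamma x -> ~ K x -> g x = 0.

Definition ahlfors_regular (C0 : R) : Prop :=
  forall x r, Gamma x -> 0 < r ->
    ((C0^-1 * r `^ d)%:E <= haus n d (Gamma `&` eball x r) <=
     (C0 * r `^ d)%:E)%E.

Definition elliptic (C1 : R) (A : E -> 'M[R]_n) : Prop :=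
  [/\ forall i j, measurable_fun (Omega : set (lebT R n)) (fun x => A x i j),
      forall x xi zeta, Omega x ->
        `|dot (mxact (A x) xi) zeta| <= C1 * weight x * enorm xi * enorm zeta &
      forall x xi, Omega x ->
        C1^-1 * weight x * enorm xi ^+ 2 <= dot (mxact (A x) xi) xi].

(* The gradients are unique up to null sets, and the integrand is absolutely  *)
(* integrable when A is elliptic.                                             *)
Definition weak_solution (A : E -> 'M[R]_n) (u : E -> R) : Prop :=
  forall v gu gv, in_W0 v ->
    weak_gradient Omega u gu -> weak_gradient Omega v gv ->
    \int[leb R n]_(z in Omega) dot (mxact (A z) (gu z)) (gv z) = 0.

(* The solution operator: on C_0^0(Gamma) `&` H it is the variational         *)
(* solution (in its continuous representative on R^n), and it is linear and   *)
(* bounded for the sup norms on C_0^0(Gamma). These properties determine      *)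
(* U g for every g in C_0^0(Gamma).                                           *)
Definition harmonic_extension (A : E -> 'M[R]_n)
    (U : (E -> R) -> E -> R) : Prop :=
  [/\ forall g, in_C00 g -> continuous (U g),
      forall a g h, in_C00 g -> in_C00 h ->
        U (fun x => a * g x + h x) = (fun x => a * U g x + U h x),
      exists K, forall g M, in_C00 g -> (forall y, Gamma y -> `|g y| <= M) ->
        forall x, `|U g x| <= K * M &
      forall g, in_C00 g -> in_H g ->
        [/\ in_W (U g), weak_solution A (U g), trace_eq (U g) g &
            forall y, Gamma y -> U g y = g y]].

Definition regular_measure (mu : {measure set (borelT R n) -> \bar R}) : Prop :=
  forall B : set (borelT R n), measurable B ->
    mu B = ereal_sup [set mu K | K in [set K : set (borelT R n) |
                                  compact (K : set E) /\ K `<=` B]] /\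
    mu B = ereal_inf [set mu V | V in [set V : set (borelT R n) |
                                  open (V : set E) /\ B `<=` V]].

(* A Borel measure on Gamma is a Borel measure on R^n which does not charge   *)
(* the complement of Gamma.                                                   *)
Definition harmonic_measure (U : (E -> R) -> E -> R) (X : E)
    (mu : {measure set (borelT R n) -> \bar R}) : Prop :=
  [/\ mu Omega = 0%E, regular_measure mu &
      forall g, in_C00 g -> (\int[mu]_(y in Gamma) (g y)%:E)%E = (U g X)%:E].

Definition corkscrew_point (eps : R) (x0 : E) (r : R) (X : E) : Prop :=
  [/\ Omega X, enorm (X - x0) <= r & eps * r <= dist_to Gamma X].

End weighted_sobolev.

(* eps provides corkscrew points for all sets with the given d, n and C0.     *)
Definition corkscrew_constant (R : realType) (n : nat) (d C0 eps : R) : Prop :=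
  0 < eps /\
  forall Gamma : set 'rV[R]_n,
    Gamma !=set0 -> closed Gamma -> ahlfors_regular Gamma d C0 ->
    forall x0 r, Gamma x0 -> 0 < r -> exists X, corkscrew_point Gamma eps x0 r X.

(* Main.v *)
Require Import Defs.
From mathcomp Require Import all_boot all_order all_algebra.
From mathcomp Require Import all_classical all_reals all_analysis.
From mathcomp Require Import measurable_realfun.
From mathcomp Require Import ring lra zify.
Set Implicit Arguments.
Unset Strict Implicit.
Unset Printing Implicit Defensive.
Import Order.TTheory GRing.Theory Num.Theory.
Import numFieldNormedType.Exports.
Local Open Scope classical_set_scope.
Local Open Scope ring_scope.

(* With delta = dist(., Gamma) and w = delta^(d+1-n), the measure w dz is an A_1
   weight on boxes of bounded eccentricity, because a neighbourhood of Gamma of width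
   s has volume O(s^(n-d)). Bisecting boxes then gives weighted Poincare inequalities,
   and also the corresponding inequality for functions which vanish near Gamma on a
   box centred on Gamma. Together with the Caccioppoli inequalities for truncated
   powers and logarithms of a solution, De Giorgi's iteration yields growth lemmas,
   both inside Omega and up to Gamma, and from them the interior Harnack inequality.
   Since d < n - 1, among many parallel segments joining two corkscrew balls one stays
   away from Gamma, so Harnack chains exist.

   Let u = U f and v = U g with f, g >= 0 supported in B(x0, r). The boundary growth
   lemma gives the Carleson estimate u <= C u(X0) near Gamma in the shell
   3r/2 < |X - x0| < 5r/2. As in De Silva and Savin's proof of the boundary Harnack
   principle, M u(X0) v - v(X0) u is then nonnegative in the shell for some M: a lower
   bound -a everywhere and A a at distance >= eta rho from Gamma improves by the same
   factor when the ball shrinks by 1/2. The maximum principle carries this over to the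
   exterior of B(x0, 2r), and regularity of the measures passes from f, g to Borel
   sets. *)

(** * Volumes of boxes *)

(** All functions in play are continuous on R^n, and the analysis is arranged around this. A
    truncation [F (t x)], with [F] of class C^1 and zero above a level, vanishes near every point of
    Gamma where [t] exceeds that level; it therefore has a weak gradient across Gamma there, and
    boundary values enter pointwise. Chain and product rules come from difference quotients tested
    against compactly supported functions. The Poincare inequalities are L^1 inequalities; their L^2
    forms come from applying them to a square. De Giorgi's iteration draws its gain from a
    Faber-Krahn inequality whose constant decays geometrically in the depth of bisection; a depth
    growing linearly with the step outweighs the factors lost to shrinking radii and levels.
    Boundary data are Lipschitz with bounded support, which puts them in H. The estimate for the
    measures is kept as a product, omega^X(E) omega^X0(F) <= C omega^X0(E) omega^X(F): it passes to
    limits, and exchanging E and F gives the reverse bound. Every constant is fixed before Gamma and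
    A, hence the long quantifier prefixes. *)

Lemma half_pow_small (R : realType) (x e : R) : 0 < e ->
  exists J, forall j, (J <= j)%N -> x / 2 ^+ j < e.
Proof.
move=> e0; exists (Num.truncn (`|x| / e)).+1 => j Jj.
rewrite ltr_pdivrMr ?exprn_gt0//.
have h1 : `|x| / e < j%:R.
  apply: lt_le_trans (truncnS_gt _) _.
  by rewrite ler_nat.
have h2 : j%:R <= 2 ^+ j :> R by rewrite -natrX ler_nat ltnW// ltn_expl.
apply: le_lt_trans (ler_norm x) _.
rewrite ltr_pdivrMr// in h1; rewrite (lt_le_trans h1)// mulrC ler_wpM2l//; exact: ltW.
Qed.

Lemma nneseries_ge_term (R : realType) (u : nat -> \bar R) k : (forall k, 0 <= u k)%E ->
  (u k <= \sum_(0 <= k <oo) u k)%E.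
Proof.
move=> u0; have h := @nneseries_lim_ge R u xpredT 0%N k.+1 (fun k _ _ => u0 k).
apply: le_trans h; rewrite big_nat_recr//= leeDr// sume_ge0// => *; exact: u0.
Qed.

Section boxes.
Context {R : realType} {n : nat}.
Local Notation E := 'rV[R]_n.
Implicit Types (a s x y : E) (i j : 'I_n).

Definition upd a i (c : R) : E := \row_j (if j == i then c else a 0 j).

Lemma updE a i c j : upd a i c 0 j = if j == i then c else a 0 j.
Proof. by rewrite mxE. Qed.

Lemma prod_upd (f : 'I_n -> R -> R) s i c :
  \prod_j f j (upd s i c 0 j) = f i c * \prod_(j | j != i) f j (s 0 j).
Proof.
rewrite (bigD1 i)//= updE eqxx; congr (_ * _); apply: eq_bigr => j /negPf ji.
by rewrite updE ji.
Qed.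

(** Half-open, so that the two halves of a bisected box partition it. The closed version serves for
    compactness, the open one as a domain for test functions; [s] is the vector of side lengths. *)
Definition box a s : set E := [set y | forall i, a 0 i <= y 0 i < a 0 i + s 0 i].
Definition cbox a s : set E := [set y | forall i, a 0 i <= y 0 i <= a 0 i + s 0 i].
Definition obox a s : set E := [set y | forall i, a 0 i < y 0 i < a 0 i + s 0 i].

Lemma box_volume_le (A : set E) a (b : E) : (forall i, a 0 i <= b 0 i) ->
  (forall x, A x -> forall i, a 0 i <= x 0 i <= b 0 i) ->
  (box_volume A <= (\prod_i (b 0 i - a 0 i))%:E)%E.
Proof.
move=> ab Aab; rewrite /box_volume; case: ifPn => _.
  by rewrite lee_fin; apply: prodr_ge0 => i _; rewrite subr_ge0.
by apply: ereal_inf_lbound; exists (a, b).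
Qed.

Lemma le_box_volume (A B : set E) : A `<=` B -> (box_volume A <= box_volume B)%E.
Proof.
move=> AB; have [->|/set0P B0] := eqVneq A set0.
  by rewrite box_volume0 box_volume_ge0.
have nB0 : B != set0 by move: B0 => [x Ax]; apply/set0P; exists x; exact: AB.
rewrite {2}/box_volume ifN//.
by apply: le_ereal_inf_tmp => _ [[a b] /= [ab Bab] <-]; apply: box_volume_le => // x /AB/Bab.
Qed.

(** A hyperplane cuts a bounding box of [F] into bounding boxes of the two pieces, whose volumes add
    up. This is Caratheodory's criterion for half-spaces, one cover element at a time. *)
Lemma box_volume_split (F : set E) i (c : R) :
  (box_volume (F `&` [set y : E | (y 0 i < c)%R]) + box_volume (F `&` ~` [set y : E | (y 0 i < c)%R])
   <= box_volume F)%E.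
Proof.
set H := [set y : E | _].
have [e0|/set0P [x [Fx Hx]]] := eqVneq (F `&` H) set0.
  by rewrite e0 box_volume0 add0e le_box_volume// => z [].
have [e0|/set0P [y [Fy Hy]]] := eqVneq (F `&` ~` H) set0.
  by rewrite e0 box_volume0 adde0 le_box_volume// => z [].
rewrite {3}/box_volume ifN; last by apply/set0P; exists x.
apply: le_ereal_inf_tmp => _ [[a b] /= [ab Fab] <-].
have ac : a 0 i <= c by have /andP[h _] := Fab _ Fx i; apply: le_trans h _; apply: ltW.
have cb : c <= b 0 i.
  have /andP[_ h] := Fab _ Fy i; apply: le_trans _ h.
  by move/negP: Hy; rewrite -leNgt.
apply: (@le_trans _ _ ((\prod_j (upd b i c 0 j - a 0 j))%:E +
                       (\prod_j (b 0 j - upd a i c 0 j))%:E)%E).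
  apply: leeD.
    apply: box_volume_le => [j|z [Fz Hz] j]; rewrite updE; case: eqP => [->|_] //.
      by have /andP[-> _] := Fab _ Fz i; rewrite ltW.
    exact: Fab.
  apply: box_volume_le => [j|z [Fz Hz] j]; rewrite updE; case: eqP => [->|_] //.
    have /andP[_ ->] := Fab _ Fz i; rewrite andbT.
    by move/negP: Hz; rewrite -leNgt.
  exact: Fab.
rewrite -EFinD lee_fin (prod_upd (fun j t => t - a 0 j)) (prod_upd (fun j t => b 0 j - t)).
by rewrite -mulrDl [leRHS](bigD1 i)//= addrC subrKA.
Qed.

Lemma measurable_halfspace i c : measurable ([set y : E | y 0 i < c] : set (lebT R n)).
Proof.
apply: le_caratheodory_measurable => X; apply: le_ereal_inf_tmp => _ [F [mF covF] <-].
set H := [set y : E | _].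
have cov G : (lebesgue_om R n (X `&` G) <= \sum_(0 <= k <oo) box_volume (F k `&` G))%E.
  apply: ereal_inf_lbound; exists (fun k => F k `&` G) => //.
  split=> // x [Xx Gx]; have [k _ Fk] := covF x Xx; by exists k.
apply: (le_trans (leeD (cov H) (cov (~` H)))).
rewrite -nneseriesD; last 2 first.
- by move=> k _ _; exact: box_volume_ge0.
- by move=> k _ _; exact: box_volume_ge0.
apply: lee_nneseries => k _; last exact: box_volume_split.
by move=> _; rewrite adde_ge0// box_volume_ge0.
Qed.

(** The length of the intersection of the intervals [[a, b]] and [[c, d]]. *)
Definition ov (a b c d : R) : R := Num.max 0 (Num.min b d - Num.max a c).

(** Writes the overlap as the increment over [[a, b]] of a single function of the endpoint, which
    makes it additive in [[a, b]]. *)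
Lemma ov_clamp (a b c d : R) : a <= b -> c <= d ->
  ov a b c d = Num.max c (Num.min b d) - Num.max c (Num.min a d).
Proof.
move=> ? ?; rewrite /ov; case: (ltP b d) => ?; case: (ltP a d) => ?; case: (ltP a c) => ?;
  repeat case: ltP => ?; lra.
Qed.

Lemma ov_split (a m b c d : R) : a <= m <= b -> c <= d ->
  ov a b c d = ov a m c d + ov m b c d.
Proof.
move=> /andP[am mb] cd.
by rewrite !ov_clamp ?(le_trans am mb)// [RHS]addrC subrKA.
Qed.

Lemma ov_ge0 (a b c d : R) : 0 <= ov a b c d.
Proof. by rewrite /ov le_max lexx. Qed.

Lemma ov_le (a b c d : R) : c <= d -> ov a b c d <= d - c.
Proof. by move=> ?; rewrite /ov /Num.min /Num.max; repeat case: ltP => ?; lra. Qed.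

Lemma ov_in (a b c d : R) : a <= b -> c <= a -> b <= d -> ov a b c d = b - a.
Proof. by move=> ? ? ?; rewrite /ov; case: (ltP b d) => ?; case: (ltP a c) => ?; case: ltP => ?; lra. Qed.

(** The volume common to the box [box a s] and the box with opposite corners [F.1] and [F.2]. *)
Definition pov a s (F : E * E) := \prod_i ov (a 0 i) (a 0 i + s 0 i) (F.1 0 i) (F.2 0 i).

Lemma pov_ge0 a s F : 0 <= pov a s F.
Proof. by apply: prodr_ge0 => i _; exact: ov_ge0. Qed.

Lemma pov_split a s (F : E * E) i : (forall i, 0 < s 0 i) -> (forall i, F.1 0 i <= F.2 0 i) ->
  pov a s F = pov a (upd s i (s 0 i / 2)) F +
              pov (upd a i (a 0 i + s 0 i / 2)) (upd s i (s 0 i / 2)) F.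
Proof.
move=> s0 F12; rewrite /pov (bigD1 i)//= [in RHS](bigD1 i)//=.
rewrite [X in _ = _ + X](bigD1 i)//= !updE !eqxx.
rewrite (@ov_split _ (a 0 i + s 0 i / 2)) ?F12//; last by have := s0 i; lra.
have -> : a 0 i + s 0 i / 2 + s 0 i / 2 = a 0 i + s 0 i by lra.
rewrite mulrDl; congr (_ * _ + _ * _); apply: eq_bigr => j /negPf ji; by rewrite !updE ji.
Qed.

(** * Lower bound for the total volume of a cover of a box *)

Section cover.
Variable F : nat -> E * E.
Hypothesis F12 : forall k i, (F k).1 0 i <= (F k).2 0 i.

(** The covering boxes fill less than the volume of [box a s]. Both sides are additive under
    bisection, so deficiency passes to one of the two halves. *)
Let deficient a s := ((\sum_(0 <= k <oo) (pov a s (F k))%:E) < (\prod_i s 0 i)%:E)%E.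

Let deficient_half a s i : (forall i, 0 < s 0 i) -> deficient a s ->
  exists2 a' : E, (forall j, a 0 j <= a' 0 j /\
     a' 0 j + upd s i (s 0 i / 2) 0 j <= a 0 j + s 0 j) &
     deficient a' (upd s i (s 0 i / 2)).
Proof.
move=> s0 d; set s' := upd _ _ _.
set b := upd a i (a 0 i + s 0 i / 2).
have [d1|d1] := pselect (deficient a s').
  exists a => // j; rewrite /s' updE; split => //; case: eqP => [->|//]; have := s0 i; lra.
have [d2|d2] := pselect (deficient b s').
  exists b => // j; rewrite /s' /b !updE; case: eqP => [->|//]; split => //; have := s0 i; lra.
exfalso; move: d; apply/negP; rewrite -leNgt.
rewrite (eq_eseriesr (g := fun k => ((pov a s' (F k))%:E + (pov b s' (F k))%:E)%E)); last first.
  by move=> k _; rewrite -EFinD -pov_split.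
rewrite nneseriesD; last 2 first.
- by move=> k _ _; rewrite lee_fin pov_ge0.
- by move=> k _ _; rewrite lee_fin pov_ge0.
have e : \prod_j s' 0 j = (\prod_j s 0 j) / 2.
  by rewrite /s' (prod_upd (fun=> id)) [in RHS](bigD1 i)//=; lra.
move/negP: d1; rewrite -leNgt => d1; move/negP: d2; rewrite -leNgt => d2.
apply: le_trans (leeD d1 d2); rewrite -EFinD lee_fin e; lra.
Qed.

Let deficient_halves a s : (forall i, 0 < s 0 i) -> deficient a s ->
  exists2 a' : E, (forall j, a 0 j <= a' 0 j /\ a' 0 j + (2^-1 *: s) 0 j <= a 0 j + s 0 j) &
     deficient a' (2^-1 *: s).
Proof.
move=> s0 d.
(* Induction on the list of coordinates already halved, so that all sides end up halved. *)
have H l : uniq l -> exists2 a' : E, (forall j, a 0 j <= a' 0 j /\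
    a' 0 j + (\row_j (if j \in l then s 0 j / 2 else s 0 j) : E) 0 j <= a 0 j + s 0 j) &
     deficient a' (\row_j (if j \in l then s 0 j / 2 else s 0 j)).
  elim: l => [_|i l IH /= /andP[il ul]].
    exists a; first by move=> j; rewrite mxE.
    by have -> : \row_j (if j \in [::] then s 0 j / 2 else s 0 j) = s
      by apply/rowP => j; rewrite mxE.
  have [a1 h1 d1] := IH ul.
  set s1 := \row_j _ in h1 d1.
  have s10 j : 0 < s1 0 j by rewrite mxE; case: ifP => _; have := s0 j; lra.
  have [a2 h2 d2] := deficient_half i s10 d1.
  have e : upd s1 i (s1 0 i / 2) =
     \row_j (if j \in i :: l then s 0 j / 2 else s 0 j).
    apply/rowP => j; rewrite updE !mxE inE; case: eqP => [->|//=].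
    by rewrite (negPf il).
  rewrite e in h2 d2; exists a2 => // j.
  have [] := h1 j; have [] := h2 j; lra.
have [a' h' d'] := H (enum 'I_n) (enum_uniq _).
have e : \row_j (if j \in enum 'I_n then s 0 j / 2 else s 0 j) = 2^-1 *: s.
  by apply/rowP => j; rewrite !mxE mem_enum mulrC.
by rewrite e in h' d'; exists a'.
Qed.

(** Nested deficient boxes shrink to a point. The open box of the cover around that point swallows
    one of them entirely, and a swallowed box is not deficient. *)
Lemma box_cover_lb a s : (forall i, 0 < s 0 i) ->
  (forall x, cbox a s x -> exists k, forall i, (F k).1 0 i < x 0 i < (F k).2 0 i) ->
  ((\prod_i s 0 i)%:E <= \sum_(0 <= k <oo) (pov a s (F k))%:E)%E.
Proof.
move=> s0 cov; rewrite leNgt; apply/negP => d.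
pose step (p : E * E) : E * E := (xget (p.1 : [the pointedType of E]) [set a' : E | (forall j, p.1 0 j <= a' 0 j /\
   a' 0 j + (2^-1 *: p.2) 0 j <= p.1 0 j + p.2 0 j) /\ deficient a' (2^-1 *: p.2)], 2^-1 *: p.2).
pose P k := iter k step (a, s).
have P2 k j : (P k).2 0 j = s 0 j / 2 ^+ k.
  elim: k => [|k IH]; first by rewrite /= expr0 divr1.
  by rewrite /= mxE IH exprS invfM; lra.
have P20 k j : 0 < (P k).2 0 j by rewrite P2 divr_gt0// exprn_gt0.
have H k : deficient (P k).1 (P k).2 /\ (forall j, (P k).1 0 j <= (P k.+1).1 0 j /\
   (P k.+1).1 0 j + (P k.+1).2 0 j <= (P k).1 0 j + (P k).2 0 j).
  have St (p : E * E) : (forall i, 0 < p.2 0 i) -> deficient p.1 p.2 ->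
     (forall j, p.1 0 j <= (step p).1 0 j /\
   (step p).1 0 j + (step p).2 0 j <= p.1 0 j + p.2 0 j) /\ deficient (step p).1 (step p).2.
    move=> p0 dp; rewrite /step /=; have [a' h1 h2] := deficient_halves p0 dp.
    by case: xgetP => [y _ //|/(_ a')[]].
  elim: k => [|k [IH1 IH2]]; first by split=> //; have [] := St (a, s) s0 d.
  have [h1 h2] := St _ (P20 k) IH1.
  by split=> //; have [] := St _ (P20 k.+1) h2.
have mono k l j : (k <= l)%N -> (P k).1 0 j <= (P l).1 0 j /\
   (P l).1 0 j + (P l).2 0 j <= (P k).1 0 j + (P k).2 0 j.
  elim: l => [|l IH]; first by rewrite leqn0 => /eqP ->.
  rewrite leq_eqVlt => /orP[/eqP->//|/IH [h1 h2]].
  have [_ /(_ j)[]] := H l; lra.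
(* The lower corners increase, and every upper corner bounds them: their supremum lies in all the
   nested boxes. *)
pose x : E := \row_j sup [set (P k).1 0 j | k in setT].
have ub k j : ubound [set (P k).1 0 j | k in setT] ((P k).1 0 j + (P k).2 0 j).
  move=> _ [l _ <-].
  have [h1 h2] := mono k (maxn k l) j (leq_maxl _ _).
  have [h3 h4] := mono l (maxn k l) j (leq_maxr _ _).
  have := P20 (maxn k l) j; lra.
have hs j : has_sup [set (P k).1 0 j | k in setT].
  by split; [exists ((P 0%N).1 0 j), 0%N|exists ((P 0%N).1 0 j + (P 0%N).2 0 j); exact: ub].
have xin k j : (P k).1 0 j <= x 0 j <= (P k).1 0 j + (P k).2 0 j.
  rewrite mxE; apply/andP; split.
    by apply: sup_upper_bound => //; exists k.
  by apply: ge_sup; [exists ((P 0%N).1 0 j), 0%N|exact: ub].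
have [k Fk] := cov x (fun j => xin 0%N j).
have [J HJ] : exists J, forall j, s 0 j / 2 ^+ J < x 0 j - (F k).1 0 j /\
    s 0 j / 2 ^+ J < (F k).2 0 j - x 0 j.
  have : forall j, exists J, forall l, (J <= l)%N -> s 0 j / 2 ^+ l < x 0 j - (F k).1 0 j /\
    s 0 j / 2 ^+ l < (F k).2 0 j - x 0 j.
    move=> j; have /andP[f1 f2] := Fk j.
    have [J1 h1] := @half_pow_small R (s 0 j) (x 0 j - (F k).1 0 j) ltac:(by rewrite subr_gt0).
    have [J2 h2] := @half_pow_small R (s 0 j) ((F k).2 0 j - x 0 j) ltac:(by rewrite subr_gt0).
    exists (maxn J1 J2) => l; rewrite geq_max => /andP[l1 l2]; split; [exact: h1|exact: h2].
  move/choice => [f hf]; exists (\max_j f j) => j; apply: hf; exact: leq_bigmax.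
have [dJ _] := H J; move: dJ; apply/negP; rewrite -leNgt.
have -> : \prod_i (P J).2 0 i = pov (P J).1 (P J).2 (F k).
  apply: eq_bigr => i _; have /andP[h1 h2] := xin J i; have [h3 h4] := HJ i.
  rewrite -P2 in h3 h4; rewrite ov_in; lra.
by apply: (nneseries_ge_term (u := fun k => (pov (P J).1 (P J).2 (F k))%:E)) => l; rewrite lee_fin pov_ge0.
Qed.

End cover.

(** Widening a box by [t] on both ends of each side puts it in the interior of the wider box at an
    arbitrarily small cost in volume. *)
Lemma prod_perturb (I : finType) (f : I -> R) (e : R) : 0 < e ->
  exists2 t, 0 < t & \prod_i (f i + 2 * t) <= \prod_i f i + e.
Proof.
move=> e0.
have c : forall r : seq I, continuous (fun t : R => \prod_(i <- r) (f i + 2 * t)).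
  elim=> [|i r IH] t.
    under eq_fun do rewrite big_nil; exact: cvg_cst.
  under eq_fun do rewrite big_cons; apply: cvgM; last exact: IH.
  by apply: cvgD; [exact: cvg_cst|apply: cvgM; [exact: cvg_cst|exact: cvg_id]].
have /cvgrPdist_lt/(_ _ e0) := c (index_enum I) 0.
rewrite -near_nbhs => /nbhs_ballP[t /= t0 h]; exists (t / 2); first by lra.
have := h (t/2); rewrite /ball /= sub0r normrN ger0_norm; last lra.
move=> /(_ ltac:(lra)).
under eq_bigr do rewrite mulr0 addr0.
by rewrite ltr_distlC => /andP[_ /ltW]; rewrite mulrC; under eq_bigr do rewrite mulrC.
Qed.

Lemma leb_cbox_le a s : (forall i, 0 <= s 0 i) ->
  (lebesgue_om R n (cbox a s) <= (\prod_i s 0 i)%:E)%E.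
Proof.
move=> s0; apply: (@le_trans _ _ (\sum_(0 <= k <oo) box_volume (if k == 0%N then cbox a s else set0))%E).
  apply: ereal_inf_lbound; exists (fun k => if k == 0%N then cbox a s else set0) => //.
  by split=> // x; exists 0%N.
rewrite (@nneseries_split _ _ 0 1)//; last by move=> *; exact: box_volume_ge0.
rewrite big_nat1/= [X in (_ + X)%E]eseries0 ?adde0; last first.
  by move=> [|k] // _ _; rewrite /= box_volume0.
apply: (le_trans (@box_volume_le _ a (a + s) _ _)).
- by move=> i; rewrite mxE lerDl.
- by move=> x xb i; rewrite mxE; exact: xb.
- by rewrite lee_fin; under eq_bigr do rewrite mxE addrAC subrr add0r.
Qed.

Lemma leb_cbox_ge a s : (0 < n)%N -> (forall i, 0 < s 0 i) ->
  ((\prod_i s 0 i)%:E <= lebesgue_om R n (cbox a s))%E.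
Proof.
move=> n0 s0; apply: le_ereal_inf_tmp => _ [A [_ covA] <-].
apply/lee_addgt0Pr => e e0.
have [f|] := pselect (forall k, (box_volume (A k) < +oo)%E); last first.
  move=> /existsNP[k /negP]; rewrite -leNgt leye_eq => /eqP Ak.
  rewrite [X in (_ <= X + _)%E](_ : _ = +oo%E) ?addye ?leey//; apply/eqP; rewrite -leye_eq.
  by rewrite -Ak; apply: nneseries_ge_term => *; exact: box_volume_ge0.
(* Each cover element is enclosed in the interior of a box of almost the same volume; the errors
   [e / 2 ^ k.+1] add up to [e]. *)
have H k : exists F : E * E, [/\ forall i, F.1 0 i <= F.2 0 i,
    forall x, A k x -> forall i, F.1 0 i < x 0 i < F.2 0 i &
    ((\prod_i (F.2 0 i - F.1 0 i))%:E <= box_volume (A k) + (e / (2 ^ k.+1)%:R)%:E)%E].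
  have ek : 0 < e / (2 ^ k.+1)%:R by rewrite divr_gt0// ltr0n expn_gt0.
  have [A0|An0] := eqVneq (A k) set0.
    (* A degenerate box encloses the empty set; its volume is 0 because [0 < n] leaves at least one
       zero factor. *)
    exists (0, 0); split=> //=; first by rewrite A0.
    rewrite A0 box_volume0 add0e lee_fin.
    under eq_bigr do rewrite subrr.
    by rewrite prodr_const card_ord expr0n gtn_eqF//= ltW.
  have bf : box_volume (A k) \is a fin_num by rewrite ge0_fin_numE ?box_volume_ge0.
  move: (bf); rewrite {1}/box_volume (negPf An0) => bf'.
  have [_ [[c d] /= [cd Acd] <-] h] := lb_ereal_inf_adherent (divr_gt0 ek (ltr0n _ 2)) bf'.
  have [t t0 ht] := @prod_perturb 'I_n (fun i => d 0 i - c 0 i) _ (divr_gt0 ek (ltr0n _ 2)).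
  exists (c - const_mx t, d + const_mx t); split => /=.
  - by move=> i; rewrite !mxE; have := cd i; lra.
  - by move=> x /Acd/(_ _) h1 i; have /andP[] := h1 i; rewrite !mxE; lra.
  - move: h; rewrite [X in (_ < X + _)%E](_ : _ = box_volume (A k)); last first.
      by rewrite /box_volume (negPf An0).
    rewrite -(fineK bf) -!EFinD lte_fin lee_fin => h.
    apply: (@le_trans _ _ (\prod_i (d 0 i - c 0 i + 2 * t))).
      rewrite le_eqVlt; apply/orP; left; apply/eqP/eq_bigr => i _; rewrite !mxE; ring.
    by apply: le_trans ht _; lra.
have {H} [F HF] := choice H.
have F12 k i : (F k).1 0 i <= (F k).2 0 i by case: (HF k).
apply: (@le_trans _ _ (\sum_(0 <= k <oo) (pov a s (F k))%:E)%E).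
  apply: box_cover_lb => // x /covA[k _ Ak]; exists k; by case: (HF k) => _ + _; apply.
apply: le_trans (epsilon_trick xpredT _ (ltW e0)); last by move=> k; exact: box_volume_ge0.
apply: lee_nneseries => k _; first by move=> _; rewrite lee_fin pov_ge0.
have [_ _] := HF k; apply: le_trans; rewrite lee_fin; apply: ler_prod => i _.
by rewrite ov_ge0 ov_le.
Qed.

Lemma leb_cbox a s : (0 < n)%N -> (forall i, 0 < s 0 i) ->
  lebesgue_om R n (cbox a s) = (\prod_i s 0 i)%:E.
Proof.
move=> n0 s0; apply/eqP; rewrite eq_le leb_cbox_ge// andbT leb_cbox_le// => i; exact: ltW.
Qed.

Lemma leb_face a s i (c : R) : (forall i, 0 <= s 0 i) ->
  lebesgue_om R n (cbox a s `&` [set y : E | y 0 i = c]) = 0%E.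
Proof.
move=> s0; apply/eqP; rewrite -measure_le0/=.
apply: (@le_trans _ _ (lebesgue_om R n (cbox (upd a i c) (upd s i 0)))).
  apply: le_outer_measure => y [yb yc] j; rewrite !updE; case: eqP => [->|_]; last exact: yb.
  by rewrite yc addr0 lexx.
apply: le_trans (leb_cbox_le _ _) _; first by move=> j; rewrite updE; case: eqP.
by rewrite (prod_upd (fun=> id)) mul0r.
Qed.

Lemma cbox_obox a s : cbox a s `<=` obox a s `|` \bigcup_(i in [set: 'I_n])
   ((cbox a s `&` [set y : E | y 0 i = a 0 i]) `|` (cbox a s `&` [set y : E | y 0 i = a 0 i + s 0 i])).
Proof.
move=> y yb; have [h|h] := pselect (obox a s y); [by left|right].
move: h => /existsNP[i h]; exists i => //.
have := yb i; rewrite !le_eqVlt => /andP[/orP[/eqP e1|l1] /orP[/eqP e2|l2]];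
  by [left|right|left|exfalso; apply: h; rewrite l1 l2].
Qed.

Lemma leb_obox a s : (0 < n)%N -> (forall i, 0 < s 0 i) ->
  lebesgue_om R n (obox a s) = (\prod_i s 0 i)%:E.
Proof.
move=> n0 s0; rewrite -(leb_cbox a)//; apply/eqP; rewrite eq_le; apply/andP; split.
  by apply: le_outer_measure => y h i; have /andP[? ?] := h i; rewrite !ltW.
apply: (le_trans (le_outer_measure _ _ _ (@cbox_obox a s))).
apply: (le_trans (outer_measureU2 _ _ _)).
rewrite [X in (_ + X)%E](_ : _ = 0%E) ?adde0//.
apply/eqP; rewrite eq_le outer_measure_ge0 andbT.
have s0' i : 0 <= s 0 i by exact: ltW.
pose G k := if insub k is Some i then cbox a s `&` [set y : E | y 0 i = a 0 i]
  `|` cbox a s `&` [set y : E | y 0 i = a 0 i + s 0 i] else set0.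
apply: (@le_trans _ _ (lebesgue_om R n (\bigcup_k G k))).
  apply: le_outer_measure => y [i _ Hy]; exists i => //.
  by rewrite /G valK.
apply: (le_trans (outer_measure_sigma_subadditive _ _)).
rewrite eseries0// => k _ _; rewrite /G; case: insub => [i|]; last exact: outer_measure0.
apply/eqP; rewrite eq_le outer_measure_ge0 andbT.
apply: (le_trans (outer_measureU2 _ _ _)).
by rewrite -[leRHS]adde0 leeD// (leb_face _ _ _ s0').
Qed.

Lemma obox_box a s : obox a s `<=` box a s.
Proof. by move=> y h i; have /andP[? ?] := h i; rewrite ltW. Qed.

Lemma box_cbox a s : box a s `<=` cbox a s.
Proof. by move=> y h i; have /andP[-> /ltW ->] := h i. Qed.

Lemma leb_box a s : (0 < n)%N -> (forall i, 0 < s 0 i) ->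
  lebesgue_om R n (box a s) = (\prod_i s 0 i)%:E.
Proof.
move=> n0 s0; apply/eqP; rewrite eq_le; apply/andP; split.
  by rewrite -(leb_cbox a)//; apply: le_outer_measure; exact: box_cbox.
by rewrite -(leb_obox a)//; apply: le_outer_measure; exact: obox_box.
Qed.

Lemma measurable_coord_lt i (c : R) : measurable ([set y : E | y 0 i < c] : set (lebT R n)).
Proof. exact: measurable_halfspace. Qed.

Lemma measurable_coord_ge i (c : R) : measurable ([set y : E | c <= y 0 i] : set (lebT R n)).
Proof.
rewrite (_ : [set y : E | _] = ~` [set y : E | y 0 i < c]); last first.
  by apply/seteqP; split => y /=; rewrite leNgt => /negP.
by apply: measurableC; exact: measurable_halfspace.
Qed.

Lemma measurable_box a s : measurable (box a s : set (lebT R n)).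
Proof.
rewrite (_ : box a s = \bigcap_(i in [set: 'I_n])
    ([set y : E | a 0 i <= y 0 i] `&` [set y : E | y 0 i < a 0 i + s 0 i])); last first.
  apply/seteqP; split => [y h i _|y h i]; first by have /andP[] := h i.
  by have [/= -> ->] := h i I.
rewrite -[X in measurable X]setCK setC_bigcap; apply: measurableC.
apply: countable_bigcupT_measurable; first exact: countableP.
move=> i; apply: measurableC; apply: measurableI; [exact: measurable_coord_ge|exact: measurable_coord_lt].
Qed.

Lemma rV_ball_box (x : E) (e : R) : 0 < e -> ball x e = obox (x - const_mx e) (const_mx (2 * e)).
Proof.
move=> e0; apply/seteqP; split => y.
  move=> [_ h] i.
  have := h 0 i; rewrite /ball /= !mxE ltr_distl; lra.
move=> h; split => // k i; have := h i; rewrite !mxE (ord1 k) /ball/= ltr_distl; lra.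
Qed.

Lemma open_ball_sub (O : set E) x : open O -> O x -> exists2 e : R, 0 < e & ball x e `<=` O.
Proof. by move=> oO Ox; have /nbhs_ballP[e /= e0 h] := open_nbhs_nbhs (conj oO Ox); exists e. Qed.

(** The dyadic boxes are indexed by a countable type, so open sets are Caratheodory measurable for
    the Lebesgue outer measure. *)
Lemma open_bigcup_box (O : set E) : open O ->
  O = \bigcup_(p in [set p : nat * 'rV[int]_n | box (\row_i ((p.2 0 i)%:~R / 2 ^+ p.1)) (const_mx (2 ^- p.1)) `<=` O])
    box (\row_i ((p.2 0 i)%:~R / 2 ^+ p.1)) (const_mx (2 ^- p.1)).
Proof.
move=> oO; apply/seteqP; split => [x Ox|x [p h]]; last exact: h.
have [e e0 he] := open_ball_sub oO Ox.
have [J /(_ J (leqnn _)) hJ] := half_pow_small 1 e0.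
pose z : 'rV[int]_n := \row_i Num.floor (x 0 i * 2 ^+ J).
have p0 : 0 < 2 ^+ J :> R by rewrite exprn_gt0.
have h i : (z 0 i)%:~R / 2 ^+ J <= x 0 i < (z 0 i)%:~R / 2 ^+ J + 2 ^- J.
  rewrite mxE ler_pdivrMr// ge_floor/= -[X in _ + X]mul1r -mulrDl ltr_pdivlMr//.
  by have := lt_succ_floor (x 0 i * 2 ^+ J); rewrite intrD.
exists (J, z); last by move=> i; have := h i; rewrite !mxE.
move=> y yb; apply: he; split => // k i; rewrite (ord1 k) /ball/=.
have := yb i; have := h i; rewrite /= !mxE => /andP[? ?] /andP[? ?].
rewrite div1r in hJ; rewrite ltr_distl; lra.
Qed.

Lemma measurable_open (O : set E) : open O -> measurable (O : set (lebT R n)).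
Proof.
move=> oO; rewrite (open_bigcup_box oO) bigcup_mkcond.
apply: countable_bigcupT_measurable; first exact: countableP.
by move=> p; case: ifP => _; [exact: measurable_box|exact: measurable0].
Qed.

Lemma measurable_closed (F : set E) : closed F -> measurable (F : set (lebT R n)).
Proof. by move=> cF; rewrite -(setCK F); apply: measurableC; apply: measurable_open; exact: closed_openC. Qed.

Lemma continuous_measurable (D : set (lebT R n)) (f : E -> R) : measurable D -> continuous f ->
  measurable_fun D (f : lebT R n -> R).
Proof.
move=> mD cf; apply: (measurability _ (RGenOInfty.measurableE R)).
move=> /= _ [_ [x ->] <-]; apply: measurableI => //; rewrite preimage_itvoy; apply: measurable_open.
have /continuousP cf' := cf; have h := cf' _ (@open_gt R x); exact: h.
Qed.

Lemma leb_shift (h : E) (A : set E) : lebesgue_om R n [set x | A (x + h)] = lebesgue_om R n A.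
Proof.
have H (k : E) (B : set E) : (lebesgue_om R n [set x : E | B (x + k)%R] <= lebesgue_om R n B)%E.
  apply: le_ereal_inf_tmp => _ [F [mF covF] <-].
  apply: (@le_trans _ _ (\sum_(0 <= j <oo) box_volume [set x : E | F j (x + k)%R])%E).
    apply: ereal_inf_lbound; exists (fun (l : nat) => [set x : E | F l (x + k)]) => //.
    by split => // x /covF[j _ Fj]; exists j.
  apply: lee_nneseries => j _; first by move=> _; exact: box_volume_ge0.
  have [F0|/set0P [x0 F0]] := eqVneq (F j) set0.
    rewrite F0 (_ : [set x | _] = set0) ?box_volume0//; by apply/seteqP; split => x.
  rewrite [leRHS]/box_volume ifN; last by apply/set0P; exists x0.
  apply: le_ereal_inf_tmp => _ [[a b] /= [ab Fab] <-].
  apply: (le_trans (@box_volume_le _ (a - k) (b - k) _ _)).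
  - by move=> i; rewrite !mxE lerB.
  - by move=> x /Fab h1 i; have := h1 i; rewrite !mxE; lra.
  - by rewrite lee_fin; under eq_bigr do rewrite !mxE opprB addrA subrK.
apply/eqP; rewrite eq_le H/=.
apply: le_trans (H (- h) _); apply: le_outer_measure => x /=; by rewrite subrK.
Qed.

Lemma measurable_shift (h : E) (A : set (lebT R n)) : measurable A ->
  measurable ([set x | A (x + h)] : set (lebT R n)).
Proof.
move=> mA; have mA' : (lebesgue_om R n).-caratheodory A := mA.
have : (lebesgue_om R n).-caratheodory [set x : E | A (x + h)]; last by [].
move=> X; have := mA' [set x : E | X (x - h)]; rewrite (leb_shift (- h) X) => ->.
congr (_ + _)%E; rewrite -[LHS](leb_shift h); congr (lebesgue_om R n _).
  by apply/seteqP; split => x /=; rewrite addrK.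
by apply/seteqP; split => x /=; rewrite addrK.
Qed.

Lemma measurable_fun_shift (h : E) : measurable_fun [set: lebT R n] ((fun x : E => x + h) : lebT R n -> lebT R n).
Proof. by move=> _ A mA; rewrite setTI; exact: measurable_shift. Qed.

End boxes.

(** * Integrals over subsets of R^n *)

Lemma Rintegral_invariant d (T : measurableType d) (R : realType) (mu : {measure set T -> \bar R})
    (phi : T -> T) (f : T -> R) : measurable_fun setT phi ->
  (forall A, measurable A -> mu (phi @^-1` A) = mu A) ->
  mu.-integrable setT (EFin \o f) ->
  mu.-integrable setT (EFin \o (f \o phi)) /\
  \int[mu]_x (f \o phi) x = \int[mu]_x f x.
Proof.
move=> mphi pe fi.
have pe' A : measurable A -> A `<=` setT -> pushforward mu phi A = mu A by move=> mA _; exact: pe.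
have /integrableP[mf fi'] := fi.
have mf' : measurable_fun setT (f \o phi).
  by apply: measurableT_comp => //; exact/measurable_EFinP.
have ii : mu.-integrable setT (EFin \o (f \o phi)).
  apply/integrableP; split; first exact/measurable_EFinP.
  rewrite -(eq_measure_integral _ pe') ge0_integral_pushforward//= in fi'.
  by apply/measurable_EFinP; apply: measurableT_comp => //; exact/measurable_EFinP.
split=> //; rewrite /Rintegral; congr fine.
have h := @integral_pushforward _ _ _ _ R _ mphi mu setT (EFin \o f) mf ii measurableT.
rewrite preimage_setT in h; rewrite -[LHS]h.
exact: (eq_measure_integral _ pe').
Qed.

Section integ.
Context {R : realType} {n : nat}.
Local Notation E := 'rV[R]_n.
Implicit Types (D A B : set E) (f g h : E -> R).

Definition msb D := measurable (D : set (lebT R n)).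
Definition mfn D f := measurable_fun (D : set (lebT R n)) (f : lebT R n -> R).
Definition intg D f := (leb R n).-integrable (D : set (lebT R n)) (EFin \o (f : lebT R n -> R)).
Definition Int D f : R := \int[leb R n]_(x in (D : set (lebT R n))) (f : lebT R n -> R) x.
Definition vol D : R := fine (lebesgue_om R n D).

Lemma mfn_cont D f : msb D -> continuous f -> mfn D f.
Proof. exact: continuous_measurable. Qed.

Lemma intg_mfn D f : intg D f -> mfn D f.
Proof. by move=> /integrableP[/measurable_EFinP]. Qed.

Lemma mfnS A B f : msb B -> A `<=` B -> mfn B f -> mfn A f.
Proof. by move=> mB AB; exact: measurable_funS. Qed.

Lemma mfnD D f g : mfn D f -> mfn D g -> mfn D (fun x => f x + g x).
Proof. exact: measurable_funD. Qed.

Lemma mfnM D f g : mfn D f -> mfn D g -> mfn D (fun x => f x * g x).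
Proof. exact: measurable_funM. Qed.

Lemma mfn_cst D c : mfn D (fun=> c).
Proof. exact: measurable_cst. Qed.

Lemma mfn_comp D (F : R -> R) f : measurable_fun setT F -> mfn D f -> mfn D (fun x => F (f x)).
Proof. by move=> mF mf; exact: (measurableT_comp mF). Qed.

Lemma mfn_abs D f : mfn D f -> mfn D (fun x => `|f x|).
Proof. by move=> mf; apply: (measurableT_comp _ mf). Qed.

Lemma mfnX D f k : mfn D f -> mfn D (fun x => f x ^+ k).
Proof. by move=> mf; apply: (measurable_funX k mf). Qed.

Lemma mfn_eq D f g : (forall x, D x -> f x = g x) -> mfn D f -> mfn D g.
Proof. by move=> fg; apply: eq_measurable_fun => x /set_mem; exact: fg. Qed.

Lemma intg_le D f h : msb D -> mfn D f -> intg D h -> (forall x, D x -> `|f x| <= h x) -> intg D f.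
Proof.
move=> mD mf ih fh; apply: (le_integrable mD _ _ ih); first exact/measurable_EFinP.
by move=> x Dx /=; rewrite lee_fin (le_trans (fh _ Dx))// ler_norm.
Qed.

Lemma intgS A B f : msb A -> msb B -> A `<=` B -> intg B f -> intg A f.
Proof. by move=> mA mB AB; exact: integrableS. Qed.

Lemma intgD D f g : msb D -> intg D f -> intg D g -> intg D (fun x => f x + g x).
Proof. by move=> mD i1 i2; have := integrableD mD i1 i2. Qed.

Lemma intgB D f g : msb D -> intg D f -> intg D g -> intg D (fun x => f x - g x).
Proof. by move=> mD i1 i2; have := integrableB mD i1 i2. Qed.

Lemma intgZ D f c : msb D -> intg D f -> intg D (fun x => c * f x).
Proof. by move=> mD i1; have := integrableZl mD c i1. Qed.

Lemma intg_abs D f : intg D f -> intg D (fun x => `|f x|).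
Proof. by move=> i1; have := integrable_norm i1. Qed.

Lemma intg_eq D f g : msb D -> (forall x, D x -> f x = g x) -> intg D f -> intg D g.
Proof. by move=> mD fg; apply: eq_integrable => // x /set_mem Dx /=; rewrite fg. Qed.

Lemma intg_bnd D f M : msb D -> (lebesgue_om R n D < +oo)%E -> mfn D f ->
  (forall x, D x -> `|f x| <= M) -> intg D f.
Proof.
move=> mD fD mf fM; apply: measurable_bounded_integrable => //.
exists M; split; first exact: num_real.
by move=> y My x Dx; apply: le_trans (fM x Dx) _; exact: ltW.
Qed.

Lemma intg0 D : msb D -> intg D (fun=> 0).
Proof. by move=> mD; exact: integrable0. Qed.

Lemma IntD D f g : msb D -> intg D f -> intg D g ->
  Int D (fun x => f x + g x) = Int D f + Int D g.
Proof. by move=> mD i1 i2; exact: RintegralD. Qed.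

Lemma IntB D f g : msb D -> intg D f -> intg D g ->
  Int D (fun x => f x - g x) = Int D f - Int D g.
Proof. by move=> mD i1 i2; exact: RintegralB. Qed.

Lemma IntZ D f c : msb D -> intg D f -> Int D (fun x => c * f x) = c * Int D f.
Proof. by move=> mD i1; exact: RintegralZl. Qed.

Lemma Int_le D f g : msb D -> intg D f -> intg D g -> (forall x, D x -> f x <= g x) ->
  Int D f <= Int D g.
Proof. by move=> mD i1 i2 h; exact: le_Rintegral. Qed.

Lemma Int_ge0 D f : (forall x, D x -> 0 <= f x) -> 0 <= Int D f.
Proof. by move=> h; exact: Rintegral_ge0. Qed.

Lemma Int_abs D f : msb D -> intg D f -> `|Int D f| <= Int D (fun x => `|f x|).
Proof. by move=> mD i1; exact: le_normr_Rintegral. Qed.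

Lemma Int_eq D f g : (forall x, D x -> f x = g x) -> Int D f = Int D g.
Proof. by move=> h; apply: eq_Rintegral => x /set_mem; exact: h. Qed.

Lemma Int_cst D c : msb D -> Int D (fun=> c) = c * vol D.
Proof. by move=> mD; rewrite /Int Rintegral_cst. Qed.

Lemma IntU A B f : msb A -> msb B -> (forall x, A x -> B x -> False) -> intg (A `|` B) f ->
  Int (A `|` B) f = Int A f + Int B f.
Proof.
move=> mA mB AB i; apply: Rintegral_setU => //.
by apply/disj_setPS => x [Ax Bx]; exact: AB Ax Bx.
Qed.

Lemma mfn_mkcond A B f : msb A -> msb B -> A `<=` B -> (forall x, B x -> ~ A x -> f x = 0) ->
  mfn A f -> mfn B f.
Proof.
move=> mA mB AB f0 mf.
apply: (mfn_eq (f := patch (fun=> 0) A f)).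
  move=> x Bx; rewrite /patch; case: ifPn => //; rewrite notin_setE => nA; by rewrite f0.
have : measurable_fun (B `&` A : set (lebT R n)) (f : lebT R n -> R) by rewrite setIidr.
by move/(measurable_restrict (f : lebT R n -> R) mA mB).
Qed.

Lemma intg_mkcond A B f : msb A -> msb B -> A `<=` B -> (forall x, B x -> ~ A x -> f x = 0) ->
  intg A f -> intg B f.
Proof.
move=> mA mB AB f0 i; apply: (intg_eq (f := patch (fun=> 0) A f)) => //.
  move=> x Bx; rewrite /patch; case: ifPn => //; rewrite notin_setE => nA; by rewrite f0.
have : (leb R n).-integrable ((B : set (lebT R n)) `&` A) (EFin \o (f : lebT R n -> R)) by rewrite setIidr.
move=> h; have := (integrable_restrict (leb R n) mA mB (EFin \o (f : lebT R n -> R))).1 h.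
apply: eq_integrable => // x _.
by rewrite /= /patch; case: ifP.
Qed.

Lemma Int_mkcond A B f : msb A -> msb B -> A `<=` B -> (forall x, B x -> ~ A x -> f x = 0) ->
  Int B f = Int A f.
Proof.
move=> mA mB AB f0; rewrite /Int -(setIidr AB) Rintegral_mkcondr.
apply: eq_Rintegral => x /set_mem Bx; rewrite /patch; case: ifPn => //; rewrite notin_setE => nA.
by rewrite f0.
Qed.

Lemma Int_subset A B f : msb A -> msb B -> A `<=` B -> intg B f -> (forall x, B x -> 0 <= f x) ->
  Int A f <= Int B f.
Proof.
move=> mA mB AB i f0; rewrite -(setDUK AB) IntU//.
- by rewrite lerDl; apply: Int_ge0 => x [Bx _]; exact: f0.
- exact: measurableD.
- by move=> x Ax [].
- by rewrite setDUK.
Qed.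

Lemma Int_dct D (f_ : nat -> E -> R) f h : msb D -> (forall k, mfn D (f_ k)) -> mfn D f ->
  intg D h -> (forall k x, D x -> `|f_ k x| <= h x) ->
  (forall x, D x -> f_ ^~ x @ \oo --> f x) ->
  intg D f /\ (fun k => Int D (f_ k)) @ \oo --> Int D f.
Proof.
move=> mD mf_ mf ih dom cvg.
have [] := @dominated_convergence _ (lebT R n) R (leb R n) D mD (fun k => EFin \o f_ k) (EFin \o f) (EFin \o h).
- by move=> k; apply/measurable_EFinP; exact: mf_.
- exact/measurable_EFinP.
- by apply/aeW => x Dx; apply: cvg_EFin; [exact: nearW|exact: cvg].
- by [].
- by apply/aeW => x k Dx /=; rewrite lee_fin dom.
move=> i1 _ c2; split=> //; apply: fine_cvg; rewrite fineK; last exact: integrable_fin_num.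
exact: c2.
Qed.

Lemma Int_CS D f g : msb D -> mfn D f -> mfn D g -> intg D (fun x => f x ^+ 2) ->
  intg D (fun x => g x ^+ 2) ->
  intg D (fun x => f x * g x) /\
  (Int D (fun x => f x * g x)) ^+ 2 <= Int D (fun x => f x ^+ 2) * Int D (fun x => g x ^+ 2).
Proof.
move=> mD mf mg if2 ig2.
have ifg : intg D (fun x => f x * g x).
  apply: (@intg_le D _ (fun x => f x ^+ 2 + g x ^+ 2)) => //; [exact: mfnM|exact: intgD|].
  move=> x _; rewrite normrM.
  rewrite -(real_normK (num_real (f x))) -(real_normK (num_real (g x))).
  have := sqr_ge0 (`|f x| - `|g x|); have := normr_ge0 (f x); have := normr_ge0 (g x); nra.
split=> //; set a := Int D _; set b := Int D (fun x => f x ^+ 2); set c := Int D (fun x => g x ^+ 2).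
have b0 : 0 <= b by apply: Int_ge0 => x _; exact: sqr_ge0.
have c0 : 0 <= c by apply: Int_ge0 => x _; exact: sqr_ge0.
have H t : 0 <= b - 2 * t * a + t ^+ 2 * c.
  have : 0 <= Int D (fun x => (f x ^+ 2 - (2 * t) * (f x * g x)) + t ^+ 2 * g x ^+ 2).
    apply: Int_ge0 => x _; have := sqr_ge0 (f x - t * g x); nra.
  rewrite IntD//; last 2 first.
  - by apply: intgB => //; exact: intgZ.
  - exact: intgZ.
  by rewrite IntB// ?IntZ//; exact: intgZ.
have [c00|cn0] := eqVneq c 0.
  have [a0|an0] := eqVneq a 0; first by rewrite a0 expr0n/= mulr_ge0.
  exfalso; have := H ((b + 1) / (2 * a)); rewrite c00.
  have -> : 2 * ((b + 1) / (2 * a)) * a = b + 1 by field.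
  lra.
have cp : 0 < c by rewrite lt_def cn0.
have := H (a / c); have -> : b - 2 * (a / c) * a + (a / c) ^+ 2 * c = (b * c - a ^+ 2) / c by field; lra.
by rewrite pmulr_lge0 ?invr_gt0// subr_ge0.
Qed.

Lemma Int_shift f (v : E) : intg setT f ->
  intg setT (fun x => f (x + v)) /\ Int setT (fun x => f (x + v)) = Int setT f.
Proof.
move=> fi; apply: (Rintegral_invariant (measurable_fun_shift v)) => //.
by move=> A _; exact: leb_shift.
Qed.

End integ.

(** * Smooth functions *)

Lemma line_quotient (R : realType) (V : normedModType R) (f : V -> R) (x v : V) (t : R) :
  (fun h : R => h^-1 *: (((fun h : R => f (h *: v + x)) \o shift t) (h *: (1 : R)) - f (t *: v + x))) =
  (fun h : R => h^-1 *: ((f \o shift (t *: v + x)) (h *: v) - f (t *: v + x))).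
Proof.
apply/funext => h; rewrite /= /shift; congr (_ *: (f _ - _)).
by rewrite scalerDl addrA /GRing.scale/= mulr1.
Qed.

Lemma is_derive_line (R : realType) (V : normedModType R) (f : V -> R) (x v : V) (t df : R) :
  is_derive (t *: v + x) v f df -> is_derive t 1 (fun h : R => f (h *: v + x)) df.
Proof. by case=> dr de; split; [rewrite /derivable|rewrite -de /derive]; rewrite line_quotient. Qed.

Lemma is_derive_line0 (R : realType) (V : normedModType R) (f : V -> R) (x v : V) (df : R) :
  is_derive (0 : R) 1 (fun h : R => f (h *: v + x)) df -> is_derive x v f df.
Proof.
case; rewrite /derivable /derive line_quotient scale0r add0r => dr de; by split.
Qed.

(** Restriction to the line through [x] in direction [v] reduces the directional chain rule to the
    one for functions of a real variable. *)
Lemma is_derive_comp1 (R : realType) (V : normedModType R) (f : V -> R) (g : R -> R) (x v : V) (df dg : R) :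
  is_derive x v f df -> is_derive (f x) 1 g dg -> is_derive x v (fun y => g (f y)) (dg * df).
Proof.
move=> Hf Hg; apply: is_derive_line0.
have Hf' : is_derive (0:R) 1 (fun h : R => f (h *: v + x)) df.
  by apply: is_derive_line; rewrite scale0r add0r.
have Hg' : is_derive (f (0 *: v + x)) 1 g dg by rewrite scale0r add0r.
exact: (is_derive1_comp Hg' Hf').
Qed.

Section is_derive_fun.
Variables (R : realType) (V : normedModType R).
Implicit Types (f g : V -> R) (x v : V).

Lemma is_derive_funD f g x v df dg : is_derive x v f df -> is_derive x v g dg ->
  is_derive x v (fun y => f y + g y) (df + dg).
Proof. by move=> h1 h2; have := is_deriveD h1 h2. Qed.

Lemma is_derive_funM f g x v df dg : is_derive x v f df -> is_derive x v g dg ->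
  is_derive x v (fun y => f y * g y) (f x * dg + g x * df).
Proof. by move=> h1 h2; have := is_deriveM h1 h2. Qed.

Lemma is_derive_funZ f x v df (c : R) : is_derive x v f df ->
  is_derive x v (fun y => c * f y) (c * df).
Proof.
move=> h; apply: (is_derive_eq (is_derive_funM (is_derive_cst c x v) h)).
by rewrite mulr0 addr0.
Qed.

Lemma is_derive_funX f x v df k : is_derive x v f df ->
  is_derive x v (fun y => f y ^+ k) (k%:R * f x ^+ k.-1 * df).
Proof.
move=> h; elim: k => [|k IH].
  by rewrite !mul0r; under eq_fun do rewrite expr0; exact: is_derive_cst.
under eq_fun do rewrite exprS.
apply: (is_derive_eq (is_derive_funM h IH)).
by case: k {IH} => [|k] /=; [rewrite !expr0; ring|rewrite exprS -!natr1; ring].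
Qed.

End is_derive_fun.

Section flat.
Variable R : realType.

(* [flat k] vanishes to infinite order at 0, and the family is stable under derivation. *)
Definition flat (k : nat) (t : R) : R := if 0 < t then t^-1 ^+ k * expR (- t^-1) else 0.

Lemma flat_ge0 k t : 0 <= flat k t.
Proof. by rewrite /flat; case: ifP => // t0; rewrite mulr_ge0 ?expR_ge0// exprn_ge0// invr_ge0 ltW. Qed.

Lemma flat_gt0 k t : 0 < t -> 0 < flat k t.
Proof. by move=> t0; rewrite /flat t0 mulr_gt0 ?expR_gt0// exprn_gt0// invr_gt0. Qed.

Lemma flat_le0 k t : t <= 0 -> flat k t = 0.
Proof. by rewrite /flat leNgt => /negPf ->. Qed.

(** The inequality [exp (i / m) >= i / m], raised to the power [m = k + 1], shows that the
    exponential beats [i ^ k] with one factor [t = 1 / i] to spare. *)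
Lemma flat_bound k t : 0 < t -> flat k t <= k.+1%:R ^+ k.+1 * t.
Proof.
move=> t0; rewrite /flat t0; set m := k.+1; set i := t^-1.
have i0 : 0 < i by rewrite invr_gt0.
have m0 : 0 < m%:R :> R by rewrite ltr0n.
have h : (i / m%:R) ^+ m <= expR i.
  have -> : expR i = expR (i / m%:R) ^+ m.
    by rewrite -expRM_natl; congr expR; rewrite mulrC divfK// gt_eqF.
  apply: lerXn2r; rewrite ?nnegrE ?expR_ge0 ?divr_ge0 ?ltW//.
  by apply: lt_le_trans (expR_ge1Dx _); rewrite ltrDr.
have ti : t = i^-1 by rewrite /i invrK.
rewrite expRN ler_pdivrMr ?expR_gt0// ti -mulrA.
apply: (@le_trans _ _ (m%:R ^+ m * (i^-1 * (i / m%:R) ^+ m))); last first.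
  by rewrite !ler_wpM2l// ?exprn_ge0// ?invr_ge0 ltW.
rewrite expr_div_n [i ^+ m]exprS le_eqVlt; apply/orP; left; apply/eqP; field.
by rewrite expf_neq0 ?gt_eqF.
Qed.

Lemma flat_is_derive_pos k (t : R) : 0 < t ->
  is_derive t 1 (flat k) (- k%:R * flat k.+1 t + flat k.+2 t).
Proof.
move=> t0.
have e : \forall s \near t, (s^-1 ^+ k * expR (- s^-1)) = flat k s.
  by near=> s; rewrite /flat ifT//; near: s; exact: lt_nbhsr.
have tn0 : t != 0 by rewrite gt_eqF.
apply: (near_eq_is_derive e).
have d1 : is_derive t 1 (fun s : R => s^-1) (- t^-1 ^+ 2).
  have := @is_deriveV R (@idfun R) t 1 1 tn0 _; rewrite /GRing.scale/= mulr1 exprVn; exact.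
have d2 : is_derive t 1 (fun s : R => s^-1 ^+ k) (k%:R * t^-1 ^+ k.-1 * (- t^-1 ^+ 2)).
  exact: (is_derive_funX k d1).
have d3 : is_derive t 1 (fun s : R => expR (- s^-1)) (expR (- t^-1) * (t^-1 ^+ 2)).
  have dN : is_derive t 1 (fun s : R => - s^-1) (t^-1 ^+ 2).
    by have := is_deriveN d1; rewrite opprK.
  exact: (is_derive_comp1 dN (is_derive_expR _)).
apply: (is_derive_eq (is_derive_funM d2 d3)).
rewrite /flat t0; set i := t^-1; set x := expR _.
by case: k {e d2} => [|k]; rewrite /= !exprS ?expr0; ring.
Unshelve. all: by end_near.
Qed.

Lemma flat_is_derive k (t : R) : is_derive t 1 (flat k) (- k%:R * flat k.+1 t + flat k.+2 t).
Proof.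
have [t0|t0|<-] := ltgtP 0 t; first exact: flat_is_derive_pos.
  have e : \forall s \near t, (cst 0 : R -> R) s = flat k s.
    by near=> s; rewrite [RHS]flat_le0// ltW//; near: s; exact: lt_nbhsl.
  rewrite !(flat_le0 _ (ltW t0)) mulr0 addr0.
  by apply: (near_eq_is_derive e); exact: is_derive_cst.
rewrite !flat_le0// mulr0 addr0.
have c : h^-1 *: ((flat k \o shift 0) (h *: (1:R)) - flat k 0) @[h --> (0:R)^'] --> (0:R).
  apply/cvgrPdist_le => e e0; near=> h.
  rewrite sub0r normrN /= (flat_le0 k (lexx 0)) subr0 addr0 /GRing.scale/= mulr1.
  have [h0|h0] := leP h 0; first by rewrite flat_le0// mulr0 normr0 ltW.
  (* The difference quotient at 0 is again a flat function, so [flat_bound] sends it to 0. *)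
  have -> : h^-1 * flat k h = flat k.+1 h by rewrite /flat h0 exprS mulrA.
  rewrite ger0_norm ?flat_ge0//; apply: le_trans (flat_bound _ h0) _.
  rewrite mulrC -ler_pdivlMr ?exprn_gt0// ltW//.
  near: h; apply: nbhs_dnbhs; apply: lt_nbhsl; by rewrite divr_gt0// exprn_gt0.
by split; [apply/cvg_ex; exists 0|exact: (cvg_lim _ c)].
Unshelve. all: by end_near.
Qed.

End flat.

Section smooth.
Context {R : realType} {n : nat}.
Local Notation E := 'rV[R]_n.
Implicit Types (f g : E -> R) (i : 'I_n).

Definition pd i f : E -> R := fun x => 'D_(delta_mx 0 i) f x.

(* Unlike [Ck], this predicate is monotone in [k]. *)
Fixpoint Sk (k : nat) f : Prop := continuous f /\
  if k is k'.+1 then forall i, (forall x, derivable f x (delta_mx 0 i)) /\ Sk k' (pd i f) else True.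

Definition smooth f := forall k, Sk k f.

Lemma SkW k f : Sk k.+1 f -> Sk k f.
Proof.
elim: k f => [|k IH] f [cf h]; first by split.
by split => // i; have [h1 h2] := h i; split => //; exact: IH.
Qed.

Lemma smooth_Ck f : smooth f <-> forall k, Ck k f.
Proof.
split=> h k.
  have := h k; elim: k f {h} => [|k IH] f; first by case.
  by move=> [_ h] i; have [h1 h2] := h i; split => //; exact: IH.
elim: k f h => [|k IH] f h; first by split => //; exact: (h 0%N).
split; first exact: (h 0%N).
move=> i; split; first by have [] := h 1%N i.
by apply: IH => l; have [] := h l.+1 i.
Qed.

Lemma smoothP f : smooth f <-> continuous f /\
  forall i, (forall x, derivable f x (delta_mx 0 i)) /\ smooth (pd i f).
Proof.
split=> [h|[cf h]].
  split; first exact: (h 0%N).1.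
  by move=> i; split=> [|k]; [have [_ /(_ i)[]] := h 1%N|have [_ /(_ i)[]] := h k.+1].
by case=> [|k]; split => // i; have [h1 h2] := h i.
Qed.

Lemma smooth_cont f : smooth f -> continuous f. Proof. by case/smoothP. Qed.

Lemma smooth_pd i f : smooth f -> smooth (pd i f).
Proof. by case/smoothP => _ /(_ i)[]. Qed.

Lemma smooth_derivable f i x : smooth f -> is_derive x (delta_mx 0 i) f (pd i f x).
Proof. by case/smoothP => _ /(_ i)[h _]; apply: DeriveDef. Qed.

Lemma Sk_cst k c : Sk k (fun _ : E => c).
Proof.
elim: k c => [|k IH] c; first by split => //; exact: cst_continuous.
split; first exact: cst_continuous.
move=> i; split=> [x|]; first exact: derivable_cst.
by rewrite (_ : pd i _ = fun=> 0)//; apply/funext => x; rewrite /pd derive_cst.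
Qed.

Lemma contD f g : continuous f -> continuous g -> continuous (fun x => f x + g x).
Proof. by move=> cf cg x; apply: continuousD; [exact: cf|exact: cg]. Qed.

Lemma contM f g : continuous f -> continuous g -> continuous (fun x => f x * g x).
Proof. by move=> cf cg x; apply: continuousM; [exact: cf|exact: cg]. Qed.

Lemma contB f g : continuous f -> continuous g -> continuous (fun x => f x - g x).
Proof. by move=> cf cg x; apply: continuousB; [exact: cf|exact: cg]. Qed.

Lemma cont_comp f (F : R -> R) : continuous F -> continuous f -> continuous (fun x => F (f x)).
Proof. by move=> cF cf x; apply: continuous_comp; [exact: cf|exact: cF]. Qed.

Lemma SkD k f g : Sk k f -> Sk k g -> Sk k (fun x => f x + g x).
Proof.
elim: k f g => [|k IH] f g [cf hf] [cg hg]; split=> //; try exact: contD.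
move=> i; have [f1 f2] := hf i; have [g1 g2] := hg i; split=> [x|]; first exact: derivableD.
rewrite (_ : pd i _ = fun x => pd i f x + pd i g x); first exact: IH.
by apply/funext => x; rewrite /pd deriveD.
Qed.

Lemma SkM k f g : Sk k f -> Sk k g -> Sk k (fun x => f x * g x).
Proof.
elim: k f g => [|k IH] f g Hf Hg; have [cf hf] := Hf; have [cg hg] := Hg; split=> //; try exact: contM.
move=> i; have [f1 f2] := hf i; have [g1 g2] := hg i; split=> [x|]; first exact: derivableM.
rewrite (_ : pd i _ = fun x => f x * pd i g x + g x * pd i f x).
  by apply: SkD; apply: IH => //; exact: SkW.
by apply/funext => x; rewrite /pd deriveM.
Qed.

Lemma cont_inv f : (forall x, f x != 0) -> continuous f -> continuous (fun x => (f x)^-1).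
Proof. by move=> f0 cf x; apply: continuousV; [exact: f0|exact: cf]. Qed.

Lemma Sk_inv k f : (forall x, f x != 0) -> Sk k f -> Sk k (fun x => (f x)^-1).
Proof.
move=> f0; elim: k => [|k IH] Hf; have [cf hf] := Hf; split=> //; try exact: cont_inv.
move=> i; have [f1 f2] := hf i.
have H x : is_derive x (delta_mx 0 i) (fun x => (f x)^-1) (- (f x)^-1 * (f x)^-1 * pd i f x).
  have d := @is_deriveV R (@idfun R) (f x) 1 1 (f0 x) (is_derive_id (f x) (1 : R)).
  apply: (is_derive_eq (@is_derive_comp1 _ _ f (fun y : R => y^-1) x _ _ _ (DeriveDef (f1 x) (erefl _)) d)).
  by rewrite /GRing.scale/= mulr1 -exprVn expr2 !mulNr.
split=> [x|]; first by case: (H x).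
rewrite (_ : pd i _ = fun x => -1 * (f x)^-1 * (f x)^-1 * pd i f x).
  by apply: SkM => //; apply: SkM; [apply: SkM; [exact: Sk_cst|]|]; apply: IH; exact: SkW.
by apply/funext => x; rewrite /pd; case: (H x) => _ ->; rewrite mulN1r.
Qed.

Lemma flat_cont k : continuous (@flat R k).
Proof.
move=> t; have [d _] := flat_is_derive k t.
exact/differentiable_continuous/derivable1_diffP.
Qed.

Lemma Sk_flat k l f : Sk k f -> Sk k (fun x => flat l (f x)).
Proof.
elim: k l f => [|k IH] l f Hf; have [cf hf] := Hf; split=> //; try exact: (cont_comp (@flat_cont l) cf).
move=> i; have [f1 f2] := hf i.
have H x : is_derive x (delta_mx 0 i) (fun x => flat l (f x))
    ((- l%:R * flat l.+1 (f x) + flat l.+2 (f x)) * pd i f x).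
  exact: (is_derive_comp1 (DeriveDef (f1 x) (erefl _)) (flat_is_derive l (f x))).
split=> [x|]; first by case: (H x).
rewrite (_ : pd i _ = fun x => (- l%:R * flat l.+1 (f x) + flat l.+2 (f x)) * pd i f x).
  apply: SkM => //; apply: SkD; last by apply: IH; exact: SkW.
  by apply: SkM; [exact: Sk_cst|apply: IH; exact: SkW].
by apply/funext => x; rewrite /pd; case: (H x).
Qed.

Lemma is_derive_coord (x : E) (v : E) j : is_derive x v (fun y : E => y 0 j) (v 0 j).
Proof.
apply: is_derive_line0.
have h : is_derive (0:R) 1 (fun h : R => h * v 0 j + x 0 j) (v 0 j).
  have d1 := is_derive_funM (is_derive_id (0:R) (1:R)) (is_derive_cst (v 0 j) (0:R) (1:R)).
  apply: (is_derive_eq (is_derive_funD d1 (is_derive_cst (x 0 j) (0:R) (1:R)))).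
  by rewrite mul0r mulr1 add0r addr0.
rewrite (_ : (fun h : R => _) = (fun h : R => h * v 0 j + x 0 j))//.
by apply/funext => t; rewrite !mxE.
Qed.

Lemma Sk_coord k j : Sk k (fun x : E => x 0 j).
Proof.
case: k => [|k]; split => //; try exact: coord_continuous.
move=> i; split=> [x|]; first by case: (is_derive_coord x (delta_mx 0 i) j).
rewrite (_ : pd i _ = fun=> (delta_mx 0 i : E) 0 j); first exact: Sk_cst.
by apply/funext => x; rewrite /pd; case: (is_derive_coord x (delta_mx 0 i) j).
Qed.

Lemma smooth_cst c : smooth (fun _ : E => c). Proof. by move=> k; exact: Sk_cst. Qed.
Lemma smooth_coord j : smooth (fun x : E => x 0 j). Proof. by move=> k; exact: Sk_coord. Qed.
Lemma smoothD f g : smooth f -> smooth g -> smooth (fun x => f x + g x).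
Proof. by move=> h1 h2 k; exact: SkD. Qed.
Lemma smoothM f g : smooth f -> smooth g -> smooth (fun x => f x * g x).
Proof. by move=> h1 h2 k; exact: SkM. Qed.
Lemma smooth_inv f : (forall x, f x != 0) -> smooth f -> smooth (fun x => (f x)^-1).
Proof. by move=> h1 h2 k; exact: Sk_inv. Qed.
Lemma smooth_flat l f : smooth f -> smooth (fun x => flat l (f x)).
Proof. by move=> h k; exact: Sk_flat. Qed.

Lemma smooth_sum (I : Type) (r : seq I) (F : I -> E -> R) : (forall j : I, smooth (F j)) ->
  smooth (fun x => \sum_(j <- r) F j x).
Proof.
move=> h; elim: r => [|i r IH]; first by under eq_fun do rewrite big_nil; exact: smooth_cst.
by under eq_fun do rewrite big_cons; exact: smoothD.
Qed.

Lemma smooth_prod (I : Type) (r : seq I) (F : I -> E -> R) : (forall j : I, smooth (F j)) ->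
  smooth (fun x => \prod_(j <- r) F j x).
Proof.
move=> h; elim: r => [|i r IH]; first by under eq_fun do rewrite big_nil; exact: smooth_cst.
by under eq_fun do rewrite big_cons; exact: smoothM.
Qed.

End smooth.

Section step.
Context {R : realType}.

Lemma flat_sum_gt0 (t : R) : 0 < flat 0 t + flat 0 (1 - t).
Proof.
have [t0|t0] := ltP 0 t; first by rewrite ltr_pwDl ?flat_gt0// flat_ge0.
by rewrite ltr_wpDl ?flat_ge0// flat_gt0//; lra.
Qed.

(** A smooth transition from 0 on [t <= 0] to 1 on [t >= 1]; one of the two summands of the
    denominator is always positive. *)
Definition step (t : R) : R := flat 0 t / (flat 0 t + flat 0 (1 - t)).

Lemma step_ge0 t : 0 <= step t.
Proof. by rewrite divr_ge0 ?flat_ge0// ltW// flat_sum_gt0. Qed.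

Lemma step_le1 t : step t <= 1.
Proof. by rewrite ler_pdivrMr ?flat_sum_gt0// mul1r lerDl flat_ge0. Qed.

Lemma step_le0 t : t <= 0 -> step t = 0.
Proof. by move=> t0; rewrite /step flat_le0// mul0r. Qed.

Lemma step_ge1 t : 1 <= t -> step t = 1.
Proof.
move=> t1; rewrite /step (@flat_le0 _ _ (1 - t)) ?addr0 ?divff//; last by rewrite subr_le0.
by rewrite gt_eqF// flat_gt0//; lra.
Qed.

Lemma smooth_step n (f : 'rV[R]_n -> R) : smooth f -> smooth (fun x => step (f x)).
Proof.
move=> sf; apply: smoothM; first exact: smooth_flat.
apply: smooth_inv; first by move=> x; rewrite gt_eqF// flat_sum_gt0.
apply: smoothD; apply: smooth_flat => //.
apply: smoothD; first exact: smooth_cst.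
rewrite (_ : (fun x => - f x) = fun x => -1 * f x); last by apply/funext => x; rewrite mulN1r.
by apply: smoothM => //; exact: smooth_cst.
Qed.

End step.

(** * Cutoff functions *)

Lemma cont_compR (R : realType) (f F : R -> R) : continuous F -> continuous f -> continuous (fun x => F (f x)).
Proof. by move=> cF cf x; apply: continuous_comp; [exact: cf|exact: cF]. Qed.

Lemma contMR (R : realType) (f g : R -> R) : continuous f -> continuous g -> continuous (fun x => f x * g x).
Proof. by move=> cf cg x; exact: (cvgM (cf x) (cg x)). Qed.

Lemma contDR (R : realType) (f g : R -> R) : continuous f -> continuous g -> continuous (fun x => f x + g x).
Proof. by move=> cf cg x; exact: (cvgD (cf x) (cg x)). Qed.

Lemma contVR (R : realType) (f : R -> R) : (forall x, f x != 0) -> continuous f -> continuous (fun x => (f x)^-1).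
Proof. by move=> f0 cf x; exact: (cvgV (f0 x) (cf x)). Qed.

Lemma cont_norm (R : realType) n (f : 'rV[R]_n -> R) : continuous f -> continuous (fun x => `|f x|).
Proof. by apply: (@cont_comp R n f (fun t => `|t|)); exact: norm_continuous. Qed.

Lemma prod01 (R : realType) (I : Type) (r : seq I) (P : pred I) (F : I -> R) : (forall i, 0 <= F i <= 1) ->
  0 <= \prod_(i <- r | P i) F i <= 1.
Proof.
move=> h; apply: (big_ind (fun x : R => 0 <= x <= 1)); first by rewrite ler01 lexx.
  by move=> x y /andP[x0 x1] /andP[y0 y1]; rewrite mulr_ge0//= mulr_ile1.
by move=> i _; exact: h.
Qed.

Section step_derivative.
Context {R : realType}.

Definition dstep (t : R) : R :=
  (flat 2 t * flat 0 (1 - t) + flat 0 t * flat 2 (1 - t)) / (flat 0 t + flat 0 (1 - t)) ^+ 2.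

Lemma is_derive_step (t : R) : is_derive t 1 (@step R) (dstep t).
Proof.
have d1 : is_derive t 1 (@flat R 0) (flat 2 t).
  by apply: (is_derive_eq (flat_is_derive 0 t)); rewrite oppr0 mul0r add0r.
have d2 : is_derive t 1 (fun s : R => flat 0 (1 - s)) (- flat 2 (1 - t)).
  have dN : is_derive t 1 (fun s : R => 1 - s) (0 - 1).
    by have := is_deriveB (is_derive_cst (1:R) t (1:R)) (is_derive_id t (1:R)).
  apply: (is_derive_eq (is_derive_comp1 dN (flat_is_derive 0 (1 - t)))).
  by rewrite oppr0 mul0r add0r sub0r mulrN1.
have d3 := is_derive_funD d1 d2.
have s0 := flat_sum_gt0 t.
have d4 := is_derive_comp1 d3 (@is_deriveV R (@idfun R) _ 1 1 (lt0r_neq0 s0) (is_derive_id _ (1 : R))).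
apply: (is_derive_eq (is_derive_funM d1 d4)).
rewrite /dstep /GRing.scale/=; field; lra.
Qed.

Lemma dstep_out (t : R) : (t <= 0) || (1 <= t) -> dstep t = 0.
Proof.
move=> /orP[t0|t1]; rewrite /dstep.
  by rewrite !(flat_le0 _ t0) mul0r mul0r addr0 mul0r.
by rewrite !(@flat_le0 _ _ (1 - t)) ?subr_le0// !mulr0 addr0 mul0r.
Qed.

Lemma dstep_cont : continuous dstep.
Proof.
have c1 k : continuous (fun t : R => flat k (1 - t)).
  apply: (@cont_compR _ (fun t => 1 - t)); first exact: flat_cont.
  by move=> t; apply: continuousB; [exact: cst_continuous|exact: cvg_id].
have c k := @flat_cont R k.
apply: contMR; first by apply: contDR; apply: contMR.
apply: contVR; first by move=> t; rewrite expf_neq0// gt_eqF// flat_sum_gt0.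
by apply: contMR; apply: contDR.
Qed.

Lemma dstep_bounded : exists2 M : R, 0 < M & forall t, `|dstep t| <= M.
Proof.
have cn : {within `[0, 1]%classic, continuous (fun t : R => `|dstep t|)}.
  apply: continuous_subspaceT; apply: (@cont_compR _ dstep (fun t => `|t|)); [exact: norm_continuous|exact: dstep_cont].
have [c _ hc] := EVT_max ler01 cn.
exists (`|dstep c| + 1); first by rewrite ltr_wpDl.
move=> t; have [t01|] := boolP (t \in `[0, 1]%R).
  by apply: le_trans (hc t t01) _; rewrite lerDl.
rewrite in_itv/= negb_and -!ltNge => h; rewrite dstep_out ?normr0 ?addr_ge0//.
by case/orP: h => /ltW ->; rewrite ?orbT.
Qed.

End step_derivative.

(** Only [x] is confined to [K]; the point [y] may leave [K], as the shifts of the following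
    sections require. *)
Lemma uniform_cont (R : realType) (T : pseudoMetricType R) (f : T -> R) (K : set T) (e : R) : continuous f -> compact K -> 0 < e ->
  exists2 r : R, 0 < r & forall x y, K x -> ball x r y -> `|f y - f x| < e.
Proof.
move=> cf cK e0.
have /compact_near_coveringP/(_ R (0^'+) (fun r x => forall y, ball x r y -> `|f y - f x| < e)) := cK.
case.
  move=> x Kx.
  have /cvgrPdist_lt/(_ _ (divr_gt0 e0 (ltr0n _ 2))) := cf x.
  rewrite -near_nbhs => /nbhs_ballP[r /= r0 hr].
  have r20 : 0 < r / 2 by rewrite divr_gt0.
  exists (ball x (r / 2), [set t | 0 < t < r / 2]).
    split=> /=; first exact: nbhsx_ballx.
    near=> t; apply/andP; split; first by [].
    by near: t; exact: nbhs_right_lt.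
  move=> [x' t] [/= xx' /andP[t0 tr]] y x'y.
  have h1 := hr _ (le_ball _ xx'); have h2 : ball x r y.
    rewrite (splitr r); apply: ball_triangle xx' _; apply: le_ball x'y; exact: ltW.
  have h1' := h1 ltac:(lra); have h2' := hr _ h2.
  rewrite /= in h1' h2'; rewrite -(subrKA (f x)) (splitr e).
  by apply: le_lt_trans (ler_normD _ _) _; rewrite ltrD// distrC.
move=> r /= r0 hr; exists (r / 2); first by rewrite divr_gt0.
move=> x y Kx; apply: (hr (r / 2)) => //; rewrite ?divr_gt0//.
rewrite /ball/= sub0r normrN ger0_norm; last by rewrite divr_ge0// ltW.
by rewrite ltr_pdivrMr// ltr_pMr// ltr1n.
Unshelve. all: by end_near.
Qed.

(** * Smooth cutoffs and uniform approximation by test functions *)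

Section urysohn.
Context {R : realType} {n : nat}.
Local Notation E := 'rV[R]_n.
Implicit Types (c x y : E) (K O : set E) (f psi phi : E -> R).

Lemma cont_bounded f K : continuous f -> compact K -> exists2 M : R, 0 < M & forall x, K x -> `|f x| <= M.
Proof.
move=> cf cK; have [K0|/set0P K0] := eqVneq K set0; first by exists 1 => // x; rewrite K0.
have cn : {within K, continuous (fun x => `|f x|)}.
  apply: continuous_subspaceT; exact: cont_norm.
have [c _ hc] := EVT_max_rV K0 cK cn.
exists (`|f c| + 1); first by rewrite ltr_wpDl.
by move=> x Kx; apply: le_trans (hc x (mem_set Kx)) _; rewrite lerDl.
Qed.

Lemma compact_cbox (a s : E) : compact (cbox a s).
Proof.
have := @rV_compact R n (fun i => `[a 0 i, a 0 i + s 0 i]%classic) (fun i => @segment_compact R _ _).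
rewrite (_ : [set v : E | _] = cbox a s)//.
Qed.

(** A plateau: 1 on the cube of half-side [r] about [c], 0 outside the cube of half-side [r']. In
    product form, a partial derivative touches the factors of one coordinate only. *)
Definition plat c (r r' : R) y : R :=
  \prod_i (step ((r' - (y 0 i - c 0 i)) / (r' - r)) * step ((r' + (y 0 i - c 0 i)) / (r' - r))).

Lemma plat_smooth c r r' : smooth (plat c r r').
Proof.
apply: smooth_prod => i; apply: smoothM; apply: smooth_step.
- rewrite (_ : (fun y => _) = fun y : E => (r' + c 0 i) / (r' - r) + (- (r' - r)^-1) * y 0 i).
    by apply: smoothD; [exact: smooth_cst|apply: smoothM; [exact: smooth_cst|exact: smooth_coord]].
  by apply/funext => y; ring.
- rewrite (_ : (fun y => _) = fun y : E => (r' - c 0 i) / (r' - r) + (r' - r)^-1 * y 0 i).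
    by apply: smoothD; [exact: smooth_cst|apply: smoothM; [exact: smooth_cst|exact: smooth_coord]].
  by apply/funext => y; ring.
Qed.

Lemma plat01 c r r' y : 0 <= plat c r r' y <= 1.
Proof.
by apply: prod01 => i; rewrite mulr_ge0 ?step_ge0//= mulr_ile1 ?step_ge0 ?step_le1.
Qed.

Lemma plat1 c r r' y : r < r' -> (forall i, `|y 0 i - c 0 i| <= r) -> plat c r r' y = 1.
Proof.
move=> rr h; apply: big1 => i _; have := h i; rewrite ler_norml => /andP[h1 h2].
by rewrite !step_ge1 ?mulr1// ler_pdivlMr ?subr_gt0// mul1r; lra.
Qed.

Lemma plat0 c r r' y i : r < r' -> r' <= `|y 0 i - c 0 i| -> plat c r r' y = 0.
Proof.
move=> rr h; rewrite /plat (bigD1 i)//=; apply/eqP; rewrite mulf_eq0; apply/orP; left.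
rewrite mulf_eq0; case: (leP 0 (y 0 i - c 0 i)) h => h0.
  rewrite ger0_norm// => h; rewrite step_le0 ?eqxx//.
  by rewrite pmulr_lle0 ?invr_gt0 ?subr_gt0//; lra.
rewrite ltr0_norm// => h; rewrite (@step_le0 _ ((r' + (y 0 i - c 0 i)) / (r' - r))) ?eqxx ?orbT//.
by rewrite pmulr_lle0 ?invr_gt0 ?subr_gt0//; lra.
Qed.

(** The same [M] serves all cubes, which makes the energy estimates scale invariant. *)
Lemma pd_plat_bound : exists2 M : R, 0 < M & forall c r r' y k, r < r' ->
  `|pd k (plat c r r') y| <= M / (r' - r).
Proof.
have [M M0 hM] := @dstep_bounded R.
exists (2 * M); first by rewrite mulr_gt0.
move=> c r r' y k rr; have rr0 : 0 < r' - r by rewrite subr_gt0.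
pose B := \prod_(i | i != k)
  (step ((r' - (y 0 i - c 0 i)) / (r' - r)) * step ((r' + (y 0 i - c 0 i)) / (r' - r))).
pose s := r' - r.
pose a (h : R) := (r' - (h + y 0 k - c 0 k)) / s.
pose b (h : R) := (r' + (h + y 0 k - c 0 k)) / s.
have e : (fun h : R => plat c r r' (h *: delta_mx 0 k + y)) = (fun h => B * (step (a h) * step (b h))).
  apply/funext => h; rewrite /plat (bigD1 k)//= !mxE !eqxx/= mulr1 mulrC; congr (_ * _).
  by apply: eq_bigr => i /negPf ik; rewrite !mxE ik andbF mulr0 add0r.
have da : is_derive (0:R) 1 a (- s^-1).
  rewrite (_ : a = fun h => (r' - y 0 k + c 0 k) / s + (- s^-1) * h); last by apply/funext => h; rewrite /a; ring.
  apply: (is_derive_eq (is_derive_funD (is_derive_cst _ _ _) (is_derive_funZ _ (is_derive_id (0:R) (1:R))))).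
  by rewrite add0r mulr1.
have db : is_derive (0:R) 1 b (s^-1).
  rewrite (_ : b = fun h => (r' + y 0 k - c 0 k) / s + (s^-1) * h); last by apply/funext => h; rewrite /b; ring.
  apply: (is_derive_eq (is_derive_funD (is_derive_cst _ _ _) (is_derive_funZ _ (is_derive_id (0:R) (1:R))))).
  by rewrite add0r mulr1.
have d := is_derive_funZ B (is_derive_funM (is_derive_comp1 da (is_derive_step (a 0)))
   (is_derive_comp1 db (is_derive_step (b 0)))).
rewrite -e in d; have [_] := is_derive_line0 d; rewrite /pd => ->.
have B1 : 0 <= B <= 1.
  by apply: prod01 => i; rewrite mulr_ge0 ?step_ge0//= mulr_ile1 ?step_ge0 ?step_le1.
case/andP: B1 => B0 B1.
rewrite normrM (ger0_norm B0); apply: le_trans (_ : 1 * _ <= _); first exact: ler_wpM2r.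
rewrite mul1r; apply: le_trans (ler_normD _ _) _.
have sv : 0 <= s^-1 by rewrite invr_ge0 ltW.
have H t1 t2 : `|step t1 * (dstep t2 * s^-1)| <= M / s.
  have e2 : `|s^-1| = s^-1 by rewrite ger0_norm.
  rewrite normrM [X in X * _]ger0_norm ?step_ge0// normrM e2.
  rewrite -[leRHS]mul1r; apply: ler_pM; rewrite ?step_ge0 ?mulr_ge0 ?step_le1//.
  by rewrite ler_wpM2r.
have h1 := H (a 0) (b 0); have h2 := H (b 0) (a 0).
by rewrite mulrN mulrN normrN -mulrA mulr2n mulrDl mul1r lerD.
Qed.

Definition testfun O phi := smooth phi /\
  exists K, [/\ compact K, K `<=` O & forall x, ~ K x -> phi x = 0].

Lemma testfunE O phi : testfun O phi <-> test_function O phi.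
Proof. by rewrite /testfun /test_function; split=> -[/smooth_Ck]. Qed.

Lemma finite_cubes_compact (s : seq (E * R)) :
  compact [set y | exists2 p, p \in s & cbox (p.1 - const_mx p.2) (const_mx (2 * p.2)) y].
Proof.
elim: s => [|p s IH].
  rewrite (_ : mkset _ = set0); first exact: compact0.
  by apply/seteqP; split => y // [].
rewrite (_ : mkset _ = cbox (p.1 - const_mx p.2) (const_mx (2 * p.2)) `|`
   [set y | exists2 p, p \in s & cbox (p.1 - const_mx p.2) (const_mx (2 * p.2)) y]).
  by apply: compactU => //; exact: compact_cbox.
apply/seteqP; split => y.
  by move=> [q]; rewrite inE => /orP[/eqP ->|qs]; [left|right; exists q].
move=> [h|[q qs h]]; first by exists p; rewrite ?mem_head.
by exists q => //; rewrite inE qs orbT.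
Qed.

(** Finitely many cubes cover [K]. The function [1 - \prod (1 - plat)] equals 1 wherever one plateau
    equals 1 and vanishes where all of them vanish. *)
Lemma urysohn K O : compact K -> open O -> K `<=` O ->
  exists chi, [/\ testfun O chi, forall x, 0 <= chi x <= 1 &
    exists2 V, open V /\ K `<=` V & forall x, V x -> chi x = 1].
Proof.
move=> cK oO KO.
(* The plateau equal to 1 on the ball of radius [r x] dies at [2 * r x]; radius [3 * r x] still lies
   in [O], so the closed cubes of half-side [2 * r x] form a compact support in [O]. *)
have H x : exists r : R, 0 < r /\ (K x -> ball x (3 * r) `<=` O).
  have [Kx|nKx] := pselect (K x); last by exists 1; split.
  have [e e0 he] := open_ball_sub oO (KO _ Kx).
  exists (e / 3); split => [|_]; first by rewrite divr_gt0.
  by rewrite mulrC divfK.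
have {H} [r hr] := choice H.
have cK' := cK; rewrite compact_cover in cK'.
have [||D DK Dcov] := cK' E K (fun x => (ball x (r x))^°).
- by move=> x _; exact: open_interior.
- by move=> x Kx; exists x => //; apply: nbhsx_ballx; exact: (hr x).1.
pose s := [seq (x, r x) | x <- finmap.enum_fset D].
pose chi y : R := 1 - \prod_(p <- s) (1 - plat p.1 p.2 (2 * p.2) y).
have rr x : r x < 2 * r x by have := (hr x).1; lra.
exists chi; split.
- split.
    apply: smoothD; first exact: smooth_cst.
    rewrite (_ : (fun y => - _) = fun y : E => -1 * \prod_(p <- s) (1 - plat p.1 p.2 (2 * p.2) y)); last first.
      by apply/funext => y; rewrite mulN1r.
    apply: smoothM; first exact: smooth_cst.
    apply: smooth_prod => p; apply: smoothD; first exact: smooth_cst.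
    rewrite (_ : (fun y => - _) = fun y : E => -1 * plat p.1 p.2 (2 * p.2) y); last first.
      by apply/funext => y; rewrite mulN1r.
    by apply: smoothM; [exact: smooth_cst|exact: plat_smooth].
  pose s' := [seq (x, 2 * r x) | x <- finmap.enum_fset D].
  exists [set y | exists2 p, p \in s' & cbox (p.1 - const_mx p.2) (const_mx (2 * p.2)) y]; split.
  + exact: finite_cubes_compact.
  + move=> y [p /mapP[x xD ->] /= h].
    have Kx : K x by have := DK x xD; rewrite inE.
    apply: (hr x).2 => //; rewrite rV_ball_box; last by have := (hr x).1; lra.
    by move=> i; have := h i; rewrite !mxE; have := (hr x).1; lra.
  + move=> y ny; rewrite /chi big_seq big1 ?subrr// => p /mapP[x xD ->] /=.
    have [i hi] : exists i, 2 * r x <= `|y 0 i - x 0 i|.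
      apply: contrapT => h; apply: ny; exists (x, 2 * r x); first by apply/mapP; exists x.
      move=> i; rewrite !mxE/=.
      have : `|y 0 i - x 0 i| < 2 * r x by rewrite ltNge; apply/negP => h'; apply: h; exists i.
      rewrite ltr_norml; lra.
    by rewrite (plat0 (rr x) hi) subr0.
- move=> y; have h : 0 <= \prod_(p <- s) (1 - plat p.1 p.2 (2 * p.2) y) <= 1.
    apply: prod01 => p.
    by have /andP[? ?] := plat01 p.1 p.2 (2 * p.2) y; apply/andP; split; lra.
  by rewrite /chi; case/andP: h => ? ?; apply/andP; split; lra.
- exists (\bigcup_(x in [set x | x \in finmap.enum_fset D]) (ball x (r x))^°).
    split; first by apply: bigcup_open => x _; exact: open_interior.
    by move=> x /Dcov[z zD h]; exists z.
  move=> y [x xD /interior_subset xy]; rewrite /chi.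
  have -> : \prod_(p <- s) (1 - plat p.1 p.2 (2 * p.2) y) = 0; last by rewrite subr0.
  apply/eqP; rewrite prodf_seq_eq0; apply/hasP; exists (x, r x); first by apply/mapP; exists x.
  rewrite /= plat1 ?subrr//; move: xy; rewrite rV_ball_box ?(hr x).1// => h i.
  by have := h i; rewrite !mxE ler_norml; lra.
Qed.

Lemma testfun_cst0 O : testfun O (fun=> 0).
Proof. by split; [exact: smooth_cst|exists set0; split => //; exact: compact0]. Qed.

Lemma testfunD O f g : testfun O f -> testfun O g -> testfun O (fun x => f x + g x).
Proof.
move=> [sf [K1 [c1 k1 h1]]] [sg [K2 [c2 k2 h2]]]; split; first exact: smoothD.
exists (K1 `|` K2); split; [exact: compactU|by move=> x []; [exact: k1|exact: k2]|].
move=> x nK; rewrite h1; last by move=> h; apply: nK; left.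
by rewrite h2 ?addr0// => h; apply: nK; right.
Qed.

Lemma testfunM O f g : testfun O f -> smooth g -> testfun O (fun x => g x * f x).
Proof.
move=> [sf [K1 [c1 k1 h1]]] sg; split; first exact: smoothM.
by exists K1; split => // x nK; rewrite h1 ?mulr0.
Qed.

Lemma testfunZ O f (c : R) : testfun O f -> testfun O (fun x => c * f x).
Proof. by move=> tf; apply: testfunM => //; exact: smooth_cst. Qed.

Lemma testfun_sub O O' f : O `<=` O' -> testfun O f -> testfun O' f.
Proof. by move=> OO' [sf [K [c k h]]]; split => //; exists K; split => //; exact: subset_trans OO'. Qed.

(** Sums [e * chi j], where [chi j] is a cutoff that is 1 on [psi >= (j + 1) e] and 0 on
    [psi <= j e]. At each point at most one layer is intermediate, so the error is at most [e]. *)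
Lemma layer_cake K O psi (e : R) : compact K -> open O -> K `<=` O -> continuous psi ->
  (forall x, ~ K x -> psi x = 0) -> (forall x, 0 <= psi x) -> 0 < e ->
  exists2 phi, testfun O phi & forall x, `|phi x - psi x| <= e.
Proof.
move=> cK oO KO cpsi psi0 psi_ge0 e0.
have [M M0 hM] := cont_bounded cpsi cK.
have H (j : nat) : exists chi, [/\ testfun O chi, forall x, 0 <= chi x <= 1,
    forall x, j.+1%:R * e <= psi x -> chi x = 1 & forall x, psi x <= j%:R * e -> chi x = 0].
  pose Kj := [set x | j.+1%:R * e <= psi x].
  pose Oj := O `&` [set x | j%:R * e < psi x].
  have KjK : Kj `<=` K.
    move=> x; rewrite /Kj /= => h; apply: contrapT => /psi0 h0; move: h; rewrite h0 leNgt => /negP; apply.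
    by rewrite mulr_gt0.
  have cKj : compact Kj.
    apply: (subclosed_compact _ cK KjK).
    have /continuousP cp := cpsi; have /continuous_closedP cp' := cpsi.
    have h := cp' _ (@closed_ge R (j.+1%:R * e)); exact: h.
  have oOj : open Oj.
    have /continuousP cp := cpsi; apply: openI => //.
    have h := cp _ (@open_gt R (j%:R * e)); exact: h.
  have KjO : Kj `<=` Oj.
    move=> x h; split; first by apply: KO; exact: KjK.
    by apply: lt_le_trans h; rewrite ltr_pM2r// ltr_nat.
  have [chi [[s [K' [c' k' h']]] h01 [V [oV KV] h1]]] := urysohn cKj oOj KjO.
  exists chi; split=> //.
  - by split=> //; exists K'; split=> // x /k'[].
  - by move=> x h; apply: h1; exact: KV.
  - move=> x h; apply: h' => /k'[_ /=]; by rewrite ltNge h.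
have {H} [chi hchi] := choice H.
(* The sum of the first [N] layers follows [min (psi, N e)] and is exactly [N e] where [psi >= N e];
   this equality feeds the next layer. *)
have S (N : nat) : exists2 phi, testfun O phi &
    forall x, phi x <= psi x + e /\ Num.min (psi x) (N%:R * e) - e <= phi x /\
      (phi x <= N%:R * e) /\ (N%:R * e <= psi x -> phi x = N%:R * e).
  elim: N => [|N [phi tphi IH]].
    exists (fun=> 0); first exact: testfun_cst0.
    move=> x; rewrite !mul0r min_r//; have := psi_ge0 x; do !split => //; lra.
  exists (fun x => phi x + e * chi N x).
    by apply: testfunD => //; apply: testfunZ; case: (hchi N).
  move=> x; have [i1 [i2 [i3 i4]]] := IH x; have [_ /(_ x)/andP[c0 c1] /(_ x) h1 /(_ x) h0] := hchi N.
  have p0 := psi_ge0 x.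
  rewrite -natr1 mulrDl mul1r in h1 *.
  have ec : e * chi N x <= e by rewrite ger_pMr.
  have ec0 : 0 <= e * chi N x by rewrite mulr_ge0// ltW.
  have [l1|l1] := leP (psi x) (N%:R * e).
    rewrite h0// mulr0 addr0; split=> //; split.
      by move: i2; rewrite min_l// min_l//; lra.
    by split; [lra|move=> ?; exfalso; lra].
  have e1 := i4 (ltW l1); rewrite e1.
  have [l2|l2] := leP (N%:R * e + e) (psi x).
    by rewrite h1// mulr1; do !split; lra.
  by do !split; try lra; move=> ?; exfalso; lra.
have [phi tphi h] := S (Num.truncn (M / e)).+1.
exists phi => // x; have [h1 [h2 [h3 h4]]] := h x.
have hx : psi x <= (Num.truncn (M / e)).+1%:R * e.
  rewrite -ler_pdivrMr//; apply: le_trans (_ : M / e <= _); last exact/ltW/truncnS_gt.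
  rewrite ler_pM2r ?invr_gt0//.
  have [Kx|nKx] := pselect (K x); first by rewrite (le_trans _ (hM x Kx))// ler_norm.
  by rewrite psi0// ltW.
by rewrite min_l// in h2; rewrite ler_distl; lra.
Qed.

Lemma testfun_approx K O psi (e : R) : compact K -> open O -> K `<=` O -> continuous psi ->
  (forall x, ~ K x -> psi x = 0) -> 0 < e ->
  exists2 phi, testfun O phi & forall x, `|phi x - psi x| <= e.
Proof.
move=> cK oO KO cpsi psi0 e0.
have e20 : 0 < e / 2 by rewrite divr_gt0.
have cp : continuous (fun x => (`|psi x| + psi x) / 2).
  apply: contM; last exact: cst_continuous.
  by apply: contD => //; exact: cont_norm.
have cm : continuous (fun x => (`|psi x| - psi x) / 2).
  apply: contM; last exact: cst_continuous.
  by apply: contB => //; exact: cont_norm.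
have [||p tp hp] := layer_cake cK oO KO cp _ _ e20.
- by move=> x /psi0 ->; rewrite normr0 addr0 mul0r.
- by move=> x; rewrite divr_ge0//; have := ler_norm (- psi x); rewrite normrN; lra.
have [||m tm hm] := layer_cake cK oO KO cm _ _ e20.
- by move=> x /psi0 ->; rewrite normr0 subr0 mul0r.
- by move=> x; rewrite divr_ge0//; have := ler_norm (psi x); lra.
exists (fun x => p x + (-1) * m x); first by apply: testfunD => //; exact: testfunZ.
move=> x; have := hp x; have := hm x; rewrite !ler_distl; lra.
Qed.

End urysohn.

(** * Weak gradients *)

Section weak.
Context {R : realType} {n : nat}.
Local Notation E := 'rV[R]_n.
Implicit Types (x y v : E) (K O D : set E) (u f psi phi : E -> R) (g : E -> E) (i : 'I_n).
Local Notation e_ i := (delta_mx 0 i : E).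

Lemma msb_compact K : compact K -> msb K.
Proof. by move=> cK; apply: measurable_closed; apply: compact_closed => //; exact: norm_hausdorff. Qed.

Lemma msb_open O : open O -> msb O. Proof. exact: measurable_open. Qed.

Lemma msbT : msb (@setT E). Proof. exact: measurableT. Qed.

Lemma compact_coord K : compact K -> exists2 M : R, 0 < M & forall x, K x -> forall i, `|x 0 i| <= M.
Proof.
move=> cK.
have c : continuous (fun x : E => \sum_i `|x 0 i|).
  have H (r : seq 'I_n) : continuous (fun x : E => \sum_(i <- r) `|x 0 i|).
    elim: r => [|i r IH]; first by under eq_fun do rewrite big_nil; exact: cst_continuous.
    under eq_fun do rewrite big_cons; apply: contD => //; apply: cont_norm; exact: coord_continuous.
  exact: H.
have [M M0 hM] := cont_bounded c cK; exists M => // x Kx i.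
apply: le_trans (hM x Kx); apply: le_trans (ler_norm _).
by rewrite (bigD1 i)//= lerDl sumr_ge0.
Qed.

Lemma cbox_vol_lty (a s : E) : (lebesgue_om R n (cbox a s) < +oo)%E.
Proof.
apply: (@le_lt_trans _ _ (lebesgue_om R n (cbox a (\row_i `|s 0 i|)))).
  apply: le_outer_measure => x h i; have /andP[-> h2] := h i; rewrite mxE /=.
  by apply: le_trans h2 _; rewrite lerD2l ler_norm.
apply: le_lt_trans (leb_cbox_le _ _) (ltry _) => i; by rewrite mxE.
Qed.

Lemma compact_vol_lty K : compact K -> (lebesgue_om R n K < +oo)%E.
Proof.
move=> /compact_coord[M M0 h].
apply: le_lt_trans (cbox_vol_lty (- const_mx M) (const_mx (2 * M))).
by apply: le_outer_measure => x Kx i; have := h x Kx i; rewrite !mxE ler_norml; lra.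
Qed.

Lemma intg_compact K f : compact K -> continuous f -> intg K f.
Proof.
move=> cK cf; have [M _ hM] := cont_bounded cf cK.
apply: (intg_bnd (M := M)) => //; [exact: msb_compact|exact: compact_vol_lty|].
by apply: mfn_cont => //; exact: msb_compact.
Qed.

Lemma L1loc_cont O f : continuous f -> L1loc O f.
Proof. by move=> cf K cK _; exact: intg_compact. Qed.

Lemma intgM_bnd D f psi (M : R) : msb D -> intg D f -> mfn D psi -> (forall x, D x -> `|psi x| <= M) ->
  intg D (fun x => f x * psi x).
Proof.
move=> mD fi mpsi hM; apply: (@intg_le _ _ _ _ (fun x => M * `|f x|)) => //.
- by apply: mfnM => //; exact: intg_mfn fi.
- by apply: intgZ => //; exact: intg_abs.
- by move=> x Dx; rewrite normrM mulrC ler_wpM2r// hM.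
Qed.

Lemma L1loc_supp O K f psi : L1loc O f -> compact K -> K `<=` O -> continuous psi ->
  (forall x, ~ K x -> psi x = 0) -> intg setT (fun x => f x * psi x).
Proof.
move=> fl cK KO cpsi psi0; have mK := msb_compact cK.
apply: (intg_mkcond mK msbT) => //.
  by move=> x _ /psi0 ->; rewrite mulr0.
have [M _ hM] := cont_bounded cpsi cK.
apply: (intgM_bnd (M := M)) => //; [exact: fl|exact: mfn_cont].
Qed.

Lemma IntT_supp D K f : msb D -> msb K -> K `<=` D -> (forall x, ~ K x -> f x = 0) ->
  Int D f = Int setT f.
Proof.
move=> mD mK KD f0.
rewrite (Int_mkcond mK mD KD); last by move=> x _; exact: f0.
by rewrite -(Int_mkcond mK msbT)//; move=> x _; exact: f0.
Qed.

Lemma pd_supp K phi i x : smooth phi -> compact K -> (forall x, ~ K x -> phi x = 0) ->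
  ~ K x -> pd i phi x = 0.
Proof.
move=> sp cK p0 nK.
have oK : open (~` K) by apply: closed_openC; apply: compact_closed => //; exact: norm_hausdorff.
have h : \forall y \near x, (cst 0 : E -> R) y = phi y.
  have := open_nbhs_nbhs (conj oK nK : open_nbhs x (~` K)).
  by apply: filterS => y /= ny; rewrite p0.
have [_] := near_eq_is_derive h (is_derive_cst (0 : R) x (e_ i)).
by [].
Qed.

(** The defining identity with integrals over all of R^n, on which translations act. *)
Lemma weak_gradientT O u g i phi : open O -> weak_gradient O u g -> testfun O phi ->
  Int setT (fun x => u x * pd i phi x) = - Int setT (fun x => g x 0 i * phi x).
Proof.
move=> oO wg tp; have [_ h] := wg i; have tp' := (testfunE O phi).1 tp.
have := h phi tp'; case: tp => sp [K [cK KO p0]].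
have mK := msb_compact cK; have mO := msb_open oO.
rewrite -/(Int O (fun x => u x * pd i phi x)) -/(Int O (fun x => g x 0 i * phi x)).
rewrite (IntT_supp mO mK KO); last by move=> x nK; rewrite (pd_supp i sp cK p0 nK) mulr0.
by rewrite (IntT_supp mO mK KO)// => x nK; rewrite p0// mulr0.
Qed.

Lemma is_derive_shift phi x v w (df : R) : is_derive (x + v : E) w phi df ->
  is_derive x w (fun y => phi (y + v)) df.
Proof.
move=> h; apply: is_derive_line0; under eq_fun do rewrite -addrA.
by apply: is_derive_line; rewrite scale0r add0r.
Qed.

Lemma cont_shift f v : continuous f -> continuous (fun x => f (x + v)).
Proof.
move=> cf x; apply: continuous_comp; last exact: cf.
by apply: continuousD; [exact: cvg_id|exact: cst_continuous].
Qed.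

Lemma pd_shift phi v i : smooth phi -> pd i (fun y => phi (y + v)) = (fun y => pd i phi (y + v)).
Proof.
move=> sp; apply/funext => x.
by have [_] := is_derive_shift (smooth_derivable i (x + v) sp).
Qed.

Lemma smooth_shift phi v : smooth phi -> smooth (fun y => phi (y + v)).
Proof.
move=> sp k; elim: k phi sp => [|k IH] phi sp.
  by split => //; apply: cont_shift; exact: smooth_cont.
split; first by apply: cont_shift; exact: smooth_cont.
move=> i; split => [x|]; first by have [] := is_derive_shift (smooth_derivable i (x + v) sp).
by rewrite pd_shift//; apply: IH; exact: smooth_pd.
Qed.

Lemma compact_shift K v : compact K -> compact [set x | K (x + v)].
Proof.
move=> cK.
have := @continuous_compact _ _ (fun x : E => x - v) K _ cK.
rewrite (_ : [set x | K (x + v)] = (fun x => x - v) @` K); last first.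
  apply/seteqP; split => x; first by move=> /= h; exists (x + v) => //; rewrite addrK.
  by move=> [y Ky <-] /=; rewrite subrK.
apply; apply: continuous_subspaceT => x.
by apply: continuousB; [exact: cvg_id|exact: cst_continuous].
Qed.

(* The mean value theorem for [t |-> \int u(x) phi(x - t e_i) dx], whose derivative is
   given by the weak gradient, replaces the mollification of [u]. *)
Lemma shift_mvt u i phi K (h : R) : continuous u -> smooth phi ->
  compact K -> (forall x, ~ K x -> phi x = 0) -> 0 < h ->
  exists2 t : R, 0 <= t <= h & Int setT (fun x => (u (x + h *: e_ i) - u x) * phi x) =
    - (h * Int setT (fun x => u x * pd i phi (x - t *: e_ i))).
Proof.
move=> cu sp cK p0 h0.
have cphi := smooth_cont sp; have cpd := smooth_cont (smooth_pd i sp).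
have [M M0 hM] := compact_coord cK.
pose K' : set E := cbox (- const_mx (M + h + 1)) (const_mx (2 * (M + h + 1))).
have cK' : compact K' by exact: compact_cbox.
have mK' := msb_compact cK'.
have inK' x (t : R) : -1 <= t <= h + 1 -> K (x - t *: e_ i) -> K' x.
  move=> /andP[t1 t2] /hM hx j; have := hx j; rewrite !mxE eqxx/= ler_norml => /andP[h1 h2].
  by case: (j == i) h1 h2; rewrite ?mulr1 ?mulr0; lra.
pose F (t : R) x := u x * phi (x - t *: e_ i).
have cF t : continuous (F t) by apply: contM => //; exact: cont_shift.
have dF (t : R) x : is_derive t 1 (F ^~ x) (u x * (- pd i phi (x - t *: e_ i))).
  apply: is_derive_funZ.
  have d1 : is_derive t 1 (fun s : R => - s) (-1).
    by have := is_deriveN (is_derive_id t (1:R)).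
  have d2 : is_derive (- t) 1 (fun s : R => phi (s *: e_ i + x)) (pd i phi (- t *: e_ i + x)).
    by apply: is_derive_line; exact: smooth_derivable.
  have := is_derive_comp1 d1 d2; rewrite mulrN1 scaleNr addrC.
  by under eq_fun do rewrite scaleNr addrC.
have [Mu Mu0 hMu] := cont_bounded cu cK'.
have [Mp Mp0 hMp] := cont_bounded cpd cK.
have pdb x : `|pd i phi x| <= Mp.
  have [/hMp//|nK] := pselect (K x); by rewrite (pd_supp i sp cK p0 nK) normr0 ltW.
(* Differentiation under the integral sign takes an open interval of parameters around [[0, h]];
   [K'] contains the supports of all shifts with parameter in that interval. *)
have itv (t : R) : 0 <= t <= h -> [set` `]-1, (h + 1)[] t by rewrite /= in_itv/=; lra.
have D (t : R) : 0 <= t <= h -> is_derive t 1 (fun s => Int K' (F s)) (Int K' (fun x => u x * (- pd i phi (x - t *: e_ i)))).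
  move=> th.
  have H1 := @derivable_under_integral R _ (lebT R n) (leb R n) F K' mK' t (-1) (h + 1) (itv t th).
  have H2 := @differentiation_under_integral R _ (lebT R n) (leb R n) F K' mK' t (-1) (h + 1) (itv t th).
  have A1 (s : R) : [set` `]-1, (h + 1)[] s -> intg K' (F s) by move=> _; apply: intg_compact.
  have A2 (s : R) x : [set` `]-1, (h + 1)[] s -> K' x -> derivable (F ^~ x) s 1 by move=> _ _; case: (dF s x).
  have A3 : intg K' (fun=> Mu * Mp) by apply: intg_compact => //; exact: cst_continuous.
  have dFE (s : R) x : partial1of2 F s x = u x * (- pd i phi (x - s *: e_ i)).
    by rewrite partial1of2E; case: (dF s x).
  have A4 (s : R) x : [set` `]-1, (h + 1)[] s -> K' x -> `|partial1of2 F s x| <= Mu * Mp.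
    by move=> _ K'x; rewrite dFE normrM normrN ler_pM// hMu.
  have G0 : forall x : E, 0 <= Mu * Mp by move=> _; rewrite mulr_ge0// ltW.
  have d := H1 A1 A2 _ G0 A3 A4; have := H2 A1 A2 _ G0 A3 A4.
  rewrite derive1E => e; split => //; rewrite e.
  by apply: Int_eq => x _; rewrite dFE.
pose dG (t : R) := Int K' (fun x => u x * (- pd i phi (x - t *: e_ i))).
have [c cin hc] : exists2 c, c \in `]0, h[ & Int K' (F h) - Int K' (F 0) = dG c * (h - 0).
  apply: (@MVT R (fun s => Int K' (F s)) dG 0 h h0) => [t|].
    by rewrite in_itv/= => th; apply: D; lra.
  apply: derivable_within_continuous => t; rewrite in_itv/= => th.
  by case: (D t th).
rewrite in_itv/= in cin; exists c; first by case/andP: cin => /ltW -> /ltW ->.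
have suppF (t : R) : 0 <= t <= h -> forall x, ~ K' x -> phi (x - t *: e_ i) = 0.
  by move=> th x nK'; apply: p0 => Kx; apply: nK'; apply: inK' Kx; lra.
have sF t : 0 <= t <= h -> intg setT (F t) /\ Int setT (F t) = Int K' (F t).
  move=> th; have s0 x : ~ K' x -> F t x = 0 by move=> nK'; rewrite /F (suppF t th)// mulr0.
  split; last by apply: (Int_mkcond mK' msbT) => // x _; exact: s0.
  by apply: (intg_mkcond mK' msbT) => // [x _|]; [exact: s0|exact: intg_compact].
have h00 : 0 <= (0:R) <= h by rewrite lexx ltW.
have hhh : 0 <= h <= h by rewrite lexx ltW.
have ->: Int setT (fun x => (u (x + h *: e_ i) - u x) * phi x) = Int K' (F h) - Int K' (F 0).
  have [i1 e1] := sF h hhh; have [i0 e0] := sF 0 h00.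
  have [i2 e2] := Int_shift (h *: e_ i) i1.
  rewrite -e1 -e0 -e2 -IntB//; last exact: msbT.
  by apply: Int_eq => x _; rewrite /F addrK scale0r subr0 mulrBl.
rewrite hc subr0 mulrC -mulrN; congr (_ * _).
have cdF : continuous (fun x => u x * pd i phi (x - c *: e_ i)).
  by apply: contM => //; exact: (cont_shift (v := - (c *: e_ i)) cpd).
have sd x : ~ K' x -> u x * pd i phi (x - c *: e_ i) = 0.
  move=> nK'; rewrite (pd_supp i sp cK p0) ?mulr0// => Kx; apply: nK'.
  by apply: inK' Kx; lra.
rewrite (Int_mkcond mK' msbT)//; last by move=> x _; exact: sd.
rewrite -mulN1r -IntZ//; last exact: intg_compact.
by apply: Int_eq => x _; rewrite mulrN mulN1r.
Qed.

Lemma testfun_shift K O phi i (c : R) : smooth phi -> compact K -> (forall x, ~ K x -> phi x = 0) ->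
  (forall x, K x -> O (x + c *: e_ i)) -> testfun O (fun x => phi (x - c *: e_ i)).
Proof.
move=> sp cK p0 KO; split; first exact: smooth_shift.
exists [set x | K (x + (- (c *: e_ i)))]; split; first exact: compact_shift.
  by move=> x /= Kx; have := KO _ Kx; rewrite subrK.
by move=> x nK; apply: p0.
Qed.

Lemma weak_shift O u g i phi K (h : R) : open O -> continuous u -> weak_gradient O u g -> smooth phi ->
  compact K -> (forall x, ~ K x -> phi x = 0) -> 0 < h ->
  (forall x (t : R), K x -> 0 <= t <= h -> O (x + t *: e_ i)) ->
  exists2 t : R, 0 <= t <= h & Int setT (fun x => (u (x + h *: e_ i) - u x) * phi x) =
    h * Int setT (fun x => g x 0 i * phi (x - t *: e_ i)).
Proof.
move=> oO cu wg sp cK p0 h0 KO.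
have [c ch ec] := shift_mvt i cu sp cK p0 h0; exists c => //; rewrite ec.
have tp := testfun_shift sp cK p0 (fun x Kx => KO x c Kx ch).
by have := weak_gradientT i oO wg tp; rewrite pd_shift// => ->; rewrite mulrN opprK.
Qed.

Lemma Int_sup_bound D f psi (e : R) : msb D -> intg D f -> mfn D psi -> (forall x, D x -> `|psi x| <= e) ->
  `|Int D (fun x => f x * psi x)| <= e * Int D (fun x => `|f x|).
Proof.
move=> mD fi mp pe; have i1 := intgM_bnd mD fi mp pe.
rewrite -IntZ//; last exact: intg_abs.
apply: le_trans (Int_abs mD i1) _; apply: Int_le => //.
- exact: intg_abs.
- by apply: intgZ => //; exact: intg_abs.
- by move=> x Dx; rewrite normrM mulrC ler_wpM2r// pe.
Qed.

(** Uniform approximation carries the bound from smooth to continuous [psi]. This freedom is what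
    allows a regularised sign of the difference as test function in [shift_abs_bound]. *)
Lemma weak_shift_le O N Q u g i psi K (h B : R) (a s : E) : open O -> open N -> continuous u ->
  weak_gradient O u g -> continuous psi ->
  compact K -> K `<=` N -> N `<=` cbox a s -> (forall x, ~ K x -> psi x = 0) ->
  (forall x, `|psi x| <= B) -> 0 < h -> 0 <= B ->
  (forall x (t : R), N x -> 0 <= t <= h -> O (x + t *: e_ i) /\ Q (x + t *: e_ i)) ->
  msb Q -> intg Q (fun x => g x 0 i) ->
  `|Int setT (fun x => (u (x + h *: e_ i) - u x) * psi x)| <= h * B * Int Q (fun x => `|g x 0 i|).
Proof.
move=> oO oN cu wg cpsi cK KN Nb psi0 hB h0 B0 NO mQ gQ.
pose D x := u (x + h *: e_ i) - u x.
have cD : continuous D by apply: contB => //; exact: cont_shift.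
have cbx := @compact_cbox R n a s; have mbx := msb_compact cbx.
have iD : intg (cbox a s) D by exact: intg_compact.
set I1 := Int (cbox a s) (fun x => `|D x|); set I2 := Int Q (fun x => `|g x 0 i|).
have I10 : 0 <= I1 by apply: Int_ge0 => *; exact: normr_ge0.
have I20 : 0 <= I2 by apply: Int_ge0 => *; exact: normr_ge0.
apply/ler_addgt0Pr => e e0.
pose e' := e / (I1 + h * I2 + 1).
have den : 0 < I1 + h * I2 + 1 by rewrite ltr_wpDl// addr_ge0// mulr_ge0// ltW.
have e'0 : 0 < e' by rewrite divr_gt0.
have [phi [sp [K' [cK' K'N p0]]] hphi] := testfun_approx cK oN KN cpsi psi0 e'0.
have [t th et] := weak_shift oO cu wg sp cK' p0 h0 (fun x t Kx th => (NO x t (K'N _ Kx) th).1).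
have cphi := smooth_cont sp.
have sb (f : E -> R) : (forall x, ~ (K `|` K') x -> f x = 0) -> Int setT (fun x => D x * f x) =
    Int (cbox a s) (fun x => D x * f x).
  move=> f0; rewrite (Int_mkcond mbx msbT)// => x _ nb; rewrite f0 ?mulr0// => -[/KN|/K'N] /Nb //.
have KU1 x : ~ (K `|` K') x -> ~ K x by move=> h1 h2; apply: h1; left.
have KU2 x : ~ (K `|` K') x -> ~ K' x by move=> h1 h2; apply: h1; right.
have ->: Int setT (fun x => D x * psi x) = Int setT (fun x => D x * phi x) - Int setT (fun x => D x * (phi x - psi x)).
  rewrite !sb; last 3 first.
  - by move=> x nK; rewrite ?(p0 _ (KU2 _ nK)) ?(psi0 _ (KU1 _ nK)) ?subrr.
  - by move=> x nK; rewrite ?(p0 _ (KU2 _ nK)) ?(psi0 _ (KU1 _ nK)) ?subrr.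
  - by move=> x nK; rewrite ?(p0 _ (KU2 _ nK)) ?(psi0 _ (KU1 _ nK)) ?subrr.
  rewrite -IntB//; last 2 first.
  - by apply: intg_compact => //; exact: contM.
  - by apply: intg_compact => //; apply: contM => //; exact: contB.
  by apply: Int_eq => x _; rewrite -mulrBr opprB addrC subrK.
have b1 : `|Int setT (fun x => D x * phi x)| <= h * (B + e') * I2.
  rewrite et normrM (gtr0_norm h0) -mulrA; apply: ler_wpM2l; first exact: ltW.
  have sQ x : ~ Q x -> phi (x - t *: e_ i) = 0.
    move=> nQ; apply: p0 => /K'N Nx; apply: nQ; have [_] := NO _ _ Nx th; by rewrite subrK.
  rewrite (Int_mkcond mQ msbT)//; last by move=> x _ /sQ ->; rewrite mulr0.
  apply: Int_sup_bound => //.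
    by apply: mfn_cont => //; exact: (cont_shift (v := - (t *: e_ i)) cphi).
  move=> x _; apply: le_trans (_ : `|psi (x - t *: e_ i)| + e' <= _); last by rewrite lerD2r hB.
  have := hphi (x - t *: e_ i); have := lerB_dist (phi (x - t *: e_ i)) (psi (x - t *: e_ i)); lra.
have b2 : `|Int setT (fun x => D x * (phi x - psi x))| <= e' * I1.
  rewrite sb; last by move=> x nK; rewrite (p0 _ (KU2 _ nK)) (psi0 _ (KU1 _ nK)) subrr.
  by apply: Int_sup_bound => //; apply: mfn_cont => //; exact: contB.
apply: le_trans (ler_normB _ _) _; apply: le_trans (lerD b1 b2) _.
have -> : e = e' * (I1 + h * I2 + 1) by rewrite /e' divfK// gt_eqF.
nra.
Qed.

Lemma intgU A B f : msb A -> msb B -> intg A f -> intg B f -> intg (A `|` B) f.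
Proof.
move=> mA mB iA iB.
have mU : msb (A `|` B) by exact: measurableU.
have mf : mfn (A `|` B) f.
  by apply/(measurable_funU (f : lebT R n -> R) mA mB); split; exact: intg_mfn.
pose fA := patch (fun=> 0) A f; pose fB := patch (fun=> 0) B f.
have iA' : intg (A `|` B) fA.
  apply: (intg_mkcond mA mU); [by move=> x; left| |].
    by move=> x _ nA; rewrite /fA /patch memNset.
  by apply: intg_eq iA => // x Ax; rewrite /fA /patch mem_set.
have iB' : intg (A `|` B) fB.
  apply: (intg_mkcond mB mU); [by move=> x; right| |].
    by move=> x _ nA; rewrite /fB /patch memNset.
  by apply: intg_eq iB => // x Ax; rewrite /fB /patch mem_set.
apply: (@intg_le _ _ _ _ (fun x => `|fA x| + `|fB x|)) => //.
  by apply: intgD => //; exact: intg_abs.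
move=> x [Ax|Bx]; rewrite /fA /fB /patch.
  by rewrite mem_set// lerDl.
by rewrite [in X in _ <= _ + X]mem_set// lerDr.
Qed.

(** [N] and [Q] are superlevel sets, at 1/2 and 1/4, of a cutoff function; its uniform continuity
    gives the width [r] available for shifts. *)
Lemma compact_nbhd K O : compact K -> open O -> K `<=` O ->
  exists N Q (r : R), [/\ open N, K `<=` N, compact Q, Q `<=` O & 0 < r] /\
    forall x y, N x -> ball x r y -> Q y.
Proof.
move=> cK oO KO; have [chi [[sc [K' [cK' K'O c0]]] c01 [V [oV KV] c1]]] := urysohn cK oO KO.
have cc := smooth_cont sc.
have QK : [set x | 4^-1 <= chi x] `<=` K'.
  by move=> x /= h; apply: contrapT => /c0 e; rewrite e in h; lra.
have e4 : 0 < 4^-1 :> R by lra.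
have [r r0 hr] := uniform_cont cc cK' e4.
exists [set x | 2^-1 < chi x], [set x | 4^-1 <= chi x], r; split; last first.
  move=> x y /= Nx xy.
  have K'x : K' x by apply: contrapT => /c0 e; rewrite e in Nx; lra.
  by have := hr x y K'x xy; rewrite ltr_distl; lra.
split=> //.
- by have /continuousP cp := cc; have h := cp _ (@open_gt R 2^-1); exact: h.
- by move=> x Kx /=; rewrite c1; [lra|exact: KV].
- apply: (subclosed_compact _ cK' QK).
  by have /continuous_closedP cp := cc; have h := cp _ (@closed_ge R 4^-1); exact: h.
- exact: subset_trans K'O.
Qed.

Lemma ball_shift x i (t r : R) : 0 <= t < r -> ball x r (x + t *: e_ i).
Proof.
move=> /andP[t0 tr]; rewrite rV_ball_box; last exact: le_lt_trans tr.
move=> j; rewrite !mxE eqxx/=; case: (j == i); rewrite ?mulr1 ?mulr0; lra.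
Qed.

Lemma wg_eq O u u' g g' : open O -> weak_gradient O u g -> (forall x, O x -> u' x = u x) ->
  (forall x, O x -> g' x = g x) -> weak_gradient O u' g'.
Proof.
move=> oO wg uu gg i; have [l h] := wg i; split.
  move=> K cK KO; apply: (intg_eq (f := fun x => g x 0 i)); [exact: msb_compact| |exact: l].
  by move=> x /KO/gg ->.
move=> phi tp; have := h phi tp; rewrite -/(Int O _) -/(Int O _) => e.
rewrite -/(Int O _) -/(Int O _) (Int_eq (g := fun z => u z * pd i phi z)); last by move=> x /uu ->.
by rewrite [X in _ = - X](Int_eq (g := fun z => g z 0 i * phi z)) // => x /gg ->.
Qed.

Lemma wg_sub O O' u g : open O -> open O' -> O' `<=` O -> weak_gradient O u g -> weak_gradient O' u g.
Proof.
move=> oO oO' OO wg i; have [l h] := wg i; split.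
  by move=> K cK KO; apply: l => //; exact: subset_trans OO.
move=> phi /testfunE tp; have tp' := testfun_sub OO tp.
have [sp [K [cK KO p0]]] := tp.
have mK := msb_compact cK; have mO' := msb_open oO'.
rewrite -/(Int O' (fun z => u z * pd i phi z)) -/(Int O' (fun z => g z 0 i * phi z)).
rewrite (IntT_supp mO' mK KO); last by move=> x nK; rewrite (pd_supp i sp cK p0 nK) mulr0.
rewrite (IntT_supp mO' mK KO); last by move=> x nK; rewrite p0// mulr0.
exact: (weak_gradientT i oO wg tp').
Qed.

Lemma wgI O u g : open O -> (forall i, L1loc O (fun x => g x 0 i)) ->
  (forall i phi, testfun O phi -> Int setT (fun x => u x * pd i phi x) = - Int setT (fun x => g x 0 i * phi x)) ->
  weak_gradient O u g.
Proof.
move=> oO l h i; split=> // phi /testfunE tp.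
have [sp [K [cK KO p0]]] := tp.
have mK := msb_compact cK; have mO' := msb_open oO.
rewrite -/(Int O (fun z => u z * pd i phi z)) -/(Int O (fun z => g z 0 i * phi z)).
rewrite (IntT_supp mO' mK KO); last by move=> x nK; rewrite (pd_supp i sp cK p0 nK) mulr0.
rewrite (IntT_supp mO' mK KO); last by move=> x nK; rewrite p0// mulr0.
exact: h.
Qed.

Lemma L1locM O f psi : L1loc O f -> continuous psi -> L1loc O (fun x => f x * psi x).
Proof.
move=> l cp K cK KO; have mK := msb_compact cK; have [M _ hM] := cont_bounded cp cK.
by apply: (intgM_bnd (M := M)) => //; [exact: l|exact: mfn_cont].
Qed.

Lemma testfun_pd O phi i : testfun O phi -> testfun O (pd i phi).
Proof.
move=> [sp [K [cK KO p0]]]; split; first exact: smooth_pd.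
by exists K; split => // x; exact: pd_supp.
Qed.

Lemma intgT_test O f phi : L1loc O f -> testfun O phi -> intg setT (fun x => f x * phi x).
Proof. by move=> l [sp [K [cK KO p0]]]; exact: (L1loc_supp l cK KO (smooth_cont sp) p0). Qed.

Lemma wg_smoothM O u g eta : open O -> continuous u -> weak_gradient O u g -> smooth eta ->
  weak_gradient O (fun x => eta x * u x) (fun x => eta x *: g x + u x *: \row_i pd i eta x).
Proof.
move=> oO cu wg se; have ce := smooth_cont se; apply: wgI => // [i K cK KO|i phi tp].
  apply: (intg_eq (f := fun x => g x 0 i * eta x + u x * pd i eta x)); first exact: msb_compact.
    by move=> x _; rewrite !mxE mulrC.
  have [l _] := wg i; apply: intgD; first exact: msb_compact.
    by have := L1locM l ce; exact.
  by apply: intg_compact => //; apply: contM => //; apply: smooth_cont; exact: smooth_pd.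
have tp' := testfunM tp se; have := weak_gradientT i oO wg tp'.
have e x : pd i (fun y => eta y * phi y) x = eta x * pd i phi x + phi x * pd i eta x.
  by have [_] := is_derive_funM (smooth_derivable i x se) (smooth_derivable i x tp.1).
rewrite (Int_eq (g := fun x => eta x * u x * pd i phi x + u x * pd i eta x * phi x)); last first.
  by move=> x _; rewrite e; ring.
have i1 : intg setT (fun x => eta x * u x * pd i phi x).
  by apply: (@intgT_test O) => //; [apply: L1loc_cont; exact: contM|exact: testfun_pd].
have i2 : intg setT (fun x => u x * pd i eta x * phi x).
  apply: (@intgT_test O) => //; apply: L1loc_cont; apply: contM => //; apply: smooth_cont; exact: smooth_pd.
have [l _] := wg i.
have i3 : intg setT (fun x => g x 0 i * eta x * phi x).
  by apply: (@intgT_test O) => //; exact: L1locM.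
rewrite IntD//; last exact: msbT.
rewrite [Int setT (fun x => g x 0 i * (eta x * phi x))](Int_eq (g := fun x => g x 0 i * eta x * phi x)); last first.
  by move=> x _; ring.
have -> : Int setT (fun x => (eta x *: g x + u x *: \row_j pd j eta x) 0 i * phi x) =
    Int setT (fun x => g x 0 i * eta x * phi x + u x * pd i eta x * phi x).
  by apply: Int_eq => x _; rewrite !mxE; ring.
rewrite IntD//; [lra|exact: msbT].
Qed.

(** A cutoff splits a test function into one supported in [O1] and one supported in [O2]. In this
    way a truncation that vanishes near part of Gamma is joined to its restriction to the complement
    of Gamma. *)
Lemma wgU O1 O2 u g : open O1 -> open O2 -> continuous u -> weak_gradient O1 u g -> weak_gradient O2 u g ->
  weak_gradient (O1 `|` O2) u g.
Proof.
move=> o1 o2 cu w1 w2; have oU : open (O1 `|` O2) by exact: openU.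
have split_cpt K : compact K -> K `<=` O1 `|` O2 -> exists chi V, [/\ testfun O1 chi, open V,
    forall x, V x -> chi x = 1, compact (K `\` V) & K `\` V `<=` O2].
  move=> cK KU.
  have cKO : compact (K `\` O2).
    apply: (subclosed_compact _ cK); last by move=> x [].
    by rewrite setDE; apply: closedI; [apply: compact_closed => //; exact: norm_hausdorff|exact: open_closedC].
  have KO1 : K `\` O2 `<=` O1 by move=> x [/KU[]].
  have [chi [tc _ [V [oV KV] c1]]] := urysohn cKO o1 KO1.
  exists chi, V; split=> //.
    apply: (subclosed_compact _ cK); last by move=> x [].
    by rewrite setDE; apply: closedI; [apply: compact_closed => //; exact: norm_hausdorff|exact: open_closedC].
  by move=> x [Kx nV]; apply: contrapT => nO; apply: nV; apply: KV; split.
apply: wgI => // [i K cK KU|i phi tp].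
  have [chi [V [[sc [K1 [cK1 K1O c0]]] oV c1 cKV KVO]]] := split_cpt K cK KU.
  have [l1 _] := w1 i; have [l2 _] := w2 i.
  apply: (@intgS _ _ K (K1 `|` (K `\` V))).
  - exact: msb_compact.
  - by apply: measurableU; exact: msb_compact.
  - move=> x Kx; have [Vx|nV] := pselect (V x); [left|by right].
    by apply: contrapT => /c0; rewrite c1// => /eqP; rewrite oner_eq0.
  - by apply: intgU; [exact: msb_compact|exact: msb_compact|exact: l1|exact: l2].
have [sp [K [cK KU p0]]] := tp.
have [chi [V [tc oV c1 cKV KVO]]] := split_cpt K cK KU.
have sc := tc.1.
have t1 : testfun O1 (fun x => phi x * chi x) by exact: testfunM.
have s1c : smooth (fun x => 1 + -1 * chi x).
  by apply: smoothD; [exact: smooth_cst|apply: smoothM => //; exact: smooth_cst].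
have t2 : testfun O2 (fun x => (1 + -1 * chi x) * phi x).
  split; first exact: smoothM.
  exists (K `\` V); split => // x nKV; have [Kx|/p0 ->] := pselect (K x); last by rewrite mulr0.
  have [Vx|nV] := pselect (V x); last by exfalso; apply: nKV.
  by rewrite c1// mulr1 subrr mul0r.
have e : phi = (fun x => phi x * chi x + (1 + -1 * chi x) * phi x) by apply/funext => x; ring.
have ep x : pd i phi x = pd i (fun x => phi x * chi x) x + pd i (fun x => (1 + -1 * chi x) * phi x) x.
  rewrite {1}e.
  by have [_] := is_derive_funD (smooth_derivable i x t1.1) (smooth_derivable i x t2.1).
rewrite (Int_eq (g := fun x => u x * pd i (fun x => phi x * chi x) x + u x * pd i (fun x => (1 + -1 * chi x) * phi x) x)); last first.
  by move=> x _; rewrite ep mulrDr.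
have lu O : L1loc O u by exact: L1loc_cont.
rewrite IntD; last 3 first.
- exact: msbT.
- by apply: (@intgT_test O1) => //; exact: testfun_pd.
- by apply: (@intgT_test O2) => //; exact: testfun_pd.
rewrite (weak_gradientT i o1 w1 t1) (weak_gradientT i o2 w2 t2) -opprD -IntD; last 3 first.
- exact: msbT.
- by apply: (@intgT_test O1) => //; case: (w1 i).
- by apply: (@intgT_test O2) => //; case: (w2 i).
by congr (- _); apply: Int_eq => x _; ring.
Qed.

Lemma shift_zero_out N Q phi K (r : R) i : (forall x y, N x -> ball x r y -> Q y) -> K `<=` N ->
  (forall x, ~ K x -> phi x = 0) -> forall (t : R) x, 0 <= t < r -> ~ Q x -> phi (x - t *: e_ i) = 0.
Proof.
move=> NQ KN p0 t x tr nQ; apply: p0 => /KN Nx; apply: nQ; apply: NQ Nx _.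
by have := ball_shift (x - t *: e_ i) i tr; rewrite subrK.
Qed.

Lemma ball_shiftN x i (t r : R) : 0 <= t < r -> ball x r (x - t *: e_ i).
Proof.
move=> /andP[t0 tr]; rewrite rV_ball_box; last exact: le_lt_trans tr.
move=> j; rewrite !mxE eqxx/=; case: (j == i); rewrite ?mulr1 ?mulr0; lra.
Qed.

Lemma unif_shift Q phi i (e : R) : continuous phi -> compact Q -> 0 < e ->
  exists2 r : R, 0 < r & forall (t : R) x, Q x -> 0 <= t < r -> `|phi (x - t *: e_ i) - phi x| <= e.
Proof.
move=> cp cQ e0; have [r r0 hr] := uniform_cont cp cQ e0.
exists r => // t x Qx tr; apply/ltW/hr => //; exact: ball_shiftN.
Qed.

(** * Difference quotients and the chain rule *)

Section chain.
Variables (O : set E) (u : E -> R) (g : E -> E) (i : 'I_n).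
Hypotheses (oO : open O) (cu : continuous u) (wg : weak_gradient O u g).
Local Notation D_ h := (fun x => u (x + h *: e_ i) - u x).

Lemma weak_shift_Q K N Q psi (r h B : R) : open N -> compact K -> K `<=` N -> compact Q -> Q `<=` O ->
  (forall x y, N x -> ball x r y -> Q y) -> continuous psi -> (forall x, ~ K x -> psi x = 0) ->
  (forall x, `|psi x| <= B) -> 0 < h < r -> 0 <= B ->
  `|Int setT (fun x => D_ h x * psi x)| <= h * B * Int Q (fun x => `|g x 0 i|).
Proof.
move=> oN cK KN cQ QO NQ cp p0 pB /andP[h0 hr] B0.
have r0 : 0 < r by exact: lt_trans hr.
have [M M0 hM] := compact_coord cQ.
apply: (weak_shift_le (K := K) (a := - const_mx M) (s := const_mx (2 * M)) oO oN) => //.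
- move=> x Nx j; have := hM x (NQ _ _ Nx (ballxx x r0)) j; rewrite !mxE ler_norml; lra.
- move=> x t Nx /andP[t0 th]; have Qx : Q (x + t *: e_ i).
    by apply: NQ Nx _; apply: ball_shift; rewrite t0 (le_lt_trans th).
  by split=> //; exact: QO.
- exact: msb_compact.
- by have [l _] := wg i; exact: l.
Qed.

Lemma weak_shift_cvg K psi (e : R) : compact K -> K `<=` O -> continuous psi ->
  (forall x, ~ K x -> psi x = 0) -> 0 < e ->
  exists2 h0 : R, 0 < h0 & forall h : R, 0 < h < h0 ->
    `|Int setT (fun x => D_ h x * psi x) - h * Int setT (fun x => g x 0 i * psi x)| <= e * h.
Proof.
move=> cK KO cp psi0 e0.
have [N [Q [r [[oN KN cQ QO r0] NQ]]]] := compact_nbhd cK oO KO.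
have NQ' : N `<=` Q by move=> x Nx; apply: NQ Nx _; exact: ballxx.
have mQ := msb_compact cQ.
set IQ := Int Q (fun x => `|g x 0 i|).
have IQ0 : 0 <= IQ by apply: Int_ge0 => *; exact: normr_ge0.
(* Three errors of size [d * IQ] arise: [phi] against [psi] in the difference, the shift by [t], and
   [phi] against [psi] in the limit. *)
pose d := e / (3 * (IQ + 1)).
have d0 : 0 < d by rewrite divr_gt0// mulr_gt0// ltr_wpDl.
have dI : 3 * (d * IQ) <= e.
  have -> : e = 3 * (d * (IQ + 1)) by rewrite /d; field; rewrite gt_eqF// ltr_wpDl.
  by rewrite ler_pM2l// ler_pM2l// lerDl.
have [phi [sp [K' [cK' K'N p0]]] hphi] := testfun_approx cK oN KN cp psi0 d0.
have cphi := smooth_cont sp.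
have [r2 r20 hr2] := unif_shift i cphi cQ d0.
exists (Num.min r r2); first by rewrite lt_min r0.
move=> h /andP[h0]; rewrite lt_min => /andP[hr hr2'].
have gQ : intg Q (fun x => g x 0 i) by have [l _] := wg i; exact: l.
have NO x (t : R) : K' x -> 0 <= t <= h -> O (x + t *: e_ i).
  move=> /K'N Nx /andP[t0 th]; apply: QO; apply: NQ Nx _; apply: ball_shift; rewrite t0; exact: le_lt_trans hr.
have [t th et] := weak_shift oO cu wg sp cK' p0 h0 NO.
have cdf : continuous (fun x => phi x - psi x) by exact: contB.
have KK0 x : ~ (K' `|` K) x -> phi x - psi x = 0.
  move=> nK; rewrite p0; last by move=> k; apply: nK; left.
  by rewrite psi0 ?subrr// => k; apply: nK; right.
have KKN : K' `|` K `<=` N by move=> x [/K'N|/KN].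
have cKK : compact (K' `|` K) by exact: compactU.
have trange : 0 <= t < r by case/andP: th => -> th; rewrite (le_lt_trans th).
have trange2 : 0 <= t < r2 by case/andP: th => -> th; rewrite (le_lt_trans th).
have b1 : `|Int setT (fun x => D_ h x * (phi x - psi x))| <= h * d * IQ.
  by apply: (weak_shift_Q oN cKK KKN cQ QO NQ) => //; [rewrite h0|exact: ltW].
have toQ (f : E -> R) : (forall x, ~ Q x -> f x = 0) -> continuous f ->
    intg setT (fun x => g x 0 i * f x) /\ Int setT (fun x => g x 0 i * f x) = Int Q (fun x => g x 0 i * f x).
  move=> f0 cf; split; first by apply: (L1loc_supp (wg i).1 cQ QO).
  by apply: (Int_mkcond mQ msbT) => // x _ /f0 ->; rewrite mulr0.
have phQ x : ~ Q x -> phi x = 0 by move=> nQ; apply: p0 => /K'N/NQ'.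
have psQ x : ~ Q x -> psi x = 0 by move=> nQ; apply: psi0 => /KN/NQ'.
have phtQ x : ~ Q x -> phi (x - t *: e_ i) = 0 by move=> nQ; exact: (shift_zero_out i NQ K'N p0 trange nQ).
have cpht : continuous (fun x => phi (x - t *: e_ i)) by exact: (cont_shift (v := - (t *: e_ i)) cphi).
have b2 : `|Int setT (fun x => g x 0 i * phi (x - t *: e_ i)) - Int setT (fun x => g x 0 i * phi x)| <= d * IQ.
  have [i1 _] := toQ _ phtQ cpht; have [i2 _] := toQ _ phQ cphi.
  rewrite -IntB//; last exact: msbT.
  rewrite (Int_eq (g := fun x => g x 0 i * (phi (x - t *: e_ i) - phi x))); last by move=> x _; rewrite mulrBr.
  have [|_ ->] := toQ (fun x => phi (x - t *: e_ i) - phi x) _ (contB cpht cphi).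
    by move=> x nQ; rewrite phtQ// phQ// subrr.
  apply: Int_sup_bound => //; first by apply: mfn_cont => //; exact: contB.
  by move=> x Qx; exact: hr2.
have b3 : `|Int setT (fun x => g x 0 i * phi x) - Int setT (fun x => g x 0 i * psi x)| <= d * IQ.
  have [i1 _] := toQ _ psQ cp; have [i2 _] := toQ _ phQ cphi.
  rewrite -IntB//; last exact: msbT.
  rewrite (Int_eq (g := fun x => g x 0 i * (phi x - psi x))); last by move=> x _; rewrite mulrBr.
  have [|_ ->] := toQ (fun x => phi x - psi x) _ cdf.
    by move=> x nQ; rewrite psQ// phQ// subrr.
  by apply: Int_sup_bound => //; exact: mfn_cont.
have cD : continuous (D_ h) by apply: contB => //; exact: cont_shift.
have e4 : Int setT (fun x => D_ h x * psi x) = Int setT (fun x => D_ h x * phi x) - Int setT (fun x => D_ h x * (phi x - psi x)).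
  rewrite -IntB.
  - by apply: Int_eq => x _; ring.
  - exact: msbT.
  - by apply: (@L1loc_supp O K') => //; [exact: L1loc_cont|exact: subset_trans (subset_trans K'N NQ') QO].
  - apply: (@L1loc_supp O (K' `|` K)) => //; first exact: L1loc_cont.
    by apply: subset_trans KKN _; exact: subset_trans NQ' QO.
rewrite e4 et; move: b1 b2 b3; rewrite !ler_norml => /andP[? ?] /andP[? ?] /andP[? ?].
apply/andP; split; nra.
Qed.

(** With [D] the difference of [u], the test function [D / (|D| + h) * psi] is a continuous
    substitute for [sign D * psi]. It recovers [|D| psi] up to [h psi], because
    [a^2 / (a + h) + h >= a]. *)
Lemma shift_abs_bound K psi (B : R) : compact K -> K `<=` O -> continuous psi ->
  (forall x, ~ K x -> psi x = 0) -> (forall x, 0 <= psi x <= B) ->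
  exists C, exists2 h0 : R, 0 < h0 & forall h : R, 0 < h < h0 ->
    Int setT (fun x => `|D_ h x| * psi x) <= C * h.
Proof.
move=> cK KO cp psi0 pB.
have [N [Q [r [[oN KN cQ QO r0] NQ]]]] := compact_nbhd cK oO KO.
set IQ := Int Q (fun x => `|g x 0 i|).
exists (B * IQ + Int setT psi), r => // h hr; have /andP[h0 _] := hr.
have cD : continuous (D_ h) by apply: contB => //; exact: cont_shift.
have den x : 0 < `|D_ h x| + h by rewrite ltr_wpDl.
pose S x := D_ h x / (`|D_ h x| + h) * psi x.
have cS : continuous S.
  apply: contM => //; apply: contM => //; apply: cont_inv; first by move=> x; rewrite gt_eqF.
  by apply: contD; [exact: cont_norm|exact: cst_continuous].
have B0 : 0 <= B by have /andP[h1 h2] := pB 0; exact: le_trans h2.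
have S0 x : ~ K x -> S x = 0 by move=> /psi0 e; rewrite /S e mulr0.
have SB x : `|S x| <= B.
  have /andP[p1 p2] := pB x; rewrite normrM (ger0_norm p1) -[leRHS]mul1r; apply: ler_pM => //.
  by rewrite normrM normfV (gtr0_norm (den x)) ler_pdivrMr// mul1r lerDl ltW.
have b1 := weak_shift_Q oN cK KN cQ QO NQ cS S0 SB hr B0.
have supp (f : E -> R) : continuous f -> (forall x, ~ K x -> f x = 0) -> intg setT f.
  move=> cf f0; apply: (intg_mkcond (msb_compact cK) msbT) => // [x _|]; [exact: f0|exact: intg_compact].
have i1 : intg setT (fun x => D_ h x * S x) by apply: supp; [exact: contM|move=> x /S0 ->; rewrite mulr0].
have i2 : intg setT psi by exact: supp.
have : Int setT (fun x => `|D_ h x| * psi x) <= Int setT (fun x => D_ h x * S x + h * psi x).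
  apply: Int_le; first exact: msbT.
  - by apply: supp; [apply: contM => //; exact: cont_norm|move=> x /psi0 ->; rewrite mulr0].
  - by apply: intgD => //; [exact: msbT|apply: intgZ => //; exact: msbT].
  move=> x _; have /andP[p1 p2] := pB x; rewrite /S mulrA -mulrDl ler_wpM2r//.
  rewrite mulrA -expr2 -real_normK ?num_real//; have a0 := normr_ge0 (D_ h x); have dx := den x.
  move: dx a0; set a := `|D_ h x| => dx a0.
  have -> : a ^+ 2 / (a + h) + h = (a ^+ 2 + h * (a + h)) / (a + h) by field; rewrite gt_eqF.
  rewrite ler_pdivlMr//; nra.
move=> le1; apply: le_trans le1 _; rewrite IntD//; last 2 first.
- exact: msbT.
- by apply: intgZ => //; exact: msbT.
rewrite IntZ//; last exact: msbT.
by move: b1; rewrite -/IQ ler_norml => /andP[_ b1]; rewrite mulrDl; lra.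
Qed.

Lemma mvt_err (F F' : R -> R) (a b e : R) : (forall t : R, is_derive t 1 F (F' t)) ->
  (forall c, `|c - a| <= `|b - a| -> `|F' c - F' a| <= e) ->
  `|F b - F a - F' a * (b - a)| <= e * `|b - a|.
Proof.
move=> dF h.
have cF (x y : R) : {within `[x, y], continuous F}.
  by apply: derivable_within_continuous => t _; case: (dF t).
have [ab|ba|->] := ltgtP a b; last by rewrite !subrr mulr0 subr0 normr0 mulr0.
  have [c] := MVT ab (fun (s : R) _ => dF s) (cF a b); rewrite in_itv/= => /andP[c1 c2] ->.
  rewrite -mulrBl normrM ler_wpM2r// h// !ger0_norm; lra.
have [c] := MVT ba (fun (s : R) _ => dF s) (cF b a); rewrite in_itv/= => /andP[c1 c2] e1.
have -> : F b - F a - F' a * (b - a) = (F' c - F' a) * (b - a) by lra.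
by rewrite normrM ler_wpM2r// h// !ltr0_norm; lra.
Qed.

End chain.

(** The difference quotient of [F (u)] differs from [F' (u)] times that of [u] by a remainder at
    most [e |D|]; its integral is O(e h) by [shift_abs_bound], so it disappears after division by
    [h]. *)
Lemma wg_comp O u g (F F' : R -> R) : open O -> continuous u -> weak_gradient O u g ->
  (forall t : R, is_derive t 1 F (F' t)) -> continuous F' ->
  weak_gradient O (fun x => F (u x)) (fun x => F' (u x) *: g x).
Proof.
move=> oO cu wg dF cF'.
have cF : continuous F by move=> t; have [d _] := dF t; exact/differentiable_continuous/derivable1_diffP.
have cFu : continuous (fun x => F (u x)) by exact: cont_comp.
have cF'u : continuous (fun x => F' (u x)) by exact: cont_comp.
apply: wgI => // [i|i phi tp].
  have [l _] := wg i; have l' := L1locM l cF'u; move=> K cK KO.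
  by apply: (intg_eq (f := fun x => g x 0 i * F' (u x))); [exact: msb_compact|move=> x _; rewrite mxE mulrC|exact: l'].
have [sp [K [cK KO p0]]] := tp; have cphi := smooth_cont sp; have mK := msb_compact cK.
pose psi x := F' (u x) * phi x.
have cpsi : continuous psi by exact: contM.
have psi0 x : ~ K x -> psi x = 0 by move=> /p0 e; rewrite /psi e mulr0.
have -> : Int setT (fun x => (F' (u x) *: g x) 0 i * phi x) = Int setT (fun x => g x 0 i * psi x).
  by apply: Int_eq => x _; rewrite mxE /psi; ring.
set T1 := Int setT (fun x => F (u x) * pd i phi x); set T2 := Int setT _.
have [N [Q [r [[oN KN cQ QO r0] NQ]]]] := compact_nbhd cK oO KO.
have NQ' : N `<=` Q by move=> x Nx; apply: NQ Nx _; exact: ballxx.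
have mQ := msb_compact cQ.
pose BF := Int Q (fun x => `|F (u x)|).
have BF0 : 0 <= BF by apply: Int_ge0 => *; exact: normr_ge0.
have [Bp Bp0 hBp] := cont_bounded cphi cK.
have pB x : 0 <= `|phi x| <= Bp.
  by rewrite normr_ge0/=; have [/hBp//|/p0 ->] := pselect (K x); rewrite normr0 ltW.
have np0 x : ~ K x -> `|phi x| = 0 by move=> /p0 ->; rewrite normr0.
have [C [h1 h10 hC]] := shift_abs_bound i oO cu wg cK KO (cont_norm cphi) np0 pB.
have [M M0 hM] := cont_bounded cu cK.
have cpd := smooth_cont (smooth_pd i sp).
(* The three contributions: [e * BF] from shifting the derivative of [phi], [e] from the weak
   convergence of the quotients of [u], and [e * C] from the first-order remainder. *)
have main (e : R) : 0 < e -> `|T1 + T2| <= e * (BF + 1 + C).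
  move=> e0.
  have [r2 r20 hr2] := unif_shift i cpd cQ e0.
  have [h2 h20 hh2] := weak_shift_cvg i oO cu wg cK KO cpsi psi0 e0.
  have [d d0 hd] := uniform_cont cF' (@segment_compact R (- M) M) e0.
  have [r3 r30 hr3] := uniform_cont cu cK d0.
  pose h := Num.min (Num.min r r2) (Num.min (Num.min h1 h2) r3) / 2.
  have hlt : [/\ 0 < h, h < r, h < r2, h < h1 & h < h2] /\ h < r3.
    have m0 : 0 < Num.min (Num.min r r2) (Num.min (Num.min h1 h2) r3) by rewrite !lt_min r0 r20 h10 h20 r30.
    have hm : h < Num.min (Num.min r r2) (Num.min (Num.min h1 h2) r3) by rewrite /h; lra.
    have hp : 0 < h by rewrite /h; lra.
    by move: hm; rewrite !lt_min => /andP[/andP[? ?] /andP[/andP[? ?] ?]].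
  have [[h0 hr hhr2 hh1 hhh2] hhr3] := hlt.
  have [c ch ec] := shift_mvt i cFu sp cK p0 h0.
  have cr : 0 <= c < r by case/andP: ch => -> /le_lt_trans ->.
  have cr2 : 0 <= c < r2 by case/andP: ch => -> /le_lt_trans ->.
  have pdK x : ~ K x -> pd i phi x = 0 by exact: pd_supp.
  have pdQ x : ~ Q x -> pd i phi x = 0 by move=> nQ; apply: pdK => /KN/NQ'.
  have pdcQ x : ~ Q x -> pd i phi (x - c *: e_ i) = 0.
    by move=> nQ; exact: (shift_zero_out i NQ KN pdK cr nQ).
  have cpdc : continuous (fun x => pd i phi (x - c *: e_ i)) by exact: (cont_shift (v := - (c *: e_ i)) cpd).
  have iQ f : continuous f -> (forall x, ~ Q x -> f x = 0) -> intg setT f /\ Int setT f = Int Q f.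
    move=> cf f0; split; last by apply: (Int_mkcond mQ msbT) => // x _ /f0.
    by apply: (intg_mkcond mQ msbT) => // [x _ /f0//|]; exact: intg_compact.
  have a1 : `|Int setT (fun x => F (u x) * pd i phi (x - c *: e_ i)) - T1| <= e * BF.
    rewrite -IntB; last 3 first.
    - exact: msbT.
    - by apply: (iQ _ _ _).1; [exact: contM|move=> x /pdcQ ->; rewrite mulr0].
    - by apply: (iQ _ _ _).1; [exact: contM|move=> x /pdQ ->; rewrite mulr0].
    rewrite (Int_eq (g := fun x => F (u x) * (pd i phi (x - c *: e_ i) - pd i phi x))); last by move=> x _; rewrite mulrBr.
    have [||_ ->] := iQ (fun x => F (u x) * (pd i phi (x - c *: e_ i) - pd i phi x)).
    - by apply: contM => //; exact: contB.
    - by move=> x nQ; rewrite pdcQ// pdQ// subrr mulr0.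
    apply: Int_sup_bound => //; first exact: intg_compact.
      by apply: mfn_cont => //; exact: contB.
    by move=> x Qx; exact: hr2.
  have cD : continuous (fun x => u (x + h *: e_ i) - u x) by apply: contB => //; exact: cont_shift.
  have cDF : continuous (fun x => F (u (x + h *: e_ i)) - F (u x)).
    by apply: contB => //; exact: (cont_shift (v := h *: e_ i) cFu).
  have KQ : K `<=` Q by exact: subset_trans KN NQ'.
  have p0Q x : ~ Q x -> phi x = 0 by move=> nQ; apply: p0 => /KQ.
  have a3 : `|Int setT (fun x => (F (u (x + h *: e_ i)) - F (u x)) * phi x) - Int setT (fun x => (u (x + h *: e_ i) - u x) * psi x)| <= e * (C * h).
    have i1 := iQ (fun x => (F (u (x + h *: e_ i)) - F (u x)) * phi x) (contM cDF cphi).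
    have i2 := iQ (fun x => (u (x + h *: e_ i) - u x) * psi x) (contM cD cpsi).
    have i3 := iQ (fun x => `|u (x + h *: e_ i) - u x| * `|phi x|) (contM (cont_norm cD) (cont_norm cphi)).
    have {}i1 := (i1 (fun x nQ => ltac:(by rewrite (p0Q x nQ) mulr0))).1.
    have {}i2 := (i2 (fun x nQ => ltac:(by rewrite /psi (p0Q x nQ) !mulr0))).1.
    have {}i3 := (i3 (fun x nQ => ltac:(by rewrite (p0Q x nQ) normr0 mulr0))).1.
    rewrite -IntB//; last exact: msbT.
    have i4 : intg setT (fun x => (F (u (x + h *: e_ i)) - F (u x)) * phi x - (u (x + h *: e_ i) - u x) * psi x).
      apply: (iQ _ _ _).1; first by apply: contB; exact: contM.
      by move=> x /p0Q e1; rewrite /psi e1 !mulr0 subrr.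
    apply: le_trans (Int_abs msbT i4) _.
    apply: (@le_trans _ _ (Int setT (fun x => e * (`|u (x + h *: e_ i) - u x| * `|phi x|)))); last first.
      rewrite IntZ//; last exact: msbT.
      by rewrite ler_wpM2l ?(ltW e0)// hC// h0.
    apply: Int_le; [exact: msbT|exact: intg_abs| |].
      by apply: intgZ => //; exact: msbT.
    move=> x _; have [Kx|nK] := pselect (K x); last by rewrite /psi (p0 _ nK) !mulr0 subrr normr0 !mulr0.
    have -> : (F (u (x + h *: e_ i)) - F (u x)) * phi x - (u (x + h *: e_ i) - u x) * psi x =
      (F (u (x + h *: e_ i)) - F (u x) - F' (u x) * (u (x + h *: e_ i) - u x)) * phi x by rewrite /psi; ring.
    rewrite normrM mulrA ler_wpM2r//; apply: mvt_err => // s hs.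
    have sm : [set` `[(- M), M]] (u x) by rewrite /= in_itv/= -ler_norml hM.
    apply/ltW/(hd (u x)) => //; rewrite /ball/= distrC; apply: le_lt_trans hs _.
    by apply: hr3 => //; apply: ball_shift; rewrite ltW.
  have a2 := hh2 h _; rewrite h0 hhh2 in a2; have {}a2 := a2 isT.
  move: a1 a2 a3; rewrite ec -/T1 -/T2.
  set X := Int setT (fun x => F (u x) * pd i phi (x - c *: e_ i)); set Y := Int setT (fun x => (u (x + h *: e_ i) - u x) * psi x).
  rewrite !ler_norml => /andP[a1 a1'] /andP[a2 a2'] /andP[a3 a3'].
  have h1' : h * (X - T1) <= h * (e * BF) by rewrite ler_pM2l.
  have h2' : h * (- (e * BF)) <= h * (X - T1) by rewrite ler_pM2l.
  by apply/andP; split; rewrite -(ler_pM2l h0); nra.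
have C0 : 0 <= BF + 1 + C by have := main 1 ltr01; rewrite mul1r; apply: le_trans.
apply/eqP; rewrite -subr_eq0 opprK -normr_le0; apply/ler_addgt0Pr => e e0; rewrite add0r.
apply: le_trans (main (e / (BF + 1 + C + 1)) _) _; first by rewrite divr_gt0// ltr_wpDl.
rewrite mulrAC ler_pdivrMr ?ltr_wpDl// ler_pM2l//; lra.
Qed.

End weak.

(** * Weighted Poincare inequalities by bisection *)

Section bisect.
Context {R : realType} {n : nat}.
Local Notation E := 'rV[R]_n.
Implicit Types (a s x y : E) (i j : 'I_n) (f : E -> R).
Local Notation e_ i := (delta_mx 0 i : E).

(** The size of a box. The sum of the sides, unlike the longest side, drops by a fixed factor each
    time the longest side is halved. *)
Definition lam s : R := \sum_i s 0 i.
(** Any two sides are within a factor 2 of each other. Halving the longest side preserves this, so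
    repeated bisection keeps the eccentricity bounded. *)
Definition good s := forall i j, 0 < s 0 i /\ s 0 i <= 2 * s 0 j.
Definition volb s : R := \prod_i s 0 i.
Definition halve s i : E := upd s i (s 0 i / 2).

Lemma good_gt0 s : good s -> forall i, 0 < s 0 i. Proof. by move=> g i; case: (g i i). Qed.

Lemma volb_gt0 s : good s -> 0 < volb s.
Proof. by move=> g; apply: prodr_gt0 => i _; exact: good_gt0. Qed.

Lemma le_lam s i : good s -> s 0 i <= lam s.
Proof. by move=> g; rewrite /lam (bigD1 i)//= lerDl sumr_ge0// => j _; exact/ltW/good_gt0. Qed.

Lemma exists_max_side s : (0 < n)%N -> exists i, forall j, s 0 j <= s 0 i.
Proof.
move=> n0; exists [arg max_(i > Ordinal n0) s 0 i]%O.
by case: arg_maxP => // i _ h j; exact: h.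
Qed.

Lemma halve_good s i : good s -> (forall j, s 0 j <= s 0 i) -> good (halve s i).
Proof.
move=> g m j k; rewrite /halve !updE; have := g j k; have := g i k; have := g j i; have := m j; have := m k.
have := good_gt0 g i; have := good_gt0 g k.
by case: eqP => [->|_]; case: eqP => [->|_]; lra.
Qed.

Lemma lam_halve s i : lam (halve s i) = lam s - s 0 i / 2.
Proof.
rewrite /lam (bigD1 i)//= [in RHS](bigD1 i)//= updE eqxx.
rewrite (eq_bigr (fun j => s 0 j)); first lra.
by move=> j /negPf ji; rewrite updE ji.
Qed.

Lemma lam_max s i : (forall j, s 0 j <= s 0 i) -> lam s <= n%:R * s 0 i.
Proof.
move=> m; rewrite /lam; apply: le_trans (ler_sum _ (fun j _ => m j)) _.
by rewrite sumr_const card_ord mulr_natl.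
Qed.

(** The longest side is at least [lam s / n]; halving it removes at least the fraction [1 / (2 n)]
    of [lam s]. *)
Definition q_ : R := 1 - (2 * n%:R)^-1.

Lemma lam_halve_le s i : (0 < n)%N -> (forall j, s 0 j <= s 0 i) -> lam (halve s i) <= q_ * lam s.
Proof.
move=> n0 m; rewrite lam_halve /q_ mulrBl mul1r lerD2l lerN2.
have n0' : 0 < n%:R :> R by rewrite ltr0n.
rewrite invfM -mulrA mulrC ler_pM2r ?invr_gt0// ler_pdivrMl//; exact: lam_max.
Qed.

Lemma volb_halve s i : volb (halve s i) = volb s / 2.
Proof. by rewrite /volb /halve (prod_upd (fun=> id)) [in RHS](bigD1 i)//=; lra. Qed.

Lemma box_halve a s i : good s -> box a s = box a (halve s i) `|` box (a + (s 0 i / 2) *: e_ i) (halve s i).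
Proof.
move=> g; have si := good_gt0 g i; apply/seteqP; split => [x h|x [h|h] j].
- have [xi|xi] := ltP (x 0 i) (a 0 i + s 0 i / 2); [left|right] => j.
    by have := h j; rewrite updE; case: eqP => [->|//]; lra.
  by have := h j; rewrite !mxE eqxx/=; case: eqP => [->|_]; rewrite ?mulr1 ?mulr0; lra.
- by have := h j; rewrite updE; case: eqP => [->|//]; lra.
- by have := h j; rewrite !mxE eqxx/=; case: eqP => [->|_]; rewrite ?mulr1 ?mulr0; lra.
Qed.

Lemma box_halve_disj a s i x : box a (halve s i) x -> box (a + (s 0 i / 2) *: e_ i) (halve s i) x -> False.
Proof. by move=> /(_ i) + /(_ i); rewrite !mxE !eqxx/= mulr1; lra. Qed.

Lemma sub_halve1 a s i : good s -> box a (halve s i) `<=` box a s.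
Proof. by move=> g; rewrite (box_halve a i g) => x; left. Qed.

Lemma sub_halve2 a s i : good s -> box (a + (s 0 i / 2) *: e_ i) (halve s i) `<=` box a s.
Proof. by move=> g; rewrite (box_halve a i g) => x; right. Qed.

Lemma msb_box a s : msb (box a s). Proof. exact: measurable_box. Qed.

Lemma Int_halve a s i f : good s -> intg (box a s) f ->
  Int (box a s) f = Int (box a (halve s i)) f + Int (box (a + (s 0 i / 2) *: e_ i) (halve s i)) f.
Proof.
move=> g; rewrite (box_halve a i g) => fi; apply: IntU => //; try exact: msb_box.
by move=> x; exact: box_halve_disj.
Qed.

Lemma box_shift a s v x : box (a + v) s (x + v) <-> box a s x.
Proof. by split => h i; have := h i; rewrite !mxE; lra. Qed.

Lemma Int_box_shift a s v f : continuous f ->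
  Int (box (a + v) s) f = Int (box a s) (fun x => f (x + v)).
Proof.
move=> cf.
have i1 : intg (box (a + v) s) f.
  apply: (@intgS _ _ _ (cbox (a + v) s)); [exact: msb_box| |exact: box_cbox|].
    exact/msb_compact/compact_cbox.
  by apply: intg_compact => //; exact: compact_cbox.
pose F := patch (fun=> 0) (box (a + v) s) f.
have F0 x : setT x -> ~ box (a + v) s x -> F x = 0 by move=> _ nb; rewrite /F /patch memNset.
have FE x : box (a + v) s x -> F x = f x by move=> b; rewrite /F /patch mem_set.
have iF : intg setT F.
  apply: (intg_mkcond (msb_box _ _) msbT _ F0) => //.
  by apply: (intg_eq (f := f)) => //; [exact: msb_box|move=> x /FE].
have [_ e] := Int_shift v iF.
rewrite -(Int_eq FE) -(Int_mkcond (msb_box _ _) msbT _ F0)// -e.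
rewrite (Int_mkcond (msb_box a s) msbT)//; last by move=> x _ nb; apply: F0 => // /box_shift.
by apply: Int_eq => x /box_shift b; rewrite FE.
Qed.

Lemma vol_box a s : (0 < n)%N -> good s -> vol (box a s) = volb s.
Proof. by move=> n0 g; rewrite /vol leb_box//; exact: good_gt0. Qed.

Lemma Int_null A f : msb A -> lebesgue_om R n A = 0%E -> mfn A f -> Int A f = 0.
Proof.
move=> mA A0 mf.
have mf' : measurable_fun (A : set (lebT R n)) (EFin \o (f : lebT R n -> R)) by exact/measurable_EFinP.
by have e := null_set_integral (mu := leb R n) mA mf' A0; rewrite /Int /Rintegral e.
Qed.

Lemma msb_obox a s : msb (obox a s).
Proof.
rewrite (_ : obox a s = (box a s) `\` (\bigcup_(i in [set: 'I_n]) [set x : E | x 0 i <= a 0 i])).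
  apply: measurableD; first exact: msb_box.
  apply: countable_bigcupT_measurable; first exact: countableP.
  move=> i; rewrite (_ : mkset _ = ~` [set y : E | a 0 i < y 0 i]); last first.
    by apply/seteqP; split => x /=; rewrite leNgt => /negP.
  apply: measurableC; apply: measurable_open.
  have /continuousP c := @coord_continuous R 1 n 0 i; have h := c _ (@open_gt R (a 0 i)); exact: h.
apply/seteqP; split => x.
  move=> h; split; first exact: obox_box.
  by move=> [i _ /=]; have /andP[h1 _] := h i; rewrite leNgt h1.
move=> [h h'] i; have /andP[h1 h2] := h i; rewrite h2 andbT ltNge; apply/negP => h3; apply: h'.
by exists i.
Qed.

Lemma open_obox a s : open (obox a s).
Proof.
have H (l : seq 'I_n) : open [set x : E | forall i, i \in l -> a 0 i < x 0 i < a 0 i + s 0 i].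
  elim: l => [|i l IH].
    by rewrite (_ : mkset _ = setT); [exact: openT|apply/seteqP; split].
  rewrite (_ : mkset _ = ([set x : E | a 0 i < x 0 i] `&` [set x : E | x 0 i < a 0 i + s 0 i]) `&`
     [set x : E | forall i, i \in l -> a 0 i < x 0 i < a 0 i + s 0 i]).
    have /continuousP c := @coord_continuous R 1 n 0 i; apply: openI => //.
    by apply: openI; [have h := c _ (@open_gt R (a 0 i))|have h := c _ (@open_lt R (a 0 i + s 0 i))]; exact: h.
  apply/seteqP; split => x /=.
    move=> h; split; first by have /andP[] := h i (mem_head _ _).
    by move=> j jl; apply: h; rewrite inE jl orbT.
  by move=> [[h1 h2] h3] j; rewrite inE => /orP[/eqP ->|/h3//]; apply/andP; split.
have := H (enum 'I_n); rewrite (_ : mkset _ = obox a s)//.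
by apply/seteqP; split => x h i; [apply: h; rewrite mem_enum|move=> _; exact: h].
Qed.

Lemma Int_obox a s f : (0 < n)%N -> (forall i, 0 < s 0 i) -> intg (box a s) f ->
  Int (box a s) f = Int (obox a s) f.
Proof.
move=> n0 s0 fi.
have ob : obox a s `<=` box a s := @obox_box _ _ a s.
have mo := msb_obox a s; have mb := msb_box a s.
have mD : msb (box a s `\` obox a s) by exact: measurableD.
rewrite -(setDUK ob) IntU//; last 2 first.
- by move=> x o [].
- by rewrite setDUK.
rewrite [X in _ + X]Int_null ?addr0//; last first.
  by apply: (mfnS mb) (intg_mfn fi) => x [].
have : (leb R n (obox a s) + leb R n (box a s `\` obox a s) = leb R n (box a s))%E.
  by rewrite -measureU ?setDUK//; apply/seteqP; split => x // [? []].
rewrite /leb/= leb_obox// leb_box// => h.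
have : (lebesgue_om R n (box a s `\` obox a s) = (\prod_i s 0 i)%:E - (\prod_i s 0 i)%:E)%E.
  by rewrite -[X in (X - _)%E]h addrAC subee// add0e.
by rewrite subee.
Qed.

End bisect.

Lemma sum_two_bounds (R : realDomainType) (I1 I2 P1 P2 T1 T2 B1 B2 X : R) : I1 <= P1 + T1 -> I2 <= P2 + T2 ->
  P1 <= B1 -> P2 <= B2 -> T1 + T2 <= X -> I1 + I2 <= B1 + B2 + X.
Proof. lra. Qed.

(** The induction step of the Poincare inequality: comparing averages costs [x / 2 * (C * D)], and
    the drop of [lam] by [x / 2] under the factor [2 * N * C] pays for it. *)
Lemma absorb_halving (R : realFieldType) (N C L x D Y : R) : 1 <= N -> 0 <= C -> 0 <= x -> 0 <= D ->
  2 * N * C * (L - x / 2) * D + Y + x / 2 * (C * D) <= 2 * N * C * L * D + Y.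
Proof.
move=> N1 C0 x0 D0; have p0 : 0 <= x * C * D by rewrite !mulr_ge0.
have : 0 <= (N - 1) * (x * C * D) by rewrite mulr_ge0// subr_ge0.
have -> : 2 * N * C * (L - x / 2) * D = 2 * N * C * L * D - N * (x * C * D) by field.
have -> : x / 2 * (C * D) = (x * C * D) / 2 by ring.
lra.
Qed.

(** * Weighted L^1 Poincare and Faber-Krahn inequalities *)

Section poincare.
Context {R : realType} {n : nat}.
Local Notation E := 'rV[R]_n.
Implicit Types (a s x y : E) (i j : 'I_n) (f : E -> R).
Local Notation e_ i := (delta_mx 0 i : E).
Variables (n0 : (0 < n)%N) (O : set E) (u : E -> R) (g : E -> E).
Hypotheses (oO : open O) (cu : continuous u) (wg : weak_gradient O u g).

Definition gs x : R := \sum_i `|g x 0 i|.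

Lemma gs_ge0 x : 0 <= gs x. Proof. by apply: sumr_ge0 => *; exact: normr_ge0. Qed.

Lemma le_gs x i : `|g x 0 i| <= gs x.
Proof. by rewrite /gs (bigD1 i)//= lerDl sumr_ge0. Qed.

Lemma intg_cont_box f a s : continuous f -> intg (box a s) f.
Proof.
move=> cf; apply: (@intgS _ _ _ (cbox a s)); [exact: msb_box| |exact: box_cbox|].
  exact/msb_compact/compact_cbox.
by apply: intg_compact => //; exact: compact_cbox.
Qed.

Lemma intg_g_box a s i : cbox a s `<=` O -> intg (box a s) (fun x => g x 0 i).
Proof.
move=> sO; apply: (@intgS _ _ _ (cbox a s)); [exact: msb_box| |exact: box_cbox|].
  exact/msb_compact/compact_cbox.
by have [l _] := wg i; apply: l => //; exact: compact_cbox.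
Qed.

(** One half is the other translated by [h = s_i / 2], so the difference of the integrals is that of
    [u (x + h e_i) - u x] over one half, and the translating segments stay inside the box. *)
Lemma mean_halves a s i : good s -> cbox a s `<=` O ->
  `|Int (box (a + (s 0 i / 2) *: e_ i) (halve s i)) u - Int (box a (halve s i)) u| <=
   s 0 i / 2 * Int (box a s) (fun x => `|g x 0 i|).
Proof.
move=> gs_ sO; set h := s 0 i / 2.
have si := good_gt0 gs_ i; have h0 : 0 < h by rewrite divr_gt0.
have s'0 j : 0 < halve s i 0 j.
  by rewrite updE; case: eqP => // _; exact: good_gt0.
rewrite Int_box_shift// -IntB; last 3 first.
- exact: msb_box.
- by apply: intg_cont_box; exact: cont_shift.
- exact: intg_cont_box.
pose D x := u (x + h *: e_ i) - u x.
have cD : continuous D by apply: contB => //; exact: cont_shift.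
rewrite Int_obox//; last exact: intg_cont_box.
set N := obox a (halve s i).
(* The closed boxes [Kk k] exhaust the open half [N]. The cutoffs [chi k] equal 1 on them and lead
   by dominated convergence to the constant test function 1 on [N]. *)
pose m k : R := 2^-1 / 2 ^+ k.
have m0 k : 0 < m k by rewrite divr_gt0// exprn_gt0.
pose Kk k := cbox (\row_j (a 0 j + m k * halve s i 0 j)) (\row_j ((1 - 2 * m k) * halve s i 0 j)).
have mk k : m k <= 2^-1 by rewrite ler_pdivrMr ?exprn_gt0// ler_peMr// exprn_ege1// ler1n.
have KN k : Kk k `<=` N.
  move=> x hx j; have := hx j; rewrite !mxE; have := s'0 j; rewrite /halve updE.
  have := m0 k; set t := m k; set r := (if j == i then _ else _) => t0 r0 /andP[h1 h2].
  have tr : 0 < t * r by exact: mulr_gt0.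
  by apply/andP; split; nra.
have oN : open N by exact: open_obox.
have NQ x (t : R) : N x -> 0 <= t <= h -> O (x + t *: e_ i) /\ box a s (x + t *: e_ i).
  move=> Nx th; have b : box a s (x + t *: e_ i).
    move=> j; have := Nx j; rewrite /halve updE !mxE eqxx/=; case: eqP => [->|_].
      rewrite mulr1 -/h => ?; have : s 0 i = h + h by rewrite /h; lra. lra.
    by rewrite mulr0; lra.
  by split=> //; apply: sO; exact: box_cbox.
have X k := urysohn (@compact_cbox R n _ _) oN (KN k).
have {X} [chi hchi] := choice X.
have ccb := @compact_cbox R n a s; have mo := msb_obox a (halve s i).
have No : N `<=` cbox a s.
  move=> x Nx; apply: box_cbox; apply: (sub_halve1 (i := i)) => //; exact: obox_box.
have iDN : intg N D.
  apply: (@intgS _ _ _ (cbox a s)) => //; [exact: msb_compact|exact: intg_compact].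
have bnd k : `|Int N (fun x => D x * chi k x)| <= h * Int (box a s) (fun x => `|g x 0 i|).
  have [[sc [K' [cK' K'N c0]]] c01 _] := hchi k.
  have cc := smooth_cont sc.
  have c1 x : `|chi k x| <= 1 by have /andP[h1 h2] := c01 x; rewrite ger0_norm.
  have := weak_shift_le (a := a) (s := s) oO oN cu wg cc cK' K'N No c0 c1 h0 ler01 NQ (msb_box a s) (intg_g_box i sO).
  rewrite mulr1 (IntT_supp (D := N) mo (msb_compact cK'))// => x /c0 ->; by rewrite mulr0.
have [|||||_ cvgI] := @Int_dct R n N (fun k x => D x * chi k x) D (fun x => `|D x|) mo.
- by move=> k; apply: mfn_cont => //; apply: contM => //; case: (hchi k) => -[sc _] _ _; exact: smooth_cont.
- exact: mfn_cont.
- exact: intg_abs.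
- move=> k x Nx; rewrite normrM ler_piMr//; have [_ c01 _] := hchi k; have /andP[h1 h2] := c01 x; by rewrite ger0_norm.
- move=> x Nx.
  have H j : exists J, forall k, (J <= k)%N -> m k * halve s i 0 j <= x 0 j - a 0 j /\
      m k * halve s i 0 j <= a 0 j + halve s i 0 j - x 0 j.
    have /andP[h1 h2] := Nx j.
    have [J1 H1] := @half_pow_small R (2^-1 * halve s i 0 j) (x 0 j - a 0 j) ltac:(by rewrite subr_gt0).
    have [J2 H2] := @half_pow_small R (2^-1 * halve s i 0 j) (a 0 j + halve s i 0 j - x 0 j) ltac:(by rewrite subr_gt0).
    exists (maxn J1 J2) => k; rewrite geq_max => /andP[k1 k2]; rewrite /m mulrAC; split; apply/ltW; [exact: H1|exact: H2].
  have [J HJ] := choice H.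
  apply: (@cvg_near_cst _ _ (D x)); exists (\max_j J j) => // k /= Jk.
  have [_ _ [V [_ KV] ->]] := hchi k; first by rewrite mulr1.
  apply: KV => j; have [] := HJ j k (leq_trans (leq_bigmax j) Jk); rewrite !mxE; lra.
apply/ler_addgt0Pr => e e0.
have /cvgrPdist_lt/(_ _ e0)[k _ /(_ k (leqnn k)) hk] := cvgI.
have b := bnd k; rewrite /= in hk; rewrite -/N -/D.
have := ler_normD (Int N (fun x => D x * chi k x)) (Int N D - Int N (fun x => D x * chi k x)).
by rewrite addrC subrK; lra.
Qed.

Definition avg a s := Int (box a s) u / volb s.

Lemma mean_half1 a s i : good s -> cbox a s `<=` O -> `|avg a (halve s i) - avg a s| <=
  s 0 i / 2 / volb s * Int (box a s) (fun x => `|g x 0 i|).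
Proof.
move=> g_ sO; have V0 := volb_gt0 g_; have := mean_halves i g_ sO.
rewrite /avg (Int_halve i g_ (intg_cont_box a s cu)) volb_halve.
set X := Int (box a (halve s i)) u; set Y := Int _ u; set Z := Int _ _.
have -> : X / (volb s / 2) - (X + Y) / volb s = - (Y - X) / volb s by field; rewrite gt_eqF.
by rewrite normrM normrN normfV (gtr0_norm V0) ler_pdivrMr// => h; rewrite mulrAC divfK// gt_eqF.
Qed.

Lemma mean_half2 a s i : good s -> cbox a s `<=` O ->
  `|avg (a + (s 0 i / 2) *: e_ i) (halve s i) - avg a s| <=
  s 0 i / 2 / volb s * Int (box a s) (fun x => `|g x 0 i|).
Proof.
move=> g_ sO; have V0 := volb_gt0 g_; have := mean_halves i g_ sO.
rewrite /avg (Int_halve i g_ (intg_cont_box a s cu)) volb_halve.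
set X := Int (box a (halve s i)) u; set Y := Int (box (_ + _) _) u; set Z := Int _ _.
have -> : Y / (volb s / 2) - (X + Y) / volb s = (Y - X) / volb s by field; rewrite gt_eqF.
by rewrite normrM normfV (gtr0_norm V0) ler_pdivrMr// => h; rewrite mulrAC divfK// gt_eqF.
Qed.

Lemma cbox_halve1 a s i : good s -> cbox a (halve s i) `<=` cbox a s.
Proof.
move=> g_ x h j; have := h j; rewrite updE; have := good_gt0 g_ i.
by case: eqP => [->|//]; lra.
Qed.

Lemma cbox_halve2 a s i : good s -> cbox (a + (s 0 i / 2) *: e_ i) (halve s i) `<=` cbox a s.
Proof.
move=> g_ x h j; have := h j; rewrite !mxE eqxx/=; have := good_gt0 g_ i.
by case: eqP => [->|_]; rewrite ?mulr1 ?mulr0; lra.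
Qed.

Lemma exists_q_pow (l d : R) : 0 < d -> exists J, l * q_ (R := R) (n := n) ^+ J < d.
Proof.
move=> d0; have n1 : 1 <= n%:R :> R by rewrite ler1n.
have q1 : `|q_ (R := R) (n := n)| < 1.
  rewrite /q_; have : 0 < (2 * n%:R)^-1 :> R by rewrite invr_gt0 mulr_gt0//; lra.
  have : (2 * n%:R)^-1 <= 2^-1 :> R by rewrite lef_pV2 ?posrE ?mulr_gt0//; lra.
  by move=> ? ?; rewrite ger0_norm; lra.
have /cvgrPdist_lt c := cvg_expr q1.
have [J _ /(_ J (leqnn J))] := c (d / (`|l| + 1)) ltac:(by rewrite divr_gt0// ltr_wpDl).
rewrite /= sub0r normrN ltr_pdivlMr ?ltr_wpDl// => h; exists J.
apply: le_lt_trans (ler_norm _) _; rewrite normrM; have := normr_ge0 (q_ (R:=R) (n:=n) ^+ J); nra.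
Qed.

(** The A_1 condition is required only at points where the gradient is nonzero: in the application
    the weight takes the value 0 on Gamma and gradients are set to 0 there. *)
Variables (w : E -> R) (CA : R).
Hypotheses (w0 : forall x, 0 <= w x) (CA0 : 0 <= CA)
  (iw : forall a s, intg (box a s) w)
  (A1 : forall a s z, good s -> cbox a s `<=` O -> box a s z -> gs z != 0 ->
     Int (box a s) w <= CA * w z * volb s)
  (igw : forall a s, cbox a s `<=` O -> intg (box a s) (fun x => gs x * w x)).

Lemma intg_contw a s f : continuous f -> intg (box a s) (fun x => f x * w x).
Proof.
move=> cf; have [M M0 hM] := cont_bounded cf (@compact_cbox R n a s).
apply: (intg_eq (f := fun x => w x * f x)); [exact: msb_box|by move=> x _; rewrite mulrC|].
apply: (intgM_bnd (M := M)) => //; [exact: msb_box|apply: mfn_cont => //; exact: msb_box|].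
by move=> x /box_cbox; exact: hM.
Qed.

(** The A_1 condition turns the unweighted gradient term of [mean_half1] and [mean_half2] into the
    weighted one. *)
Lemma A1_gs a s i : good s -> cbox a s `<=` O ->
  Int (box a s) w / volb s * Int (box a s) (fun x => `|g x 0 i|) <= CA * Int (box a s) (fun x => gs x * w x).
Proof.
move=> g_ sO; have V0 := volb_gt0 g_; have mb := msb_box a s.
have ig := intg_abs (intg_g_box i sO).
rewrite -IntZ// -IntZ//; last exact: igw.
apply: Int_le => //; [exact: intgZ|by apply: intgZ => //; exact: igw|].
move=> x bx; have [e|ne] := eqVneq (gs x) 0.
  have : `|g x 0 i| <= 0 by rewrite -e le_gs.
  by rewrite normr_le0 => /eqP ->; rewrite normr0 e mul0r !mulr0.
have h := A1 g_ sO bx ne.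
have le1 : Int (box a s) w / volb s <= CA * w x by rewrite ler_pdivrMr.
have := le_gs x i; have := normr_ge0 (g x 0 i); have : 0 <= CA * w x by rewrite mulr_ge0.
nra.
Qed.

Lemma osc_avg a s x (e : R) : good s -> box a s x -> (forall y, box a s y -> `|u x - u y| <= e) ->
  `|u x - avg a s| <= e.
Proof.
move=> g_ bx h; have V0 := volb_gt0 g_; have mb := msb_box a s.
have e0 : 0 <= e by apply: le_trans (h x bx).
have -> : u x - avg a s = Int (box a s) (fun y => u x - u y) / volb s.
  rewrite IntB//; [|by apply: intg_cont_box; exact: cst_continuous|exact: intg_cont_box].
  by rewrite Int_cst// vol_box// /avg mulrBl mulfK// gt_eqF.
have iD : intg (box a s) (fun y => u x - u y).
  by apply: intg_cont_box; apply: contB => //; exact: cst_continuous.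
rewrite normrM normfV (gtr0_norm V0) ler_pdivrMr//.
apply: le_trans (Int_abs mb iD) _.
rewrite -(vol_box a n0 g_) -Int_cst//; apply: Int_le => //; first exact: intg_abs.
by apply: intg_cont_box; exact: cst_continuous.
Qed.

Local Notation D_ a s := (Int (box a s) (fun x => gs x * w x)).
Local Notation K_ := (2 * n%:R * CA).

Lemma D_ge0 a s : 0 <= D_ a s.
Proof. by apply: Int_ge0 => x _; rewrite mulr_ge0// gs_ge0. Qed.

(** Induction on the number [J] of bisections that bring the size below the modulus of continuity
    [d], where the oscillation is at most [e]. Each bisection changes the average, and
    [absorb_halving] covers the change. *)
Lemma poincare_step B (e d : R) : (forall x y, B x -> ball x d y -> `|u y - u x| <= e) -> 0 <= e ->
  B `<=` O -> forall J a s, good s -> cbox a s `<=` B -> lam s * q_ (R := R) (n := n) ^+ J < d ->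
  Int (box a s) (fun x => `|u x - avg a s| * w x) <= K_ * lam s * D_ a s + e * Int (box a s) w.
Proof.
move=> osc e0 BO; elim=> [|J IH] a s g_ sB hd; have mb := msb_box a s.
  rewrite expr0 mulr1 in hd.
  have lam0 : 0 <= lam s by apply: sumr_ge0 => j _; exact/ltW/good_gt0.
  apply: (@le_trans _ _ (e * Int (box a s) w)); last first.
    by rewrite lerDr mulr_ge0// ?D_ge0// mulr_ge0// mulr_ge0// mulr_ge0.
  have ci : continuous (fun x => `|u x - avg a s|).
    by apply: cont_norm; apply: contB => //; exact: cst_continuous.
  rewrite -IntZ//; apply: Int_le => //; [exact: intg_contw|exact: intgZ|].
  move=> x bx; rewrite ler_wpM2r//; apply: osc_avg => // y by_.
  rewrite distrC; apply: osc; first exact/sB/box_cbox.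
  rewrite rV_ball_box; last by apply: le_lt_trans hd.
  move=> j; rewrite !mxE; have := bx j; have := by_ j; have := le_lam j g_; lra.
have [i im] := exists_max_side s n0.
have g' := halve_good g_ im.
have hl := lam_halve_le n0 im.
have q0 : 0 <= q_ (R := R) (n := n).
  rewrite /q_ subr_ge0 invf_le1; last by rewrite mulr_gt0// ltr0n.
  have h : 1 <= n%:R :> R by rewrite ler1n.
  by lra.
have hd' : lam (halve s i) * q_ (R := R) (n := n) ^+ J < d.
  apply: le_lt_trans hd; rewrite exprS mulrCA mulrA ler_wpM2r ?exprn_ge0//.
have sO := subset_trans sB BO.
have b1 := IH a _ g' (subset_trans (@cbox_halve1 a s i g_) sB) hd'.
have b2 := IH _ _ g' (subset_trans (@cbox_halve2 a s i g_) sB) hd'.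
have m1 := mean_half1 i g_ sO; have m2 := mean_half2 i g_ sO.
have ca := A1_gs i g_ sO.
set a2 := a + _ in b2 m2.
have ci c : continuous (fun x => `|u x - c|).
  by apply: cont_norm; apply: contB => //; exact: cst_continuous.
rewrite (Int_halve i g_ (intg_contw a s (ci _))) -/a2.
have st (b : E) : Int (box b (halve s i)) (fun x => `|u x - avg a s| * w x) <=
    Int (box b (halve s i)) (fun x => `|u x - avg b (halve s i)| * w x) +
    `|avg b (halve s i) - avg a s| * Int (box b (halve s i)) w.
  have mb' := msb_box b (halve s i).
  rewrite -IntZ// -IntD//; [|exact: intg_contw|exact: intgZ].
  apply: Int_le => //; [exact: intg_contw|by apply: intgD => //; [exact: intg_contw|exact: intgZ]|].
  move=> x _; rewrite -mulrDl ler_wpM2r//.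
  by rewrite -[u x - avg a s](subrKA (avg b (halve s i))) ler_normD.
have s1 := st a; have s2 := st a2.
have eD := Int_halve i g_ (igw sO); have ew := Int_halve i g_ (iw a s); rewrite -/a2 in eD ew.
set M1 := Int (box a (halve s i)) w in s1 b1 ew; set M2 := Int (box a2 (halve s i)) w in s2 b2 ew.
have M10 : 0 <= M1 by apply: Int_ge0 => *; exact: w0.
have M20 : 0 <= M2 by apply: Int_ge0 => *; exact: w0.
set D1 := D_ a (halve s i) in b1 eD; set D2 := D_ a2 (halve s i) in b2 eD.
set G := Int (box a s) (fun x => `|g x 0 i|) in m1 m2 ca.
rewrite eD ew in ca *.
set v := volb s in m1 m2 ca; have v0 : 0 < v by exact: volb_gt0.
have D10 : 0 <= D1 by exact: D_ge0.
have D20 : 0 <= D2 by exact: D_ge0.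
(* The total cost of replacing the averages over the halves by the average over the whole box. *)
have t1 : `|avg a (halve s i) - avg a s| * M1 + `|avg a2 (halve s i) - avg a s| * M2 <= s 0 i / 2 * (CA * (D1 + D2)).
  apply: (@le_trans _ _ (s 0 i / 2 / v * G * M1 + s 0 i / 2 / v * G * M2)).
    by apply: lerD; rewrite ler_wpM2r.
  apply: (@le_trans _ _ (s 0 i / 2 * ((M1 + M2) / v * G))).
    by rewrite le_eqVlt; apply/orP; left; apply/eqP; ring.
  by rewrite ler_wpM2l// divr_ge0// ltW// good_gt0.
have K0 : 0 <= K_ by rewrite mulr_ge0.
have nn : 0 < n%:R :> R by rewrite ltr0n.
apply: (le_trans (sum_two_bounds s1 s2 b1 b2 t1)).
have n1 : 1 <= n%:R :> R by rewrite ler1n.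
have := absorb_halving (lam s) (e * (M1 + M2)) n1 CA0 (ltW (good_gt0 g_ i)) (addr_ge0 D10 D20).
by rewrite lam_halve; apply: le_trans; rewrite le_eqVlt; apply/orP; left; apply/eqP; ring.
Qed.

Lemma poincare a s : good s -> cbox a s `<=` O ->
  Int (box a s) (fun x => `|u x - avg a s| * w x) <= K_ * lam s * D_ a s.
Proof.
move=> g_ sO; apply/ler_addgt0Pr => e e0.
set M := Int (box a s) w; have M0 : 0 <= M by apply: Int_ge0 => *; exact: w0.
have e'0 : 0 < e / (M + 1) by rewrite divr_gt0// ltr_wpDl.
have [d d0 hd] := uniform_cont cu (@compact_cbox R n a s) e'0.
have [J hJ] := exists_q_pow (lam s) d0.
have := poincare_step (fun x y Bx xy => ltW (hd x y Bx xy)) (ltW e'0) sO g_ (@subset_refl _ _) hJ.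
move/le_trans; apply; rewrite lerD2l -/M mulrAC ler_pdivrMr ?ltr_wpDl// ler_pM2l//; lra.
Qed.

(** On [Z] the deviation [|u - avg|] equals [|avg|], so the Poincare inequality bounds [|avg|] times
    the mass of [Z], hence [|avg|] times the mass of the box. *)
Lemma poincare_zero a s (nu : R) (Z : set E) : good s -> cbox a s `<=` O -> 0 < nu ->
  msb Z -> Z `<=` box a s -> (forall x, Z x -> u x = 0) -> nu * Int (box a s) w <= Int Z w ->
  Int (box a s) (fun x => `|u x| * w x) <= (1 + nu^-1) * K_ * lam s * D_ a s.
Proof.
move=> g_ sO nu0 mZ Zs uZ hZ; have P := poincare g_ sO; have mb := msb_box a s.
set X := K_ * lam s * D_ a s in P *; set A := avg a s in P *; set M := Int (box a s) w in hZ *.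
have ci c : continuous (fun x => `|u x - c|).
  by apply: cont_norm; apply: contB => //; exact: cst_continuous.
have iw' : intg Z w by apply: (@intgS _ _ _ (box a s)) => //; exact: iw.
have h1 : `|A| * Int Z w <= X.
  apply: le_trans P; rewrite -IntZ//.
  apply: (@le_trans _ _ (Int Z (fun x => `|u x - A| * w x))).
    apply: Int_le => //; [exact: intgZ|by apply: (@intgS _ _ _ (box a s)) => //; exact: intg_contw|].
    by move=> x /uZ ->; rewrite sub0r normrN.
  by apply: Int_subset => // [|x _]; [exact: intg_contw|rewrite mulr_ge0].
have h2 : `|A| * M <= nu^-1 * X.
  rewrite mulrC ler_pdivlMl//; apply: le_trans h1; have := normr_ge0 A; nra.
have -> : (1 + nu^-1) * K_ * lam s * D_ a s = X + nu^-1 * X by rewrite /X; ring.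
apply: le_trans (lerD P h2); rewrite -IntZ// -IntD//; last 2 first.
- exact: intg_contw.
- exact: intgZ.
apply: Int_le => //; first by apply: intg_contw; exact: cont_norm.
  by apply: intgD => //; [exact: intg_contw|exact: intgZ].
move=> x _; rewrite -mulrDl ler_wpM2r//; have := ler_normD (u x - A) A; by rewrite subrK.
Qed.

(* Faber-Krahn: if [u] vanishes on half of each piece of scale [2^-N], the Poincare
   constant improves to that scale. *)
Lemma faber_krahn (Z : set E) : msb Z -> (forall x, Z x -> u x = 0) ->
  forall N a s, good s -> cbox a s `<=` O ->
  (forall a' s', good s' -> box a' s' `<=` box a s -> volb s' = volb s / 2 ^+ N ->
     2^-1 * Int (box a' s') w <= Int (box a' s' `&` Z) w) ->
  Int (box a s) (fun x => `|u x| * w x) <= 3 * K_ * (lam s * q_ (R := R) (n := n) ^+ N) * D_ a s.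
Proof.
move=> mZ uZ; elim=> [|N IH] a s g_ sO H.
  have h := H a s g_ (@subset_refl _ _); rewrite expr0 divr1 in h; have {}h := h erefl.
  (* At depth 0 the zero set has at least half the mass: [nu = 1/2], and [1 + 1 / nu] is the factor
     3 of the statement. *)
  have := poincare_zero g_ sO (nu := 2^-1) _ (measurableI _ _ (msb_box a s) mZ) (@subIsetl _ _ _) _ h.
  rewrite invrK expr0 mulr1 (_ : 1 + 2 = 3)// !mulrA; apply; first by rewrite invr_gt0.
  by move=> x [_ /uZ].
have [i im] := exists_max_side s n0; have g' := halve_good g_ im.
have hl := lam_halve_le n0 im.
have cu' : continuous (fun x => `|u x|) by exact: cont_norm.
rewrite (Int_halve i g_ (intg_contw a s cu')) (Int_halve i g_ (igw sO)).
set a2 := a + _; have b1 : box a (halve s i) `<=` box a s by exact: sub_halve1.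
have b2 : box a2 (halve s i) `<=` box a s by exact: sub_halve2.
have V a' s' : volb s' = volb (halve s i) / 2 ^+ N -> volb s' = volb s / 2 ^+ N.+1.
  by move=> ->; rewrite volb_halve exprS invfM; ring.
have i1 := IH a _ g' (subset_trans (@cbox_halve1 a s i g_) sO)
  (fun a' s' gs' bs v => H a' s' gs' (subset_trans bs b1) (V a' s' v)).
have i2 := IH a2 _ g' (subset_trans (@cbox_halve2 a s i g_) sO)
  (fun a' s' gs' bs v => H a' s' gs' (subset_trans bs b2) (V a' s' v)).
have q0 : 0 <= q_ (R := R) (n := n).
  rewrite /q_ subr_ge0 invf_le1; last by rewrite mulr_gt0// ltr0n.
  have h : 1 <= n%:R :> R by rewrite ler1n.
  by lra.
have K0 : 0 <= 3 * K_ by rewrite mulr_ge0// mulr_ge0.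
have st X : 0 <= X -> 3 * K_ * (lam (halve s i) * q_ (R := R) (n := n) ^+ N) * X <=
    3 * K_ * (lam s * q_ (R := R) (n := n) ^+ N.+1) * X.
  move=> X0; rewrite ler_wpM2r// ler_wpM2l// exprS mulrCA mulrA ler_wpM2r ?exprn_ge0//.
rewrite mulrDr; apply: lerD; [apply: le_trans i1 _|apply: le_trans i2 _]; apply: st; exact: D_ge0.
Qed.

End poincare.

(** * Euclidean distance and Hausdorff measure *)

Section euclid.
Context {R : realType} {n : nat}.
Local Notation E := 'rV[R]_n.
Implicit Types (x y z : E) (i : 'I_n).

Lemma dotE x : dot x x = \sum_i x 0 i ^+ 2.
Proof. by apply: eq_bigr => i _; rewrite expr2. Qed.

Lemma dot_ge0 x : 0 <= dot x x.
Proof. by rewrite dotE; apply: sumr_ge0 => i _; exact: sqr_ge0. Qed.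

Lemma enorm_ge0 x : 0 <= enorm x. Proof. exact: sqrtr_ge0. Qed.

Lemma enorm_sqr x : enorm x ^+ 2 = dot x x. Proof. by rewrite sqr_sqrtr// dot_ge0. Qed.

Lemma dotDl x y z : dot (x + y) z = dot x z + dot y z.
Proof. by rewrite /dot -big_split/=; apply: eq_bigr => i _; rewrite mxE mulrDl. Qed.

Lemma dotC x y : dot x y = dot y x.
Proof. by apply: eq_bigr => i _; rewrite mulrC. Qed.

Lemma dotZl (c : R) x y : dot (c *: x) y = c * dot x y.
Proof. by rewrite /dot mulr_sumr; apply: eq_bigr => i _; rewrite mxE mulrA. Qed.

Lemma dot_CS x y : dot x y <= enorm x * enorm y.
Proof.
have H t : 0 <= dot x x + 2 * t * dot x y + t ^+ 2 * dot y y.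
  have := dot_ge0 (x + t *: y); rewrite dotDl [dot x (_ + _)]dotC [dot (t *: y) (_ + _)]dotC !dotDl.
  by rewrite [dot x (t *: y)]dotC !dotZl [dot y (t *: y)]dotC dotZl (dotC y x); nra.
have [y0|yn0] := eqVneq (dot y y) 0.
  have [xy0|xyn0] := eqVneq (dot x y) 0; first by rewrite xy0 mulr_ge0// enorm_ge0.
  exfalso; have := H (- (dot x x + 1) / (2 * dot x y)); rewrite y0.
  have -> : 2 * (- (dot x x + 1) / (2 * dot x y)) * dot x y = - (dot x x + 1) by field.
  lra.
have yp : 0 < dot y y by rewrite lt_def yn0 dot_ge0.
have h : dot x y ^+ 2 <= dot x x * dot y y.
  have := H (- dot x y / dot y y).
  have -> : dot x x + 2 * (- dot x y / dot y y) * dot x y + (- dot x y / dot y y) ^+ 2 * dot y y =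
     (dot x x * dot y y - dot x y ^+ 2) / dot y y by field; lra.
  by rewrite pmulr_lge0 ?invr_gt0// subr_ge0.
apply: le_trans (ler_norm _) _.
by rewrite -ler_sqr ?nnegrE ?mulr_ge0 ?enorm_ge0// exprMn !enorm_sqr real_normK ?num_real.
Qed.

Lemma enormD x y : enorm (x + y) <= enorm x + enorm y.
Proof.
rewrite -ler_sqr ?nnegrE ?addr_ge0 ?enorm_ge0// enorm_sqr dotDl [dot x (_ + _)]dotC [dot y (_ + _)]dotC !dotDl.
have := dot_CS x y; rewrite sqrrD !enorm_sqr (dotC y x) mulr2n; lra.
Qed.

Lemma enormN x : enorm (- x) = enorm x.
Proof. by congr Num.sqrt; apply: eq_bigr => i _; rewrite mxE mulrNN. Qed.

Lemma enormB x y : enorm (x - y) = enorm (y - x).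
Proof. by rewrite -enormN opprB. Qed.

Lemma enorm_trans x y z : enorm (x - z) <= enorm (x - y) + enorm (y - z).
Proof. by rewrite -[x - z](subrKA y) enormD. Qed.

Lemma enormZ (c : R) x : enorm (c *: x) = `|c| * enorm x.
Proof. by rewrite /enorm dotZl dotC dotZl mulrA -expr2 sqrtrM ?sqr_ge0// sqrtr_sqr. Qed.

Lemma enorm0 : enorm (0 : E) = 0.
Proof. by rewrite -(scale0r 0) enormZ normr0 mul0r. Qed.

Lemma coord_le_enorm x i : `|x 0 i| <= enorm x.
Proof.
rewrite -ler_sqr ?nnegrE ?enorm_ge0// enorm_sqr dotE real_normK ?num_real//.
by rewrite (bigD1 i)//= lerDl sumr_ge0// => *; exact: sqr_ge0.
Qed.

Lemma enorm_le_sum x : enorm x <= \sum_i `|x 0 i|.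
Proof.
rewrite -ler_sqr ?nnegrE ?enorm_ge0 ?sumr_ge0// enorm_sqr dotE expr2 mulr_suml.
apply: ler_sum => i _; rewrite -real_normK ?num_real// expr2 ler_wpM2l//.
by rewrite (bigD1 i)//= lerDl sumr_ge0.
Qed.

Lemma enorm_le_sup x (r : R) : (forall i, `|x 0 i| <= r) -> enorm x <= n%:R * r.
Proof.
move=> h; apply: le_trans (enorm_le_sum x) _; apply: le_trans (ler_sum _ (fun i _ => h i)) _.
by rewrite sumr_const card_ord mulr_natl.
Qed.

Lemma eball_ball x (r : R) : eball x r `<=` ball x r.
Proof.
move=> y; rewrite /eball/= => h; have r0 : 0 < r by exact: le_lt_trans (enorm_ge0 _) h.
rewrite rV_ball_box// => i; rewrite !mxE.
have := le_lt_trans (coord_le_enorm (y - x) i) h; rewrite !mxE ltr_norml; lra.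
Qed.

Lemma ball_eball x (r : R) : (0 < n)%N -> 0 < r -> ball x (r / (2 * n%:R)) `<=` eball x r.
Proof.
move=> n0 r0 y; have nn : 0 < n%:R :> R by rewrite ltr0n.
have r'0 : 0 < r / (2 * n%:R) by rewrite divr_gt0// mulr_gt0.
rewrite rV_ball_box// => h; rewrite /eball/=.
have H i : `|(y - x) 0 i| <= r / (2 * n%:R) by have := h i; rewrite !mxE ler_norml; lra.
apply: le_lt_trans (enorm_le_sup H) _.
have -> : n%:R * (r / (2 * n%:R)) = r / 2 by field; rewrite gt_eqF.
lra.
Qed.

Lemma contI (f : E -> R) : (forall x (e : R), 0 < e -> exists2 r : R, 0 < r &
    forall y, ball x r y -> `|f y - f x| < e) -> continuous f.
Proof.
move=> H x; apply/(@cvgrPdist_lt _ _ _ (nbhs x) (nbhs_filter x) f (f x)) => e e0.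
have [r r0 hr] := H x e e0.
by have := nbhsx_ballx x _ r0; apply: filterS => y /hr; rewrite distrC.
Qed.

Lemma enorm_cont : (0 < n)%N -> continuous (@enorm R n).
Proof.
move=> n0; apply: contI => x e e0.
exists (e / (2 * n%:R)); first by rewrite divr_gt0// mulr_gt0// ltr0n.
move=> y /(ball_eball n0 e0); rewrite /eball/= => h.
apply: le_lt_trans h; have := enorm_trans x y 0; have := enorm_trans y x 0.
by rewrite !subr0 ler_norml (enormB y x); lra.
Qed.

Lemma eball_open x (r : R) : (0 < n)%N -> open (eball x r).
Proof.
move=> n0; have c : continuous (fun y : E => enorm (y - x)) by exact: (cont_shift (v := - x) (enorm_cont n0)).
by have /continuousP c' := c; have h := c' _ (@open_lt R r); exact: h.
Qed.

End euclid.

Section distance.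
Context {R : realType} {n : nat}.
Local Notation E := 'rV[R]_n.
Implicit Types (x y z : E).
Variables (G : set E) (n0 : (0 < n)%N) (G0 : G !=set0).

Let hinf z : has_inf [set enorm (z - y) | y in G].
Proof.
split; first by have [y Gy] := G0; exists (enorm (z - y)), y.
by exists 0 => _ [y _ <-]; exact: enorm_ge0.
Qed.

Lemma dist_le z y : G y -> dist_to G z <= enorm (z - y).
Proof. by move=> Gy; apply: ge_inf; [case: (hinf z)|exists y]. Qed.

Lemma dist_ge0 z : 0 <= dist_to G z.
Proof. by apply: lb_le_inf; [case: (hinf z)|move=> _ [y _ <-]; exact: enorm_ge0]. Qed.

Lemma dist_lt z (r : R) : dist_to G z < r -> exists2 y, G y & enorm (z - y) < r.
Proof. by move=> h; have [_ [y Gy <-] hy] := inf_lt (hinf z).1 h; exists y. Qed.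

Lemma dist_lip z z' : dist_to G z <= dist_to G z' + enorm (z - z').
Proof.
rewrite -lerBlDr; apply: lb_le_inf; first by case: (hinf z').
move=> _ [y Gy <-]; rewrite lerBlDr; apply: le_trans (dist_le z Gy) _.
by rewrite [leRHS]addrC; exact: (enorm_trans z z' y).
Qed.

Lemma dist_cont : continuous (dist_to G).
Proof.
apply: contI => x e e0; exists (e / (2 * n%:R)); first by rewrite divr_gt0// mulr_gt0// ltr0n.
move=> y /(ball_eball n0 e0); rewrite /eball/= => h.
apply: le_lt_trans h; have := dist_lip x y; have := dist_lip y x.
by rewrite ler_norml (enormB x y); lra.
Qed.

Lemma dist0 z : G z -> dist_to G z = 0.
Proof. by move=> Gz; apply/eqP; rewrite eq_le dist_ge0 andbT; have := dist_le z Gz; rewrite subrr enorm0. Qed.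

Lemma dist_gt0 z : closed G -> ~ G z -> 0 < dist_to G z.
Proof.
move=> cG nG; rewrite lt_def dist_ge0 andbT; apply/eqP => h; apply: nG.
have oG : open (~` G) by exact: closed_openC.
apply: contrapT => nGz; have [e e0 he] := open_ball_sub oG nGz.
have [|y Gy hy] := @dist_lt z e; first by rewrite h.
by apply: (he y) Gy; apply: eball_ball; rewrite /eball/= enormB.
Qed.

End distance.

(** * Closed sets and metric outer measures *)

Section metric_outer.
Context {R : realType} {n : nat}.
Local Notation E := 'rV[R]_n.
Variables (mu : {outer_measure set E -> \bar R}) (n0 : (0 < n)%N).
Hypothesis metric : forall (A B : set E) (e : R), 0 < e ->
  (forall x y, A x -> B y -> e <= enorm (x - y)) -> (mu A + mu B <= mu (A `|` B))%E.

(* Caratheodory's criterion. *)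
Lemma metric_closed (F : set E) : closed F -> mu.-caratheodory F.
Proof.
move=> cF; apply: le_caratheodory_measurable => X.
have [F0|/set0P F0] := eqVneq F set0.
  by rewrite F0 setI0 outer_measure0 add0e; apply: le_outer_measure => x [].
have [->|] := eqVneq (mu X) +oo%E; first by rewrite leey.
rewrite -ltey => Xfin.
pose D := dist_to F.
(* [A k] is the part of [X] at distance at least [1 / (k + 1)] from [F], and the rings [r k] fill
   the rest off [F]. If the masses of the rings are summable, the part of [X] missed by [A k] and
   [F] is negligible for large [k]. *)
pose A (k : nat) := X `&` [set x | k.+1%:R^-1 <= D x].
pose r (k : nat) := X `&` [set x | k.+2%:R^-1 <= D x < k.+1%:R^-1].
have rX k : r k `<=` X by move=> x [].
have sep (j k : nat) x y : (j.+1 < k)%N -> r j x -> r k y -> j.+2%:R^-1 - k.+1%:R^-1 <= enorm (x - y).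
  move=> jk [_ /= /andP[h1 _]] [_ /= /andP[_ h2]].
  have h3 := dist_lip F0 x y; rewrite lerBlDr. have h4 := le_trans h1 h3; apply: le_trans h4 _.
  by rewrite addrC lerD2l ltW.
have gap (j k : nat) : (j.+1 < k)%N -> 0 < j.+2%:R^-1 - k.+1%:R^-1 :> R.
  by move=> jk; rewrite subr_gt0 ltf_pV2 ?posrE ?ltr0n// ltr_nat.
(* Rings whose indices differ by at least 2 lie at positive distance, so [mu] adds up along the even
   rings ([b = 0]) and along the odd rings ([b = 1]). *)
have parity (b N : nat) : (\sum_(0 <= j < N) mu (r (2 * j + b)%N) <= mu X)%E.
  apply: (@le_trans _ _ (mu (\bigcup_(j < N) r (2 * j + b)%N))); last first.
    by apply: le_outer_measure => x [j _ /rX].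
  elim: N => [|N IH]; first by rewrite big_geq// outer_measure_ge0.
  rewrite big_nat_recr//=; apply: le_trans (leeD IH (lexx _)) _.
  have e0 := gap (2 * N.-1 + b)%N (2 * N + b)%N.
  case: N {IH} e0 => [|N] e0.
    rewrite bigcup_mkord big_ord0 outer_measure0 add0e.
    by apply: le_outer_measure => x h; exists 0%N.
  apply: (le_trans (metric (e0 ltac:(rewrite /=; lia)) _)).
    move=> x y [j /= jN rj] rN.
    apply: le_trans (sep _ _ _ _ _ rj rN); last by lia.
    by rewrite lerD2r lef_pV2 ?posrE ?ltr0n// ler_nat; lia.
  apply: le_outer_measure => x [[j /= jN h]|h]; [exists j => //=; lia|exists N.+1 => //=].
have sumr : (\sum_(0 <= k <oo) mu (r k) < +oo)%E.
  apply: (@le_lt_trans _ _ (mu X + mu X)%E); last by rewrite lte_add_pinfty.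
  apply: lime_le; first by apply: is_cvg_nneseries => *; exact: outer_measure_ge0.
  apply: nearW => N.
  apply: (@le_trans _ _ (\sum_(0 <= j < N) mu (r (2 * j + 0)%N) + \sum_(0 <= j < N) mu (r (2 * j + 1)%N))%E); last first.
    by apply: leeD; exact: parity.
  elim: N => [|N IH]; first by rewrite !big_geq// adde0.
  have h0 k : (0 <= mu (r k))%E by exact: outer_measure_ge0.
  apply: (@le_trans _ _ (\sum_(0 <= j < (2 * N.+1)%N) mu (r j))%E).
    by apply: lee_sum_nneg_natr => // ; lia.
  elim: N.+1 => [|m IHm]; first by rewrite muln0 !big_geq// adde0.
  rewrite (_ : (2 * m.+1 = (2 * m).+2)%N); last by lia.
  rewrite !big_nat_recr//= addn0 addn1 -addeA [leRHS]addeACA; apply: leeD => //.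
apply/lee_addgt0Pr => e e0.
have tail := nneseries_tail_cvg sumr (fun k _ => outer_measure_ge0 mu (r k)).
have /fine_cvgP[ft /cvgrPdist_lt/(_ _ e0)] := tail.
move=> h; near \oo => k.
have hk : (\sum_(k <= j <oo) mu (r j) <= e%:E)%E.
  have hf : (\sum_(k <= j <oo) mu (r j))%E \is a fin_num by near: k.
  rewrite -(fineK hf) lee_fin.
  have : `|0 - fine (\sum_(k <= j <oo) mu (r j))%E| < e by near: k.
  by rewrite sub0r normrN => /ltW; apply: le_trans; exact: ler_norm.
have cov : X `&` ~` F `<=` A k `|` \bigcup_(j in ~` `I_k) r j.
  move=> x [Xx nFx]; have dx : 0 < D x by exact: (dist_gt0 F0 cF nFx).
  have [h1|h1] := leP (k.+1%:R^-1) (D x); [by left|right].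
  pose P (j : nat) := (D x)^-1 <= j.+2%:R.
  have exP : exists j, P j.
    exists (Num.truncn (D x)^-1); apply/ltW; apply: lt_trans (truncnS_gt _) _; by rewrite ltr_nat.
  case: (ex_minnP exP) => j Pj minj.
  have pk : k.+1%:R < (D x)^-1 by rewrite -[k.+1%:R]invrK ltf_pV2 ?posrE// invr_gt0.
  have pj : j.+1%:R < (D x)^-1.
    case: j Pj minj => [|j] Pj minj; first by apply: le_lt_trans pk; rewrite ler_nat.
    by rewrite ltNge; apply/negP => /minj; rewrite ltnn.
  exists j; first by move=> /=; apply/negP; rewrite -leqNgt -ltnS -ltnS -(ltr_nat R); exact: lt_le_trans Pj.
  split=> //=; rewrite -[D x]invrK lef_pV2 ?posrE ?invr_gt0// ltf_pV2 ?posrE ?invr_gt0//.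
  by rewrite pj andbT; exact: Pj.
have s1 : (mu (X `&` F) + mu (A k) <= mu X)%E.
  have k0 : 0 < k.+1%:R^-1 :> R by rewrite invr_gt0.
  apply: (@le_trans _ _ (mu ((X `&` F) `|` A k))).
    apply: (metric k0) => x y [_ Fx] [_ /= hy]; apply: le_trans hy _.
    by rewrite enormB; exact: dist_le.
  by apply: le_outer_measure => x [[]|[]].
apply: (@le_trans _ _ (mu (X `&` F) + (mu (A k) + e%:E))%E); last by rewrite addeA leeD2r.
rewrite leeD2l//; apply: le_trans (le_outer_measure mu _ _ cov) _.
apply: le_trans (outer_measureU2 _ _ _) _; apply: leeD => //.
by apply: le_trans hk; exact: outer_measure_sigma_subadditive_tail.
Unshelve. all: by end_near.
Qed.

End metric_outer.

Section hausdorff.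
Context {R : realType} {n : nat} {d : R}.
Local Notation E := 'rV[R]_n.
Local Notation hs := (hausdorff_om n d).

Lemma hausdorff_pre_anti (A : set E) (d1 d2 : R) : d1 <= d2 ->
  (hausdorff_pre d d2 A <= hausdorff_pre d d1 A)%E.
Proof.
move=> d12; apply: le_ereal_inf_tmp => _ [F covF <-].
apply: (@le_trans _ _ (\sum_(0 <= k <oo) diam_gauge d d2 (F k))%E).
  by apply: ereal_inf_lbound; exists F.
apply: lee_nneseries => k _; first by move=> _; exact: diam_gauge_ge0.
rewrite /diam_gauge; case: ifP => // _; case: (leP (ediam (F k)) d1%:E) => h; last by rewrite leey.
by rewrite ifT// (le_trans h).
Qed.

Lemma ediam_ge (A : set E) x y : A x -> A y -> ((enorm (x - y))%:E <= ediam A)%E.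
Proof. by move=> Ax Ay; apply: ereal_sup_ubound; exists x => //; exists y. Qed.

(** A set of diameter at most [d1 < e] cannot meet both [A] and [B], so a cover of the union
    separates into a cover of each. *)
Lemma hausdorff_pre_metric (A B : set E) (e d1 : R) : 0 < d -> d1 < e ->
  (forall x y, A x -> B y -> e <= enorm (x - y)) ->
  (hausdorff_pre d d1 A + hausdorff_pre d d1 B <= hausdorff_pre d d1 (A `|` B))%E.
Proof.
move=> d0 d1e sep; apply: le_ereal_inf_tmp => _ [F [mF covF] <-].
pose FA k := if `[< exists x, F k x /\ A x >] then F k else set0.
pose FB k := if `[< exists x, F k x /\ B x >] then F k else set0.
have hA : (hausdorff_pre d d1 A <= \sum_(0 <= k <oo) diam_gauge d d1 (FA k))%E.
  apply: ereal_inf_lbound; exists FA => //; split => // x Ax.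
  by have [k _ Fk] := covF x (or_introl Ax); exists k => //; rewrite /FA; case: asboolP => // -[]; exists x.
have hB : (hausdorff_pre d d1 B <= \sum_(0 <= k <oo) diam_gauge d d1 (FB k))%E.
  apply: ereal_inf_lbound; exists FB => //; split => // x Bx.
  by have [k _ Fk] := covF x (or_intror Bx); exists k => //; rewrite /FB; case: asboolP => // -[]; exists x.
apply: le_trans (leeD hA hB) _; rewrite -nneseriesD; last 2 first.
- by move=> k _ _; exact: diam_gauge_ge0.
- by move=> k _ _; exact: diam_gauge_ge0.
apply: lee_nneseries => k _; first by move=> _; rewrite adde_ge0// diam_gauge_ge0.
rewrite /FA /FB; case: asboolP => [[x [Fx Ax]]|_]; case: asboolP => [[y [Fy By]]|_];
  rewrite ?diam_gauge0 ?add0e ?adde0 ?diam_gauge_ge0//.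
(* A set meeting both has diameter above [d1], and its gauge is [+oo]. *)
rewrite [leRHS]/diam_gauge ifF; last by apply/negbTE/set0P; exists x.
rewrite ifF ?leey//; apply/negbTE; rewrite -ltNge; apply: lt_le_trans (ediam_ge Fx Fy).
by rewrite lte_fin (lt_le_trans d1e)// sep.
Qed.

Lemma hausdorff_metric (A B : set E) (e : R) : 0 < d -> 0 < e ->
  (forall x y, A x -> B y -> e <= enorm (x - y)) -> (hs A + hs B <= hs (A `|` B))%E.
Proof.
move=> d0 e0 sep; have [->|] := eqVneq (hs (A `|` B)) +oo%E; first by rewrite leey.
rewrite -ltey => fin.
have le1 (C : set E) (d1 : R) : 0 < d1 -> (hausdorff_pre d d1 C <= hs C)%E.
  by move=> d10; apply: ereal_sup_ubound; exists d1.
have H (d1 d2 : R) : 0 < d1 -> 0 < d2 -> (hausdorff_pre d d1 A + hausdorff_pre d d2 B <= hs (A `|` B))%E.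
  move=> d10 d20; pose d3 := Num.min (Num.min d1 d2) (e / 2).
  have d30 : 0 < d3 by rewrite !lt_min d10 d20 divr_gt0.
  have d31 : d3 <= d1 by rewrite !ge_min lexx.
  have d32 : d3 <= d2 by rewrite !ge_min lexx orbT.
  have d3e : d3 < e by apply: (@le_lt_trans _ _ (e / 2)); [rewrite ge_min lexx orbT|lra].
  apply: le_trans (leeD (hausdorff_pre_anti A d31) (hausdorff_pre_anti B d32)) _.
  by apply: le_trans (hausdorff_pre_metric d0 d3e sep) _; exact: le1.
have fC (C : set E) : C `<=` A `|` B -> hs C \is a fin_num.
  by move=> CAB; rewrite ge0_fin_numE ?outer_measure_ge0// (le_lt_trans _ fin)// le_outer_measure.
have fA : hs A \is a fin_num by apply: fC => x; left.
have fB : hs B \is a fin_num by apply: fC => x; right.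
rewrite -leeBrDr//; apply: ge_ereal_sup => _ [d1 /= d10 <-].
rewrite leeBrDr//.
have fp : hausdorff_pre d d1 A \is a fin_num.
  rewrite ge0_fin_numE; first by apply: le_lt_trans (le1 A d1 d10) _; rewrite -ge0_fin_numE// outer_measure_ge0.
  by apply: (@mu_ext_ge0 _ (allsets E) R _ (diam_gauge_ge0 d d1)).
rewrite addeC -leeBrDr//; apply: ge_ereal_sup => _ [d2 /= d20 <-].
by rewrite leeBrDr// addeC H.
Qed.

End hausdorff.

(** * The weight *)

Lemma le_of_eq (R : realType) (x y : R) : x = y -> x <= y. Proof. by move=> ->. Qed.

Lemma powR_div (R : realType) (x y a : R) : 0 <= x -> 0 < y -> (x / y) `^ a = x `^ a / y `^ a.
Proof.
move=> x0 y0; rewrite powRM ?invr_ge0 ?(ltW y0)//; congr (_ * _).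
by rewrite -powR_inv1 ?(ltW y0)// -powRrM mulN1r powRN.
Qed.

Section ahlfors.
Context {R : realType} {n : nat}.
Variables (d C0 : R) (Gamma : set 'rV[R]_n).
Local Notation E := 'rV[R]_n.
Implicit Types (x y z : E) (S : seq E).
Local Notation hs := (hausdorff_om n d).
Local Notation delta := (dist_to Gamma).
Hypotheses (n0 : (0 < n)%N) (d0 : 0 < d) (dn : d < n%:R - 1) (C01 : 1 <= C0)
  (G0 : Gamma !=set0) (cG : closed Gamma) (AR : ahlfors_regular Gamma d C0).

Let C0p : 0 < C0. Proof. exact: lt_le_trans C01. Qed.

Lemma ar_lo x (r : R) : Gamma x -> 0 < r -> ((C0^-1 * r `^ d)%:E <= hs (Gamma `&` eball x r))%E.
Proof. by move=> Gx r0; have /andP[] := AR Gx r0. Qed.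

Lemma ar_hi x (r : R) : Gamma x -> 0 < r -> (hs (Gamma `&` eball x r) <= (C0 * r `^ d)%:E)%E.
Proof. by move=> Gx r0; have /andP[] := AR Gx r0. Qed.

Lemma cthick (z : E) : ~ Gamma z -> 0 < delta z.
Proof. by move=> nG; exact: dist_gt0. Qed.

Definition separated (s : R) S := uniq S /\ forall x y, x \in S -> y \in S -> x != y -> s <= enorm (x - y).

(** The balls of radius [s / 3] about the points of [S] are at mutual distance at least [s / 3], so
    their Hausdorff masses add up by [hausdorff_metric], and all of them lie in the ball of radius
    [2 * L]. *)
Lemma packing x0 (L s : R) S : Gamma x0 -> 0 < s <= L ->
  (forall x, x \in S -> Gamma x /\ enorm (x - x0) < L) -> separated s S ->
  (size S)%:R * (s / 3) `^ d <= C0 ^+ 2 * (2 * L) `^ d.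
Proof.
move=> Gx0 /andP[s0 sL] SG [uS sepS].
have s30 : 0 < s / 3 by rewrite divr_gt0.
pose BU S := [set y : E | exists2 x, x \in S & eball x (s / 3) y].
have lo : (((size S)%:R * (C0^-1 * (s / 3) `^ d))%:E <= hs (Gamma `&` BU S))%E.
  elim: S uS sepS SG => [|x S IH] /=; first by move=> *; rewrite mul0r outer_measure_ge0.
  move=> /andP[xS uS] sepS SG.
  have IH' := IH uS (fun y z yS zS => sepS y z (mem_behead (s := x :: S) yS) (mem_behead (s := x :: S) zS)) (fun y yS => SG y (mem_behead (s := x :: S) yS)).
  have [Gx _] := SG x (mem_head _ _).
  rewrite -natr1 mulrDl mul1r EFinD.
  apply: (le_trans (leeD IH' (ar_lo Gx s30))).
  apply: (@le_trans _ _ (hs ((Gamma `&` BU S) `|` (Gamma `&` eball x (s / 3))))).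
    apply: (hausdorff_metric d0 s30) => y z [_ [x' x'S hy]] [_ hz].
    have := sepS x x' (mem_head _ _) (mem_behead (s := x :: S) x'S).
    have xx' : x != x' by apply: contraNneq xS => ->.
    move=> /(_ xx'); rewrite /eball/= in hy hz.
    have := enorm_trans x z x'; have := enorm_trans z y x'.
    by rewrite (enormB x z) (enormB y z); lra.
  apply: le_outer_measure => y [[Gy [x' x'S h]]|[Gy h]]; split=> //.
    by exists x' => //; rewrite inE x'S orbT.
  by exists x => //; exact: mem_head.
have hi : (hs (Gamma `&` BU S) <= (C0 * (2 * L) `^ d)%:E)%E.
  apply: le_trans (ar_hi Gx0 _); last by rewrite mulr_gt0//; exact: lt_le_trans sL.
  apply: le_outer_measure => y [Gy [x xS h]]; split=> //; rewrite /eball/= in h *.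
  have [_ hx] := SG x xS; have := enorm_trans y x x0; lra.
have := le_trans lo hi; rewrite lee_fin mulrCA -ler_pdivlMl ?invr_gt0// invrK mulrA -expr2.
by [].
Qed.

(** A separated set of maximal cardinality, which exists by [packing]; maximality makes it
    [s]-dense. *)
Lemma separated_net x0 (L s : R) : Gamma x0 -> 0 < s <= L -> exists S,
  [/\ separated s S, forall x, x \in S -> Gamma x /\ enorm (x - x0) < L,
      forall y, Gamma y -> enorm (y - x0) < L -> exists2 x, x \in S & enorm (y - x) < s &
      (size S)%:R * (s / 3) `^ d <= C0 ^+ 2 * (2 * L) `^ d].
Proof.
move=> Gx0 sL; have /andP[s0 _] := sL.
pose valid S := separated s S /\ forall x, x \in S -> Gamma x /\ enorm (x - x0) < L.
pose P m := `[< exists S, valid S /\ size S = m >].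
have p0 : 0 < (s / 3) `^ d by rewrite powR_gt0// divr_gt0.
have bnd m : P m -> (m <= Num.truncn (C0 ^+ 2 * (2 * L) `^ d / (s / 3) `^ d))%N.
  move=> /asboolP[S [[v1 v2] <-]]; rewrite truncn_ge_nat.
    by rewrite ler_pdivlMr//; exact: (packing Gx0 sL v2 v1).
  by rewrite divr_ge0 ?powR_ge0// mulr_ge0 ?sqr_ge0 ?powR_ge0.
have exP : exists m, P m by exists 0%N; apply/asboolP; exists [::]; do !split.
case: (ex_maxnP exP bnd) => m /asboolP[S [[v1 v2] sm]] maxm.
exists S; split=> //; last exact: (packing Gx0 sL v2 v1).
move=> y Gy hy; apply: contrapT => nex.
have far x : x \in S -> s <= enorm (y - x) by move=> xS; rewrite leNgt; apply/negP => h; apply: nex; exists x.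
have yS : y \notin S by apply/negP => /far; rewrite subrr enorm0; lra.
have : P m.+1.
  apply/asboolP; exists (y :: S); split; last by rewrite /= sm.
  split; last by move=> x; rewrite inE => /orP[/eqP ->|/v2].
  have [u1 u2] := v1; split; first by rewrite /= yS.
  move=> x z; rewrite !inE => /orP[/eqP ->|xS] /orP[/eqP ->|zS]; rewrite ?eqxx//.
  - by move=> _; exact: far.
  - by move=> _; rewrite enormB; exact: far.
  - exact: u2.
by move=> /maxm; rewrite ltnn.
Qed.

Definition nbd x0 (L s : R) : set E := [set z | enorm (z - x0) < L /\ delta z < s].

Lemma cover_vol (S : seq E) (s : R) : 0 < s ->
  (lebesgue_om R n [set z : E | exists2 x, x \in S & (enorm (z - x) < s)%R] <= ((size S)%:R * (2 * s) ^+ n)%:E)%E.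
Proof.
move=> s0; elim: S => [|x S IH].
  rewrite (_ : mkset _ = set0) ?outer_measure0 ?lee_fin ?mul0r//.
  by apply/seteqP; split => z // [].
rewrite /= -natr1 mulrDl mul1r EFinD.
apply: (@le_trans _ _ (lebesgue_om R n ([set z : E | exists2 x, x \in S & (enorm (z - x) < s)%R] `|` cbox (x - const_mx s) (const_mx (2 * s))))).
  apply: le_outer_measure => z [y]; rewrite inE => /orP[/eqP -> h|yS h]; [right|left]; last by exists y.
  move=> i; have := le_lt_trans (coord_le_enorm (z - x) i) h; rewrite !mxE ltr_norml; lra.
apply: le_trans (outer_measureU2 _ _ _) _; apply: leeD => //.
apply: le_trans (leb_cbox_le _ _) _; first by move=> i; rewrite mxE mulr_ge0// ltW.
by rewrite lee_fin; under eq_bigr do rewrite mxE; rewrite prodr_const card_ord.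
Qed.

(** The number of net points times the volume of a cube of side [4 s]: 12 is 4 from the doubled
    radius [2 * (2 * L)] times 3 from [s / 3], and [4 ^ n] comes from the cubes. *)
Definition CV : R := C0 ^+ 2 * 12 `^ d * 4 ^+ n.

Lemma CV_gt0 : 0 < CV.
Proof. by rewrite !mulr_gt0 ?exprn_gt0 ?powR_gt0. Qed.

(** About [(L / s)^d] balls of radius [2 * s] cover the neighbourhood of width [s], each of volume
    comparable to [s^n]. *)
Lemma nbd_vol x0 (L s : R) : Gamma x0 -> 0 < s <= L ->
  (lebesgue_om R n (nbd x0 L s) <= (CV * L `^ d * s `^ (n%:R - d))%:E)%E.
Proof.
move=> Gx0 sL; have /andP[s0 sL'] := sL; have L0 : 0 < L by exact: lt_le_trans sL'.
have s2L : 0 < s <= 2 * L by rewrite s0/=; lra.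
have [S [_ _ cov sz]] := separated_net Gx0 s2L.
have s20 : 0 < 2 * s by rewrite mulr_gt0.
apply: (@le_trans _ _ (((size S)%:R * (2 * (2 * s)) ^+ n)%:E)).
  apply: le_trans (cover_vol S s20); apply: le_outer_measure => z [hz hd].
  have [y Gy hy] := dist_lt G0 hd.
  have [|x xS hx] := cov y Gy.
    have := enorm_trans y z x0; rewrite (enormB y z); lra.
  by exists x => //; have := enorm_trans z y x; lra.
rewrite lee_fin.
have sd : 0 < s `^ d by rewrite powR_gt0.
have e1 : (s / 3) `^ d = s `^ d / 3 `^ d.
  exact: (powR_div _ (ltW s0) (ltr0n R 3)).
have e2 : (2 * (2 * L)) `^ d = 4 `^ d * L `^ d.
  by rewrite mulrA powRM ?ltW// ; congr (_ `^ _ * _); lra.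
have sz' : (size S)%:R <= C0 ^+ 2 * (12 `^ d * L `^ d) / s `^ d.
  rewrite ler_pdivlMr//; move: sz; rewrite e1 e2 mulrA ler_pdivrMr ?powR_gt0// => sz.
  apply: le_trans sz _; rewrite -!mulrA ler_pM2l ?exprn_gt0//.
  have -> : 12 `^ d = 4 `^ d * 3 `^ d :> R by rewrite -powRM//; congr (_ `^ _); lra.
  by rewrite le_eqVlt; apply/orP; left; apply/eqP; ring.
apply: (@le_trans _ _ (C0 ^+ 2 * (12 `^ d * L `^ d) / s `^ d * (2 * (2 * s)) ^+ n)).
  by rewrite ler_wpM2r// exprn_ge0// mulr_ge0// mulr_ge0// ltW.
have e3 : s `^ (n%:R - d) = s ^+ n / s `^ d.
  by rewrite powRB ?powR_mulrn ?ltW//; apply/implyP => _; rewrite gt_eqF.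
have e4 : (2 * (2 * s)) ^+ n = 4 ^+ n * s ^+ n by rewrite -exprMn; congr (_ ^+ _); ring.
by rewrite e3 /CV e4 le_eqVlt; apply/orP; left; apply/eqP; ring.
Qed.

Lemma nbd_msb x0 (L s : R) : msb (nbd x0 L s).
Proof.
apply: measurable_open; apply: openI; first exact: eball_open.
have /continuousP c := dist_cont n0 G0; have h := c _ (@open_lt R s); exact: h.
Qed.

Local Notation a_ := (n%:R - 1 - d).
Local Notation w := (weight Gamma d).

Let a0 : 0 < a_. Proof. by rewrite subr_gt0. Qed.

Lemma weightE z : w z = delta z `^ (- a_).
Proof. by rewrite /weight; congr (_ `^ _); ring. Qed.

Lemma weight_ge0 z : 0 <= w z. Proof. exact: powR_ge0. Qed.

Lemma weight_mfn D : msb D -> mfn D w.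
Proof.
move=> mD; apply: (@mfn_comp _ _ _ (fun t : R => t `^ (d + 1 - n%:R)) delta).
  exact: measurable_powR.
by apply: mfn_cont => //; exact: dist_cont.
Qed.

Lemma weight_anti z (t : R) : 0 < t -> t <= delta z -> w z <= t `^ (- a_).
Proof.
move=> t0 h; rewrite weightE !powRN lef_pV2 ?posrE ?powR_gt0//; last exact: lt_le_trans h.
by apply: ge0_ler_powR; rewrite ?nnegrE; [exact: ltW a0|exact: ltW|apply: ltW; exact: lt_le_trans h|].
Qed.

(** Restricted to points off [Gamma] since the weight is 0 on [Gamma], by the convention on powers
    of 0. *)
Lemma weight_lower z (t : R) : ~ Gamma z -> delta z <= t -> t `^ (- a_) <= w z.
Proof.
move=> nG h; have z0 := cthick nG; have t0 : 0 < t by exact: lt_le_trans h.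
rewrite weightE !powRN lef_pV2 ?posrE ?powR_gt0//.
by apply: ge0_ler_powR; rewrite ?nnegrE; [exact: ltW a0|exact: ltW|exact: ltW|].
Qed.

Definition Cm : R := 2 * (CV * 2 `^ a_).

(** Decomposes by the layers [t_(k+1) <= delta < t_k] with [t_k = L / 2^k]. A layer contributes at
    most a constant times [t_k^(-a) L^d t_k^(n-d) = L^d t_k], since [n - d - a = 1]: a geometric
    series. *)
Lemma weight_mass x0 (L : R) : Gamma x0 -> 0 < L ->
  intg (nbd x0 L L) w /\ Int (nbd x0 L L) w <= Cm * L `^ (d + 1).
Proof.
move=> Gx0 L0; set N := nbd x0 L L; have mN : msb N by exact: nbd_msb.
pose t (k : nat) := L / 2 ^+ k.
have t0 k : 0 < t k by rewrite divr_gt0// exprn_gt0.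
have tL k : 0 < t k <= L by rewrite t0/= ler_pdivrMr ?exprn_gt0// ler_peMr ?(ltW L0)//; apply: exprn_ege1; rewrite ler1n.
pose f (k : nat) (z : lebT R n) : \bar R := ((t k.+1 `^ (- a_))%:E * (\1_(nbd x0 L (t k)) z)%:E)%E.
have f0 k z : (0 <= f k z)%E by rewrite mule_ge0// lee_fin ?powR_ge0.
have wle z : N z -> ((w z)%:E <= \sum_(0 <= k <oo) f k z)%E.
  move=> [hz hd].
  have [Gz|nG] := pselect (Gamma z).
    rewrite (_ : w z = 0) ?nneseries_ge0// weightE dist0// powR0// oppr_eq0 gt_eqF//.
  have z0 := cthick nG.
  have exk : exists k, delta z < t k /\ t k.+1 <= delta z.
    have [J hJ] := half_pow_small L z0.
    have exP : exists k, t k.+1 <= delta z by exists J; apply/ltW; apply: hJ; exact: leqnSn.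
    case: (ex_minnP exP) => k hk mink; exists k; split=> //.
    case: k hk mink => [|k] hk mink; first by rewrite /t expr0 divr1.
    by rewrite ltNge; apply/negP => /mink; rewrite ltnn.
  have [k [k1 k2]] := exk.
  apply: le_trans (nneseries_ge_term k (fun k => f0 k z)).
  rewrite /f indicE mem_set; last by split.
  by rewrite mule1 lee_fin; exact: weight_anti.
have mI k : msb (nbd x0 L (t k)) by exact: nbd_msb.
have mf k : measurable_fun (N : set (lebT R n)) (f k).
  apply: emeasurable_funM; first exact: measurable_cst.
  by apply/measurable_EFinP; apply: (measurable_indic (mI k)).
have bndI k : (\int[leb R n]_(z in (N : set (lebT R n))) f k z <= (Cm * L `^ (d + 1) / (2 ^ k.+1)%:R)%:E)%E.
  have mi : measurable_fun (N : set (lebT R n)) (fun z : lebT R n => (\1_(nbd x0 L (t k)) z)%:E : \bar R).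
    by apply/measurable_EFinP; apply: (measurable_indic (mI k)).
  have i0 (z : lebT R n) : N z -> (0 <= (\1_(nbd x0 L (t k)) z)%:E :> \bar R)%E by move=> _; rewrite lee_fin.
  have c0 : (0 <= (t k.+1 `^ (- a_))%:E)%E by rewrite lee_fin powR_ge0.
  rewrite (ge0_integralZl (leb R n) mN mi i0 c0).
  rewrite (integral_indic (leb R n) mN (mI k)).
  apply: (@le_trans _ _ ((t k.+1 `^ (- a_))%:E * (CV * L `^ d * t k `^ (n%:R - d))%:E)%E).
    rewrite lee_wpmul2l ?lee_fin ?powR_ge0//.
    apply: le_trans (nbd_vol Gx0 (tL k)); apply: le_outer_measure; exact: subIsetl.
  rewrite -EFinM lee_fin.
  have -> : t k.+1 = t k / 2 by rewrite /t exprS invfM; ring.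
  rewrite powRM ?invr_ge0 ?(ltW (t0 k))// (_ : 2^-1 `^ (- a_) = 2 `^ a_); last first.
    by rewrite -powR_inv1// -powRrM mulN1r opprK.
  have e1 : t k `^ (- a_) * t k `^ (n%:R - d) = t k.
    rewrite -powRD; last by apply/implyP => _; rewrite gt_eqF.
    by rewrite (_ : - a_ + (n%:R - d) = 1) ?powRr1 ?ltW//; ring.
  have -> : t k `^ (- a_) * 2 `^ a_ * (CV * L `^ d * t k `^ (n%:R - d)) =
      CV * 2 `^ a_ * L `^ d * (t k `^ (- a_) * t k `^ (n%:R - d)) by ring.
  have e2 : L `^ (d + 1) = L `^ d * L.
    by rewrite powRD ?powRr1 ?ltW//; apply/implyP => _; rewrite gt_eqF.
  rewrite e1 /Cm e2 /t natrX exprS; apply: le_of_eq; field.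
  by rewrite expf_neq0.
have fin : (\int[leb R n]_(z in (N : set (lebT R n))) (w z)%:E <= (Cm * L `^ (d + 1))%:E)%E.
  apply: (@le_trans _ _ (\int[leb R n]_(z in (N : set (lebT R n))) (\sum_(0 <= k <oo) f k z))%E).
    have mS : measurable_fun (N : set (lebT R n)) (fun z => \sum_(0 <= k <oo) f k z)%E.
      by apply: ge0_emeasurable_sum => [j z _ _|j _]; [exact: f0|exact: mf].
    have mw : measurable_fun (N : set (lebT R n)) (fun z : lebT R n => (w z)%:E : \bar R).
      by apply/measurable_EFinP; exact: weight_mfn.
    apply: (@ge0_le_integral _ (lebT R n) R (leb R n) N mN _ _ _ mw mS).
    - by move=> z _; rewrite lee_fin weight_ge0.
    - by move=> z /wle.
  rewrite integral_nneseries//.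
  apply: (@le_trans _ _ (\sum_(0 <= k <oo) (Cm * L `^ (d + 1) / (2 ^ k.+1)%:R)%:E)%E).
    apply: lee_nneseries => [j _ _|j _]; last exact: bndI.
    by apply: integral_ge0 => z _; exact: f0.
  by apply: epsilon_trick0; rewrite mulr_ge0 ?powR_ge0// /Cm mulr_ge0// mulr_ge0 ?powR_ge0// ltW// CV_gt0.
split.
  apply/integrableP; split; first by apply/measurable_EFinP; exact: weight_mfn.
  rewrite (eq_integral (fun z : lebT R n => (w z)%:E : \bar R)); last by move=> z _ /=; rewrite ger0_norm ?weight_ge0.
  exact: le_lt_trans fin (ltry _).
rewrite /Int /Rintegral -lee_fin fineK// ge0_fin_numE; first exact: le_lt_trans fin (ltry _).
by apply: integral_ge0 => z _; rewrite lee_fin weight_ge0.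
Qed.

Lemma weight_intg_box a s : intg (box a s) w.
Proof.
have [x0 Gx0] := G0.
pose L := enorm (a - x0) + \sum_i `|s 0 i| + 1.
have S0 : 0 <= \sum_i `|s 0 i| by exact: sumr_ge0.
have L0 : 0 < L by rewrite ltr_wpDl// addr_ge0// enorm_ge0.
have [i _] := weight_mass Gx0 L0.
apply: (intgS _ _ _ i); [exact: msb_box|exact: nbd_msb|].
move=> z hz; have h1 : enorm (z - a) <= \sum_i `|s 0 i|.
  apply: le_trans (enorm_le_sum _) _; apply: ler_sum => j _; have := hz j; rewrite !mxE => h.
  by rewrite ger0_norm; [rewrite -[leRHS]ger0_norm//; have := ler_norm (s 0 j); rewrite normr_id; lra|lra].
have h2 : enorm (z - x0) < L by have := enorm_trans z a x0; rewrite /L; lra.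
by split=> //; apply: le_lt_trans h2; exact: dist_le.
Qed.

Lemma gamma_null a s : lebesgue_om R n (Gamma `&` box a s) = 0%E.
Proof.
have [x0 Gx0] := G0.
pose L := enorm (a - x0) + \sum_i `|s 0 i| + 1.
have S0 : 0 <= \sum_i `|s 0 i| by exact: sumr_ge0.
have L0 : 0 < L by rewrite ltr_wpDl// addr_ge0// enorm_ge0.
apply/eqP; rewrite eq_le outer_measure_ge0 andbT.
apply/lee_addgt0Pr => e e0; rewrite add0e.
pose c := CV * L `^ d * L `^ (n%:R - d).
have c0 : 0 < c by rewrite !mulr_gt0 ?powR_gt0 ?CV_gt0.
have nd1 : 1 <= n%:R - d by rewrite lerBrDr -lerBrDl ltW.
pose k := Num.min 1 (e / c).
have k0 : 0 < k by rewrite lt_min ltr01 divr_gt0.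
have k1 : k <= 1 by rewrite ge_min lexx.
have kL : 0 < k * L <= L by rewrite mulr_gt0//= ger_pMl.
apply: (@le_trans _ _ (lebesgue_om R n (nbd x0 L (k * L)))).
  apply: le_outer_measure => z [Gz hz]; split; last by rewrite dist0// mulr_gt0.
  have h1 : enorm (z - a) <= \sum_i `|s 0 i|.
    apply: le_trans (enorm_le_sum _) _; apply: ler_sum => j _; have := hz j; rewrite !mxE => h.
    by rewrite ger0_norm; [rewrite -[leRHS]ger0_norm//; have := ler_norm (s 0 j); rewrite normr_id; lra|lra].
  by have := enorm_trans z a x0; rewrite /L; lra.
apply: le_trans (nbd_vol Gx0 kL) _; rewrite lee_fin powRM ?(ltW k0) ?(ltW L0)//.
have : k `^ (n%:R - d) <= k by rewrite -[leRHS]powRr1 ?(ltW k0)//; apply: ger_powR => //; rewrite k0.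
move=> h; apply: (@le_trans _ _ (c * k)).
  by rewrite [k `^ _ * _]mulrC mulrA ler_pM2l.
have : k <= e / c by rewrite ge_min lexx orbT.
by rewrite ler_pdivlMr// mulrC.
Qed.

Lemma lam_gt0 (s : E) : good s -> 0 < lam s.
Proof. by move=> gs; apply: lt_le_trans (le_lam (Ordinal n0) gs); exact: good_gt0. Qed.

Lemma box_enorm (a s x y : E) : box a s x -> box a s y -> enorm (x - y) <= lam s.
Proof.
move=> hx hy; apply: le_trans (enorm_le_sum _) _; apply: ler_sum => j _.
by have := hx j; have := hy j; rewrite !mxE ler_norml; lra.
Qed.

Lemma volb_lower (s : E) : good s -> (lam s / (2 * n%:R)) ^+ n <= volb s.
Proof.
move=> g; have nn : (0 < n%:R :> R) by rewrite ltr0n.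
rewrite -[n in _ ^+ n]card_ord -prodr_const; apply: ler_prod => j _.
rewrite divr_ge0 ?(ltW (lam_gt0 g)) ?mulr_ge0 ?ler0n//=.
rewrite ler_pdivrMr ?mulr_gt0//.
have -> : s 0 j * (2 * n%:R) = \sum_(i < n) (2 * s 0 j) by rewrite sumr_const card_ord -mulr_natr; ring.
by apply: ler_sum => i _; have [] := g i j.
Qed.

(** The first summand serves boxes far from Gamma, the second those near it. *)
Definition CA : R := 2 `^ a_ + Cm * 4 `^ (d + 1) * 2 `^ a_ * (2 * n%:R) ^+ n.

Lemma Cm_gt0 : 0 < Cm. Proof. by rewrite mulr_gt0// mulr_gt0 ?CV_gt0 ?powR_gt0. Qed.

Lemma CA_gt0 : 0 < CA.
Proof. by rewrite ltr_pwDl ?powR_gt0// mulr_ge0 ?exprn_ge0 ?mulr_ge0 ?ler0n// ?powR_ge0// ltW// Cm_gt0. Qed.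

Lemma weight_near (a s y : E) (k : R) : good s -> Gamma y -> 1 <= k -> (forall x, box a s x -> enorm (x - y) < k * lam s) ->
  Int (box a s) w <= Cm * k `^ (d + 1) * lam s `^ (d + 1).
Proof.
move=> g Gy k1 hb; have l0 := lam_gt0 g; have k0 : 0 < k by exact: lt_le_trans k1.
have kl : 0 < k * lam s by rewrite mulr_gt0.
have [i h] := weight_mass Gy kl.
apply: le_trans (_ : Int (nbd y (k * lam s) (k * lam s)) w <= _).
  apply: Int_subset i _ => //; [exact: msb_box|exact: nbd_msb| |by move=> *; exact: weight_ge0].
  by move=> x /hb hx; split=> //; exact: le_lt_trans (dist_le G0 _ Gy) hx.
by move: h; rewrite powRM ?(ltW k0) ?(ltW l0)// mulrA.
Qed.

Lemma lam_volb (s : E) : good s -> lam s `^ (d + 1) <= lam s `^ (- a_) * (2 * n%:R) ^+ n * volb s.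
Proof.
move=> g; have l0 := lam_gt0 g; have n1 : 0 < 2 * n%:R :> R by rewrite mulr_gt0 ?ltr0n.
have e : lam s `^ (d + 1) = lam s `^ (- a_) * (2 * n%:R) ^+ n * (lam s / (2 * n%:R)) ^+ n.
  rewrite -mulrA -exprMn [2 * _ * _]mulrC divfK ?gt_eqF// -powR_mulrn ?(ltW l0)//.
  by rewrite -powRD; [congr (_ `^ _); ring|apply/implyP => _; rewrite gt_eqF].
by rewrite [leLHS]e ler_wpM2l ?volb_lower// mulr_ge0 ?powR_ge0// exprn_ge0// ltW.
Qed.

(** If [delta z >= 2 lam], the weight on the box is at most [2^a w z]. Otherwise the mass of the box
    is at most [C lam^(d+1)], that is [C lam^(-a)] times the volume, and [lam^(-a) <= 2^a w z]
    because [delta z < 2 lam]. *)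
Lemma weight_A1 (a s z : E) : good s -> box a s z -> ~ Gamma z -> Int (box a s) w <= CA * w z * volb s.
Proof.
move=> g bz nG; have l0 := lam_gt0 g; have z0 := cthick nG.
have v0 := volb_gt0 g; have w0 := weight_ge0 z.
have n1 : 0 < 2 * n%:R :> R by rewrite mulr_gt0 ?ltr0n.
have [far|near] := leP (2 * lam s) (delta z).
  have z20 : 0 < delta z / 2 by rewrite divr_gt0.
  have bw x : box a s x -> w x <= 2 `^ a_ * w z.
    move=> bx; have -> : 2 `^ a_ * w z = (delta z / 2) `^ (- a_).
      by rewrite powR_div ?(ltW z0)// weightE !powRN invrK mulrC.
    apply: weight_anti => //; have := dist_lip G0 z x; have := box_enorm bz bx; lra.
  apply: (@le_trans _ _ (Int (box a s) (fun=> 2 `^ a_ * w z))).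
    apply: Int_le => //; [exact: msb_box|exact: weight_intg_box|].
    by apply: intg_cont_box; exact: cst_continuous.
  rewrite Int_cst ?vol_box//; last exact: msb_box.
  rewrite ler_wpM2r ?(ltW v0)// ler_wpM2r// /CA lerDl mulr_ge0 ?(exprn_ge0 _ (ltW n1))//.
  by rewrite !mulr_ge0 ?powR_ge0// ltW// Cm_gt0.
have [y Gy hy] := dist_lt G0 near.
have k1 : 1 <= 4 :> R by lra.
apply: le_trans (weight_near g Gy k1 _) _.
  by move=> x bx; have := enorm_trans x z y; have := box_enorm bx bz; lra.
apply: (@le_trans _ _ (Cm * 4 `^ (d + 1) * (lam s `^ (- a_) * (2 * n%:R) ^+ n * volb s))).
  by rewrite ler_wpM2l ?lam_volb// mulr_ge0 ?powR_ge0// ltW// Cm_gt0.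
have wz : lam s `^ (- a_) <= 2 `^ a_ * w z.
  have := weight_lower nG (ltW near); rewrite powRM ?(ltW l0)//.
  rewrite {1}powRN ler_pdivrMl ?powR_gt0//.
have N0 : 0 <= (2 * n%:R) ^+ n :> R by rewrite exprn_ge0// ltW.
rewrite /CA; move: ((2 * n%:R) ^+ n) N0 => N N0.
have -> : (2 `^ a_ + Cm * 4 `^ (d + 1) * 2 `^ a_ * N) * w z * volb s =
   2 `^ a_ * w z * volb s + Cm * 4 `^ (d + 1) * (2 `^ a_ * w z * N * volb s) by ring.
rewrite ler_wpDl ?mulr_ge0 ?powR_ge0 ?(ltW v0)//.
apply: ler_wpM2l; first by rewrite mulr_ge0 ?powR_ge0// ltW// Cm_gt0.
apply: ler_wpM2r; first exact: ltW.
by apply: ler_wpM2r.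
Qed.

Lemma msb_Gamma : msb Gamma. Proof. exact: measurable_closed. Qed.

Lemma Int_offGamma (a s : E) f : intg (box a s) f -> Int (box a s) f = Int (box a s `\` Gamma) f.
Proof.
move=> i; have mB := msb_box a s; have mG := msb_Gamma.
have e : box a s = (box a s `&` Gamma) `|` (box a s `\` Gamma) by rewrite setDE -setIUr setUCr setIT.
have m1 : msb (box a s `&` Gamma) by exact: measurableI.
have m2 : msb (box a s `\` Gamma) by exact: measurableD.
rewrite {1}e IntU//; last 2 first.
- by move=> x [_ h] [_ h'].
- by rewrite -e.
rewrite Int_null ?add0r//; first by rewrite setIC gamma_null.
by apply: intg_mfn; apply: intgS i => //; exact: subIsetl.
Qed.

(** By A_1 the weight is bounded below off the null set Gamma by its mean over the big box up to
    [CA]; integration over the small box compares masses with volumes, and contains doubling. *)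
Lemma weight_sub (a s a' s' : E) : good s -> good s' -> box a' s' `<=` box a s ->
  volb s' * Int (box a s) w <= CA * volb s * Int (box a' s') w.
Proof.
move=> g g' sub; have v0 := volb_gt0 g; have v0' := volb_gt0 g'; have cA := CA_gt0.
set m := Int (box a s) w; pose c := m / (CA * volb s).
have cv : 0 < CA * volb s by rewrite mulr_gt0.
have ic : intg (box a' s') (fun=> c).
  by apply: intg_cont_box; exact: cst_continuous.
have iw := weight_intg_box a' s'; have mD : msb (box a' s' `\` Gamma) by apply: measurableD; [exact: msb_box|exact: msb_Gamma].
have h : c * volb s' <= Int (box a' s') w.
  rewrite -(vol_box a' n0 g') -Int_cst; last exact: msb_box.
  rewrite !Int_offGamma//; apply: Int_le => //.
  - by apply: intgS ic => //; exact: msb_box.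
  - by apply: intgS iw => //; exact: msb_box.
  move=> x [bx nG]; rewrite /c ler_pdivrMr// mulrCA mulrA -/m.
  by have := weight_A1 g (sub _ bx) nG; rewrite -/m -mulrA mulrCA mulrA.
rewrite mulrC [leRHS]mulrC -ler_pdivrMr//; apply: le_trans h.
by rewrite /c mulrAC.
Qed.

End ahlfors.

(** * Poincare inequalities for functions vanishing on Gamma *)

Lemma CS_absorb (R : realFieldType) (I J K N e : R) : 0 <= K -> 0 <= I -> 0 <= e ->
  I <= K * (2 * J) -> J ^+ 2 <= I * (N ^+ 2 * e) -> I <= (2 * N * K) ^+ 2 * e.
Proof.
move=> K0 I0 e0 IJ cs; have [->|In] := eqVneq I 0; first by rewrite mulr_ge0 ?sqr_ge0.
have Ip : 0 < I by rewrite lt_def In.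
rewrite -(ler_pM2l Ip) -expr2; apply: (@le_trans _ _ ((K * (2 * J)) ^+ 2)).
  by rewrite ler_sqr ?nnegrE//; exact: le_trans IJ.
have -> : (K * (2 * J)) ^+ 2 = 4 * K ^+ 2 * J ^+ 2 by ring.
have -> : I * ((2 * N * K) ^+ 2 * e) = 4 * K ^+ 2 * (I * (N ^+ 2 * e)) by ring.
by rewrite ler_wpM2l// mulr_ge0 ?sqr_ge0.
Qed.

Lemma abs_le_shift (R : realDomainType) (x y e : R) : `|y - x| <= e -> `|x| <= `|y| + e.
Proof. by have := ler_distD y x 0; rewrite !subr0 (distrC x) => h1 h2; lra. Qed.

Section trace.
Context {R : realType} {n : nat}.
Variables (d C0 : R) (Gamma : set 'rV[R]_n).
Local Notation E := 'rV[R]_n.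
Local Notation e_ i := (delta_mx 0 i : E).
Implicit Types (x y z a s : E).
Local Notation hs := (hausdorff_om n d).
Local Notation delta := (dist_to Gamma).
Local Notation a_ := (n%:R - 1 - d).
Local Notation w := (weight Gamma d).
Local Notation q := (q_ (R := R) (n := n)).
Hypotheses (n0 : (0 < n)%N) (d0 : 0 < d) (dn : d < n%:R - 1) (C01 : 1 <= C0)
  (G0 : Gamma !=set0) (cG : closed Gamma) (AR : ahlfors_regular Gamma d C0).

Lemma intg_sum (I : Type) (r : seq I) (D : set E) (f : I -> E -> R) : msb D ->
  (forall i, intg D (f i)) -> intg D (fun x => \sum_(i <- r) f i x).
Proof.
move=> mD fi; elim: r => [|i r IH].
  by apply: (@intg_eq _ _ _ (fun=> 0)) (intg0 _) => // x _; rewrite big_nil.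
by apply: (@intg_eq _ _ _ (fun x => f i x + \sum_(j <- r) f j x)) (intgD _ _ _) => // x _; rewrite big_cons.
Qed.

Definition sg a s : R := fine (hs (Gamma `&` box a s)).

Lemma sg_fin a s y : good s -> Gamma y -> box a s y -> (hs (Gamma `&` box a s) <= (C0 * (2 * lam s) `^ d)%:E)%E.
Proof.
move=> g Gy by_; have l0 := lam_gt0 n0 g.
have l20 : 0 < 2 * lam s by rewrite mulr_gt0.
apply: le_trans (ar_hi AR Gy l20); apply: le_outer_measure => x [Gx bx]; split=> //.
by rewrite /eball/=; have := box_enorm bx by_; lra.
Qed.

Lemma sg_ge0 a s : 0 <= sg a s.
Proof. by rewrite fine_ge0// outer_measure_ge0. Qed.

Lemma sg_nil a s : ~ (exists2 y, Gamma y & box a s y) -> sg a s = 0.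
Proof.
move=> h; rewrite /sg (_ : _ `&` _ = set0) ?outer_measure0//.
by apply/seteqP; split=> x // [Gx bx]; apply: h; exists x.
Qed.

Lemma sg_le a s a' s' y : good s -> Gamma y -> box a s y -> box a' s' `<=` box a s -> sg a' s' <= C0 * (2 * lam s) `^ d.
Proof.
move=> g Gy by_ sub; have h := sg_fin g Gy by_.
have h' : (hs (Gamma `&` box a' s') <= (C0 * (2 * lam s) `^ d)%:E)%E.
  by apply: le_trans h; apply: le_outer_measure => x [Gx /sub].
by rewrite -lee_fin fineK// ge0_fin_numE ?outer_measure_ge0// (le_lt_trans h')// ltry.
Qed.

Lemma sg_halve a s i y : good s -> Gamma y -> box a s y ->
  sg a s <= sg a (halve s i) + sg (a + (s 0 i / 2) *: e_ i) (halve s i).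
Proof.
move=> g Gy by_; have h := sg_fin g Gy by_.
have f a' s' : box a' s' `<=` box a s -> hs (Gamma `&` box a' s') \is a fin_num.
  move=> sub; rewrite ge0_fin_numE ?outer_measure_ge0//; apply: le_lt_trans (ltry (C0 * (2 * lam s) `^ d)).
  by apply: le_trans h; apply: le_outer_measure => x [Gx /sub].
have f0 := f a s (fun x h => h).
have f1 := f _ _ (@sub_halve1 _ _ a s i g).
have f2 := f _ _ (@sub_halve2 _ _ a s i g).
rewrite -lee_fin EFinD !fineK//; apply: le_trans (outer_measureU2 _ _ _).
by apply: le_outer_measure => x [Gx]; rewrite (box_halve a i g) => -[] bx; [left|right].
Qed.

Definition qa : R := q `^ (- a_).
(** Chosen so that [CT2 * (qa - 1)] is the constant in the error of one bisection; see [key] in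
    [trace_rec]. The factor [qa] in [CT] is what a half box that misses Gamma requires. *)
Definition CT2 : R := C0 * 2 `^ d * (2 * n%:R) ^+ n / (qa - 1).
Definition CT : R := CT2 * qa.

Lemma q_gt0 : 0 < q.
Proof.
rewrite /q_ subr_gt0 invf_lt1 ?mulr_gt0 ?ltr0n//.
have : 1 <= n%:R :> R by rewrite ler1n.
lra.
Qed.

Lemma q_lt1 : q < 1.
Proof. by rewrite /q_ gtrBl invr_gt0 mulr_gt0// ltr0n. Qed.

Let a0 : 0 < a_. Proof. by rewrite subr_gt0. Qed.

Lemma qa_gt1 : 1 < qa.
Proof.
rewrite /qa powRN invf_gt1 ?powR_gt0 ?q_gt0//.
have := @gt0_ltr_powR R a_ a0 q 1; rewrite powR1; apply; rewrite ?in_itv/= ?nnegrE ?(ltW q_gt0)//; exact: q_lt1.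
Qed.

Lemma CT2_ge0 : 0 <= CT2.
Proof.
rewrite /CT2 divr_ge0// ?subr_ge0 ?(ltW qa_gt1)// mulr_ge0 ?exprn_ge0 ?mulr_ge0 ?ler0n ?powR_ge0//.
exact: le_trans C01.
Qed.

(** * Averages controlled through the Hausdorff measure of Gamma *)

Section fixed_function.
Variables (O : set E) (u : E -> R) (g : E -> E).
Hypotheses (oO : open O) (cu : continuous u) (wg : weak_gradient O u g)
  (gG : forall x, Gamma x -> g x = 0)
  (igw : forall a s, cbox a s `<=` O -> intg (box a s) (fun x => gs g x * w x)).

Local Notation D_ a s := (Int (box a s) (fun x => gs g x * w x)).
Local Notation I_ a s := (Int (box a s) (gs g)).

Lemma gs_offGamma z : gs g z != 0 -> ~ Gamma z.
Proof. by move=> h /gG gz; move/eqP: h; apply; rewrite /gs big1// => i _; rewrite gz mxE normr0. Qed.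

Lemma intg_gs a s : cbox a s `<=` O -> intg (box a s) (gs g).
Proof.
move=> sO; apply: intg_sum; first exact: msb_box.
by move=> i; apply: intg_abs; exact: (intg_g_box wg).
Qed.

Lemma near_DI a s a' s' y : good s -> cbox a' s' `<=` O -> box a' s' `<=` box a s -> Gamma y -> box a s y ->
  lam s `^ (- a_) * I_ a' s' <= D_ a' s'.
Proof.
move=> gd sO sub Gy by_; have ii := intg_gs sO.
rewrite -IntZ//; last exact: msb_box.
apply: Int_le; [exact: msb_box|apply: intgZ => //; exact: msb_box|exact: igw|].
move=> x /sub bx; have [->|h] := eqVneq (gs g x) 0; first by rewrite mulr0 mul0r.
rewrite mulrC ler_wpM2l ?gs_ge0//; apply: weight_lower => //; first exact: gs_offGamma.
exact: le_trans (dist_le G0 _ Gy) (box_enorm bx by_).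
Qed.

(** Each bisection changes the average by about [lam / volume] times the integral of the gradient,
    and these errors have to be summed over all scales. The negative term is the reserve that pays:
    near Gamma the weight is at least [lam^(-a)], and this power grows by the factor [qa > 1] or
    more when the box is halved. *)
Lemma trace_rec (d1 : R) (C : set E) : C `<=` O -> (forall x, C x -> delta x < d1 -> u x = 0) ->
  forall J a s, good s -> cbox a s `<=` C -> lam s * q ^+ J < d1 -> (exists2 y, Gamma y & box a s y) ->
  sg a s * `|avg u a s| <= CT * D_ a s - CT2 * lam s `^ (- a_) * I_ a s.
Proof.
move=> CO uz; elim => [|J IH] a s gd sC.
  rewrite expr0 mulr1 => ls [y Gy by_].
  have -> : avg u a s = 0.
    rewrite /avg (@Int_eq _ _ _ _ (fun=> 0)); last first.
      move=> x bx; apply: uz; first exact/sC/box_cbox.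
      exact: le_lt_trans (dist_le G0 _ Gy) (le_lt_trans (box_enorm bx by_) ls).
    by rewrite Int_cst ?mul0r//; exact: msb_box.
  have h := near_DI gd (subset_trans sC CO) (fun x h => h) Gy by_.
  have Dge : 0 <= D_ a s by apply: Int_ge0 => x _; rewrite mulr_ge0 ?gs_ge0 ?weight_ge0.
  rewrite normr0 mulr0 subr_ge0 /CT -!(mulrA CT2); apply: ler_wpM2l; first exact: CT2_ge0.
  apply: le_trans h _.
  by rewrite ler_peMl// ltW// qa_gt1.
move=> ls [y Gy by_]; have l0 := lam_gt0 n0 gd.
have [i imax] := exists_max_side s n0.
have gi := halve_good gd imax; have lq := lam_halve_le n0 imax.
have sO := subset_trans sC CO.
have cb1 := @cbox_halve1 _ _ a s i gd; have cb2 := @cbox_halve2 _ _ a s i gd.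
have sb1 := @sub_halve1 _ _ a s i gd; have sb2 := @sub_halve2 _ _ a s i gd.
set s' := halve s i in gi lq cb1 cb2 sb1 sb2 *; set a2 := a + (s 0 i / 2) *: e_ i in cb2 sb2 *.
have li0 := lam_gt0 n0 gi.
have lJ : lam s' * q ^+ J < d1.
  apply: le_lt_trans ls; rewrite exprS mulrA [lam s * q]mulrC; apply: ler_wpM2r lq.
  by apply: exprn_ge0; exact/ltW/q_gt0.
pose L := lam s `^ (- a_).
have L0 : 0 <= L by exact: powR_ge0.
have child a' : cbox a' s' `<=` cbox a s -> box a' s' `<=` box a s ->
    sg a' s' * `|avg u a' s'| <= CT * D_ a' s' - CT2 * qa * L * I_ a' s'.
  move=> cb sb; have cbC := subset_trans cb sC.
  have Ige : 0 <= I_ a' s' by apply: Int_ge0 => x _; exact: gs_ge0.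
  have [ex|nex] := pselect (exists2 y, Gamma y & box a' s' y).
    apply: le_trans (IH a' s' gi cbC lJ ex) _; rewrite lerD2l lerN2.
    rewrite ler_wpM2r// -(mulrA CT2); apply: ler_wpM2l; first exact: CT2_ge0.
    rewrite /qa /L -powRM ?(ltW q_gt0) ?(ltW l0)//.
    rewrite !powRN lef_pV2 ?posrE ?powR_gt0 ?mulr_gt0 ?q_gt0//.
    by apply: ge0_ler_powR; rewrite ?nnegrE; [exact: ltW a0|exact: ltW|rewrite ltW// mulr_gt0// q_gt0|].
  (* A half that misses Gamma contributes no Hausdorff mass; its right-hand side is nonnegative by
     [near_DI], as Gamma is still within [lam s]. *)
  rewrite sg_nil// mul0r subr_ge0 /CT -!(mulrA CT2); apply: ler_wpM2l; first exact: CT2_ge0.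
  rewrite -mulrA; apply: ler_wpM2l; first by rewrite ltW// (lt_trans ltr01 qa_gt1).
  exact: near_DI (subset_trans cbC CO) sb Gy by_.
have c1 := child _ cb1 sb1; have c2 := child _ cb2 sb2.
have m1 := mean_half1 n0 oO cu wg i gd sO.
have m2 := mean_half2 n0 oO cu wg i gd sO.
have i12 f : intg (box a s) f -> Int (box a s) f = Int (box a s') f + Int (box a2 s') f by exact: Int_halve.
have eD := i12 _ (igw sO); have eI := i12 _ (intg_gs sO).
have gI : Int (box a s) (fun x => `|g x 0 i|) <= I_ a s.
  apply: Int_le; [exact: msb_box|apply: intg_abs; exact: (intg_g_box wg)|exact: intg_gs|].
  by move=> x _; exact: le_gs.
have v0 := volb_gt0 gd; have si0 := good_gt0 gd i.
pose e := lam s / (2 * volb s) * I_ a s.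
have Ige : 0 <= I_ a s by apply: Int_ge0 => x _; exact: gs_ge0.
have me (m : R) : m <= s 0 i / 2 / volb s * Int (box a s) (fun x => `|g x 0 i|) -> m <= e.
  move=> h; apply: le_trans h _; apply: ler_pM => //.
  - by rewrite !divr_ge0// ltW.
  - by apply: Int_ge0 => x _.
  - by rewrite -mulrA -invfM ler_wpM2r ?invr_ge0 ?mulr_ge0 ?(ltW v0)// le_lam.
have s12 := sg_halve i gd Gy by_.
have s1le := sg_le gd Gy by_ sb1; have s2le := sg_le gd Gy by_ sb2.
have e0 : 0 <= e by rewrite mulr_ge0// divr_ge0 ?mulr_ge0 ?(ltW l0) ?(ltW v0).
(* The change [e] of the average, times the Hausdorff mass of both halves, is at most the increment
   [CT2 * (qa - 1) * L * I] of the reserve. *)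
have key : C0 * (2 * lam s) `^ d * e * 2 <= C0 * 2 `^ d * (2 * n%:R) ^+ n * L * I_ a s.
  have lv := lam_volb d n0 gd; rewrite /e powRM ?(ltW l0)//.
  have e1 : lam s `^ (d + 1) = lam s `^ d * lam s.
    by rewrite powRD ?powRr1 ?(ltW l0)//; apply/implyP => _; rewrite gt_eqF.
  have -> : C0 * (2 `^ d * lam s `^ d) * (lam s / (2 * volb s) * I_ a s) * 2 =
     C0 * 2 `^ d * (lam s `^ (d + 1) / volb s) * I_ a s by rewrite e1; field; rewrite gt_eqF.
  rewrite ler_wpM2r// -[leRHS]mulrA ler_wpM2l ?mulr_ge0 ?powR_ge0 ?(le_trans ler01 C01)//.
  rewrite ler_pdivrMr//; apply: le_trans lv _; rewrite /L le_eqVlt; apply/orP; left; apply/eqP; ring.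
have K : CT2 * (qa - 1) = C0 * 2 `^ d * (2 * n%:R) ^+ n.
  by rewrite /CT2 divfK// subr_eq0 gt_eqF// qa_gt1.
have m1' := me _ m1; have m2' := me _ m2.
have t1 : `|avg u a s| <= `|avg u a s'| + e.
  exact: abs_le_shift m1'.
have t2 : `|avg u a s| <= `|avg u a2 s'| + e.
  exact: abs_le_shift m2'.
have g1 := ler_wpM2l (sg_ge0 a s') t1; have g2 := ler_wpM2l (sg_ge0 a2 s') t2.
have g3 := ler_wpM2r (normr_ge0 (avg u a s)) s12.
have g4 := ler_wpM2r e0 s1le; have g5 := ler_wpM2r e0 s2le.
move: key; rewrite -K => key; rewrite eD eI -/L; rewrite -/s' -/a2 eI in g3 key *.
move: c1 c2 g1 g2 g3 g4 g5 key; clear.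
move: (sg a s) (sg a s') (sg a2 s') (`|avg u a s|) (`|avg u a s'|) (`|avg u a2 s'|) => S S1 S2 A A1 A2.
move: (D_ a s') (D_ a2 s') (I_ a s') (I_ a2 s') (C0 * _) => D1 D2 I1 I2 M.
by move: L CT CT2 qa e => L T T2 qa e; lra.
Qed.

Lemma A1_gsw a s z : good s -> cbox a s `<=` O -> box a s z -> gs g z != 0 ->
  Int (box a s) w <= @CA R n d C0 * w z * volb s.
Proof. by move=> gd _ bz /gs_offGamma nG; apply: weight_A1. Qed.

Let CA0 : 0 <= @CA R n d C0. Proof. by apply/ltW/CA_gt0. Qed.
Let w0 x : 0 <= w x. Proof. exact: weight_ge0. Qed.
Let iw a s : intg (box a s) w. Proof. exact: (weight_intg_box n0 d0 dn C01 G0 cG AR). Qed.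

Definition poincareW := poincare n0 oO cu wg w0 CA0 iw A1_gsw igw.
Definition poincareW_zero := poincare_zero n0 oO cu wg w0 CA0 iw A1_gsw igw.
Definition faber_krahnW := faber_krahn n0 oO cu wg w0 CA0 iw A1_gsw igw.

Definition KT (c : R) : R := 2 * n%:R * @CA R n d C0 + CT * (@Cm R n d C0 * 2 `^ (d + 1)) / c.

(** [trace_rec] bounds the average because [sg] is at least [c lam^d], the Poincare inequality
    bounds the deviation from it, and the box has mass at most a constant times [lam^(d+1)]. *)
Lemma trace_poincare (d1 c : R) a s : good s -> cbox a s `<=` O -> 0 < d1 ->
  (forall x, cbox a s x -> delta x < d1 -> u x = 0) -> 0 < c -> c * lam s `^ d <= sg a s ->
  Int (box a s) (fun x => `|u x| * w x) <= KT c * lam s * D_ a s.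
Proof.
move=> gd sO d10 uz c0 cs; have l0 := lam_gt0 n0 gd; have ld : 0 < lam s `^ d by rewrite powR_gt0.
have sp : 0 < sg a s by apply: lt_le_trans cs; rewrite mulr_gt0.
have [y Gy by_] : exists2 y, Gamma y & box a s y by apply: contrapT => /sg_nil h; move: sp; rewrite h ltxx.
have [J hJ] := exists_q_pow n0 (lam s) d10.
have h1 := trace_rec sO uz gd (fun x h => h) hJ (ex_intro2 _ _ y Gy by_).
have Dge : 0 <= D_ a s by apply: Int_ge0 => x _; rewrite mulr_ge0 ?gs_ge0.
have Ige : 0 <= I_ a s by apply: Int_ge0 => x _; exact: gs_ge0.
have h2 : c * lam s `^ d * `|avg u a s| <= CT * D_ a s.
  apply: (@le_trans _ _ (sg a s * `|avg u a s|)); first by rewrite ler_wpM2r.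
  by apply: le_trans h1 _; rewrite gerBl; apply: mulr_ge0 => //; apply: mulr_ge0; [exact: CT2_ge0|exact: powR_ge0].
have h3 := poincareW gd sO.
have k2 : 1 <= 2 :> R by lra.
have h4 := weight_near n0 d0 dn C01 G0 cG AR gd Gy k2.
have {}h4 : Int (box a s) w <= @Cm R n d C0 * 2 `^ (d + 1) * (lam s `^ d * lam s).
  have -> : lam s `^ d * lam s = lam s `^ (d + 1).
    by rewrite powRD ?powRr1 ?(ltW l0)//; apply/implyP => _; rewrite gt_eqF.
  by apply: h4 => x bx; have := box_enorm bx by_; lra.
have cua : continuous (fun x => `|u x - avg u a s|).
  by apply: cont_norm; apply: contB => //; exact: cst_continuous.
have i1 : intg (box a s) (fun x => `|u x - avg u a s| * w x) by exact: intg_contw.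
have i2 : intg (box a s) (fun x => `|avg u a s| * w x) by apply: intgZ => //; exact: msb_box.
have i3 : intg (box a s) (fun x => `|u x| * w x) by apply: intg_contw => //; exact: cont_norm.
have h5 : Int (box a s) (fun x => `|u x| * w x) <=
    Int (box a s) (fun x => `|u x - avg u a s| * w x) + `|avg u a s| * Int (box a s) w.
  rewrite -IntZ//; last exact: msb_box.
  rewrite -IntD//; last exact: msb_box.
  apply: Int_le => //; [exact: msb_box|apply: intgD => //; exact: msb_box|].
  move=> x _; rewrite -mulrDl ler_wpM2r//; have := ler_normD (u x - avg u a s) (avg u a s); rewrite subrK; lra.
apply: le_trans h5 _; rewrite /KT mulrDl [_ * D_ a s]mulrDl; apply: lerD => //.
apply: le_trans (ler_wpM2l (normr_ge0 _) h4) _.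
have -> : CT * (@Cm R n d C0 * 2 `^ (d + 1)) / c * lam s * D_ a s =
   (CT * D_ a s) * (@Cm R n d C0 * 2 `^ (d + 1) * lam s / c) by ring.
have -> : `|avg u a s| * (@Cm R n d C0 * 2 `^ (d + 1) * (lam s `^ d * lam s)) =
   c * lam s `^ d * `|avg u a s| * (@Cm R n d C0 * 2 `^ (d + 1) * lam s / c) by field; rewrite gt_eqF.
have Cm0 : 0 < @Cm R n d C0 by exact: Cm_gt0.
apply: ler_wpM2r h2; apply: divr_ge0; last exact: ltW.
by apply: mulr_ge0; [apply: mulr_ge0; [exact: ltW|exact: powR_ge0]|exact: ltW].
Qed.

End fixed_function.

(** * From L^1 inequalities for the square to L^2 inequalities *)

Section square.
Variables (O : set E) (f : E -> R) (g : E -> E).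
Hypotheses (oO : open O) (cf : continuous f) (wg : weak_gradient O f g)
  (gG : forall x, Gamma x -> g x = 0)
  (ie : forall a s, cbox a s `<=` O -> intg (box a s) (fun x => enorm (g x) ^+ 2 * w x)).

Local Notation g2 := (fun x => (2 * f x) *: g x).
Local Notation En a s := (Int (box a s) (fun x => enorm (g x) ^+ 2 * w x)).

Lemma wg_sq : weak_gradient O (fun x => f x ^+ 2) g2.
Proof.
apply: (wg_comp (F := fun t => t ^+ 2) (F' := fun t => 2 * t)) => //.
  move=> t; apply: is_derive_eq; rewrite /GRing.scale/=; ring.
by move=> t; apply: (@continuousM R R (fun=> 2) id); [exact: cst_continuous|].
Qed.

Lemma gs_sq x : gs g2 x = 2 * `|f x| * gs g x.
Proof.
rewrite /gs mulr_sumr; apply: eq_bigr => i _.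
by rewrite mxE !normrM ger0_norm.
Qed.

Lemma gs_enorm x : gs g x <= n%:R * enorm (g x).
Proof.
rewrite mulr_natl -[n in _ *+ n]card_ord -sumr_const; apply: ler_sum => i _; exact: coord_le_enorm.
Qed.

Lemma mfn_gs a s : cbox a s `<=` O -> mfn (box a s) (gs g).
Proof. by move=> sO; apply: intg_mfn; exact: (intg_gs wg). Qed.

Let w0 x : 0 <= w x. Proof. exact: weight_ge0. Qed.
Let iw a s : intg (box a s) w. Proof. exact: (weight_intg_box n0 d0 dn C01 G0 cG AR). Qed.

Lemma igw_sq a s : cbox a s `<=` O -> intg (box a s) (fun x => gs g2 x * w x).
Proof.
move=> sO; have mB := msb_box a s; have [M M0 hM] := cont_bounded cf (@compact_cbox R n a s).
apply: (@intg_le _ _ _ _ (fun x => (M * n%:R) * (enorm (g x) ^+ 2 * w x + w x))) => //.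
- apply: mfnM; last exact: weight_mfn.
  apply: (@mfn_eq _ _ _ (fun x => 2 * `|f x| * gs g x)); first by move=> x _; rewrite gs_sq.
  apply: mfnM; last exact: mfn_gs.
  by apply: mfnM; [exact: mfn_cst|apply: mfn_abs; exact: mfn_cont].
- by apply: intgZ => //; apply: intgD => //; exact: ie.
move=> x bx; rewrite gs_sq ger0_norm ?mulr_ge0 ?gs_ge0//.
have := hM _ (box_cbox bx); have := gs_enorm x; have := enorm_ge0 (g x).
move: (enorm _) (gs g x) (gs_ge0 g x) (normr_ge0 (f x)) => e G Ge fe e0 Gle fM.
rewrite (_ : e ^+ 2 * w x + w x = (e ^+ 2 + 1) * w x); last ring.
rewrite mulrA ler_wpM2r//.
have h : 2 * e <= e ^+ 2 + 1 by have := sqr_ge0 (e - 1); lra.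
apply: (@le_trans _ _ (2 * M * (n%:R * e))).
  have : 2 * `|f x| <= 2 * M by lra.
  by move=> h2; apply: ler_pM => //; rewrite mulr_ge0.
have : M * n%:R * (2 * e) <= M * n%:R * (e ^+ 2 + 1) by rewrite ler_wpM2l// mulr_ge0// ltW.
lra.
Qed.

(** The gradient of [f^2] is [2 f] times that of [f]; by Cauchy-Schwarz the right-hand side contains
    the square root of the left one, which is divided out. *)
Lemma L2_of_L1 a s (K : R) : cbox a s `<=` O -> 0 <= K ->
  Int (box a s) (fun x => `|f x ^+ 2| * w x) <= K * Int (box a s) (fun x => gs g2 x * w x) ->
  Int (box a s) (fun x => f x ^+ 2 * w x) <= (2 * n%:R * K) ^+ 2 * En a s.
Proof.
move=> sO K0; have mB := msb_box a s.
rewrite (@Int_eq _ _ _ _ (fun x => f x ^+ 2 * w x)); last by move=> x _; rewrite ger0_norm ?sqr_ge0.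
set I := Int _ (fun x => f x ^+ 2 * w x); set J := Int _ _ => IJ.
have mw : mfn (box a s) (fun x => Num.sqrt (w x)).
  apply: (@mfn_comp _ _ _ (fun t => Num.sqrt t) w); last exact: weight_mfn.
  by apply: continuous_measurable_fun; exact: sqrt_continuous.
have mf : mfn (box a s) (fun x => `|f x| * Num.sqrt (w x)).
  by apply: mfnM => //; apply: mfn_abs; exact: mfn_cont.
have mg : mfn (box a s) (fun x => gs g x * Num.sqrt (w x)) by apply: mfnM => //; exact: mfn_gs.
have sw x : Num.sqrt (w x) ^+ 2 = w x by rewrite sqr_sqrtr.
have i1 : intg (box a s) (fun x => (`|f x| * Num.sqrt (w x)) ^+ 2).
  apply: (@intg_eq _ _ _ (fun x => f x ^+ 2 * w x)) => //.
    by move=> x _; rewrite exprMn sw real_normK ?num_real.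
  apply: (intg_contw iw); exact: (contM cf cf).
have ig2 : intg (box a s) (fun x => n%:R ^+ 2 * (enorm (g x) ^+ 2 * w x)) by apply: intgZ => //; exact: ie.
have gle x : (gs g x * Num.sqrt (w x)) ^+ 2 <= n%:R ^+ 2 * (enorm (g x) ^+ 2 * w x).
  rewrite exprMn sw mulrA ler_wpM2r// -exprMn ler_sqr ?nnegrE ?gs_ge0 ?mulr_ge0 ?enorm_ge0//.
  exact: gs_enorm.
have i2 : intg (box a s) (fun x => (gs g x * Num.sqrt (w x)) ^+ 2).
  by apply: (intg_le mB (mfnX 2 mg) ig2) => x _; rewrite ger0_norm ?sqr_ge0.
have [_ cs] := Int_CS mB mf mg i1 i2.
have eJ : J = 2 * Int (box a s) (fun x => `|f x| * Num.sqrt (w x) * (gs g x * Num.sqrt (w x))).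
  have [ic _] := Int_CS mB mf mg i1 i2.
  rewrite -IntZ//; apply: Int_eq => x _; rewrite gs_sq -{1}(sw x); ring.
have e1 : Int (box a s) (fun x => (`|f x| * Num.sqrt (w x)) ^+ 2) = I.
  by apply: Int_eq => x _; rewrite exprMn sw real_normK ?num_real.
have e2 : Int (box a s) (fun x => (gs g x * Num.sqrt (w x)) ^+ 2) <= n%:R ^+ 2 * En a s.
  by rewrite -IntZ//; [apply: Int_le|exact: ie].
have I0 : 0 <= I by apply: Int_ge0 => x _; rewrite mulr_ge0 ?sqr_ge0.
rewrite e1 in cs; have cs' := le_trans cs (ler_wpM2l I0 e2).
have E0 : 0 <= En a s by apply: Int_ge0 => x _; rewrite mulr_ge0 ?sqr_ge0.
by apply: (CS_absorb K0 I0 E0 _ cs'); rewrite -eJ.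
Qed.

Let g2G x : Gamma x -> g2 x = 0.
Proof. by move=> /gG ->; rewrite scaler0. Qed.

Let cf2 : continuous (fun x => f x ^+ 2). Proof. exact: (contM cf cf). Qed.

Let CA0 : 0 <= @CA R n d C0. Proof. by apply/ltW/CA_gt0. Qed.

Lemma poincare2_zero (nu : R) (Z : set E) a s : good s -> cbox a s `<=` O -> 0 < nu ->
  msb Z -> Z `<=` box a s -> (forall x, Z x -> f x = 0) -> nu * Int (box a s) w <= Int Z w ->
  Int (box a s) (fun x => f x ^+ 2 * w x) <=
    (2 * n%:R * ((1 + nu^-1) * (2 * n%:R * @CA R n d C0) * lam s)) ^+ 2 * En a s.
Proof.
move=> gd sO nu0 mZ Zs fZ hZ; have l0 := lam_gt0 n0 gd; apply: L2_of_L1 => //.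
  apply: mulr_ge0; last exact: ltW.
  apply: mulr_ge0; first by rewrite addr_ge0 ?invr_ge0 ?(ltW nu0).
  by apply: mulr_ge0 => //; rewrite mulr_ge0.
apply: (poincareW_zero oO cf2 wg_sq g2G igw_sq gd sO nu0 mZ Zs _ hZ) => x /fZ ->; by rewrite expr0n.
Qed.

Lemma KT_ge0 (c : R) : 0 < c -> 0 <= KT c.
Proof.
move=> c0; have Cm0 : 0 < @Cm R n d C0 by exact: Cm_gt0.
apply: addr_ge0; first by apply: mulr_ge0 => //; rewrite mulr_ge0.
apply: mulr_ge0; last by rewrite invr_ge0 ltW.
apply: mulr_ge0; last by apply: mulr_ge0; [exact: ltW|exact: powR_ge0].
by apply: mulr_ge0; [exact: CT2_ge0|exact: ltW (lt_trans ltr01 qa_gt1)].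
Qed.

Lemma poincare2_trace (d1 c : R) a s : good s -> cbox a s `<=` O -> 0 < d1 ->
  (forall x, cbox a s x -> delta x < d1 -> f x = 0) -> 0 < c -> c * lam s `^ d <= sg a s ->
  Int (box a s) (fun x => f x ^+ 2 * w x) <= (2 * n%:R * (KT c * lam s)) ^+ 2 * En a s.
Proof.
move=> gd sO d10 fz c0 cs; have l0 := lam_gt0 n0 gd; apply: L2_of_L1 => //.
  by rewrite mulr_ge0 ?(ltW l0) ?KT_ge0.
apply: (trace_poincare oO cf2 wg_sq g2G igw_sq gd sO d10 _ c0 cs) => x cx dx; by rewrite fz// expr0n.
Qed.

Lemma faber_krahn2 (Z : set E) N a s : msb Z -> (forall x, Z x -> f x = 0) -> good s -> cbox a s `<=` O ->
  (forall a' s', good s' -> box a' s' `<=` box a s -> volb s' = volb s / 2 ^+ N ->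
     2^-1 * Int (box a' s') w <= Int (box a' s' `&` Z) w) ->
  Int (box a s) (fun x => f x ^+ 2 * w x) <=
    (2 * n%:R * (3 * (2 * n%:R * @CA R n d C0) * (lam s * q ^+ N))) ^+ 2 * En a s.
Proof.
move=> mZ fZ gd sO h; have l0 := lam_gt0 n0 gd; apply: L2_of_L1 => //.
  have Q0 := ltW q_gt0.
  apply: mulr_ge0; last by rewrite mulr_ge0 ?exprn_ge0// ltW.
  by apply: mulr_ge0 => //; apply: mulr_ge0 => //; rewrite mulr_ge0.
apply: (faber_krahnW oO cf2 wg_sq g2G igw_sq mZ _ gd sO h) => x /fZ ->; by rewrite expr0n.
Qed.

End square.
End trace.

(** * Truncations and logarithms *)

Section glue.
Context {R : realType}.
Implicit Types (F f : R -> R) (s t c k : R).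

Lemma is_derive_glue F1 F2 f1 f2 c : (forall s, s <= c -> is_derive s 1 F1 (f1 s)) ->
  (forall s, c <= s -> is_derive s 1 F2 (f2 s)) -> F1 c = F2 c -> f1 c = f2 c ->
  forall s, is_derive s 1 (fun t => if t <= c then F1 t else F2 t) (if s <= c then f1 s else f2 s).
Proof.
move=> d1 d2 e1 e2 s; have [sc|cs|->] := ltgtP s c.
- have e : \forall t \near s, F1 t = (if t <= c then F1 t else F2 t).
    by near=> t; rewrite ifT// ltW//; near: t; exact: lt_nbhsl.
  by apply: (near_eq_is_derive e); apply: d1; exact: ltW.
- have e : \forall t \near s, F2 t = (if t <= c then F1 t else F2 t).
    by near=> t; rewrite ifF//; apply/negbTE; rewrite -ltNge; near: t; exact: lt_nbhsr.
  by apply: (near_eq_is_derive e); apply: d2; exact: ltW.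
have [x1 y1] := d1 c (lexx c); have [x2 y2] := d2 c (lexx c).
set F := fun t => _.
have Fc : F c = F1 c by rewrite /F lexx.
have cv : h^-1 *: ((F \o shift c) (h *: (1:R)) - F c) @[h --> (0:R)^'] --> f1 c.
  have /cvgrPdist_le c1 : h^-1 *: ((F1 \o shift c) (h *: (1:R)) - F1 c) @[h --> (0:R)^'] --> f1 c by rewrite -y1; exact: x1.
  have /cvgrPdist_le c2 : h^-1 *: ((F2 \o shift c) (h *: (1:R)) - F2 c) @[h --> (0:R)^'] --> f1 c by rewrite e2 -y2; exact: x2.
  apply/cvgrPdist_le => e e0; near=> h; rewrite Fc.
  have [hc|hc] := leP (h *: (1:R) + c) c.
    have -> : (F \o shift c) (h *: (1:R)) = (F1 \o shift c) (h *: (1:R)) by rewrite /F/= hc.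
    by near: h; exact: c1.
  have -> : (F \o shift c) (h *: (1:R)) = (F2 \o shift c) (h *: (1:R)) by rewrite /F/= leNgt hc.
  by rewrite e1; near: h; exact: c2.
by split; [apply/cvg_ex; exists (f1 c)|exact: (cvg_lim _ cv)].
Unshelve. all: by end_near.
Qed.

Definition pos t : R := Num.max t 0.

Lemma pos_ge0 t : 0 <= pos t. Proof. by rewrite le_max lexx orbT. Qed.
Lemma pos_le0 t : t <= 0 -> pos t = 0. Proof. by move=> h; rewrite /pos max_r. Qed.
Lemma pos_gt0 t : 0 <= t -> pos t = t. Proof. by move=> h; rewrite /pos max_l. Qed.
Lemma le_pos t : t <= pos t. Proof. by rewrite le_max lexx. Qed.
Lemma pos_mono s t : s <= t -> pos s <= pos t.
Proof. by move=> h; rewrite ge_max !le_max h/= lexx orbT. Qed.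

Lemma max_cont c : continuous (fun t => Num.max t c).
Proof.
move=> t; apply/cvgrPdist_lt => e e0; near=> s.
have h : `|t - s| < e by near: s; exact: cvgr_dist_lt.
by move: h; rewrite !ltr_norml; case: (ltP t c); case: (ltP s c); lra.
Unshelve. all: by end_near.
Qed.

Lemma cont_pos f : continuous f -> continuous (fun t => pos (f t)).
Proof. by move=> cf; apply: cont_compR => //; exact: max_cont. Qed.

Lemma contXR f m : continuous f -> continuous (fun t => f t ^+ m).
Proof.
move=> cf; elim: m => [|m IH]; first by rewrite (_ : (fun _ => _) = fun=> 1); [exact: cst_continuous|apply/funext => s; rewrite expr0].
by rewrite (_ : (fun _ => _) = (fun t => f t * f t ^+ m)); [exact: contMR|apply/funext => s; rewrite exprS].
Qed.

(** From the exponent 2 on, a power of the positive part is continuously differentiable. *)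
Lemma is_derive_posX m t : is_derive t 1 (fun s => pos s ^+ m.+2) (m.+2%:R * pos t ^+ m.+1).
Proof.
have H := @is_derive_glue (fun=> 0) (fun s => s ^+ m.+2) (fun=> 0) (fun s => m.+2%:R * s ^+ m.+1) 0.
have e : (fun s => pos s ^+ m.+2) = (fun s => if s <= 0 then 0 else s ^+ m.+2).
  by apply/funext => s; case: ifP => h; [rewrite pos_le0// expr0n|rewrite pos_gt0// ltW// ltNge h].
have e' : m.+2%:R * pos t ^+ m.+1 = (if t <= 0 then 0 else m.+2%:R * t ^+ m.+1).
  by case: ifP => h; [rewrite pos_le0// expr0n/= mulr0|rewrite pos_gt0// ltW// ltNge h].
rewrite e e'; apply: H.
- by move=> s _; apply: (is_derive_eq (is_derive_funX m.+2 (is_derive_id s 1))); rewrite mulr1.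
- by rewrite expr0n.
- by rewrite expr0n/= mulr0.
Qed.

Lemma is_derive_affine k c t : is_derive t 1 (fun s => k + c * s) c.
Proof.
by apply: (is_derive_eq (is_derive_funD (is_derive_cst k t 1) (is_derive_funZ c (is_derive_id t 1)))); rewrite add0r mulr1.
Qed.

Lemma is_derive_comp f (g : R -> R) t (df dg : R) : is_derive t 1 f df -> is_derive (f t) 1 g dg ->
  is_derive t 1 (fun s => g (f s)) (dg * df).
Proof. exact: is_derive_comp1. Qed.

Section cutlog.
Variables (e : R) (e0 : 0 < e).

Definition mx t : R := Num.max t e.
Lemma mx_ge t : e <= mx t. Proof. by rewrite le_max lexx orbT. Qed.
Lemma mx_gt0 t : 0 < mx t. Proof. exact: lt_le_trans (mx_ge t). Qed.
Lemma mx_id t : e <= t -> mx t = t. Proof. by move=> h; rewrite /mx max_l. Qed.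
Lemma mx_cont : continuous mx. Proof. exact: max_cont. Qed.
Lemma mxV_cont : continuous (fun t => (mx t)^-1).
Proof. by apply: contVR; [move=> t; rewrite gt_eqF// mx_gt0|exact: mx_cont]. Qed.

(* [1 / t] and [ln t], continued by their tangents below [e]. *)
Definition inve t : R := if t <= e then 2 / e - t / e ^+ 2 else t^-1.
Definition lne t : R := if t <= e then ln e + (t - e) / e else ln t.

Lemma is_derive_inve t : is_derive t 1 inve (- (mx t)^-1 ^+ 2).
Proof.
have -> : - (mx t)^-1 ^+ 2 = if t <= e then - (e^-1 ^+ 2) else - (t^-1 ^+ 2).
  by rewrite /mx; case: ltgtP => // ->.
apply: (is_derive_glue (f1 := fun=> - (e^-1 ^+ 2)) (f2 := fun s => - (s^-1 ^+ 2))).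
- move=> s _; have := is_derive_affine (2 / e) (- (e^-1 ^+ 2)) s.
  by congr (is_derive _ _ _ _); apply/funext => u; rewrite exprVn; field; rewrite gt_eqF.
- move=> s es; have sn : s != 0 by rewrite gt_eqF// (lt_le_trans e0).
  by have := @is_deriveV R (@idfun R) s 1 1 sn _; rewrite /GRing.scale/= mulr1 exprVn; exact.
- by field; rewrite gt_eqF.
- by [].
Qed.

Lemma is_derive_lne t : is_derive t 1 lne (mx t)^-1.
Proof.
have -> : (mx t)^-1 = if t <= e then e^-1 else t^-1 by rewrite /mx; case: ltgtP => // ->.
apply: is_derive_glue => //.
- move=> s _; have := is_derive_affine (ln e - 1) e^-1 s.
  by congr (is_derive _ _ _ _); apply/funext => u; field; rewrite gt_eqF.
- by move=> s es; apply: is_derive1_ln; exact: lt_le_trans es.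
- by rewrite subrr mul0r addr0.
Qed.

Lemma inve_id t : e <= t -> inve t = t^-1.
Proof.
rewrite /inve; case: ltgtP => // <- _; by field; rewrite gt_eqF.
Qed.

Lemma lne_id t : e <= t -> lne t = ln t.
Proof. by rewrite /lne; case: ltgtP => // <- _; rewrite subrr mul0r addr0. Qed.

Hypothesis e2 : 2 * e <= 1.

(* The test function and the logarithm of the log-Caccioppoli estimate. *)
Definition lpsi t : R := pos (1 - 2 * t) ^+ 2 * inve t.
Definition lpsi' t : R := pos (1 - 2 * t) ^+ 2 * (- (mx t)^-1 ^+ 2) + inve t * (2%:R * pos (1 - 2 * t) ^+ 1 * (- 2)).

Lemma inve_cont : continuous inve.
Proof. by move=> t; have [h _] := is_derive_inve t; exact/differentiable_continuous/derivable1_diffP. Qed.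

Lemma lin_cont : continuous (fun t => 1 - 2 * t).
Proof.
apply: contDR; first exact: cst_continuous.
rewrite (_ : (fun _ => _) = (fun t => (-2) * t)); last by apply/funext => t; rewrite mulNr.
by apply: (contMR (f := fun=> -2) (g := id)); [exact: cst_continuous|move=> t; exact: cvg_id].
Qed.

Lemma is_derive_lpsi t : is_derive t 1 lpsi (lpsi' t).
Proof.
apply: is_derive_funM; last exact: is_derive_inve.
have d : is_derive t 1 (fun s => 1 - 2 * s) (- 2).
  by have := is_derive_affine 1 (-2) t; congr (is_derive _ _ _ _); apply/funext => u; rewrite mulNr.
exact: (is_derive_comp d (is_derive_posX 0 _)).
Qed.

Lemma lpsi'_cont : continuous lpsi'.
Proof.
have cp := cont_pos lin_cont.
apply: contDR.
  apply: contMR; first exact: contXR.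
  rewrite (_ : (fun _ => _) = (fun t => -1 * (mx t)^-1 ^+ 2)); last by apply/funext => t; rewrite mulN1r.
  by apply: contMR; [exact: cst_continuous|exact: contXR mxV_cont].
apply: contMR; first exact: inve_cont.
apply: contMR; last exact: cst_continuous.
by apply: contMR; [exact: cst_continuous|exact: contXR].
Qed.

(** The function [- ln (2 t)] cut off at 1/2: the correction [2 t - 1] makes value and slope vanish
    there. *)
Definition lphi t : R := if t <= 2^-1 then - lne t - ln 2 - 1 + 2 * t else 0.
Definition lphi' t : R := - (pos (1 - 2 * mx t) / mx t).

Lemma lphi'_cont : continuous lphi'.
Proof.
rewrite (_ : lphi' = (fun t => -1 * (pos (1 - 2 * mx t) * (mx t)^-1))); last by apply/funext => t; rewrite mulN1r.
apply: contMR; first exact: cst_continuous.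
by apply: contMR; [apply: cont_pos; exact: (cont_compR lin_cont mx_cont)|exact: mxV_cont].
Qed.

Lemma is_derive_lphi t : is_derive t 1 lphi (lphi' t).
Proof.
have e12 : e <= 2^-1 by have := e2; lra.
have -> : lphi' t = if t <= 2^-1 then - (mx t)^-1 + 2 else 0.
  rewrite /lphi'; case: ifP => h.
    rewrite pos_gt0; last by (have : mx t <= 2^-1 by rewrite ge_max h e12); lra.
    by field; rewrite gt_eqF// mx_gt0.
  move/negbT : h; rewrite -ltNge => h; rewrite mx_id; last by rewrite ltW// (le_lt_trans e12).
  by rewrite pos_le0 ?mul0r ?oppr0//; lra.
apply: (is_derive_glue (f1 := fun s => - (mx s)^-1 + 2) (f2 := fun=> 0)).
- move=> s _.
  have := is_derive_funD (is_derive_funZ (-1) (is_derive_lne s)) (is_derive_affine (- ln 2 - 1) 2 s).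
  rewrite mulN1r; congr (is_derive _ _ _ _); apply/funext => u; ring.
- by rewrite lne_id// lnV ?posrE//; field.
- by rewrite mx_id// invrK; ring.
Qed.

Lemma lphi0 t : 2^-1 <= t -> lphi t = 0 /\ lphi' t = 0.
Proof.
move=> h; have et : e <= t by have := e2; lra.
split; last by rewrite /lphi' mx_id// pos_le0 ?mul0r ?oppr0//; lra.
rewrite /lphi; case: ifP => // h'; have t2 : t = 2^-1 by apply/eqP; rewrite eq_le h' h.
by rewrite lne_id// t2 lnV ?posrE//; field.
Qed.

Lemma lpsi0 t : 2^-1 <= t -> lpsi t = 0.
Proof. by move=> h; rewrite /lpsi pos_le0 ?expr0n/= ?mul0r//; lra. Qed.

Lemma lphi_lower t (c : R) : e <= t -> t <= c -> c <= 2^-1 -> ln (2 * c)^-1 - 1 <= lphi t.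
Proof.
move=> et tc ch; have t0 : 0 < t by exact: lt_le_trans et.
rewrite /lphi ifT; last exact: le_trans ch.
have c0 : 0 < c by exact: lt_le_trans tc.
rewrite lne_id// lnV ?posrE ?mulr_gt0// lnM ?posrE//.
have : ln t <= ln c by rewrite ler_ln ?posrE.
lra.
Qed.

(** With [p = 1 - 2 t > 0] and [i = 1 / t], the derivative satisfies [- lpsi' = i^2 p (2 - p)],
    while [lpsi^2 = i^2 p^4] and [lphi'^2 = i^2 p^2]; and [p <= 1 <= 2 - p]. *)
Lemma lpsi_ineq t : e <= t -> [/\ 0 <= - lpsi' t, lpsi t ^+ 2 <= 1 * (- lpsi' t) & lphi' t ^+ 2 <= - lpsi' t].
Proof.
move=> et; have t0 : 0 < t by exact: lt_le_trans et.
rewrite /lpsi /lpsi' /lphi' mx_id// inve_id//.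
have [h|h] := leP (1 - 2 * t) 0.
  rewrite !pos_le0//; set i := t^-1.
  have -> : - (0 ^+ 2 * - i ^+ 2 + i * (2 * 0 ^+ 1 * -2)) = 0 :> R by ring.
  have -> : (0 ^+ 2 * i) ^+ 2 = 0 :> R by ring.
  have -> : (- (0 * i)) ^+ 2 = 0 :> R by ring.
  by rewrite mulr0.
rewrite (pos_gt0 (ltW h)); set p := 1 - 2 * t in h *; set i := t^-1.
have i0 : 0 < i by rewrite invr_gt0.
have it : i * t = 1 by rewrite mulVf// gt_eqF.
have p1 : p <= 1 by rewrite /p; lra.
have e1 : - (p ^+ 2 * - i ^+ 2 + i * (2 * p ^+ 1 * - 2)) = i ^+ 2 * p * (2 - p).
  have -> : i ^+ 2 * p * (2 - p) = i ^+ 2 * p ^+ 2 + i * p * (4 * (i * t)) by rewrite /p; ring.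
  by rewrite it; ring.
rewrite e1; have ip : 0 <= i ^+ 2 * p by rewrite mulr_ge0 ?sqr_ge0// ltW.
split; first by rewrite mulr_ge0//; lra.
  have -> : (p ^+ 2 * i) ^+ 2 = i ^+ 2 * p * p ^+ 3 by ring.
  rewrite mul1r ler_wpM2l//; apply: (@le_trans _ _ 1); first by rewrite exprn_ile1// ltW.
  lra.
have -> : (- (p * i)) ^+ 2 = i ^+ 2 * p * p by ring.
by rewrite ler_wpM2l//; lra.
Qed.

End cutlog.
End glue.

(** * Energy estimates *)

Section pde.
Context {R : realType} {n : nat}.
Variables (d C0 C1 : R) (Gamma : set 'rV[R]_n) (A : 'rV[R]_n -> 'M[R]_n).
Local Notation E := 'rV[R]_n.
Implicit Types (x y z a s : E) (u t v f eta : E -> R) (g G gv : E -> E) (K : set E).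
Local Notation Omega := (~` Gamma).
Local Notation delta := (dist_to Gamma).
Local Notation w := (weight Gamma d).
Hypotheses (n0 : (0 < n)%N) (d0 : 0 < d) (dn : d < n%:R - 1) (C01 : 1 <= C0) (C11 : 1 <= C1)
  (G0 : Gamma !=set0) (cG : closed Gamma) (AR : ahlfors_regular Gamma d C0)
  (el : elliptic Gamma d C1 A).

Let w0 x : 0 <= w x. Proof. exact: weight_ge0. Qed.
Let mw D : msb D -> mfn D w. Proof. exact: weight_mfn. Qed.
Let iw a s : intg (box a s) w. Proof. exact: (weight_intg_box n0 d0 dn C01 G0 cG AR). Qed.
Let oO : open Omega. Proof. exact: closed_openC. Qed.
Let mO : msb Omega. Proof. exact: measurable_open. Qed.

(** The default value of a power of 0. Together with gradients set to 0 on Gamma it makes weighted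
    integrals over R^n and over the complement of Gamma agree. *)
Lemma weight_Gamma x : Gamma x -> w x = 0.
Proof.
move=> Gx; rewrite weightE (dist0 G0 Gx) powR0// oppr_eq0 gt_eqF// subr_gt0; exact: dn.
Qed.

(** The complement of Gamma is the union of the compact sets [K k], on each of which [f] is
    integrable. *)
Lemma mfn_L1loc f : L1loc Omega f -> mfn Omega f.
Proof.
move=> lf.
pose K (k : nat) : set E := cbox (- const_mx k%:R) (const_mx (2 * k%:R)) `&` [set x | k.+1%:R^-1 <= delta x].
have cl k : closed [set x : E | k.+1%:R^-1 <= delta x].
  have /continuous_closedP c := dist_cont n0 G0; have h := c _ (@closed_ge R k.+1%:R^-1); exact: h.
have cK k : compact (K k).
  apply: (subclosed_compact _ (@compact_cbox R n (- const_mx k%:R) (const_mx (2 * k%:R)))); last by move=> x [].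
  by apply: closedI => //; apply: compact_closed; [exact: norm_hausdorff|exact: compact_cbox].
have KO k : K k `<=` Omega.
  by move=> x [_ /= h] /(dist0 G0) dx; move: h; rewrite dx leNgt invr_gt0 ltr0n.
have -> : Omega = \bigcup_k K k.
  apply/seteqP; split => [x nG|x [k _ /KO]//].
  have dx := dist_gt0 G0 cG nG.
  pose k := maxn (Num.truncn (enorm x)).+1 (Num.truncn (delta x)^-1).+1.
  exists k => //; split.
    have : enorm x < k%:R by apply: lt_le_trans (truncnS_gt _) _; rewrite ler_nat leq_maxl.
    by move=> h i; have := coord_le_enorm x i; rewrite !mxE ler_norml; lra.
  rewrite /= -[leRHS]invrK lef_pV2 ?posrE ?invr_gt0 ?ltr0n//.
  apply: ltW; apply: lt_le_trans (truncnS_gt _) _; rewrite ler_nat.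
  by apply: leq_trans (leqnSn _); exact: leq_maxr.
rewrite /mfn; apply/measurable_fun_bigcup => k; first exact: (msb_compact (cK k)).
by have := lf _ (cK k) (KO k) => /intg_mfn.
Qed.

Lemma mfn_wg u g i : weak_gradient Omega u g -> mfn Omega (fun x => g x 0 i).
Proof. by move=> wg; apply: mfn_L1loc; have [] := wg i. Qed.

Lemma mfn_sum (I : Type) (r : seq I) (D : set E) (f : I -> E -> R) : msb D ->
  (forall i, mfn D (f i)) -> mfn D (fun x => \sum_(i <- r) f i x).
Proof.
move=> mD fi; elim: r => [|i r IH].
  by apply: (mfn_eq (f := fun=> 0)); [move=> x _; rewrite big_nil|exact: mfn_cst].
by apply: (mfn_eq (f := fun x => f i x + \sum_(j <- r) f j x)); [move=> x _; rewrite big_cons|exact: mfnD].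
Qed.

Lemma mfn_enorm2 D g : msb D -> (forall i, mfn D (fun x => g x 0 i)) -> mfn D (fun x => enorm (g x) ^+ 2).
Proof.
move=> mD mg; apply: (@mfn_eq _ _ _ (fun x => \sum_i g x 0 i ^+ 2)).
  by move=> x _; rewrite enorm_sqr dotE.
by apply: mfn_sum => // i; exact: mfnX.
Qed.

Lemma Omega_mkcond f : (forall x, Gamma x -> f x = 0) ->
  Int setT f = Int Omega f /\ (intg Omega f -> intg setT f).
Proof.
move=> fG; have h x : setT x -> ~ Omega x -> f x = 0 by move=> _ /contrapT /fG.
split; first by apply: (Int_mkcond mO (@msbT R n) _ h) => //.
by apply: (intg_mkcond mO (@msbT R n) _ h).
Qed.

Lemma compact_box K : compact K -> exists a s, K `<=` box a s.
Proof.
move=> /compact_coord[M M0 h]; exists (- const_mx M), (const_mx (3 * M)) => x /h hx i.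
by have := hx i; rewrite !mxE ler_norml; lra.
Qed.

Lemma intg_cw K f : compact K -> (forall x, ~ K x -> f x = 0) -> continuous f -> intg setT (fun x => f x * w x).
Proof.
move=> cK f0 cf; have [a [s sub]] := compact_box cK.
apply: (intg_mkcond (msb_box a s) (@msbT R n)) => //.
  by move=> x _ nb; rewrite f0 ?mul0r// => /sub.
exact: (intg_contw iw).
Qed.

Lemma trace0 v x : continuous v -> v x = 0 -> has_trace v x 0.
Proof.
move=> cv vx; rewrite /has_trace; apply/cvgrPdist_le => /= e e0.
have [r r0 hr] := uniform_cont cv (@compact_set1 _ x) e0.
near=> rho.
have rr : rho < r by near: rho; exact: nbhs_right_lt.
have hb z : eball x rho z -> `|v z| <= e.
  move=> hz; have := hr x z erefl (eball_ball (lt_trans hz rr)).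
  by rewrite vx subr0 => /ltW.
have mB : msb (eball x rho) by apply: measurable_open; exact: eball_open.
have sB : eball x rho `<=` cbox (x - const_mx rho) (const_mx (2 * rho)).
  move=> z hz i; have := le_lt_trans (coord_le_enorm (z - x) i) hz.
  by rewrite !mxE ltr_norml; lra.
have cC := @compact_cbox R n (x - const_mx rho) (const_mx (2 * rho)).
have iC f : continuous f -> intg (eball x rho) f.
  by move=> cf; apply: (intgS mB (msb_compact cC) sB); exact: intg_compact.
have iv := iC v cv; have ie := iC _ (@cst_continuous _ _ e).
have h1 : `|Int (eball x rho) v| <= e * vol (eball x rho).
  rewrite -Int_cst//; apply: le_trans (Int_abs mB iv) _.
  by apply: Int_le => //; exact: intg_abs.
rewrite sub0r normrN -/(Int _ _) -/(vol _).
have v0 : 0 <= vol (eball x rho) by rewrite fine_ge0// outer_measure_ge0.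
have [->|vn] := eqVneq (vol (eball x rho)) 0; first by rewrite invr0 mulr0 normr0 ltW.
have vp : 0 < vol (eball x rho) by rewrite lt_def vn.
by rewrite normrM [X in _ * X]ger0_norm ?invr_ge0// ler_pdivrMr.
Unshelve. all: by end_near.
Qed.

Lemma in_W0_cont v gv : continuous v -> (forall x, Gamma x -> v x = 0) -> weak_gradient Omega v gv ->
  intg Omega (fun x => enorm (gv x) ^+ 2 * w x) -> in_W0 Gamma d v.
Proof.
move=> cv v0 wg ig; split; last first.
  by apply: aeW => x Gx; apply: trace0 => //; exact: v0.
split; first by have := L1loc_cont (O := Omega) cv; exact.
exists gv => //.
have /integrableP[_ h] := ig.
apply: le_lt_trans h; rewrite le_eqVlt; apply/orP; left; apply/eqP.
by apply: eq_integral => z _; rewrite /= ger0_norm// mulr_ge0// sqr_ge0.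
Qed.

Definition energy G D := intg D (fun x => enorm (G x) ^+ 2 * w x).

Lemma mfn_dotA G gv : (forall i, mfn Omega (fun x => G x 0 i)) -> (forall i, mfn Omega (fun x => gv x 0 i)) ->
  mfn Omega (fun z => dot (mxact (A z) (G z)) (gv z)).
Proof.
move=> mG mg; have [mA _ _] := el; apply: mfn_sum => // i; apply: mfnM => //.
apply: (@mfn_eq _ _ _ (fun z => \sum_j A z i j * G z 0 j)).
  by move=> z _; rewrite /mxact !mxE; apply: eq_bigr => j _; rewrite mxE.
by apply: mfn_sum => // j; apply: mfnM => //; exact: mA.
Qed.

Lemma dotA_le z x y : Omega z -> `|dot (mxact (A z) x) y| <= C1 * (enorm x ^+ 2 * w z + enorm y ^+ 2 * w z).
Proof.
move=> Oz; have [_ h _] := el; apply: le_trans (h z x y Oz) _.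
rewrite -[C1 * w z * _]mulrA -[C1 * _ * _]mulrA; apply: ler_wpM2l; first exact: le_trans C11.
rewrite -mulrDl -mulrA [leLHS]mulrC; apply: ler_wpM2r => //.
have := sqr_ge0 (enorm x - enorm y); have := sqr_ge0 (enorm x); have := sqr_ge0 (enorm y); lra.
Qed.

Lemma intg_dotA G gv : (forall i, mfn Omega (fun x => G x 0 i)) -> (forall i, mfn Omega (fun x => gv x 0 i)) ->
  energy G Omega -> energy gv Omega -> intg Omega (fun z => dot (mxact (A z) (G z)) (gv z)).
Proof.
move=> mG mg eG eg.
apply: (@intg_le _ _ _ _ (fun z => C1 * (enorm (G z) ^+ 2 * w z + enorm (gv z) ^+ 2 * w z))) => //.
- exact: mfn_dotA.
- by apply: intgZ => //; exact: intgD.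
- by move=> z Oz; exact: dotA_le.
Qed.

(** What is retained of a variational solution: the gradient is extended by 0 to Gamma, the energy
    is finite on all of R^n, and the test functions are continuous and vanish pointwise on Gamma.
    Affine changes of [t] preserve it, so that [B - t] and [t + a] are available. *)
Definition sol t G := [/\ continuous t, weak_gradient Omega t G, (forall x, Gamma x -> G x = 0),
  energy G setT & forall v gv, continuous v -> (forall x, Gamma x -> v x = 0) ->
   weak_gradient Omega v gv -> energy gv Omega ->
   Int Omega (fun z => dot (mxact (A z) (G z)) (gv z)) = 0].

Lemma mxactZ (M : 'M[R]_n) (c : R) x : mxact M (c *: x) = c *: mxact M x.
Proof. by rewrite /mxact linearZ/= -scalemxAr linearZ. Qed.

Lemma sol_affine t G (c b : R) : sol t G -> sol (fun x => c + b * t x) (fun x => b *: G x).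
Proof.
move=> [ct wg GG eG test]; have eGO : energy G Omega by apply: intgS eG => //; exact: msbT.
split.
- by apply: contD; [exact: cst_continuous|apply: contM => //; exact: cst_continuous].
- have := wg_comp (F := fun r : R => c + b * r) (F' := fun=> b) oO ct wg (is_derive_affine c b) (@cst_continuous _ _ b).
  by [].
- by move=> x /GG ->; rewrite scaler0.
- apply: (@intg_eq _ _ _ (fun x => b ^+ 2 * (enorm (G x) ^+ 2 * w x))) => //; first exact: msbT.
    by move=> x _; rewrite enormZ exprMn real_normK ?num_real// mulrA.
  by apply: intgZ => //; exact: msbT.
move=> v gv cv v0 wv ev; rewrite (@Int_eq _ _ _ _ (fun z => b * dot (mxact (A z) (G z)) (gv z))); last first.
  by move=> z _; rewrite mxactZ dotZl.
have ii := intg_dotA (fun i => mfn_wg i wg) (fun i => mfn_wg i wv) eGO ev.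
by rewrite (IntZ _ mO ii) (test v gv)// mulr0.
Qed.

Lemma sol_U U f : harmonic_extension Gamma d A U -> in_C00 Gamma f -> in_H Gamma d f -> exists G, sol (U f) G.
Proof.
move=> [cU _ _ hU] f0 fH; have [[_ [g wg eg]] ws _ _] := hU f f0 fH.
pose G x := if `[< Gamma x >] then 0 else g x.
have GO x : Omega x -> G x = g x by rewrite /G; case: asboolP.
have wG : weak_gradient Omega (U f) G by apply: (wg_eq oO wg).
have eO : energy G Omega.
  rewrite /energy /intg; apply/integrableP; split.
    apply/measurable_EFinP; apply: mfnM; last exact: mw.
    by apply: mfn_enorm2 => // i; exact: mfn_wg wG.
  rewrite (eq_integral (fun z : lebT R n => (enorm (g z) ^+ 2 * w z)%:E : \bar R)) => //.
  by move=> z; rewrite inE => Oz; rewrite /= GO// ger0_norm// mulr_ge0// sqr_ge0.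
exists G; split => //; first exact: cU.
- by move=> x Gx; rewrite /G; case: asboolP.
- have hG x : Gamma x -> enorm (G x) ^+ 2 * w x = 0 by move=> Gx; rewrite weight_Gamma// mulr0.
  by have [_ h] := Omega_mkcond hG; exact: h.
move=> v gv cv v0 wv ev; apply: ws => //; exact: in_W0_cont wv ev.
Qed.

Definition gr eta x : E := \row_i pd i eta x.

Lemma pd_sqr eta i x : smooth eta -> pd i (fun y => eta y * eta y) x = 2 * eta x * pd i eta x.
Proof.
move=> se; have h := is_derive_funM (smooth_derivable i x se) (smooth_derivable i x se).
by have [_ e] := h; rewrite /pd e /pd; ring.
Qed.

Lemma gr_cont eta : smooth eta -> continuous (fun x => enorm (gr eta x) ^+ 2).
Proof.
move=> se; rewrite (_ : (fun _ => _) = (fun x => \sum_i pd i eta x * pd i eta x)); last first.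
  by apply/funext => x; rewrite enorm_sqr; apply: eq_bigr => i _; rewrite mxE.
apply: smooth_cont; apply: smooth_sum => i; apply: smoothM; exact: smooth_pd.
Qed.

Lemma gr_supp K eta x : smooth eta -> compact K -> (forall x, ~ K x -> eta x = 0) -> ~ K x -> gr eta x = 0.
Proof.
move=> se cK h nK; apply/rowP => i; rewrite !mxE; by apply: (pd_supp (K := K)).
Qed.

Lemma enormD2 x y : enorm (x + y) ^+ 2 <= 2 * enorm x ^+ 2 + 2 * enorm y ^+ 2.
Proof.
apply: (@le_trans _ _ ((enorm x + enorm y) ^+ 2)).
  by rewrite ler_sqr ?nnegrE ?addr_ge0 ?enorm_ge0// enormD.
have := sqr_ge0 (enorm x - enorm y); lra.
Qed.

Lemma energy_test t G (psi psi' : R -> R) eta K : sol t G -> smooth eta -> compact K -> (forall x, ~ K x -> eta x = 0) ->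
  (forall c : R, is_derive c 1 psi (psi' c)) -> continuous psi' ->
  let gv x := (eta x * eta x) *: (psi' (t x) *: G x) + psi (t x) *: \row_i pd i (fun y => eta y * eta y) x in
  weak_gradient Omega (fun x => eta x * eta x * psi (t x)) gv /\ energy gv Omega.
Proof.
move=> [ct wg GG eG test] se cK e0 dp cp gv.
have cps : continuous psi by move=> c; have [h _] := dp c; exact/differentiable_continuous/derivable1_diffP.
have cpt : continuous (fun x => psi (t x)) by exact: cont_comp.
have cpt' : continuous (fun x => psi' (t x)) by exact: cont_comp.
have see := smoothM se se; have ce := smooth_cont se.
have wv : weak_gradient Omega (fun x => eta x * eta x * psi (t x)) gv.
  exact: (wg_smoothM oO cpt (wg_comp oO ct wg dp cp) see).
split=> //.
pose b x := eta x * eta x * psi' (t x).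
have cb : continuous b by apply: contM => //; exact: contM.
have b0 x : ~ K x -> b x = 0 by move=> /e0 h; rewrite /b h !mul0r.
have [M M0 hM] := cont_bounded cb cK.
have bM x : `|b x| <= M by have [/hM//|/b0 ->] := pselect (K x); rewrite normr0 ltW.
pose c x := psi (t x) ^+ 2 * enorm (gr (fun y => eta y * eta y) x) ^+ 2.
have cc : continuous c by apply: contM; [exact: (contM cpt cpt)|exact: gr_cont].
have ee0 x : ~ K x -> eta x * eta x = 0 by move=> /e0 ->; rewrite mul0r.
have c0 x : ~ K x -> c x = 0.
  by move=> nK; rewrite /c (gr_supp see cK ee0 nK) enorm0 expr0n mulr0.
have ic : intg Omega (fun x => 2 * (c x * w x)).
  by apply: intgZ => //; apply: intgS (intg_cw cK c0 cc) => //; exact: msbT.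
have eGO : energy G Omega by apply: intgS eG => //; exact: msbT.
apply: (@intg_le _ _ _ _ (fun x => 2 * M ^+ 2 * (enorm (G x) ^+ 2 * w x) + 2 * (c x * w x))) => //.
- apply: mfnM; last exact: mw.
  by apply: mfn_enorm2 => // i; exact: mfn_wg wv.
- by apply: intgD => //; apply: intgZ.
move=> x _; rewrite ger0_norm; last by rewrite mulr_ge0// sqr_ge0.
have -> : 2 * M ^+ 2 * (enorm (G x) ^+ 2 * w x) + 2 * (c x * w x) = (2 * (M ^+ 2 * enorm (G x) ^+ 2) + 2 * c x) * w x by ring.
apply: ler_wpM2r => //; apply: le_trans (enormD2 _ _) _; apply: lerD.
  rewrite scalerA enormZ exprMn; apply: ler_wpM2l => //; apply: ler_wpM2r; first exact: sqr_ge0.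
  by rewrite ler_sqr ?nnegrE ?(ltW M0)//; exact: bM.
by rewrite enormZ exprMn real_normK ?num_real.
Qed.

(** Young's inequality for a factor with [X^2 <= h m]. If [m = 0], the cross term vanishes with
    [X]. *)
Lemma young (X Y Z h m c : R) : 0 <= h -> 0 <= m -> 0 <= X -> 0 < c -> X ^+ 2 <= h * m ->
  2 * c * X * Y * Z <= (2 * c)^-1 * (m * Y ^+ 2) + 2 * c ^+ 3 * (h * Z ^+ 2).
Proof.
move=> h0 m0 X0 c0 Xm.
have [m00|mn] := eqVneq m 0.
  have -> : X = 0 by apply/eqP; rewrite -sqrf_eq0 eq_le sqr_ge0 andbT; move: Xm; rewrite m00 mulr0.
  rewrite m00 !(mulr0, mul0r) add0r; apply: mulr_ge0; last by rewrite mulr_ge0// sqr_ge0.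
  by rewrite mulr_ge0// exprn_ge0// ltW.
have mp : 0 < m by rewrite lt_def mn.
rewrite -(ler_pM2l mp) -(ler_pM2l (_ : 0 < 2 * c)); last by rewrite mulr_gt0.
have -> : 2 * c * (m * ((2 * c)^-1 * (m * Y ^+ 2) + 2 * c ^+ 3 * (h * Z ^+ 2))) =
  m ^+ 2 * Y ^+ 2 + (2 * c ^+ 2 * Z) ^+ 2 * (h * m) by field; rewrite gt_eqF.
apply: (@le_trans _ _ (m ^+ 2 * Y ^+ 2 + (2 * c ^+ 2 * Z) ^+ 2 * X ^+ 2)); last first.
  by rewrite lerD2l ler_wpM2l ?sqr_ge0.
have := sqr_ge0 (m * Y - 2 * c ^+ 2 * Z * X); lra.
Qed.

Lemma dotDr x y z : dot z (x + y) = dot z x + dot z y.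
Proof. by rewrite dotC dotDl !(dotC _ z). Qed.
Lemma dotZr (c : R) x y : dot y (c *: x) = c * dot y x.
Proof. by rewrite dotC dotZl dotC. Qed.

(** The equation is tested with [eta^2 psi (t)], where [psi] is nonincreasing along [t] on [K]. The
    condition [psi^2 <= h (- psi')] lets half of the main term absorb the cross term. De Giorgi's
    step takes [h] proportional to a fourth power, the logarithmic estimate takes [h = 1]. *)
Lemma caccioppoli t G (psi psi' : R -> R) eta (h : E -> R) K : sol t G -> smooth eta -> compact K -> (forall x, ~ K x -> eta x = 0) ->
  (forall c : R, is_derive c 1 psi (psi' c)) -> continuous psi' -> continuous h -> (forall x, 0 <= h x) ->
  (forall x, Gamma x -> eta x * psi (t x) = 0) ->
  (forall x, K x -> 0 <= - psi' (t x) /\ psi (t x) ^+ 2 <= h x * - psi' (t x)) ->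
  intg setT (fun x => eta x ^+ 2 * (- psi' (t x)) * enorm (G x) ^+ 2 * w x) /\
  Int setT (fun x => eta x ^+ 2 * (- psi' (t x)) * enorm (G x) ^+ 2 * w x) <=
    4 * C1 ^+ 4 * Int setT (fun x => h x * enorm (gr eta x) ^+ 2 * w x).
Proof.
move=> S se cK e0 dp cp ch h0 eG hp.
have [ct wg GG eGT test] := S; have [wv ev] := energy_test S se cK e0 dp cp.
set gv := (fun x => _ *: _ + _) in wv ev.
have cps : continuous psi by move=> c; have [k _] := dp c; exact/differentiable_continuous/derivable1_diffP.
have ce := smooth_cont se; have C1p : 0 < C1 by exact: lt_le_trans C11.
have cv : continuous (fun x => eta x * eta x * psi (t x)).
  by apply: contM; [exact: contM|exact: cont_comp].
have v0 x : Gamma x -> eta x * eta x * psi (t x) = 0 by move=> Gx; rewrite -mulrA eG// mulr0.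
have z := test _ _ cv v0 wv ev.
have cpt' : continuous (fun x => psi' (t x)) by exact: cont_comp.
pose b x := eta x ^+ 2 * - psi' (t x).
have cb : continuous b.
  apply: contM; first exact: (contM ce ce).
  rewrite (_ : (fun _ => _) = (fun x => (-1) * psi' (t x))); last by apply/funext => x; rewrite mulN1r.
  by apply: contM => //; exact: cst_continuous.
have b0 x : ~ K x -> b x = 0 by move=> /e0 k; rewrite /b k expr0n/= mul0r.
have bpos x : 0 <= b x.
  by have [/hp[k _]|/b0 ->//] := pselect (K x); rewrite mulr_ge0 ?sqr_ge0.
have [M M0 hM] := cont_bounded cb cK.
have bM x : `|b x| <= M by have [/hM//|/b0 ->] := pselect (K x); rewrite normr0 ltW.
have eGO : energy G Omega by apply: intgS eGT => //; exact: msbT.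
pose P x := b x * enorm (G x) ^+ 2 * w x.
pose H x := h x * enorm (gr eta x) ^+ 2 * w x.
have PG x : Gamma x -> P x = 0 by move=> Gx; rewrite /P weight_Gamma// mulr0.
have HG x : Gamma x -> H x = 0 by move=> Gx; rewrite /H weight_Gamma// mulr0.
have iP : intg Omega P.
  apply: (@intg_le _ _ _ _ (fun x => M * (enorm (G x) ^+ 2 * w x))) => //.
  - apply: mfnM; last exact: mw.
    apply: mfnM; first exact: mfn_cont.
    by apply: mfn_enorm2 => // i; exact: mfn_wg wg.
  - exact: intgZ.
  - move=> x _; rewrite /P -mulrA normrM; apply: ler_pM => //.
    by rewrite ger0_norm// mulr_ge0 ?sqr_ge0.
have iH : intg Omega H.
  apply: (intgS _ _ _ (intg_cw cK _ _)) => //; first exact: msbT.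
    by move=> x nK; rewrite (gr_supp se cK e0 nK) enorm0 expr0n/= mulr0.
  by apply: contM => //; exact: gr_cont.
have idot : intg Omega (fun x => dot (mxact (A x) (G x)) (gv x)).
  by apply: intg_dotA => // i; [exact: mfn_wg wg|exact: mfn_wg wv].
have [eP ieP] := Omega_mkcond PG; have [eH ieH] := Omega_mkcond HG.
split; first exact: ieP.
rewrite eP eH.
have [_ ell1 ell2] := el.
have key x : Omega x -> dot (mxact (A x) (G x)) (gv x) <= 2 * C1 ^+ 3 * H x - (2 * C1)^-1 * P x.
  move=> Ox.
  have egr : \row_i pd i (fun y => eta y * eta y) x = (2 * eta x) *: gr eta x.
    by apply/rowP => i; rewrite !mxE pd_sqr.
  have [kx|nk] := pselect (K x); last first.
    rewrite /gv egr (e0 _ nk) !(mulr0, scale0r) scaler0 addr0 /P (b0 _ nk) !mul0r mulr0 subr0.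
    rewrite dotC (_ : 0 = 0 *: G x) ?dotZl ?mul0r; last by rewrite scale0r.
    apply: mulr_ge0; first by rewrite mulr_ge0// exprn_ge0// ltW.
    by rewrite /H mulr_ge0// mulr_ge0// sqr_ge0.
  have [m0 pm] := hp x kx.
  rewrite /gv egr dotDr !dotZr.
  have d1 := ell2 x (G x) Ox; have d2 := ell1 x (G x) (gr eta x) Ox.
  set D1 := dot _ (G x) in d1 *; set D2 := dot _ (gr eta x) in d2 *.
  have yg := young (X := `|psi (t x)|) (`|eta x| * enorm (G x)) (enorm (gr eta x)) (h0 x) m0 (normr_ge0 _) C1p.
  have {}yg := yg ltac:(by rewrite real_normK ?num_real).
  have t1 : psi (t x) * (2 * eta x * D2) <= 2 * C1 * `|psi (t x)| * (`|eta x| * enorm (G x)) * enorm (gr eta x) * w x.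
    apply: le_trans (ler_norm _) _; rewrite !normrM [`|2|]ger0_norm//.
    have -> : 2 * C1 * `|psi (t x)| * (`|eta x| * enorm (G x)) * enorm (gr eta x) * w x =
      `|psi (t x)| * (2 * `|eta x| * (C1 * w x * enorm (G x) * enorm (gr eta x))) by ring.
    by rewrite !ler_wpM2l.
  have t2 : eta x * eta x * (psi' (t x) * D1) <= - (b x * (C1^-1 * w x * enorm (G x) ^+ 2)).
    have -> : eta x * eta x * (psi' (t x) * D1) = - (b x * D1) by rewrite /b; ring.
    by rewrite lerN2 ler_wpM2l.
  have t3 := ler_wpM2r (w0 x) yg.
  apply: le_trans (lerD t2 (le_trans t1 t3)) _.
  rewrite le_eqVlt; apply/orP; left; apply/eqP.
  have e2 : (`|eta x| * enorm (G x)) ^+ 2 = eta x ^+ 2 * enorm (G x) ^+ 2 by rewrite exprMn real_normK ?num_real.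
  by rewrite e2 /P /H /b; field; rewrite gt_eqF.
have iR : intg Omega (fun x => 2 * C1 ^+ 3 * H x - (2 * C1)^-1 * P x) by apply: intgB => //; exact: intgZ.
have := Int_le mO idot iR key; rewrite z IntB//; last 2 first.
- exact: intgZ.
- exact: intgZ.
rewrite !IntZ// subr_ge0 ler_pdivrMl ?mulr_gt0// => k.
by apply: le_trans k _; rewrite le_eqVlt; apply/orP; left; apply/eqP; ring.
Qed.

Lemma wg_zero (O : set E) : open O -> weak_gradient O (fun=> 0) (fun=> 0).
Proof.
move=> oO'; apply: wgI => // [i|i phi _].
  have h := L1loc_cont (O := O) (@cst_continuous E R 0).
  by move=> K cK KO; apply: (intg_eq (f := fun=> 0)); [exact: msb_compact|move=> x _; rewrite mxE|exact: h].
rewrite (@Int_eq _ _ _ _ (fun=> 0)) ?(@Int_eq _ _ _ (fun x => (0 : E) 0 i * _) (fun=> 0)).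
- by rewrite Int_cst ?mul0r ?oppr0//; exact: msbT.
- by move=> x _; rewrite mxE mul0r.
- by move=> x _; rewrite mul0r.
Qed.

(** A set inside [above t k] meets Gamma only where [t > k]. Truncations that vanish above level [k]
    have a weak gradient on this open set, Gamma included. *)
Definition above t (k : R) : set E := Omega `|` [set x | k < t x].

Lemma above_open t k : continuous t -> open (above t k).
Proof.
move=> ct; apply: openU; first exact: oO.
by have /continuousP c := ct; have h := c _ (@open_gt R k); exact: h.
Qed.

Lemma wg_trunc t G (F F' : R -> R) (k : R) : sol t G -> (forall s : R, is_derive s 1 F (F' s)) -> continuous F' ->
  (forall s : R, k <= s -> F s = 0 /\ F' s = 0) ->
  weak_gradient (above t k) (fun x => F (t x)) (fun x => F' (t x) *: G x).
Proof.
move=> [ct wg _ _ _] dF cF' z.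
have cF : continuous F by move=> c; have [h _] := dF c; exact/differentiable_continuous/derivable1_diffP.
have oV : open [set x | k < t x].
  by have /continuousP c := ct; have h := c _ (@open_gt R k); exact: h.
apply: wgU => //; [exact: cont_comp|exact: wg_comp|].
apply: (wg_eq oV (wg_zero oV)) => x /= /ltW /z[e1 e2]; first by rewrite e1.
by rewrite e2 scale0r.
Qed.

Lemma mfn_solG t G i : sol t G -> mfn setT (fun x => G x 0 i).
Proof.
move=> [_ wg GG _ _]; apply: (mfn_mkcond mO (@msbT R n) (fun x _ => I) _ (mfn_wg i wg)).
by move=> x _ /contrapT /GG ->; rewrite mxE.
Qed.

Lemma energy_box t G (b c : E -> R) eta a s : sol t G -> continuous b -> continuous c -> smooth eta ->
  intg (box a s) (fun x => enorm (b x *: G x + c x *: gr eta x) ^+ 2 * w x).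
Proof.
move=> S cb cc se; have [_ _ _ eG _] := S; have mB := msb_box a s.
have [M M0 hM] := cont_bounded cb (@compact_cbox R n a s).
have i1 : intg (box a s) (fun x => enorm (G x) ^+ 2 * w x).
  by apply: (intgS mB (@msbT R n)) eG.
have i2 : intg (box a s) (fun x => c x ^+ 2 * enorm (gr eta x) ^+ 2 * w x).
  by apply: (intg_contw iw); apply: contM; [exact: (contM cc cc)|exact: gr_cont].
apply: (@intg_le _ _ _ _ (fun x => 2 * M ^+ 2 * (enorm (G x) ^+ 2 * w x) + 2 * (c x ^+ 2 * enorm (gr eta x) ^+ 2 * w x))) => //.
- apply: mfnM; last exact: mw.
  apply: mfn_enorm2 => // i; apply: (mfn_eq (f := fun x => b x * G x 0 i + c x * pd i eta x)).
    by move=> x _; rewrite !mxE.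
  apply: mfnD; apply: mfnM.
  - exact: mfn_cont.
  - exact: (mfnS (@msbT R n) (fun x _ => I) (mfn_solG i S)).
  - exact: mfn_cont.
  - by apply: mfn_cont => //; apply: smooth_cont; exact: smooth_pd.
- by apply: intgD => //; apply: intgZ.
move=> x bx; rewrite ger0_norm; last by rewrite mulr_ge0// sqr_ge0.
have -> : 2 * M ^+ 2 * (enorm (G x) ^+ 2 * w x) + 2 * (c x ^+ 2 * enorm (gr eta x) ^+ 2 * w x) =
  (2 * (M ^+ 2 * enorm (G x) ^+ 2) + 2 * (c x ^+ 2 * enorm (gr eta x) ^+ 2)) * w x by ring.
apply: ler_wpM2r => //; apply: le_trans (enormD2 _ _) _; apply: lerD.
  rewrite enormZ exprMn; apply: ler_wpM2l => //; apply: ler_wpM2r; first exact: sqr_ge0.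
  by rewrite ler_sqr ?nnegrE ?(ltW M0)//; apply: hM; exact: box_cbox.
by rewrite enormZ exprMn real_normK ?num_real.
Qed.

(** [K] minus [V] is compact and misses Gamma, so it keeps a positive distance from Gamma. *)
Lemma compact_near_gamma K (V : set E) : compact K -> open V ->
  K `<=` Omega `|` V -> exists2 d1 : R, 0 < d1 & forall x, K x -> delta x < d1 -> V x.
Proof.
move=> cK oV Ka; pose K' := K `&` ~` V.
have cK' : compact K'.
  apply: (subclosed_compact _ cK); last by move=> x [].
  apply: closedI; first exact: compact_closed (@norm_hausdorff _ _) cK.
  exact: open_closedC.
have K'O : K' `<=` Omega by move=> x [/Ka[]].
have [N [Q [r [[_ K'N _ QO r0] NQ]]]] := compact_nbhd cK' oO K'O.
exists r => // x Kx dx; apply: contrapT => nV.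
have [y Gy hy] := dist_lt G0 dx.
by apply: (QO y) Gy; apply: (NQ x); [exact: K'N|apply: eball_ball; rewrite /eball/= enormB].
Qed.

Lemma compact_above K t (k : R) : compact K -> continuous t -> K `<=` above t k ->
  exists2 d1 : R, 0 < d1 & forall x, K x -> delta x < d1 -> k < t x.
Proof.
move=> cK ct Ka; apply: (compact_near_gamma cK _ Ka).
by have /continuousP c := ct; have h := c _ (@open_gt R k); exact: h.
Qed.

Lemma weight_Int_gt0 a s : good s -> 0 < Int (box a s) w.
Proof.
move=> gd; have l0 := lam_gt0 n0 gd; have v0 := volb_gt0 gd; have mB := msb_box a s.
pose T := delta a + lam s; have T0 : 0 < T by rewrite ltr_wpDl// dist_ge0.
pose k := T `^ (- (n%:R - 1 - d)); have k0 : 0 < k by exact: powR_gt0.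
have ba : box a s a by move=> i; have := good_gt0 gd i; lra.
have ic : intg (box a s) (fun=> k) by apply: intg_cont_box; exact: cst_continuous.
have mD : msb (box a s `\` Gamma) by apply: measurableD => //; exact: msb_Gamma.
apply: (@lt_le_trans _ _ (k * volb s)); first by rewrite mulr_gt0.
rewrite -(vol_box a n0 gd) -Int_cst// (Int_offGamma d0 dn C01 G0 cG AR ic) (Int_offGamma d0 dn C01 G0 cG AR (iw a s)).
apply: Int_le => //; [by apply: intgS ic|by apply: intgS (iw a s)|].
move=> x [bx nG]; apply: (weight_lower dn G0 cG nG).
by have := dist_lip G0 x a; have := box_enorm bx ba; rewrite /T; lra.
Qed.

Definition cub (c : E) (r : R) := box (c - const_mx r) (const_mx (2 * r)).
Definition ccub (c : E) (r : R) := cbox (c - const_mx r) (const_mx (2 * r)).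

Lemma ccubP (c : E) (r : R) x : ccub c r x <-> forall i, `|x 0 i - c 0 i| <= r.
Proof. by split => h i; have := h i; rewrite !mxE ler_norml; lra. Qed.

Lemma cubP (c : E) (r : R) x : cub c r x <-> forall i, - r <= x 0 i - c 0 i < r.
Proof. by split => h i; have := h i; rewrite !mxE; lra. Qed.

Lemma cub_in (c : E) (r : R) x : (forall i, `|x 0 i - c 0 i| < r) -> cub c r x.
Proof. by move=> h; apply/cubP => i; have := h i; rewrite ltr_norml; lra. Qed.

Lemma cub_good (r : R) : 0 < r -> good (const_mx (2 * r) : E).
Proof. by move=> r0 i j; rewrite !mxE; lra. Qed.

Lemma lam_cub (r : R) : lam (const_mx (2 * r) : E) = 2 * n%:R * r.
Proof. by rewrite /lam; under eq_bigr do rewrite mxE; rewrite sumr_const card_ord -mulr_natr; ring. Qed.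

Lemma volb_cub (r : R) : volb (const_mx (2 * r) : E) = (2 * r) ^+ n.
Proof. by rewrite /volb; under eq_bigr do rewrite mxE; rewrite prodr_const card_ord. Qed.

Lemma ccub_sub (c : E) (r r' : R) : r <= r' -> ccub c r `<=` ccub c r'.
Proof. by move=> rr x /ccubP h; apply/ccubP => i; exact: le_trans (h i) rr. Qed.

Lemma cub_sub (c : E) (r r' : R) : r <= r' -> cub c r `<=` cub c r'.
Proof. by move=> rr x /cubP h; apply/cubP => i; have := h i; lra. Qed.

Lemma ccub_cub (c : E) (r r' : R) : r < r' -> ccub c r `<=` cub c r'.
Proof. by move=> rr x /ccubP h; apply/cubP => i; have := h i; rewrite ler_norml; lra. Qed.

Lemma Int_zero (c : E) (r : R) f : continuous f -> (forall x, 0 <= f x) -> Int (cub c r) (fun x => f x * w x) <= 0 ->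
  forall x, (forall i, `|x 0 i - c 0 i| < r) -> f x = 0.
Proof.
move=> cf f0 z x hx; apply/eqP; rewrite eq_le f0 andbT leNgt; apply/negP => fx.
have oC : open [set y : E | forall i, `|y 0 i - c 0 i| < r].
  rewrite (_ : mkset _ = obox (c - const_mx r) (const_mx (2 * r))); first exact: open_obox.
  by apply/seteqP; split=> y h i; have := h i; rewrite !mxE ltr_norml; lra.
have [e e0 he] := open_ball_sub oC hx.
have f2 : 0 < f x / 2 by rewrite divr_gt0.
have [r1 r10 hr1] := uniform_cont cf (@compact_set1 _ x) f2.
pose s := Num.min e r1 / 2.
have m0 : 0 < Num.min e r1 by rewrite lt_min e0.
have s0 : 0 < s by rewrite divr_gt0.
have se : s < e by rewrite /s ltr_pdivrMr//; apply: (@le_lt_trans _ _ e); [rewrite ge_min lexx|lra].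
have sr : s < r1 by rewrite /s ltr_pdivrMr//; apply: (@le_lt_trans _ _ r1); [rewrite ge_min lexx orbT|lra].
have bb (q : R) y : s < q -> cub x s y -> ball x q y.
  move=> sq /cubP h; split; first exact: lt_trans sq.
  move=> i j; rewrite (ord1 i) /ball/= distrC; have := h j; rewrite ltr_norml; lra.
have sub : cub x s `<=` cub c r by move=> y /(bb _ _ se)/he; exact: cub_in.
have fl y : cub x s y -> f x / 2 <= f y.
  by move=> /(bb _ _ sr) /(hr1 x y erefl); rewrite ltr_norml; lra.
have wp := weight_Int_gt0 (x - const_mx s) (cub_good s0).
suff : f x / 2 * Int (cub x s) w <= 0 by rewrite leNgt mulr_gt0.
apply: le_trans z; rewrite -(IntZ (f x / 2) (msb_box _ _) (iw _ _)).
apply: (@le_trans _ _ (Int (cub x s) (fun y => f y * w y))).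
  apply: Int_le; [exact: msb_box|by apply: intgZ => //; exact: msb_box|exact: (intg_contw iw)|].
  by move=> y /fl h; exact: ler_wpM2r.
apply: Int_subset => //; [exact: msb_box|exact: msb_box|exact: (intg_contw iw)|].
by move=> y _; rewrite mulr_ge0.
Qed.

End pde.

(** * De Giorgi iteration *)

Section degiorgi.
Context {R : realType} {n : nat}.
Variables (d C0 C1 : R) (Gamma : set 'rV[R]_n) (A : 'rV[R]_n -> 'M[R]_n).
Local Notation E := 'rV[R]_n.
Implicit Types (x y z a s : E) (t u v f eta : E -> R) (g G gv : E -> E) (K : set E).
Local Notation Omega := (~` Gamma).
Local Notation delta := (dist_to Gamma).
Local Notation w := (weight Gamma d).
Local Notation q := (q_ (R := R) (n := n)).
Hypotheses (n0 : (0 < n)%N) (d0 : 0 < d) (dn : d < n%:R - 1) (C01 : 1 <= C0) (C11 : 1 <= C1)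
  (G0 : Gamma !=set0) (cG : closed Gamma) (AR : ahlfors_regular Gamma d C0)
  (el : elliptic Gamma d C1 A).
Variables (Mp : R) (Mp0 : 0 < Mp)
  (hMp : forall (c : E) (r r' : R) y k, r < r' -> `|pd k (plat c r r') y| <= Mp / (r' - r)).

Let w0 x : 0 <= w x. Proof. exact: weight_ge0. Qed.
Let mw D : msb D -> mfn D w. Proof. exact: weight_mfn. Qed.
Let iw a s : intg (box a s) w. Proof. exact: (weight_intg_box n0 d0 dn C01 G0 cG AR). Qed.
Let oO : open Omega. Proof. exact: closed_openC. Qed.
Let mO : msb Omega. Proof. exact: measurable_open. Qed.
Let CA0 : 0 < @CA R n d C0. Proof. exact: CA_gt0. Qed.
Let nn : 0 < n%:R :> R. Proof. by rewrite ltr0n. Qed.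

Lemma gr_plat (c : E) (r r' : R) x : r < r' -> enorm (gr (plat c r r') x) ^+ 2 <= (n%:R * (Mp / (r' - r))) ^+ 2.
Proof.
move=> rr; have h : enorm (gr (plat c r r') x) <= n%:R * (Mp / (r' - r)).
  by apply: enorm_le_sup => i; rewrite mxE; exact: hMp.
by rewrite ler_sqr ?nnegrE ?enorm_ge0// (le_trans _ h)// enorm_ge0.
Qed.

Lemma plat_out (c : E) (r r' : R) x : r < r' -> ~ ccub c r' x -> plat c r r' x = 0.
Proof.
move=> rr nx; have [i hi] : exists i, r' < `|x 0 i - c 0 i|.
  apply: contrapT => h; apply: nx; apply/ccubP => i; rewrite leNgt; apply/negP => hi; apply: h; by exists i.
by apply: (plat0 (i := i)) => //; exact: ltW.
Qed.

Lemma plat_in (c : E) (r r' : R) x : r < r' -> ccub c r x -> plat c r r' x = 1.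
Proof. by move=> rr /ccubP; exact: plat1. Qed.

Lemma is_derive_posB m (k s : R) :
  is_derive s 1 (fun b : R => pos (k - b) ^+ m.+2) (- (m.+2%:R * pos (k - s) ^+ m.+1)).
Proof.
have h : is_derive s 1 (fun r : R => k - r) (-1).
  by have := is_derive_affine k (-1) s; congr (is_derive _ _ _ _); apply/funext => r; rewrite mulN1r.
have := is_derive_comp h (is_derive_posX m (k - s)); by rewrite mulrN1.
Qed.

Lemma cont_posB m (k : R) : continuous (fun s : R => pos (k - s) ^+ m).
Proof.
apply: contXR; apply: cont_pos.
rewrite (_ : (fun _ => _) = (fun s : R => k + (-1) * s)); last by apply/funext => s; rewrite mulN1r.
apply: contDR; first exact: cst_continuous.
by apply: (contMR (f := fun=> -1) (g := id)); [exact: cst_continuous|move=> s; exact: cvg_id].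
Qed.

(** The fourth power, because the L^2 inequalities are applied to the C^1 truncation
    [pos (k - t) ^ 2]. *)
Definition Yk t (c : E) (k r : R) := Int (cub c r) (fun x => pos (k - t x) ^+ 4 * w x).

Lemma Yk_intg t c k r : continuous t -> intg (cub c r) (fun x => pos (k - t x) ^+ 4 * w x).
Proof. by move=> ct; apply: (intg_contw iw); exact: (cont_comp (@cont_posB 4 k) ct). Qed.

Lemma Yk_mono t c (k k' r r' : R) : continuous t -> k' <= k -> r' <= r -> Yk t c k' r' <= Yk t c k r.
Proof.
move=> ct kk rr; apply: (@le_trans _ _ (Int (cub c r) (fun x => pos (k' - t x) ^+ 4 * w x))).
  apply: Int_subset; [exact: msb_box|exact: msb_box|exact: cub_sub|exact: Yk_intg|].
  by move=> x _; rewrite mulr_ge0// exprn_ge0// pos_ge0.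
apply: Int_le; [exact: msb_box|exact: Yk_intg|exact: Yk_intg|move=> x _].
apply: ler_wpM2r => //; rewrite ler_pXn2r ?nnegrE ?pos_ge0//.
by apply: pos_mono; rewrite lerD2r.
Qed.

Lemma Yk_ge0 t c k r : 0 <= Yk t c k r.
Proof. by apply: Int_ge0 => x _; rewrite mulr_ge0// exprn_ge0// pos_ge0. Qed.

Definition K2 : R := (2 * n%:R * (3 * (2 * n%:R * @CA R n d C0) * (2 * n%:R))) ^+ 2 *
   ((4 * C1 ^+ 4 + 2) * (2 * n%:R * Mp) ^+ 2).

(** Smallness of [Yk] forces [t >= k1] on at least half the mass of each piece of depth [N]. Then
    Faber-Krahn, with its factor [q ^ N], applies to [eta * pos (k1 - t) ^ 2], whose energy is at
    most a constant times [Yk / (r - r1)^2]. *)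
Lemma DG_step t G c (r r1 k k1 m0 : R) (N : nat) : sol d Gamma A t G -> 0 < r1 -> r1 < r -> k1 < k ->
  ccub c r `<=` above Gamma t k ->
  (forall a' s', good s' -> box a' s' `<=` cub c r -> volb s' = volb (const_mx (2 * r) : E) / 2 ^+ N ->
     2 * m0 <= Int (box a' s') w) ->
  Yk t c k r <= (k - k1) ^+ 4 * m0 ->
  Yk t c k1 r1 <= K2 * (r * q ^+ N / (r - r1)) ^+ 2 * Yk t c k r.
Proof.
move=> S r10 rr kk sub big small; have [ct wg GG eG _] := S.
have r0 : 0 < r by exact: lt_trans rr.
pose r2 := (r + r1) / 2; have r12 : r1 < r2 by rewrite /r2; lra.
have r2r : r2 < r by rewrite /r2; lra.
pose eta := plat c r1 r2; have se : smooth eta by exact: plat_smooth.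
pose K := ccub c r2; have cK : compact K by exact: compact_cbox.
have e0 x : ~ K x -> eta x = 0 by exact: plat_out.
have KQ : K `<=` cub c r by exact: ccub_cub.
have KQ' : K `<=` ccub c r by exact/ccub_sub/ltW.
pose B := n%:R * (Mp / (r2 - r1)).
have grB x : enorm (gr eta x) ^+ 2 <= B ^+ 2 by exact: gr_plat.
pose F (s : R) := pos (k1 - s) ^+ 2; pose F' (s : R) := - (2%:R * pos (k1 - s) ^+ 1).
have dF (s : R) : is_derive s 1 F (F' s) by exact: is_derive_posB.
have cF : continuous F by exact: cont_posB.
have cF' : continuous F'.
  rewrite (_ : F' = (fun b : R => (-2) * pos (k1 - b) ^+ 1)); last by apply/funext => b; rewrite /F' mulNr.
  by apply: contMR; [exact: cst_continuous|exact: cont_posB].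
have Fz (s : R) : k1 <= s -> F s = 0 /\ F' s = 0.
  by move=> h; rewrite /F /F' pos_le0 ?subr_le0// !expr0n/= mulr0 oppr0.
pose O := above Gamma t k1; have oOk : open O by exact: above_open.
have subO : ccub c r `<=` O.
  by apply: subset_trans sub _ => x [|/= h]; [left|right; exact: lt_trans kk h].
pose f x := eta x * F (t x).
have cFt : continuous (fun x => F (t x)) by exact: cont_comp.
have cF't : continuous (fun x => F' (t x)) by exact: cont_comp.
have ce := smooth_cont se.
have cf : continuous f by exact: contM.
pose g x := (eta x * F' (t x)) *: G x + F (t x) *: gr eta x.
have wf : weak_gradient O f g.
  have := wg_smoothM oOk cFt (wg_trunc cG S dF cF' Fz) se.
  by move=> h; apply: (wg_eq oOk h) => // x _; rewrite /g scalerA.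
have gG x : Gamma x -> g x = 0.
  move=> Gx; rewrite /g (GG x Gx) scaler0 add0r.
  have [kx|nk] := pselect (K x); last by rewrite (gr_supp se cK e0 nk) scaler0.
  have [//|/= h] := sub x (KQ' x kx).
  by have [-> _] := Fz (t x) (ltW (lt_trans kk h)); rewrite scale0r.
have ie a s : cbox a s `<=` O -> intg (box a s) (fun x => enorm (g x) ^+ 2 * w x).
  by move=> _; apply: (energy_box n0 d0 dn C01 G0 cG AR a s S _ cFt se); exact: contM.
pose Z := [set x | k1 <= t x].
have mZ : msb Z.
  apply: measurable_closed; have /continuous_closedP cc := ct; have h := cc _ (@closed_ge R k1); exact: h.
have fZ x : Z x -> f x = 0 by move=> h; rewrite /f (Fz _ h).1 mulr0.
(* Chebyshev's inequality: [pos (k - t) ^ 4 >= (k - k1) ^ 4] where [t < k1]. *)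
have half a' s' : good s' -> box a' s' `<=` cub c r -> volb s' = volb (const_mx (2 * r) : E) / 2 ^+ N ->
    2^-1 * Int (box a' s') w <= Int (box a' s' `&` Z) w.
  move=> gs' bs' vs'; have hb := big a' s' gs' bs' vs'; have mB := msb_box a' s'.
  have m1 : msb (box a' s' `&` Z) by exact: measurableI.
  have m2 : msb (box a' s' `\` Z) by exact: measurableD.
  have eB : box a' s' = (box a' s' `&` Z) `|` (box a' s' `\` Z) by rewrite setDE -setIUr setUCr setIT.
  have e1 : Int (box a' s') w = Int (box a' s' `&` Z) w + Int (box a' s' `\` Z) w.
    rewrite {1}eB IntU//; last by rewrite -eB.
    by move=> x [_ h] [_ h'].
  have i2 : intg (box a' s' `\` Z) w by apply: intgS (iw a' s').
  have iY := @Yk_intg t c k r ct.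
  have kp : 0 < (k - k1) ^+ 4 by rewrite exprn_gt0// subr_gt0.
  suff : Int (box a' s' `\` Z) w <= m0 by lra.
  rewrite -(ler_pM2l kp); apply: le_trans small.
  rewrite -IntZ//; apply: (@le_trans _ _ (Int (box a' s' `\` Z) (fun x => pos (k - t x) ^+ 4 * w x))); last first.
    apply: Int_subset => //; [exact: msb_box|by move=> x [/bs']|].
    by move=> x _; rewrite mulr_ge0// exprn_ge0// pos_ge0.
  apply: Int_le => //; first exact: intgZ.
    by apply: intgS iY => //; [exact: msb_box|move=> x [/bs']].
  move=> x [_ /= /negP]; rewrite -ltNge => h; apply: ler_wpM2r => //.
  rewrite ler_pXn2r ?nnegrE ?pos_ge0 ?subr_ge0 ?(ltW kk)//.
  by apply: le_trans (le_pos _); lra.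
have FK := faber_krahn2 n0 d0 dn C01 G0 cG AR oOk cf wf gG ie mZ fZ (cub_good r0) subO half.
set En := Int _ (fun x => enorm (g x) ^+ 2 * w x) in FK.
have Yf : Yk t c k1 r1 <= Int (cub c r) (fun x => f x ^+ 2 * w x).
  have if2 : intg (cub c r) (fun x => f x ^+ 2 * w x) by apply: (intg_contw iw); exact: (contM cf cf).
  apply: (@le_trans _ _ (Int (cub c r1) (fun x => f x ^+ 2 * w x))); last first.
    apply: Int_subset => //; [exact: msb_box|exact: msb_box|exact/cub_sub/ltW|].
    by move=> x _; rewrite mulr_ge0// sqr_ge0.
  rewrite /Yk le_eqVlt; apply/orP; left; apply/eqP; apply: Int_eq => x bx.
  by rewrite /f /eta plat_in//; [rewrite mul1r /F -exprM|exact: box_cbox].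
(* With the cube as [psi] and a third of the fourth power as [h], [psi^2 = h (- psi')] holds with
   equality. *)
pose psi (s : R) := pos (k1 - s) ^+ 3; pose psi' (s : R) := - (3%:R * pos (k1 - s) ^+ 2).
have cp' : continuous psi'.
  rewrite (_ : psi' = (fun b : R => (-3) * pos (k1 - b) ^+ 2)); last by apply/funext => b; rewrite /psi' mulNr.
  by apply: contMR; [exact: cst_continuous|exact: cont_posB].
pose h x := 3^-1 * pos (k1 - t x) ^+ 4.
have ch : continuous h by apply: contM; [exact: cst_continuous|exact: (cont_comp (@cont_posB 4 k1) ct)].
have hge x : 0 <= h x by rewrite mulr_ge0// exprn_ge0// pos_ge0.
have ep x : Gamma x -> eta x * psi (t x) = 0.
  move=> Gx; have [kx|nk] := pselect (K x); last by rewrite e0// mul0r.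
  have [//|/= hh] := sub x (KQ' x kx).
  by rewrite /psi pos_le0 ?expr0n ?mulr0// subr_le0 ltW// (lt_trans kk).
have hp x : K x -> 0 <= - psi' (t x) /\ psi (t x) ^+ 2 <= h x * - psi' (t x).
  move=> _; rewrite /psi' opprK; split; first by rewrite mulr_ge0// exprn_ge0// pos_ge0.
  rewrite /psi /h; move: (pos _) => p; have -> : 3^-1 * p ^+ 4 * (3%:R * p ^+ 2) = (p ^+ 3) ^+ 2 by field.
  by [].
have [iP cac] := caccioppoli n0 d0 dn C01 C11 G0 cG AR el S se cK e0 (is_derive_posB 1 k1) cp' ch hge ep hp.
pose P x := eta x ^+ 2 * - psi' (t x) * enorm (G x) ^+ 2 * w x.
pose H x := pos (k1 - t x) ^+ 4 * enorm (gr eta x) ^+ 2 * w x.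
have cH : continuous (fun x => pos (k1 - t x) ^+ 4 * enorm (gr eta x) ^+ 2).
  by apply: contM; [exact: (cont_comp (@cont_posB 4 k1) ct)|exact: gr_cont].
have iH : intg (cub c r) H by exact: (intg_contw iw).
have HK x : ~ cub c r x -> H x = 0.
  by move=> nb; rewrite /H (gr_supp se cK e0) ?enorm0 ?expr0n/= ?mulr0 ?mul0r// => /KQ.
have mQ : msb (cub c r) by exact: msb_box.
have eH : Int setT (fun x => h x * enorm (gr eta x) ^+ 2 * w x) = 3^-1 * Int (cub c r) H.
  rewrite -IntZ//; rewrite (Int_mkcond mQ (@msbT R n)) //.
    by apply: Int_eq => x _; rewrite /h /H; ring.
  move=> x _ nb; have -> : h x * enorm (gr eta x) ^+ 2 * w x = 3^-1 * H x by rewrite /h /H; ring.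
  by rewrite HK// mulr0.
have HY : Int (cub c r) H <= B ^+ 2 * Yk t c k r.
  rewrite -IntZ//; last exact: Yk_intg.
  apply: Int_le => //; first by apply: intgZ => //; exact: Yk_intg.
  move=> x _; rewrite /H mulrA; apply: ler_wpM2r => //; rewrite mulrC.
  apply: ler_pM => //; [exact: sqr_ge0|by rewrite exprn_ge0// pos_ge0|].
  rewrite ler_pXn2r ?nnegrE ?pos_ge0//; apply: pos_mono; lra.
have EnB : En <= (4 * C1 ^+ 4 + 2) * (B ^+ 2 * Yk t c k r).
  have iPQ : intg (cub c r) P by apply: (intgS mQ (@msbT R n)) iP.
  have PT : Int (cub c r) P <= Int setT P.
    apply: Int_subset => //; first exact: msbT.
    move=> x _; rewrite /P; apply: mulr_ge0 => //; apply: mulr_ge0; last exact: sqr_ge0.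
    apply: mulr_ge0; first exact: sqr_ge0.
    by rewrite /psi' opprK mulr_ge0// exprn_ge0// pos_ge0.
  (* Here [F'^2 = 4 pos^2] and [- psi' = 3 pos^2]; the factor is [2 * 4 / 3], the 2 coming from the
     square of a sum. *)
  have E1 : En <= 8 / 3 * Int (cub c r) P + 2 * Int (cub c r) H.
    rewrite -!IntZ// -IntD//; [|exact: intgZ|exact: intgZ].
    apply: Int_le => //; first exact: ie.
      by apply: intgD => //; exact: intgZ.
    move=> x _; rewrite /P /H.
    have -> : 8 / 3 * (eta x ^+ 2 * - psi' (t x) * enorm (G x) ^+ 2 * w x) +
        2 * (pos (k1 - t x) ^+ 4 * enorm (gr eta x) ^+ 2 * w x) =
      (2 * (4 * eta x ^+ 2 * pos (k1 - t x) ^+ 2 * enorm (G x) ^+ 2) +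
       2 * (pos (k1 - t x) ^+ 4 * enorm (gr eta x) ^+ 2)) * w x by rewrite /psi'; field.
    apply: ler_wpM2r => //; apply: le_trans (enormD2 _ _) _; apply: lerD; rewrite ler_wpM2l//.
      by rewrite enormZ exprMn real_normK ?num_real// /F' le_eqVlt; apply/orP; left; apply/eqP; ring.
    by rewrite enormZ exprMn real_normK ?num_real// /F -exprM.
  have IH0 : 0 <= Int (cub c r) H by apply: Int_ge0 => x _; rewrite /H mulr_ge0// mulr_ge0 ?sqr_ge0// exprn_ge0// pos_ge0.
  have C14 : 0 <= C1 ^+ 4 by rewrite exprn_ge0// (le_trans ler01).
  rewrite -/P eH in cac.
  have PH : Int (cub c r) P <= 4 * C1 ^+ 4 * (3^-1 * Int (cub c r) H) by exact: le_trans PT cac.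
  have : (4 * C1 ^+ 4 + 2) * Int (cub c r) H <= (4 * C1 ^+ 4 + 2) * (B ^+ 2 * Yk t c k r).
    by rewrite ler_wpM2l// addr_ge0// mulr_ge0.
  have : 0 <= C1 ^+ 4 * Int (cub c r) H by exact: mulr_ge0.
  move: E1 PH; move: (Int _ P) (Int _ H) (_ * Yk _ _ _ _) (C1 ^+ 4) => P' H' Y M E1 PH h1 h2; lra.
apply: (le_trans Yf); apply: (le_trans FK).
rewrite lam_cub; apply: (@le_trans _ _ ((2 * n%:R * (3 * (2 * n%:R * @CA R n d C0) * (2 * n%:R * r * q ^+ N))) ^+ 2 *
   ((4 * C1 ^+ 4 + 2) * (B ^+ 2 * Yk t c k r)))).
  by rewrite ler_wpM2l// sqr_ge0.
rewrite le_eqVlt; apply/orP; left; apply/eqP.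
have D0 : r - r1 != 0 by rewrite subr_eq0 gt_eqF.
have -> : B = 2 * n%:R * Mp / (r - r1) by rewrite /B (_ : r2 - r1 = (r - r1) / 2); [field|rewrite /r2; field].
by rewrite /K2; field.
Qed.

(** De Giorgi's lemma with threshold [nu0], as a predicate, so that one [nu0] can be chosen for all
    Gamma and A. *)
Definition DG (nu0 : R) := forall t G c (r k b : R), sol d Gamma A t G -> 0 < r -> 0 < b ->
  ccub c r `<=` above Gamma t k -> Yk t c k r <= nu0 * b ^+ 4 * Int (cub c r) w ->
  forall x, (forall i, `|x 0 i - c 0 i| < r / 2) -> k - b <= t x.

Lemma K2_ge0 : 0 <= K2.
Proof.
rewrite /K2; apply: mulr_ge0; first exact: sqr_ge0.
apply: mulr_ge0; last exact: sqr_ge0.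
by rewrite addr_ge0// mulr_ge0// exprn_ge0// (le_trans ler01).
Qed.

Lemma q_pos : 0 < q. Proof. exact: q_gt0. Qed.

(** Step [j] uses gaps of radii and levels proportional to [2^-j] and bisects to depth
    [N = al * j + be]. Shrinking radii cost [4^j], paid by [q ^ (2 * al * j)]; the remaining
    [q ^ (2 * be)] makes the step contract by [rho = 1 / (2^al 16)]. This is exactly the rate at
    which the admissible size decays: [16^-j] from the level gaps, [2^(- al j)] from the masses of
    the pieces. *)
Lemma deGiorgi_iter (al be : nat) (nu0 : R) : 4 * q ^+ (2 * al) <= 1 ->
  16 * K2 * q ^+ (2 * be) <= (2 ^+ al * 16)^-1 -> 0 <= nu0 -> nu0 * (32 * @CA R n d C0 * 2 ^+ n * 2 ^+ be) <= 1 -> DG nu0.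
Proof.
move=> c1 c2 nu0p c3 t G c r k b S r0 b0 sub small x hx.
have [ct _ _ _ _] := S.
pose h (j : nat) : R := 2^-1 ^+ j.
have h0 j : 0 < h j by rewrite exprn_gt0.
have h1 j : h j <= 1 by rewrite exprn_ile1 ?invr_ge0// invf_le1// ler1n.
have hS j : h j.+1 = h j / 2 by rewrite /h exprS mulrC.
pose rj j := r / 2 * (1 + h j); pose kj j := k - b * (1 - h j).
have rj_lo j : r / 2 < rj j by rewrite /rj ltr_pMr ?divr_gt0// ltrDl.
have rj_hi j : rj j <= r.
  apply: (@le_trans _ _ (r / 2 * 2)); last by rewrite divfK.
  by rewrite /rj ler_pM2l ?divr_gt0//; have := h1 j; lra.
have rjp j : 0 < rj j by apply: lt_trans (rj_lo j); rewrite divr_gt0.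
have kj_lo j : k - b <= kj j.
  by rewrite /kj lerD2l lerN2 ger_pMr//; have := h0 j; lra.
have kj_hi j : kj j <= k by rewrite /kj gerBl mulr_ge0 ?(ltW b0)// subr_ge0.
set m := Int (cub c r) w in small.
have m_gt0 : 0 < m by apply: (weight_Int_gt0 n0 d0 dn C01 G0 cG AR); exact: cub_good.
pose rho : R := (2 ^+ al * 16)^-1.
have rho0 : 0 < rho by rewrite invr_gt0 mulr_gt0// exprn_gt0.
have inv j : Yk t c (kj j) (rj j) <= nu0 * b ^+ 4 * m * rho ^+ j.
  elim: j => [|j IH].
    rewrite expr0 mulr1; apply: le_trans small; apply: Yk_mono => //.
  pose N := (al * j + be)%N.
  (* By [weight_sub], a piece of depth [N] has mass at least [2 * m0]; [2 ^+ n] accounts for the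
     shrunken cube, whose half-side is at least [r / 2]. *)
  pose m0 := m / (2 * (@CA R n d C0 * (2 ^+ n * 2 ^+ N))).
  have n2 : 0 < 2 ^+ n :> R by exact: exprn_gt0.
  have N2 : 0 < 2 ^+ N :> R by exact: exprn_gt0.
  have rdiff : rj j - rj j.+1 = r / 4 * h j by rewrite /rj hS; field.
  have kdiff : kj j - kj j.+1 = b * h j / 2 by rewrite /kj hS; field.
  have rlt : rj j.+1 < rj j by rewrite -subr_gt0 rdiff mulr_gt0// divr_gt0.
  have klt : kj j.+1 < kj j by rewrite -subr_gt0 kdiff !mulr_gt0// invr_gt0.
  have sub' : ccub c (rj j) `<=` above Gamma t (kj j).
    move=> y /(ccub_sub (rj_hi j))/sub[|/= hy]; [by left|right; exact: le_lt_trans hy].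
  have big a' s' : good s' -> box a' s' `<=` cub c (rj j) ->
      volb s' = volb (const_mx (2 * rj j) : E) / 2 ^+ N -> 2 * m0 <= Int (box a' s') w.
    move=> gs' bs' vs'.
    have sb : box a' s' `<=` cub c r by apply: subset_trans bs' _; exact: cub_sub.
    have ws := weight_sub n0 d0 dn C01 G0 cG AR (cub_good r0) gs' sb.
    rewrite -/(cub c r) -/m vs' !volb_cub in ws.
    have rn : 0 < r ^+ n by exact: exprn_gt0.
    have v1 : r ^+ n <= (2 * rj j) ^+ n.
      have hh : r <= 2 * rj j by rewrite mulrC -ler_pdivrMr// ltW.
      by apply: lerXn2r => //; rewrite nnegrE; [exact: ltW|rewrite mulr_ge0// ltW].
    have ws2 : r ^+ n / 2 ^+ N * m <= @CA R n d C0 * (2 * r) ^+ n * Int (box a' s') w.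
      by apply: le_trans ws; rewrite ler_pM2r// ler_pM2r ?invr_gt0.
    have -> : 2 * m0 = m / (@CA R n d C0 * (2 ^+ n * 2 ^+ N)) by rewrite /m0; field; rewrite !gt_eqF.
    rewrite ler_pdivrMr ?mulr_gt0// -(ler_pM2l rn).
    have -> : r ^+ n * m = 2 ^+ N * (r ^+ n / 2 ^+ N * m) by field; rewrite gt_eqF.
    have -> : r ^+ n * (Int (box a' s') w * (@CA R n d C0 * (2 ^+ n * 2 ^+ N))) =
      2 ^+ N * (@CA R n d C0 * (2 * r) ^+ n * Int (box a' s') w) by rewrite exprMn; ring.
    by rewrite ler_pM2l.
  have hN : 2 ^+ N = (2 ^+ al) ^+ j * 2 ^+ be :> R by rewrite /N exprD exprM.
  have h4 : h j ^+ 4 = 16^-1 ^+ j.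
    by rewrite /h -exprM mulnC exprM; congr (_ ^+ _); field.
  have rhoj : rho ^+ j = ((2 ^+ al) ^+ j)^-1 * 16^-1 ^+ j.
    by rewrite /rho invfM exprMn !exprVn.
  have a2 : 0 < (2 ^+ al) ^+ j :> R by rewrite !exprn_gt0.
  have b2 : 0 < 2 ^+ be :> R by rewrite exprn_gt0.
  have small' : Yk t c (kj j) (rj j) <= (kj j - kj j.+1) ^+ 4 * m0.
    apply: le_trans IH _; rewrite kdiff rhoj.
    have -> : (b * h j / 2) ^+ 4 * m0 = b ^+ 4 * m * (((2 ^+ al) ^+ j)^-1 * 16^-1 ^+ j) * (32 * @CA R n d C0 * 2 ^+ n * 2 ^+ be)^-1.
      rewrite /m0 hN -h4; field; rewrite !gt_eqF//.
    have -> : nu0 * b ^+ 4 * m * (((2 ^+ al) ^+ j)^-1 * 16^-1 ^+ j) = b ^+ 4 * m * (((2 ^+ al) ^+ j)^-1 * 16^-1 ^+ j) * nu0 by ring.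
    apply: ler_wpM2l; last by rewrite -[leRHS]mul1r ler_pdivlMr// !mulr_gt0.
    apply: mulr_ge0; first by rewrite mulr_ge0 ?(ltW m_gt0)// exprn_ge0// ltW.
    by apply: mulr_ge0; [rewrite invr_ge0 ltW|rewrite exprn_ge0// invr_ge0].
  have step := DG_step S (rjp j.+1) rlt klt sub' big small'.
  apply: le_trans step _.
  have q0 := q_pos; have Yg := @Yk_ge0 t c (kj j) (rj j).
  have coef : K2 * (rj j * q ^+ N / (rj j - rj j.+1)) ^+ 2 <= rho.
    rewrite rdiff; have -> : rj j * q ^+ N / (r / 4 * h j) = 4 * (rj j / r) * (q ^+ N / h j) by field; rewrite !gt_eqF.
    have X1 : (4 * (rj j / r) * (q ^+ N / h j)) ^+ 2 <= 16 * (q ^+ N / h j) ^+ 2.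
      rewrite [leLHS]exprMn [(4 * _) ^+ 2]exprMn; apply: ler_wpM2r.
        exact: sqr_ge0.
      rewrite (_ : 16 = 4 ^+ 2 * 1 :> R); last by ring.
      apply: ler_wpM2l; first exact: sqr_ge0.
      rewrite exprn_ile1//; first by rewrite divr_ge0 ?(ltW (rjp j)) ?(ltW r0).
      by rewrite ler_pdivrMr// mul1r.
    have X2 : (q ^+ N / h j) ^+ 2 <= q ^+ (2 * be).
      have -> : (q ^+ N / h j) ^+ 2 = (4 * q ^+ (2 * al)) ^+ j * q ^+ (2 * be).
        rewrite /h exprVn invrK exprMn (_ : 2 ^+ j ^+ 2 = 4 ^+ j :> R); last by rewrite -exprM mulnC exprM; congr (_ ^+ _); ring.
        have -> : q ^+ N ^+ 2 = q ^+ (2 * al) ^+ j * q ^+ (2 * be) by rewrite -!exprM -exprD; congr (_ ^+ _); rewrite /N mulnC mulnDr mulnA.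
        by rewrite exprMn; ring.
      rewrite ger_pMl ?exprn_gt0//; apply: exprn_ile1 => //.
      by rewrite mulr_ge0// exprn_ge0// ltW.
    apply: le_trans (ler_wpM2l K2_ge0 X1) _.
    apply: le_trans c2; rewrite mulrA [K2 * 16]mulrC; apply: ler_wpM2l => //.
    by rewrite mulr_ge0// K2_ge0.
  apply: le_trans (ler_wpM2r Yg coef) _.
  by rewrite (exprS rho j) [leRHS]mulrCA; apply: ler_wpM2l => //; exact: ltW.
have rho2 : rho <= 2^-1.
  rewrite /rho lef_pV2 ?posrE ?mulr_gt0 ?exprn_gt0//.
  have : 1 <= 2 ^+ al :> R by apply: exprn_ege1; rewrite ler1n.
  lra.
have z : Yk t c (k - b) (r / 2) <= 0.
  apply/ler_addgt0Pr => e e0; rewrite add0r.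
  have [J hJ] := half_pow_small (nu0 * b ^+ 4 * m) e0.
  apply: le_trans (Yk_mono c ct (kj_lo J) (ltW (rj_lo J))) _.
  apply: le_trans (inv J) _; apply: le_trans (ltW (hJ J (leqnn J))).
  rewrite -exprVn; apply: ler_wpM2l; last by rewrite lerXn2r// nnegrE ?invr_ge0// ltW.
  by rewrite mulr_ge0 ?(ltW m_gt0)// mulr_ge0// exprn_ge0// ltW.
have cP : continuous (fun x => pos (k - b - t x) ^+ 4) by exact: (cont_comp (@cont_posB 4 (k - b)) ct).
have p0 y : 0 <= pos (k - b - t y) ^+ 4 by rewrite exprn_ge0// pos_ge0.
have := Int_zero n0 d0 dn C01 G0 cG AR cP p0 z hx => /eqP.
by rewrite expf_eq0/= => /eqP pz; have := le_pos (k - b - t x); rewrite pz; lra.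
Qed.

Definition K4 : R := 4 * C1 ^+ 4 * ((2 * n%:R * Mp) ^+ 2 * (@CA R n d C0 * 2 ^+ n)).

(** [4 * tau_] is [exp (- L)] with [L = 2 + 16 P^2 K4 / nu0]. Where [t < tau_] the logarithm is at
    least [L - 1], and [nu0 (L - 1)^2 >= 16 P^2 K4] is what the smallness hypothesis of [DG] comes
    down to. *)
Definition tau_ (P nu0 : R) : R := expR (- (2 + 16 * P ^+ 2 * K4 / nu0)) / 4.

Lemma K4_ge0 : 0 <= K4.
Proof.
rewrite /K4; apply: mulr_ge0; first by rewrite mulr_ge0// exprn_ge0// (le_trans ler01).
apply: mulr_ge0; first exact: sqr_ge0.
by rewrite mulr_ge0 ?(ltW CA0)// exprn_ge0.
Qed.

(** The Caccioppoli inequality with [lpsi] and [h = 1]. The bound is independent of [tau], which can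
    therefore be taken as small as the iteration requires. *)
Lemma log_energy t G c (r tau : R) : sol d Gamma A t G -> 0 < r -> 0 < tau -> 2 * tau <= 1 ->
  (forall x, ccub c (2 * r) x -> tau <= t x) -> ccub c (2 * r) `<=` above Gamma t 2^-1 ->
  Int (cub c r) (fun x => enorm (lphi' tau (t x) *: G x) ^+ 2 * w x) <= K4 / r ^+ 2 * Int (cub c r) w.
Proof.
move=> S r0 t0 t2 tpos sub; have [ct wg GG eG _] := S.
pose r2 := 3 / 2 * r; have r12 : r < r2 by rewrite /r2; lra.
have r2r : r2 < 2 * r by rewrite /r2; lra.
pose eta := plat c r r2; have se : smooth eta by exact: plat_smooth.
pose K := ccub c r2; have cK : compact K by exact: compact_cbox.
have e0 x : ~ K x -> eta x = 0 by exact: plat_out.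
have KQ' : K `<=` ccub c (2 * r) by exact/ccub_sub/ltW.
have KQ : K `<=` cub c (2 * r) by exact: ccub_cub.
have ep x : Gamma x -> eta x * lpsi tau (t x) = 0.
  move=> Gx; have [kx|nk] := pselect (K x); last by rewrite e0// mul0r.
  by have [//|/= /ltW hh] := sub x (KQ' x kx); rewrite lpsi0 ?mulr0.
have hp x : K x -> 0 <= - lpsi' tau (t x) /\ lpsi tau (t x) ^+ 2 <= 1 * - lpsi' tau (t x).
  by move=> /KQ'/tpos h; have [] := lpsi_ineq t0 h.
have c1 : continuous (fun _ : E => 1 : R) by exact: cst_continuous.
have [iP cac] := caccioppoli n0 d0 dn C01 C11 G0 cG AR el S se cK e0 (is_derive_lpsi t0) (lpsi'_cont t0) c1 (fun _ => ler01) ep hp.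
have mQ : msb (cub c r) by exact: msb_box.
set B := n%:R * (Mp / (r2 - r)).
have iP' : intg (cub c r) (fun x => eta x ^+ 2 * - lpsi' tau (t x) * enorm (G x) ^+ 2 * w x).
  by apply: (intgS mQ (@msbT R n)) iP.
apply: (@le_trans _ _ (Int (cub c r) (fun x => eta x ^+ 2 * - lpsi' tau (t x) * enorm (G x) ^+ 2 * w x))).
  apply: Int_le => //.
    have := energy_box n0 d0 dn C01 G0 cG AR (c - const_mx r) (const_mx (2 * r)) S (cont_comp (lphi'_cont t0) ct) (@cst_continuous _ _ 0) se.
    by apply: intg_eq => // x _; rewrite scale0r addr0.
  move=> x bx; apply: ler_wpM2r => //; rewrite enormZ exprMn real_normK ?num_real//.
  apply: ler_wpM2r; first exact: sqr_ge0.
  rewrite /eta plat_in//; last exact: box_cbox.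
  rewrite expr1n mul1r; have : tau <= t x by apply: tpos; apply: (ccub_sub (r := r)); [lra|exact: box_cbox].
  by move=> /(lpsi_ineq t0)[].
have Pge x : 0 <= eta x ^+ 2 * - lpsi' tau (t x) * enorm (G x) ^+ 2 * w x.
  apply: mulr_ge0 => //; apply: mulr_ge0; last exact: sqr_ge0.
  have [/hp[h _]|/e0 ->] := pselect (K x); last by rewrite expr0n/= mul0r.
  by apply: mulr_ge0 => //; exact: sqr_ge0.
apply: (@le_trans _ _ (Int setT (fun x => eta x ^+ 2 * - lpsi' tau (t x) * enorm (G x) ^+ 2 * w x))).
  by apply: Int_subset => //; exact: msbT.
apply: le_trans cac _.
rewrite (_ : K4 / r ^+ 2 * _ = 4 * C1 ^+ 4 * ((2 * n%:R * Mp) ^+ 2 * (@CA R n d C0 * 2 ^+ n) / r ^+ 2 * Int (cub c r) w)); last by rewrite /K4; ring.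
apply: ler_wpM2l; first by rewrite mulr_ge0// exprn_ge0// (le_trans ler01).
have mQ2 : msb (cub c (2 * r)) by exact: msb_box.
have i2 : intg (cub c (2 * r)) (fun x => 1 * enorm (gr eta x) ^+ 2 * w x).
  by apply: (intg_contw iw); apply: contM => //; exact: gr_cont.
rewrite (Int_mkcond mQ2 (@msbT R n)) //; last first.
  by move=> x _ nb; rewrite (gr_supp se cK e0) ?enorm0 ?expr0n/= ?mulr0 ?mul0r// => /KQ.
apply: (@le_trans _ _ (B ^+ 2 * Int (cub c (2 * r)) w)).
  rewrite -(IntZ _ mQ2 (iw _ _)); apply: (Int_le mQ2 i2); first exact: (intgZ _ mQ2 (iw _ _)).
  by move=> x _; apply: ler_wpM2r => //; rewrite mul1r; exact: gr_plat.
have sQ : cub c r `<=` cub c (2 * r) by apply: cub_sub; lra.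
have r20 : 0 < 2 * r by rewrite mulr_gt0.
have ws := weight_sub n0 d0 dn C01 G0 cG AR (cub_good r20) (cub_good r0) sQ.
rewrite !volb_cub in ws.
have rn : 0 < (2 * r) ^+ n by exact: exprn_gt0.
have {}ws : Int (cub c (2 * r)) w <= @CA R n d C0 * 2 ^+ n * Int (cub c r) w.
  rewrite -(ler_pM2l rn); apply: le_trans ws _.
  by rewrite [(2 * (2 * r)) ^+ n]exprMn le_eqVlt; apply/orP; left; apply/eqP; ring.
apply: le_trans (ler_wpM2l (sqr_ge0 B) ws) _.
rewrite le_eqVlt; apply/orP; left; apply/eqP; rewrite /B /r2; field.
by rewrite gt_eqF//=; lra.
Qed.

(** The last hypothesis is a Poincare inequality for functions that vanish where [t >= 1/2], as
    [lphi (tau + t)] does. With [log_energy] it bounds the square integral of the logarithm; since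
    the logarithm is large on [t < tau], that set has little mass and [DG] applies at level
    [tau]. *)
Lemma growth_core (P nu0 : R) t G c (r : R) : 0 <= P -> 0 < nu0 -> DG nu0 -> sol d Gamma A t G -> 0 < r ->
  (forall x, ccub c (2 * r) x -> 0 <= t x) -> ccub c (2 * r) `<=` above Gamma t 2^-1 ->
  (forall (tau : R) O f g, 0 < tau -> 2 * tau <= 1 -> open O -> continuous f -> weak_gradient O f g -> (forall x, Gamma x -> g x = 0) ->
    (forall a s, cbox a s `<=` O -> intg (box a s) (fun x => enorm (g x) ^+ 2 * w x)) -> ccub c r `<=` O ->
    (forall x, 2^-1 <= t x -> f x = 0) ->
    Int (cub c r) (fun x => f x ^+ 2 * w x) <= (P * r) ^+ 2 * Int (cub c r) (fun x => enorm (g x) ^+ 2 * w x)) ->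
  forall x, (forall i, `|x 0 i - c 0 i| < r / 2) -> tau_ P nu0 / 2 <= t x.
Proof.
move=> P0 nu0p dg S r0 tpos sub poin x hx; have [ct wg GG eG _] := S.
set L := 2 + 16 * P ^+ 2 * K4 / nu0; set tau := tau_ P nu0.
have K4p := K4_ge0.
have X0 : 0 <= 16 * P ^+ 2 * K4 / nu0.
  apply: divr_ge0; last exact: ltW.
  by apply: mulr_ge0 => //; apply: mulr_ge0 => //; exact: sqr_ge0.
have L0 : 0 < L by rewrite /L ltr_wpDr.
have tau0 : 0 < tau by rewrite /tau /tau_ divr_gt0// expR_gt0.
have tau4 : 4 * tau <= 1.
  by rewrite /tau /tau_ mulrC divfK// -/L -expR0 ler_expR oppr_le0 ltW.
have tau2 : 2 * tau <= 1 by lra.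
(* The shift by [tau] keeps the function at or above [tau], where [inve] and [lne] are the true
   reciprocal and logarithm. *)
have ST := sol_affine n0 C11 G0 cG el tau 1 S.
set T := (fun x => tau + 1 * t x) in ST; set GT := (fun x => 1 *: G x) in ST.
have [cT _ GTG _ _] := ST.
have Tt y : T y = tau + t y by rewrite /T mul1r.
have subT : ccub c (2 * r) `<=` above Gamma T 2^-1.
  by move=> y /sub[|/= h]; [left|right; rewrite /= Tt; lra].
have Tpos y : ccub c (2 * r) y -> tau <= T y by move=> /tpos; rewrite Tt; lra.
have en := log_energy ST r0 tau0 tau2 Tpos subT.
pose f y := lphi tau (T y).
have cf : continuous f.
  apply: (cont_comp _ cT) => s; have [h _] := is_derive_lphi tau0 tau2 s; exact/differentiable_continuous/derivable1_diffP.
have ie a s : cbox a s `<=` above Gamma T 2^-1 -> intg (box a s) (fun x => enorm (lphi' tau (T x) *: GT x) ^+ 2 * w x).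
  move=> _; have := energy_box n0 d0 dn C01 G0 cG AR a s ST (cont_comp (lphi'_cont tau0) cT) (@cst_continuous _ _ 0) (smooth_cst 0).
  by apply: intg_eq => [|y _]; [exact: msb_box|rewrite scale0r addr0].
have gG y : Gamma y -> lphi' tau (T y) *: GT y = 0 by move=> /GTG ->; rewrite scaler0.
have rr2 : r <= 2 * r by lra.
have sO : ccub c r `<=` above Gamma T 2^-1 by apply: subset_trans subT; exact: ccub_sub.
have fz y : 2^-1 <= t y -> f y = 0.
  move=> h; have h' : 2^-1 <= T y by rewrite Tt; lra.
  by have [] := lphi0 tau2 h'.
have wf := wg_trunc cG ST (is_derive_lphi tau0 tau2) (lphi'_cont tau0) (@lphi0 _ _ tau2).
have h1 := poin tau _ _ _ tau0 tau2 (above_open cG cT) cf wf gG ie sO fz.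
have h2 : Int (cub c r) (fun x => f x ^+ 2 * w x) <= P ^+ 2 * K4 * Int (cub c r) w.
  apply: le_trans h1 _; apply: le_trans (ler_wpM2l (sqr_ge0 _) en) _.
  by rewrite le_eqVlt; apply/orP; left; apply/eqP; field; rewrite gt_eqF.
have sub2 : ccub c r `<=` above Gamma t tau.
  by move=> y /(ccub_sub rr2)/sub[|/= h]; [left|right; rewrite /=; lra].
have th2 : 0 < tau / 2 by rewrite divr_gt0.
suff small : Yk t c tau r <= nu0 * (tau / 2) ^+ 4 * Int (cub c r) w.
  by have := dg t G c r tau (tau / 2) S r0 th2 sub2 small x hx; lra.
have lnL : ln (2 * (2 * tau))^-1 = L.
  rewrite (_ : 2 * (2 * tau) = expR (- L)); last by rewrite /tau /tau_ -/L; field.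
  by rewrite -expRN opprK expRK.
have mQ : msb (cub c r) by exact: msb_box.
have fl y : cub c r y -> t y < tau -> (L - 1) ^+ 2 <= f y ^+ 2.
  move=> by_ ty; have Ty : tau <= T y by apply: Tpos; apply: (ccub_sub rr2); exact: box_cbox.
  have T2 : T y <= 2 * tau by rewrite Tt; lra.
  have t22 : 2 * tau <= 2^-1 by lra.
  have := lphi_lower tau0 Ty T2 t22; rewrite lnL => h.
  have L1 : 0 <= L - 1 by rewrite /L; lra.
  by rewrite ler_sqr ?nnegrE// (le_trans L1).
have Lsq : 16 * P ^+ 2 * K4 <= nu0 * (L - 1) ^+ 2.
  have e1 : L - 1 = 1 + 16 * P ^+ 2 * K4 / nu0 by rewrite /L; ring.
  rewrite e1 -ler_pdivrMl// mulrC; move: (16 * P ^+ 2 * K4 / nu0) X0 => X X0.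
  have := sqr_ge0 X; have : (1 + X) ^+ 2 = 1 + 2 * X + X ^+ 2 by ring.
  lra.
have L1p : 0 < (L - 1) ^+ 2 by rewrite exprn_gt0// /L; lra.
rewrite -(ler_pM2l L1p); apply: (@le_trans _ _ (tau ^+ 4 * Int (cub c r) (fun x => f x ^+ 2 * w x))).
  have if2 : intg (cub c r) (fun x => f x ^+ 2 * w x) by apply: (intg_contw iw); exact: (contM cf cf).
  rewrite -!IntZ//; [|exact: Yk_intg]; apply: Int_le => //; [by apply: intgZ => //; exact: Yk_intg|exact: intgZ|].
  move=> y by_; rewrite [leLHS]mulrA [leRHS]mulrA; apply: ler_wpM2r => //.
  have [ty|ty] := ltP (t y) tau; last first.
    by rewrite pos_le0 ?subr_le0// expr0n/= mulr0 mulr_ge0 ?sqr_ge0// exprn_ge0// ltW.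
  rewrite mulrC; apply: ler_pM; [by rewrite exprn_ge0// pos_ge0|exact: ltW| |exact: fl].
  rewrite ler_pXn2r ?nnegrE ?pos_ge0 ?(ltW tau0)// -[leRHS]pos_gt0 ?(ltW tau0)//; apply: pos_mono.
  have : 0 <= t y by apply: tpos; apply: (ccub_sub rr2); exact: box_cbox.
  lra.
have t4 : 0 <= tau ^+ 4 by rewrite exprn_ge0// ltW.
apply: le_trans (ler_wpM2l t4 h2) _.
have m0 : 0 <= Int (cub c r) w by exact: Int_ge0.
have -> : (L - 1) ^+ 2 * (nu0 * (tau / 2) ^+ 4 * Int (cub c r) w) =
  tau ^+ 4 / 16 * Int (cub c r) w * (nu0 * (L - 1) ^+ 2) by field.
have -> : tau ^+ 4 * (P ^+ 2 * K4 * Int (cub c r) w) = tau ^+ 4 / 16 * Int (cub c r) w * (16 * P ^+ 2 * K4) by field.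
by apply: ler_wpM2l => //; apply: mulr_ge0 => //; apply: divr_ge0.
Qed.

Definition Pz (nu : R) : R := 2 * n%:R * ((1 + nu^-1) * (2 * n%:R * @CA R n d C0) * (2 * n%:R)).
Definition Pt (c1 : R) : R := 2 * n%:R * (KT (n := n) d C0 c1 * (2 * n%:R)).

Lemma growth_zero (nu nu0 : R) t G c (r : R) (Z : set E) : 0 < nu -> 0 < nu0 -> DG nu0 -> sol d Gamma A t G -> 0 < r ->
  (forall x, ccub c (2 * r) x -> 0 <= t x) -> ccub c (2 * r) `<=` above Gamma t 2^-1 ->
  msb Z -> Z `<=` cub c r -> (forall x, Z x -> 2^-1 <= t x) -> nu * Int (cub c r) w <= Int Z w ->
  forall x, (forall i, `|x 0 i - c 0 i| < r / 2) -> tau_ (Pz nu) nu0 / 2 <= t x.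
Proof.
move=> nu_0 nu0p dg S r0 tpos sub mZ Zs tZ hZ.
apply: (growth_core _ nu0p dg S r0 tpos sub).
  rewrite /Pz; apply: mulr_ge0; first by rewrite mulr_ge0.
  apply: mulr_ge0; last by rewrite mulr_ge0.
  apply: mulr_ge0; first by rewrite addr_ge0// invr_ge0 ltW.
  by apply: mulr_ge0; [rewrite mulr_ge0|exact: ltW].
move=> tau O f g tau0 tau2 oO' cf wf gG ie sO fz.
have fZ x : Z x -> f x = 0 by move=> /tZ/fz.
have := poincare2_zero n0 d0 dn C01 G0 cG AR oO' cf wf gG ie (cub_good r0) sO nu_0 mZ Zs fZ hZ.
rewrite lam_cub => h; apply: le_trans h _; rewrite le_eqVlt; apply/orP; left; apply/eqP.
by rewrite /Pz; ring.
Qed.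

(** In the compact cube [t > 1/2] holds on Gamma, hence near Gamma, and there the truncated
    logarithm vanishes, as the trace inequality asks. *)
Lemma growth_trace (c1 nu0 : R) t G c (r : R) : 0 < c1 -> 0 < nu0 -> DG nu0 -> sol d Gamma A t G -> 0 < r ->
  (forall x, ccub c (2 * r) x -> 0 <= t x) -> ccub c (2 * r) `<=` above Gamma t 2^-1 ->
  c1 * (2 * n%:R * r) `^ d <= sg d Gamma (c - const_mx r) (const_mx (2 * r)) ->
  forall x, (forall i, `|x 0 i - c 0 i| < r / 2) -> tau_ (Pt c1) nu0 / 2 <= t x.
Proof.
move=> c10 nu0p dg S r0 tpos sub hs; have [ct _ _ _ _] := S.
apply: (growth_core _ nu0p dg S r0 tpos sub).
  rewrite /Pt; apply: mulr_ge0; first by rewrite mulr_ge0.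
  apply: mulr_ge0; last by rewrite mulr_ge0.
  exact: (KT_ge0 n0 dn C01 c10).
move=> tau O f g tau0 tau2 oO' cf wf gG ie sO fz.
have rr2 : r <= 2 * r by lra.
have subr : ccub c r `<=` above Gamma t 2^-1 by apply: subset_trans sub; exact: ccub_sub.
have [d1 d10 hd] := compact_above G0 cG (@compact_cbox R n (c - const_mx r) (const_mx (2 * r))) ct subr.
have fz' x : ccub c r x -> delta x < d1 -> f x = 0 by move=> cx /(hd x cx)/ltW/fz.
have hs' : c1 * lam (const_mx (2 * r) : E) `^ d <= sg d Gamma (c - const_mx r) (const_mx (2 * r)) by rewrite lam_cub.
have := poincare2_trace n0 d0 dn C01 G0 cG AR oO' cf wf gG ie (cub_good r0) sO d10 fz' c10 hs'.
rewrite lam_cub => h; apply: le_trans h _; rewrite le_eqVlt; apply/orP; left; apply/eqP.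
by rewrite /Pt; ring.
Qed.

End degiorgi.

(** * Growth lemmas and the interior Harnack inequality *)

Section harnack.
Context {R : realType} {n : nat}.
Variables (d C0 C1 : R).
Local Notation E := 'rV[R]_n.
Implicit Types (x y z a s c : E) (t u v f : E -> R) (G : E -> E) (K Z : set E) (Gamma : set E) (A : E -> 'M[R]_n).
Hypotheses (n0 : (0 < n)%N) (d0 : 0 < d) (dn : d < n%:R - 1) (C01 : 1 <= C0) (C11 : 1 <= C1).
Local Notation q := (q_ (R := R) (n := n)).

Definition setting Gamma A :=
  [/\ Gamma !=set0, closed Gamma, ahlfors_regular Gamma d C0 & elliptic Gamma d C1 A].

Lemma exists_q_le (b : R) : 0 < b -> exists k, q ^+ (2 * k) <= b.
Proof.
move=> b0; have [J hJ] := exists_q_pow n0 1 b0; exists J.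
apply: le_trans (ltW hJ); rewrite mul1r mulnC muln2 -addnn exprD.
have q0 := q_gt0 n0 (R := R).
rewrite ger_pMl ?exprn_gt0//; apply: exprn_ile1; [exact: ltW|exact/ltW/(q_lt1 n0)].
Qed.

Lemma DG_exists : exists2 nu0 : R, 0 < nu0 & forall Gamma A, setting Gamma A -> DG d Gamma A nu0.
Proof.
have [Mp Mp0 hMp] := @pd_plat_bound R n.
have K20 : 0 <= K2 (n := n) d C0 C1 Mp by exact: K2_ge0.
have [al hal] := @exists_q_le 4^-1 ltac:(by []).
have [be hbe] : exists be, 16 * K2 (n := n) d C0 C1 Mp * q ^+ (2 * be) <= (2 ^+ al * 16)^-1.
  have p0 : 0 < (2 ^+ al * 16)^-1 / (16 * K2 (n := n) d C0 C1 Mp + 1).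
    by rewrite divr_gt0 ?invr_gt0 ?mulr_gt0 ?exprn_gt0// ltr_wpDl// mulr_ge0.
  have [be h] := exists_q_le p0; exists be.
  have K1 : 0 < 16 * K2 (n := n) d C0 C1 Mp + 1 by rewrite ltr_wpDl// mulr_ge0.
  move: h; rewrite ler_pdivlMr// mulrC => h; apply: le_trans h; apply: ler_wpM2r; last by lra.
  by rewrite exprn_ge0// ltW// q_gt0.
have CAp : 0 < @CA R n d C0 by exact: CA_gt0.
have p0 : 0 < 32 * @CA R n d C0 * 2 ^+ n * 2 ^+ be.
  by apply: mulr_gt0; [apply: mulr_gt0; [apply: mulr_gt0|exact: exprn_gt0]|exact: exprn_gt0].
exists (32 * @CA R n d C0 * 2 ^+ n * 2 ^+ be)^-1; first by rewrite invr_gt0.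
move=> Gamma A [G0 cG AR el].
apply: (deGiorgi_iter n0 d0 dn C01 C11 G0 cG AR el hMp _ hbe).
- by move: hal; rewrite -[4^-1]mul1r ler_pdivlMr// mulrC.
- by rewrite invr_ge0 ltW.
- by rewrite mulVf// gt_eqF.
Qed.

Lemma tau_gt0 (Mp P nu0 : R) : 0 < tau_ (n := n) d C0 C1 Mp P nu0.
Proof. by rewrite divr_gt0// expR_gt0. Qed.

Lemma growth_interior (nu : R) : 0 < nu -> exists2 th : R, 0 < th & forall Gamma A t G c (r l : R) Z,
  setting Gamma A -> sol d Gamma A t G -> 0 < r -> 0 < l -> ccub c (2 * r) `<=` ~` Gamma ->
  (forall x, ccub c (2 * r) x -> 0 <= t x) -> msb Z -> Z `<=` cub c r -> (forall x, Z x -> l <= t x) ->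
  nu * Int (cub c r) (weight Gamma d) <= Int Z (weight Gamma d) ->
  forall x, (forall i, `|x 0 i - c 0 i| < r / 2) -> th * l <= t x.
Proof.
move=> nu_0; have [nu0 nu0p dg] := DG_exists; have [Mp Mp0 hMp] := @pd_plat_bound R n.
exists (tau_ (n := n) d C0 C1 Mp (Pz (n := n) d C0 nu) nu0 / 2); first by rewrite divr_gt0// tau_gt0.
move=> Gamma A t G c r l Z S st r0 l0 sub tpos mZ Zs tZ hZ x hx; have [G0 cG AR el] := S.
have st' := sol_affine n0 C11 G0 cG el 0 l^-1 st.
have e y : 0 + l^-1 * t y = t y / l by rewrite add0r mulrC.
rewrite -ler_pdivlMr// -e.
apply: (growth_zero n0 d0 dn C01 C11 G0 cG AR el hMp nu_0 nu0p (dg _ _ S) st' r0 _ _ mZ Zs _ hZ hx).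
- by move=> y /tpos h; rewrite e divr_ge0// ltW.
- by move=> y /sub; left.
- by move=> y /tZ h; rewrite e ler_pdivlMr//; lra.
Qed.

Lemma sg_cub Gamma y (r : R) : ahlfors_regular Gamma d C0 -> Gamma y -> 0 < r ->
  C0^-1 / (2 * n%:R) `^ d * lam (const_mx (2 * r) : E) `^ d <= sg d Gamma (y - const_mx r) (const_mx (2 * r)).
Proof.
move=> AR Gy r0; have nn : 0 < 2 * n%:R :> R by rewrite mulr_gt0 ?ltr0n.
have -> : C0^-1 / (2 * n%:R) `^ d * lam (const_mx (2 * r) : E) `^ d = C0^-1 * r `^ d.
  have h0 : 0 < (2 * n%:R) `^ d :> R by rewrite powR_gt0.
  rewrite lam_cub [(2 * n%:R * r) `^ d]powRM ?(ltW r0) ?(ltW nn)//.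
  have := C01 => C0p; have C0n : C0 != 0 by rewrite gt_eqF// (lt_le_trans ltr01).
  by move: ((2 * n%:R) `^ d) h0 => X X0; field; rewrite C0n gt_eqF.
have by_ : cub y r y by apply: cub_in => i; rewrite subrr normr0.
have hfin := sg_fin n0 AR (cub_good r0) Gy by_.
rewrite -lee_fin /sg fineK; last by rewrite ge0_fin_numE ?outer_measure_ge0// (le_lt_trans hfin)// ltry.
apply: le_trans (ar_lo AR Gy r0) _; apply: le_outer_measure => z [Gz hz]; split=> //.
by apply: cub_in => i; have := le_lt_trans (coord_le_enorm (z - y) i) hz; rewrite !mxE.
Qed.

(** By Ahlfors regularity Gamma carries a fixed share of Hausdorff mass in every cube centred on it,
    so a lower bound on Gamma spreads to a smaller cube. *)
Lemma growth_boundary : exists2 th : R, 0 < th & forall Gamma A t G y (r l : R),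
  setting Gamma A -> sol d Gamma A t G -> Gamma y -> 0 < r -> 0 < l ->
  (forall x, ccub y (2 * r) x -> 0 <= t x) -> (forall x, Gamma x -> ccub y (2 * r) x -> l <= t x) ->
  forall x, (forall i, `|x 0 i - y 0 i| < r / 2) -> th * l <= t x.
Proof.
have [nu0 nu0p dg] := DG_exists; have [Mp Mp0 hMp] := @pd_plat_bound R n.
pose c1 := C0^-1 / (2 * n%:R) `^ d.
have c10 : 0 < c1 by rewrite divr_gt0 ?invr_gt0 ?powR_gt0 ?mulr_gt0 ?ltr0n// (lt_le_trans ltr01).
exists (tau_ (n := n) d C0 C1 Mp (Pt (n := n) d C0 c1) nu0 / 2); first by rewrite divr_gt0// tau_gt0.
move=> Gamma A t G y r l S st Gy r0 l0 tpos tG x hx; have [G0 cG AR el] := S.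
have st' := sol_affine n0 C11 G0 cG el 0 l^-1 st.
have e z : 0 + l^-1 * t z = t z / l by rewrite add0r mulrC.
have sgl := sg_cub AR Gy r0; rewrite lam_cub in sgl.
rewrite -ler_pdivlMr// -e.
apply: (growth_trace n0 d0 dn C01 C11 G0 cG AR el hMp c10 nu0p (dg _ _ S) st' r0 _ _ sgl hx).
- by move=> z /tpos h; rewrite e divr_ge0// ltW.
- move=> z cz; have [Gz|] := pselect (Gamma z); last by left.
  right; rewrite /= e; have := tG z Gz cz; rewrite -(ler_pM2r (_ : 0 < l^-1)) ?invr_gt0// mulfV ?gt_eqF//; lra.
Qed.

Lemma cub_ratio Gamma A c (r : R) : setting Gamma A -> 0 < r ->
  (@CA R n d C0 * 5 ^+ n)^-1 * Int (cub c (5 * r)) (weight Gamma d) <= Int (cub c r) (weight Gamma d).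
Proof.
move=> [G0 cG AR el] r0; have r50 : 0 < 5 * r by rewrite mulr_gt0.
have CAp : 0 < @CA R n d C0 by exact: CA_gt0.
have n5 : 0 < 5 ^+ n :> R by rewrite exprn_gt0.
have rr : r <= 5 * r by lra.
have := weight_sub n0 d0 dn C01 G0 cG AR (cub_good r50) (cub_good r0) (@cub_sub _ _ c _ _ rr).
rewrite !volb_cub => h.
have p0 : 0 < (2 * r) ^+ n by rewrite exprn_gt0// mulr_gt0.
rewrite ler_pdivrMl ?mulr_gt0// -(ler_pM2l p0); apply: le_trans h _.
rewrite (_ : 2 * (5 * r) = 5 * (2 * r)); last by ring.
by rewrite exprMn le_eqVlt; apply/orP; left; apply/eqP; ring.
Qed.

(** The cube of half-side [b] has a fixed share of the mass of the cube of half-side [5 * b], and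
    growth is valid up to [5 / 2 * b], beyond the doubled closed cube. Each doubling costs the
    factor [ga]. *)
Lemma expansion : exists2 ga : R, 0 < ga & forall Gamma A t G z (s l D : R) (j : nat),
  setting Gamma A -> sol d Gamma A t G -> 0 < s -> 0 < l -> 2 ^+ j * s < D ->
  ccub z (5 * D) `<=` ~` Gamma -> (forall x, ccub z (5 * D) x -> 0 <= t x) ->
  (forall x, ccub z s x -> l <= t x) -> forall x, ccub z (2 ^+ j * s) x -> ga ^+ j * l <= t x.
Proof.
have CAp : 0 < @CA R n d C0 by exact: CA_gt0.
have nu0 : 0 < (@CA R n d C0 * 5 ^+ n)^-1 by rewrite invr_gt0 mulr_gt0// exprn_gt0.
have [ga ga0 H] := growth_interior nu0.
exists ga => // Gamma A t G z s l D j S st s0 l0 sD sub tpos base.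
elim: j sD => [|j IH] sD x; first by rewrite expr0 !mul1r; exact: base.
have p0 : 0 < 2 ^+ j * s by rewrite mulr_gt0// exprn_gt0.
have e2 : 2 ^+ j.+1 * s = 2 * (2 ^+ j * s) by rewrite exprS mulrA.
rewrite e2 in sD *; have sD' : 2 ^+ j * s < D by lra.
set b := 2 ^+ j * s in IH p0 sD sD' e2 *.
have b5 : 0 < 5 * b by rewrite mulr_gt0.
have sb : ccub z (2 * (5 * b)) `<=` ccub z (5 * D) by apply: ccub_sub; lra.
move=> /ccubP hx; rewrite exprS -mulrA.
apply: (H Gamma A t G z (5 * b) (ga ^+ j * l) (cub z b) S st b5).
- by rewrite mulr_gt0// exprn_gt0.
- exact: subset_trans sb sub.
- by move=> y /sb/tpos.
- exact: msb_box.
- by apply: cub_sub; lra.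
- by move=> y /box_cbox; exact: IH.
- exact: cub_ratio S p0.
- by move=> i; have := hx i; lra.
Qed.

(** De Giorgi's lemma for [- t]: if [t >= H / 2] on too small a set, then [t c <= 3 / 4 * H],
    against [t c = H]. The upper bound on [t] turns the mass of that set into a bound on [Yk]. *)
Lemma sup_critical (be : nat) : exists2 nu : R, 0 < nu & forall Gamma A t G c (r H : R),
  setting Gamma A -> sol d Gamma A t G -> 0 < r -> 0 < H -> ccub c r `<=` ~` Gamma ->
  (forall x, ccub c r x -> t x <= 2 ^+ be * H) -> t c = H ->
  exists Z, [/\ msb Z, Z `<=` cub c r, forall x, Z x -> H / 2 <= t x &
    nu * Int (cub c r) (weight Gamma d) <= Int Z (weight Gamma d)].
Proof.
have [nu0 nu0p dg] := DG_exists.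
pose M : R := 2 ^+ be; have M0 : 0 < M by rewrite exprn_gt0.
exists (nu0 / (4 * M) ^+ 4); first by rewrite divr_gt0// exprn_gt0// mulr_gt0.
move=> Gamma A t G c r H S st r0 H0 sub tM tc; have [G0 cG AR el] := S.
have [ct _ _ _ _] := st.
pose Z := cub c r `&` [set x | H / 2 <= t x].
have mZ : msb Z.
  apply: measurableI; first exact: msb_box.
  apply: measurable_closed; have /continuous_closedP cc := ct; have h := cc _ (@closed_ge R (H / 2)); exact: h.
exists Z; split=> //; [by move=> x []|by move=> x []|].
rewrite leNgt; apply/negP => small.
have st' := sol_affine n0 C11 G0 cG el 0 (-1) st.
set t' := (fun x => 0 + -1 * t x) in st'.
have e y : t' y = - t y by rewrite /t' add0r mulN1r.
have H4 : 0 < H / 4 by rewrite divr_gt0.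
have iw a s : intg (box a s) (weight Gamma d) by exact: (weight_intg_box n0 d0 dn C01 G0 cG AR).
have [ct' _ _ _ _] := st'.
have key : Yk d Gamma t' c (- (H / 2)) r <= nu0 * (H / 4) ^+ 4 * Int (cub c r) (weight Gamma d).
  have MH : 0 <= (M * H) ^+ 4 by rewrite exprn_ge0// mulr_ge0 ?ltW.
  apply: (@le_trans _ _ ((M * H) ^+ 4 * Int Z (weight Gamma d))); last first.
    apply: le_trans (ler_wpM2l MH (ltW small)) _.
    by rewrite le_eqVlt; apply/orP; left; apply/eqP; field; rewrite gt_eqF.
  have iZ : intg Z (weight Gamma d) by apply: intgS (iw (c - const_mx r) (const_mx (2 * r))) => //; [exact: msb_box|move=> x []].
  rewrite -IntZ// /Yk (@Int_mkcond _ _ Z (cub c r)) //; last 3 first.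
  - exact: msb_box.
  - by move=> x [].
  - move=> x bx nZ; have : t x < H / 2 by rewrite ltNge; apply/negP => h; apply: nZ.
    by move=> h; rewrite e pos_le0 ?expr0n ?mul0r//; lra.
  apply: Int_le => //.
  - have iY := Yk_intg n0 d0 dn C01 G0 cG AR c (- (H / 2)) r ct'.
    by apply: intgS iY => //; [exact: msb_box|move=> x []].
  - exact: intgZ.
  move=> x [bx /= hx]; apply: ler_wpM2r; first exact: weight_ge0.
  rewrite e; have := tM x (box_cbox bx); rewrite -/M => tx.
  have p0 : 0 <= M * H by rewrite mulr_ge0 ?ltW.
  apply: lerXn2r; rewrite ?nnegrE ?pos_ge0//.
  by rewrite ge_max p0 andbT; lra.
have sub' : ccub c r `<=` above Gamma t' (- (H / 2)) by move=> x /sub; left.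
have hc i : `|c 0 i - c 0 i| < r / 2 by rewrite subrr normr0 divr_gt0.
have := dg Gamma A S t' _ c r (- (H / 2)) (H / 4) st' r0 H4 sub' key c hc.
by rewrite e tc; lra.
Qed.

Lemma enorm_cub x c (r : R) : (forall i, `|x 0 i - c 0 i| <= r) -> enorm (x - c) <= n%:R * r.
Proof. by move=> h; apply: enorm_le_sup => i; rewrite !mxE. Qed.

Lemma cub_enorm x c (r : R) : enorm (x - c) <= r -> ccub c r x.
Proof. by move=> h; apply/ccubP => i; have := coord_le_enorm (x - c) i; rewrite !mxE => h'; exact: le_trans h. Qed.

Lemma enorm_shift_cont c : continuous (fun z : E => enorm (z - c)).
Proof. by apply: (cont_shift (f := @enorm R n)); exact: enorm_cont. Qed.

Lemma contX f m : continuous f -> continuous (fun z : E => f z ^+ m).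
Proof.
move=> cf; elim: m => [|m IH].
  by rewrite (_ : (fun _ => _) = fun=> 1); [exact: cst_continuous|apply/funext => z; rewrite expr0].
by rewrite (_ : (fun _ => _) = (fun z => f z * f z ^+ m)); [exact: contM|apply/funext => z; rewrite exprS].
Qed.

Lemma compact_eball c (r : R) : compact [set z : E | enorm (z - c) <= r].
Proof.
apply: (subclosed_compact _ (@compact_cbox R n (c - const_mx r) (const_mx (2 * r)))); last by move=> z /cub_enorm.
have /continuous_closedP cc := @enorm_shift_cont c; have h := cc _ (@closed_le R r); exact: h.
Qed.

(* The maximum of [t D^b], where [D] is the distance to the sphere: near the
   maximum point [X] the function is comparable to [t X] from above. *)
Lemma weighted_max t c (r : R) (b : nat) x : continuous t -> enorm (x - c) <= r / 2 -> 0 < r -> 0 < t x ->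
  exists X, exists Ds : R, [/\ 0 < Ds <= r, enorm (X - c) = r - Ds, 0 < t X,
    t x * (r / 2) ^+ b.+1 <= t X * Ds ^+ b.+1 &
    forall z, enorm (z - X) <= Ds / 2 -> t z <= 2 ^+ b.+1 * t X].
Proof.
move=> ct hx r0 tx; pose D z := r - enorm (z - c).
pose B : set E := [set z | enorm (z - c) <= r].
have cD : continuous D by apply: contB; [exact: cst_continuous|exact: enorm_shift_cont].
pose F z := t z * D z ^+ b.+1.
have cF : continuous F by apply: contM => //; exact: contX.
have Bx : B x by rewrite /B/=; lra.
have [X BX maxX] := EVT_max_rV (ex_intro _ x Bx) (@compact_eball c r) (continuous_subspaceT cF).
rewrite inE /= in BX.
have FX : F x <= F X by apply: maxX; rewrite inE.
have Dx : r / 2 <= D x by rewrite /D; lra.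
have Fx0 : 0 < F x by rewrite /F mulr_gt0// exprn_gt0//; lra.
have Ds0 : 0 <= D X by rewrite /D subr_ge0.
have FXp := lt_le_trans Fx0 FX.
have Dsp : 0 < D X.
  by rewrite lt_def Ds0 andbT; apply: contraTneq FXp => h; rewrite /F h exprS mul0r mulr0 ltxx.
have DX : 0 < D X ^+ b.+1 by rewrite exprn_gt0.
have H0 : 0 < t X by move: FXp; rewrite /F pmulr_lgt0.
exists X, (D X); split => //.
- by rewrite Dsp/= /D gerBl enorm_ge0.
- by rewrite /D subKr.
- apply: le_trans FX; rewrite /F ler_pM2l// lerXn2r// nnegrE//; lra.
move=> z hz; have Dz : D X / 2 <= D z.
  by have := enorm_trans z X c; rewrite /D in hz *; lra.
have Bz : B z by rewrite /B/=; rewrite /D in Dz Dsp; lra.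
have Fz : F z <= F X by apply: maxX; rewrite inE.
have Dz0 : 0 < D z by lra.
have DzX : 0 < D z ^+ b.+1 by rewrite exprn_gt0.
rewrite -(ler_pM2r DzX); apply: le_trans Fz _; rewrite /F.
have : D X ^+ b.+1 <= (2 * D z) ^+ b.+1 by rewrite lerXn2r// ?nnegrE; lra.
by rewrite exprMn => h; rewrite mulrAC [leRHS]mulrC; apply: ler_wpM2l => //; exact: ltW.
Qed.

(** At the maximum point [X] of [t * D ^ be.+1], [sup_critical] and then [growth_interior] give
    [t >= th * H / 2] on a cube of size about [Ds], and [expansion] carries this to [y] in [j]
    doublings, [2^j] being about [r / Ds]. The total loss is at most a power [be.+1] of [r / Ds],
    and the choice of [X] makes [H] larger than [t x] by just such a power. *)
Lemma interior_harnack : exists2 CH : R, 1 <= CH & forall Gamma A t G c (r : R),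
  setting Gamma A -> sol d Gamma A t G -> 0 < r -> ccub c (21 * r) `<=` ~` Gamma ->
  (forall x, ccub c (21 * r) x -> 0 <= t x) ->
  forall x y, enorm (x - c) <= r / 2 -> enorm (y - c) <= r / 2 -> t x <= CH * t y.
Proof.
have nn : 1 <= n%:R :> R by rewrite ler1n.
have np : 0 < n%:R :> R by rewrite ltr0n.
have [ga ga0 EX] := expansion.
(* Makes the loss [ga ^ j] at most the loss of the weight [D ^ be.+1]. *)
have [be hbe] : exists be : nat, (2 ^+ be.+1)^-1 <= ga.
  have [J hJ] := half_pow_small 1 ga0; exists J; have := hJ J.+1 (leqnSn J); rewrite mul1r => /ltW; exact.
have [nu nu_0 SC] := sup_critical be.+1.
have [th th0 GI] := growth_interior nu_0.
pose CH0 := 2 * (64 * n%:R) ^+ be.+1 / th.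
exists (Num.max 1 CH0); first by rewrite le_max lexx.
move=> Gamma A t G c r S st r0 sub tpos x y hx hy; have [G0 cG AR el] := S; have [ct _ _ _ _] := st.
have ty : 0 <= t y by apply: tpos; apply: (ccub_sub _ (cub_enorm hy)); lra.
have [tx0|tx] := leP (t x) 0.
  by apply: le_trans tx0 _; rewrite mulr_ge0// le_max ler01.
have [X [Ds [/andP[Dsp Dsr] eX H0 Hx Hz]]] := weighted_max be ct hx r0 tx.
set H := t X in H0 Hx Hz.
pose r1 := Ds / (2 * n%:R); have r10 : 0 < r1 by rewrite divr_gt0// mulr_gt0.
have nr1 : n%:R * r1 = Ds / 2 by rewrite /r1; field; rewrite gt_eqF.
have r1D : r1 <= Ds / 2 by rewrite -nr1 ler_peMl// ltW.
(* The expansion runs in cubes of half-side up to [5 * (4 * r)] about [X], which is within [r] of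
   [c]: hence the [21 * r] of the statement. *)
have Xin (b : R) z : ccub X b z -> b <= 20 * r -> ccub c (21 * r) z.
  move=> /ccubP h b20; have Xc : enorm (X - c) <= r by rewrite eX; lra.
  have /ccubP h2 := cub_enorm Xc; apply/ccubP => i; have := h i; have := h2 i.
  by rewrite !ler_norml; lra.
have sub1 : ccub X r1 `<=` ~` Gamma by move=> z /Xin h; apply: sub; apply: h; lra.
have t1 z : ccub X r1 z -> t z <= 2 ^+ be.+1 * H.
  by move=> /ccubP h; apply: Hz; rewrite -nr1; exact: enorm_cub.
have [Z [mZ Zs tZ hZ]] := SC Gamma A t G X r1 H S st r10 H0 sub1 t1 erefl.
have H20 : 0 < H / 2 by rewrite divr_gt0.
have sub2 : ccub X (2 * r1) `<=` ~` Gamma by move=> z /Xin h; apply: sub; apply: h; lra.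
have tp2 z : ccub X (2 * r1) z -> 0 <= t z by move=> /Xin h; apply: tpos; apply: h; lra.
have base := GI Gamma A t G X r1 (H / 2) Z S st r10 H20 sub2 tp2 mZ Zs tZ hZ.
pose s0 := r1 / 4; have s00 : 0 < s0 by rewrite divr_gt0.
have base' z : ccub X s0 z -> th * (H / 2) <= t z.
  by move=> /ccubP h; apply: base => i; have := h i; rewrite /s0; lra.
(* The cube reaches [y], which is within [2 * r] of [X]; the least such [j] keeps [2 ^+ j * s0]
   below [4 * r]. *)
have exj : exists j, 2 * r <= 2 ^+ j * s0.
  have [J hJ] := half_pow_small (2 * r) s00; exists J; have := hJ J (leqnn J).
  by rewrite ltr_pdivrMr ?exprn_gt0// [s0 * _]mulrC => /ltW.
case: (ex_minnP exj) => j hj minj.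
have j4 : 2 ^+ j * s0 < 4 * r.
  case: j hj minj => [|j] hj minj; first by rewrite expr0 mul1r /s0; lra.
  have : 2 ^+ j * s0 < 2 * r by rewrite ltNge; apply/negP => /minj; rewrite ltnn.
  by rewrite exprS -mulrA; lra.
have sub5 : ccub X (5 * (4 * r)) `<=` ~` Gamma by move=> z /Xin h; apply: sub; apply: h; lra.
have tp5 z : ccub X (5 * (4 * r)) z -> 0 <= t z by move=> /Xin h; apply: tpos; apply: h; lra.
have thH : 0 < th * (H / 2) by rewrite mulr_gt0.
have yX : ccub X (2 ^+ j * s0) y.
  apply: (ccub_sub hj); apply: cub_enorm; have := enorm_trans y c X; rewrite (enormB c X) eX; lra.
have := EX Gamma A t G X s0 (th * (H / 2)) (4 * r) j S st s00 thH j4 sub5 tp5 base' y yX.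
have gaj : (s0 / (4 * r)) ^+ be.+1 <= ga ^+ j.
  apply: (@le_trans _ _ (((2 ^+ be.+1)^-1) ^+ j)); last first.
    by rewrite lerXn2r// nnegrE ?invr_ge0 ?exprn_ge0// ltW.
  have -> : ((2 ^+ be.+1)^-1) ^+ j = ((2 ^+ j)^-1) ^+ be.+1 :> R by rewrite !exprVn -!exprM mulnC.
  rewrite lerXn2r// ?nnegrE ?invr_ge0 ?exprn_ge0//; first by rewrite divr_ge0 ?ltW// mulr_gt0.
  rewrite ler_pdivrMr ?mulr_gt0// mulrC -ler_pdivrMr ?invr_gt0 ?exprn_gt0// invrK mulrC; exact: ltW.
move=> fin; have {}fin : (s0 / (4 * r)) ^+ be.+1 * (th * (H / 2)) <= t y.
  by apply: le_trans fin; rewrite ler_pM2r.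
apply: (@le_trans _ _ (CH0 * t y)); last by rewrite ler_wpM2r// le_max lexx orbT.
have rb : 0 < (r / 2) ^+ be.+1 by rewrite exprn_gt0// divr_gt0.
have e1 : (s0 / (4 * r)) ^+ be.+1 = Ds ^+ be.+1 / ((64 * n%:R) ^+ be.+1 * (r / 2) ^+ be.+1).
  rewrite -exprMn -expr_div_n; congr (_ ^+ _); rewrite /s0 /r1; field.
  by rewrite !gt_eqF.
have n64 : 0 < (64 * n%:R) ^+ be.+1 :> R by rewrite exprn_gt0// mulr_gt0.
rewrite -(ler_pM2r rb); apply: le_trans Hx _.
have -> : H * Ds ^+ be.+1 = CH0 * ((s0 / (4 * r)) ^+ be.+1 * (th * (H / 2))) * (r / 2) ^+ be.+1.
  rewrite e1 /CH0; move: rb n64; move: (_ ^+ be.+1) ((64 * _) ^+ _) ((r / 2) ^+ _) => a b' c' c0' b0'.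
  by field; rewrite !gt_eqF.
by rewrite ler_pM2r// ler_pM2l// divr_gt0// mulr_gt0.
Qed.

End harnack.

(** * Harnack chains *)

Section lines.
Context {R : realType} {m : nat}.
Local Notation n := m.+1.
Variables (d C0 : R).
Local Notation E := 'rV[R]_n.
Implicit Types (x y z p X Y V : E) (Gamma : set E).
Hypotheses (d0 : 0 < d) (dn : d < n%:R - 1) (C01 : 1 <= C0).

Lemma powR_archi (a B : R) : 0 < a -> 0 <= B -> exists2 M : nat, (0 < M)%N & B < M%:R `^ a.
Proof.
move=> a0 B0; pose c := (B + 1) `^ a^-1.
have ec : c `^ a = B + 1 by rewrite -powRrM mulVf ?gt_eqF// powRr1//; lra.
exists (Num.truncn c).+1 => //; apply: (@lt_le_trans _ _ (c `^ a)); first by rewrite ec; lra.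
apply: ge0_ler_powR; [exact: ltW|by rewrite nnegrE powR_ge0|by rewrite nnegrE|].
by apply: ltW; exact: truncnS_gt.
Qed.

Lemma powRM3 (x y z : R) : 0 <= x -> 0 <= y -> 0 <= z -> x `^ d * (y `^ d * z `^ d) = (x * (y * z)) `^ d.
Proof. by move=> x0 y0 z0; rewrite -(powRM _ y0 z0) -powRM// mulr_ge0. Qed.

(** A grid in the coordinate hyperplane orthogonal to [e_i]: coordinate [i] is 0 and each of the [m]
    others takes [M] values. *)
Definition gridpt (h : R) (i : 'I_n) (M : nat) (f : {ffun 'I_m -> 'I_M}) : E :=
  \row_j (if unlift i j is Some k then h * (f k)%:R else 0).

Lemma gridpt_le (h : R) (i : 'I_n) (M : nat) (f : {ffun 'I_m -> 'I_M}) : 0 <= h ->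
  enorm (gridpt h i f) <= n%:R * (h * M%:R).
Proof.
move=> h0; apply: enorm_le_sup => j; rewrite mxE; case: unliftP => [k _|_]; last by rewrite normr0 mulr_ge0.
by rewrite normrM ger0_norm// ger0_norm// ler_wpM2l// ler_nat ltnW.
Qed.

Lemma gridpt_inj (h : R) (i : 'I_n) (M : nat) (f f' : {ffun 'I_m -> 'I_M}) : 0 < h ->
  (forall j, `|gridpt h i f 0 j - gridpt h i f' 0 j| < h) -> f = f'.
Proof.
move=> h0 H; apply/ffunP => k; apply/val_inj => /=; have := H (lift i k); rewrite !mxE liftK -mulrBr normrM gtr0_norm//.
rewrite -ltr_pdivlMl// mulVf ?gt_eqF// => h1.
apply/eqP; rewrite -(eqr_nat R); have [//|ne] := eqVneq ((f k)%:R : R) (f' k)%:R.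
have : (1 : R) <= `|(f k)%:R - (f' k)%:R|.
  have [lt|lt|eq] := ltngtP (f k) (f' k).
  - by rewrite distrC ger0_norm ?subr_ge0 ?ler_nat ?(ltnW lt)// lerBrDr -[1]/(1%:R) -natrD ler_nat add1n.
  - by rewrite ger0_norm ?subr_ge0 ?ler_nat ?(ltnW lt)// lerBrDr -[1]/(1%:R) -natrD ler_nat add1n.
  - by move: ne; rewrite eq eqxx.
by rewrite leNgt h1.
Qed.

(* The lines of a grid of parallel lines which pass within tau s of Gamma do so near
   distinct points of a separated net of Gamma, and a net has only O(tau^-d) points,
   fewer than the tau^(1-n) lines. *)
Lemma free_line (K : R) : 0 <= K -> exists2 tau : R, 0 < tau <= 8^-1 & forall Gamma X Y (s : R),
  Gamma !=set0 -> closed Gamma -> ahlfors_regular Gamma d C0 -> 0 < s ->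
  s <= dist_to Gamma X -> s <= dist_to Gamma Y -> enorm (Y - X) <= K * s ->
  exists2 p, enorm p <= s / 4 & forall b : R, 0 <= b <= 1 -> tau * s <= dist_to Gamma (X + p + b *: (Y - X)).
Proof.
move=> K0; pose a := n%:R - 1 - d; have a0 : 0 < a by rewrite subr_gt0.
have nn : 1 <= n%:R :> R by rewrite ler1n.
(* Calibrated so that [2 * LL = L0 * (M * (tau * s / 3))], which turns the size bound of the net
   into [B * M^d] points. *)
pose L0 := 216 * n%:R * (2 * K + 5).
have L00 : 0 < L0 by rewrite mulr_gt0 ?mulr_gt0 ?ltr0n// ltr_wpDl// mulr_ge0.
pose B := C0 ^+ 2 * L0 `^ d.
have B0 : 0 <= B by rewrite mulr_ge0 ?sqr_ge0 ?powR_ge0.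
have [M M0 hM] := powR_archi a0 B0.
have M1 : 1 <= M%:R :> R by rewrite ler1n.
(* The grid of spacing [9 * tau * s] with [M] steps then stays within [s / 4] of the origin. *)
pose tau := (36 * n%:R * M%:R)^-1 : R.
have den : 0 < 36 * n%:R * M%:R :> R by rewrite !mulr_gt0//; lra.
have tau0 : 0 < tau by rewrite invr_gt0.
have nM : 1 <= n%:R * M%:R :> R by rewrite -natrM ler1n muln_gt0.
have tau8 : tau <= 8^-1 by rewrite lef_pV2 ?posrE//; rewrite -mulrA; lra.
exists tau; first by rewrite tau0.
move=> Gamma X Y s G0 cG AR s0 sX sY XY.
pose V := Y - X.
have Vb (b : R) : 0 <= b <= 1 -> enorm (b *: V) <= K * s.
  move=> /andP[b0 b1]; rewrite enormZ ger0_norm//; apply: le_trans XY.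
  by rewrite ler_piMl ?enorm_ge0.
have Ks : 0 <= K * s by rewrite mulr_ge0// ltW.
have ts : tau * s <= s by rewrite ler_piMl ?ltW//; lra.
have ts0 : 0 < tau * s by rewrite mulr_gt0.
have [far|near] := leP ((K + 2) * s) (dist_to Gamma X).
  exists 0; first by rewrite enorm0 divr_ge0// ltW.
  move=> b hb; rewrite addr0; have := dist_lip G0 X (X + b *: V).
  by rewrite opprD addNKr enormN; have := Vb b hb; lra.
have [y0 Gy0 hy0] := dist_lt G0 near.
pose h := 9 * (tau * s); have h0 : 0 < h by rewrite mulr_gt0.
(* The hyperplane of the grid is transversal to the segment: since [V_i] dominates, closeness in
   coordinate [i] controls the displacement along [V] in all coordinates. *)
have [i hi] : exists i, forall j, `|V 0 j| <= `|V 0 i|.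
  have [i h'] := @exists_max_side R n (\row_j `|V 0 j|) isT; exists i => j.
  by have := h' j; rewrite !mxE.
have pf (f : {ffun 'I_m -> 'I_M}) : enorm (gridpt h i f) <= s / 4.
  apply: le_trans (gridpt_le i f (ltW h0)) _; rewrite /h /tau le_eqVlt; apply/orP; left; apply/eqP; field.
  by rewrite !gt_eqF//=; lra.
apply: contrapT => none.
have bad (f : {ffun 'I_m -> 'I_M}) : exists b : R, 0 <= b <= 1 /\ dist_to Gamma (X + gridpt h i f + b *: V) < tau * s.
  apply: contrapT => nb; apply: none; exists (gridpt h i f); first exact: pf.
  by move=> b hb; rewrite leNgt; apply/negP => lt; apply: nb; exists b.
pose LL := (2 * K + 5) * s.
have LL0 : 0 < tau * s <= LL by rewrite ts0/= /LL; lra.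
have [S [_ _ cov sz]] := separated_net d0 C01 AR Gy0 LL0.
have /choice[zf hz] (f : {ffun 'I_m -> 'I_M}) : exists z, z \in S /\ exists2 b : R, 0 <= b <= 1 & enorm (z - (X + gridpt h i f + b *: V)) < 2 * (tau * s).
  have [b [hb lt]] := bad f; have [y Gy hy] := dist_lt G0 lt.
  have yL : enorm (y - y0) < LL.
    have eQ : X + gridpt h i f + b *: V - X = gridpt h i f + b *: V by rewrite -(addrA X) (addrC X) addrK.
    have e1 := enorm_trans y (X + gridpt h i f + b *: V) X; rewrite eQ in e1.
    have e2 := enormD (gridpt h i f) (b *: V); have e3 := pf f; have e4 := Vb b hb.
    have e5 := enorm_trans y X y0; rewrite (enormB y (_ + _)) in e1.
    by rewrite /LL; lra.
  have [z zS hyz] := cov y Gy yL; exists z; split=> //; exists b => //.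
  have := enorm_trans z y (X + gridpt h i f + b *: V); rewrite (enormB z y) (enormB y (_ + _)); lra.
(* Two lines with the same net point come within [4 * tau * s] of each other; the displacement along
   [V] adds at most as much again, and [8 < 9]. *)
have injz : injective zf.
  move=> f f' e; have [_ [b _ h1]] := hz f; have [_ [b' _ h2]] := hz f'; rewrite e in h1.
  apply: (gridpt_inj (i := i) h0) => j.
  pose W := (X + gridpt h i f + b *: V) - (X + gridpt h i f' + b' *: V).
  have hW : enorm W < 4 * (tau * s).
    have := enorm_trans (X + gridpt h i f + b *: V) (zf f') (X + gridpt h i f' + b' *: V).
    by rewrite (enormB (_ + _) (zf f')) -/W; lra.
  have Wc k : `|(gridpt h i f 0 k - gridpt h i f' 0 k) + (b - b') * V 0 k| < 4 * (tau * s).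
    apply: le_lt_trans hW; apply: le_trans (coord_le_enorm W k).
    by rewrite /W !mxE le_eqVlt; apply/orP; left; apply/eqP; congr `|_|; ring.
  have gi f0 : gridpt h i f0 0 i = 0 by rewrite mxE unlift_none.
  have Wi := Wc i; rewrite !gi subrr add0r normrM in Wi.
  have Wj := Wc j; have bj : `|b - b'| * `|V 0 j| <= `|b - b'| * `|V 0 i| by rewrite ler_wpM2l.
  have gb := ler_normB (gridpt h i f 0 j - gridpt h i f' 0 j + (b - b') * V 0 j) ((b - b') * V 0 j).
  rewrite addrK normrM in gb; apply: le_lt_trans gb _.
  by rewrite [X in _ < X](_ : h = 9 * (tau * s))//; move: Wj Wi bj; move: (`|_ + _|) (_ * `|V 0 i|) (_ * `|V 0 j|) => u1 u2 u3; lra.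
have cardS : (M ^ m <= size S)%N.
  have := uniq_leq_size (s1 := [seq zf f | f <- enum {ffun 'I_m -> 'I_M}]) (s2 := S).
  rewrite size_map -cardE card_ffun !card_ord; apply; first by rewrite map_inj_uniq// enum_uniq.
  by move=> z /mapP[f _ ->]; have [] := hz f.
(* Since [a + d = m], the [M ^ m] lines outnumber the [B * M^d] net points. *)
have : B * M%:R `^ d < M%:R `^ a * M%:R `^ d by rewrite ltr_pM2r// powR_gt0//; exact: lt_le_trans ltr01 M1.
rewrite -powRD; last by apply/implyP => _; rewrite gt_eqF// (lt_le_trans ltr01 M1).
have -> : a + d = m%:R by rewrite /a -natr1; ring.
rewrite powR_mulrn ?ler0n// -natrX => lt.
have : (M ^ m)%:R <= (size S)%:R :> R by rewrite ler_nat.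
suff : (size S)%:R <= B * M%:R `^ d by lra.
have p0 : 0 < (tau * s / 3) `^ d by rewrite powR_gt0// divr_gt0.
rewrite -(ler_pM2r p0); apply: le_trans sz _.
have -> : B * M%:R `^ d * (tau * s / 3) `^ d = C0 ^+ 2 * (L0 `^ d * (M%:R `^ d * (tau * s / 3) `^ d)) by rewrite /B; ring.
apply: ler_wpM2l; first exact: sqr_ge0.
have -> : L0 `^ d * (M%:R `^ d * (tau * s / 3) `^ d) = (L0 * (M%:R * (tau * s / 3))) `^ d.
  have X0 : 0 <= tau * s / 3 by rewrite divr_ge0// ltW.
  exact: (powRM3 (ltW L00) (ler0n _ _) X0).
apply: ge0_ler_powR; [exact: ltW|rewrite nnegrE; lra|rewrite nnegrE; apply: mulr_ge0; [exact: ltW|by rewrite mulr_ge0// divr_ge0// ltW]|].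
rewrite le_eqVlt; apply/orP; left; apply/eqP; rewrite /LL /L0 /tau; field.
by rewrite !gt_eqF//=; lra.
Qed.

End lines.

Section chains.
Context {R : realType} {n : nat}.
Variables (d C0 C1 : R).
Local Notation E := 'rV[R]_n.
Implicit Types (x y z p X Y V : E) (t u v : E -> R) (G : E -> E) (Gamma : set E) (A : E -> 'M[R]_n).
Hypotheses (n0 : (0 < n)%N) (d0 : 0 < d) (dn : d < n%:R - 1) (C01 : 1 <= C0) (C11 : 1 <= C1).

Lemma segment_harnack (L : R) : 0 <= L -> exists2 C : R, 1 <= C & forall Gamma A t G P V (s : R),
  setting d C0 C1 Gamma A -> sol d Gamma A t G -> 0 < s -> enorm V <= L * s ->
  (forall b : R, 0 <= b <= 1 -> s <= dist_to Gamma (P + b *: V)) ->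
  (forall z (b : R), 0 <= b <= 1 -> enorm (z - (P + b *: V)) < s -> 0 <= t z) ->
  t P <= C * t (P + V).
Proof.
move=> L0; have [CH CH1 IH] := interior_harnack n0 d0 dn C01 C11.
have np : 0 < n%:R :> R by rewrite ltr0n.
pose N := (Num.truncn (44 * n%:R * L)).+1.
have NL : 44 * n%:R * L <= N%:R by apply: ltW; exact: truncnS_gt.
have N0 : 0 < N%:R :> R by rewrite ltr0n.
exists (CH ^+ N); first exact: exprn_ege1.
move=> Gamma A t G P V s S st s0 VL far pos; have [G0 cG AR el] := S.
(* The cube of half-side [21 * r] about a point of the segment then has Euclidean radius below [s],
   so it avoids Gamma. *)
pose r := s / (22 * n%:R); have r0 : 0 < r by rewrite divr_gt0// mulr_gt0.
have nr : n%:R * (21 * r) < s.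
  have -> : n%:R * (21 * r) = 21 / 22 * s by rewrite /r; field; rewrite gt_eqF.
  by lra.
pose Q (k : nat) := P + (k%:R / N%:R) *: V.
have hk k : (k <= N)%N -> 0 <= (k%:R / N%:R : R) <= 1.
  by move=> kN; rewrite divr_ge0//= ler_pdivrMr// mul1r ler_nat.
have dQ k : enorm (Q k.+1 - Q k) <= r / 2.
  have -> : Q k.+1 - Q k = N%:R^-1 *: V.
    by rewrite /Q opprD addrACA subrr add0r -scalerBl -mulrBl -natr1 addrAC subrr add0r div1r.
  rewrite enormZ ger0_norm ?invr_ge0// mulrC ler_pdivrMr//.
  apply: le_trans VL _.
  have -> : r / 2 * N%:R = s * (N%:R / (44 * n%:R)) by rewrite /r; field; rewrite gt_eqF.
  rewrite mulrC ler_pM2l// ler_pdivlMr ?mulr_gt0// mulrC; exact: NL.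
have main k : (k <= N)%N -> t P <= CH ^+ k * t (Q k).
  elim: k => [|k IHk] kN; first by rewrite /Q mul0r scale0r addr0 expr0 mul1r.
  apply: le_trans (IHk (ltnW kN)) _; rewrite exprSr -mulrA.
  apply: ler_wpM2l; first by rewrite exprn_ge0// (le_trans ler01).
  have hkk := hk k (ltnW kN).
  have cs z : ccub (Q k) (21 * r) z -> enorm (z - Q k) < s.
    by move=> /ccubP h; apply: le_lt_trans nr; exact: enorm_cub.
  apply: (IH Gamma A t G (Q k) r S st r0).
  - move=> z /cs hz Gz; have := dist_le G0 (Q k) Gz; rewrite enormB.
    by have := far _ hkk; rewrite -/(Q k); lra.
  - by move=> z /cs; exact: pos.
  - by rewrite subrr enorm0 divr_ge0// ltW.
  - exact: dQ.
have := main N (leqnn N); by rewrite /Q divff ?gt_eqF// scale1r.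
Qed.

Lemma free_line_n (K : R) : 0 <= K -> exists2 tau : R, 0 < tau <= 8^-1 & forall Gamma X Y (s : R),
  Gamma !=set0 -> closed Gamma -> ahlfors_regular Gamma d C0 -> 0 < s ->
  s <= dist_to Gamma X -> s <= dist_to Gamma Y -> enorm (Y - X) <= K * s ->
  exists2 p : E, enorm p <= s / 4 & forall b : R, 0 <= b <= 1 -> tau * s <= dist_to Gamma (X + p + b *: (Y - X)).
Proof. by case: n n0 dn => // m _ dn' K0; exact: free_line. Qed.

(** Three segments: from [X] to [X + p], along the free line to [Y + p], and on to [Y]. The first
    and last are short compared with the distance of their endpoints from Gamma. *)
Lemma chain_harnack (K : R) : 0 <= K -> exists2 C : R, 1 <= C & forall Gamma A t G X Y (s : R),
  setting d C0 C1 Gamma A -> sol d Gamma A t G -> 0 < s ->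
  s <= dist_to Gamma X -> s <= dist_to Gamma Y -> enorm (Y - X) <= K * s ->
  (forall z, enorm (z - X) < (K + 2) * s -> 0 <= t z) -> t X <= C * t Y.
Proof.
move=> K0; have [tau /andP[tau0 tau8] FL] := free_line_n K0.
have L0 : 0 <= (K + 1) / tau by rewrite divr_ge0 ?addr_ge0// ltW.
have [C C1' SH] := segment_harnack L0.
have Cp : 0 <= C by exact: le_trans ler01 C1'.
exists (C ^+ 3); first exact: exprn_ege1.
move=> Gamma A t G X Y s S st s0 sX sY XY pos; have [G0 cG AR el] := S.
have [p hp line] := FL Gamma X Y s G0 cG AR s0 sX sY XY.
have ts0 : 0 < tau * s by rewrite mulr_gt0.
have ts : tau * s <= s / 8 by rewrite mulrC ler_pM2l.
have LL : (K + 1) / tau * (tau * s) = (K + 1) * s by field; rewrite gt_eqF.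
have pb (b : R) : 0 <= b <= 1 -> enorm (b *: p) <= s / 4.
  move=> /andP[b0 b1]; rewrite enormZ ger0_norm//; apply: le_trans hp; by rewrite ler_piMl ?enorm_ge0.
have Vb (b : R) : 0 <= b <= 1 -> enorm (b *: (Y - X)) <= K * s.
  move=> /andP[b0 b1]; rewrite enormZ ger0_norm//; apply: le_trans XY; by rewrite ler_piMl ?enorm_ge0.
have Ks : 0 <= K * s by rewrite mulr_ge0// ltW.
have dp Z (b : R) : 0 <= b <= 1 -> s <= dist_to Gamma Z -> tau * s <= dist_to Gamma (Z + b *: p).
  move=> hb sZ; have := dist_lip G0 Z (Z + b *: p); rewrite opprD addNKr enormN; have := pb b hb; lra.
have h01 : 0 <= (1 : R) <= 1 by lra.
have s1 : t X <= C * t (X + p).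
  apply: (SH Gamma A t G X p (tau * s) S st ts0); first by rewrite LL; lra.
    by move=> b hb; exact: dp.
  move=> z b hb hz; apply: pos; have := enorm_trans z (X + b *: p) X; rewrite addrAC subrr add0r.
  by have := pb b hb; lra.
have s2 : t (X + p) <= C * t (X + p + (Y - X)).
  apply: (SH Gamma A t G (X + p) (Y - X) (tau * s) S st ts0); [by rewrite LL; lra|exact: line|].
  move=> z b hb hz; apply: pos; have := enorm_trans z (X + p + b *: (Y - X)) X.
  have -> : X + p + b *: (Y - X) - X = p + b *: (Y - X) by rewrite -(addrA X) (addrC X) addrK.
  by have := enormD p (b *: (Y - X)); have := Vb b hb; lra.
have s3 : t (X + p + (Y - X)) <= C * t Y.
  have -> : X + p + (Y - X) = Y + p by rewrite addrC addrA subrK addrC.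
  have e1 : Y = Y + p + - p by rewrite addrK.
  rewrite [X in _ <= C * t X]e1.
  have bN (b : R) : 0 <= b <= 1 -> Y + p + b *: - p = Y + (1 - b) *: p by rewrite scalerBl scale1r scalerN addrA.
  have hb1 (b : R) : 0 <= b <= 1 -> 0 <= 1 - b <= 1 by lra.
  apply: (SH Gamma A t G (Y + p) (- p) (tau * s) S st ts0).
  - by rewrite enormN LL; lra.
  - by move=> b hb; rewrite bN//; apply: dp => //; exact: hb1.
  move=> z b hb; rewrite bN// => hz; apply: pos.
  have := enorm_trans z (Y + (1 - b) *: p) X; have := enorm_trans (Y + (1 - b) *: p) Y X.
  have -> : Y + (1 - b) *: p - Y = (1 - b) *: p by rewrite addrAC subrr add0r.
  by have := pb _ (hb1 b hb); lra.
apply: le_trans s1 _; rewrite !exprS expr0 mulr1 -!mulrA; apply: ler_wpM2l => //.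
by apply: le_trans s2 _; exact: ler_wpM2l.
Qed.

End chains.

(** * The maximum principle *)

Section maxprinciple.
Context {R : realType} {n : nat}.
Variables (d C0 C1 : R).
Local Notation E := 'rV[R]_n.
Implicit Types (x y z a s c : E) (t u v f : E -> R) (G g : E -> E) (K Z : set E) (Gamma : set E) (A : E -> 'M[R]_n).
Hypotheses (n0 : (0 < n)%N) (d0 : 0 < d) (dn : d < n%:R - 1) (C01 : 1 <= C0) (C11 : 1 <= C1).

Section glue.
Variables (Gamma : set E) (A : E -> 'M[R]_n) (t : E -> R) (G : E -> E) (O1 O2 : set E) (k M : R).
Hypotheses (S : setting d C0 C1 Gamma A) (st : sol d Gamma A t G) (o1 : open O1) (o2 : open O2)
  (cover : forall x, O1 x \/ O2 x) (tM : forall x, `|t x| <= M)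
  (tO : forall x, O1 x -> O2 x -> k <= t x) (tG : forall x, Gamma x -> O1 x -> k < t x).
Variables (F F' : R -> R).
Hypotheses (dF : forall s : R, is_derive s 1 F (F' s)) (cF' : continuous F')
  (Fk : forall s : R, k <= s -> F s = 0 /\ F' s = 0).

(** [F] vanishes above [k] and [t >= k] on the overlap of [O1] and [O2], so the extension by 0 is
    continuous and has a weak gradient on all of R^n. *)
Definition glue x := if `[< O1 x >] then F (t x) else 0.
Definition dglue x := if `[< O1 x >] then F' (t x) *: G x else 0.

Let g1 x : O1 x -> glue x = F (t x) /\ dglue x = F' (t x) *: G x.
Proof. by move=> h; rewrite /glue /dglue asboolT. Qed.

Let g2 x : O2 x -> glue x = 0 /\ dglue x = 0.
Proof.
move=> h; have [h1|h1] := pselect (O1 x); last by rewrite /glue /dglue asboolF.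
by have [-> ->] := g1 h1; have [-> ->] := Fk (tO h1 h); rewrite scale0r.
Qed.

Lemma glue_cont : continuous glue.
Proof.
have [ct _ _ _ _] := st.
have cF : continuous F by move=> s; have [h _] := dF s; exact/differentiable_continuous/derivable1_diffP.
have cFt := cont_comp cF ct.
move=> x; have [h|h] := cover x.
  have e : {near x, (fun y => F (t y)) =1 glue}.
    by near=> y; have /g1[-> _] : O1 y by near: y; exact: open_nbhs_nbhs.
  by have [h1 _] := g1 h; rewrite /continuous_at h1; exact: (cvg_trans (near_eq_cvg e) (cFt x)).
have e : {near x, (fun=> 0 : R) =1 glue}.
  by near=> y; have /g2[-> _] : O2 y by near: y; exact: open_nbhs_nbhs.
by have [h1 _] := g2 h; rewrite /continuous_at h1; exact: (cvg_trans (near_eq_cvg e) (@cvg_cst _ _ _ _ _)).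
Unshelve. all: by end_near. Qed.

Lemma glue_wg : weak_gradient setT glue dglue.
Proof.
have [ct wg _ _ _] := st; have [G0 cG AR el] := S.
have oA : open (O1 `&` above Gamma t k) by apply: openI => //; exact: above_open.
rewrite (_ : setT = (O1 `&` above Gamma t k) `|` O2); last first.
  apply/seteqP; split=> x _ //; have [h|] := cover x; last by right.
  by left; split=> //; have [Gx|] := pselect (Gamma x); [right; exact: tG|left].
apply: wgU => //; first exact: glue_cont.
  have sub : O1 `&` above Gamma t k `<=` above Gamma t k by move=> x [].
  apply: (wg_eq oA (wg_sub (above_open cG ct) oA sub (wg_trunc cG st dF cF' Fk))).
  - by move=> x [/g1[]].
  - by move=> x [/g1[]].
by apply: (wg_eq o2 (wg_zero o2)) => x /g2[].
Qed.

Lemma dglue_bound : exists B : R, forall x, enorm (dglue x) ^+ 2 <= B * enorm (G x) ^+ 2.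
Proof.
have [B B0 hB] : exists2 B : R, 0 < B & forall s : R, -M <= s <= M -> `|F' s| <= B.
  have [||c /= _ hc] := @EVT_max R (fun b : R => `|F' b|) (-M) M.
  - by have := le_trans (normr_ge0 _) (tM 0); lra.
  - apply: continuous_subspaceT => s; apply: continuous_comp; [exact: cF'|exact: norm_continuous].
  exists (`|F' c| + 1); first by rewrite ltr_pwDr// normr_ge0.
  by move=> s h; apply: (le_trans (hc s _)); [rewrite in_itv/=|rewrite lerDl].
exists (B ^+ 2) => x; rewrite /dglue; case: asboolP => _; last first.
  by rewrite enorm0 expr0n/= mulr_ge0// sqr_ge0.
rewrite enormZ exprMn; apply: ler_wpM2r; first exact: sqr_ge0.
by rewrite ler_sqr ?nnegrE ?(ltW B0)//; apply: hB; rewrite -ler_norml.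
Qed.

Lemma dglue_energy : energy d Gamma dglue setT.
Proof.
have [_ _ GG eG _] := st; have [G0 cG AR el] := S; have [B hB] := dglue_bound.
have w0 x : 0 <= weight Gamma d x by exact: weight_ge0.
have mT := @msbT R n.
have g0 x : Gamma x -> dglue x = 0 by move=> /GG e; rewrite /dglue; case: asboolP => //; rewrite e scaler0.
apply: (@intg_le _ _ _ _ (fun x => B * (enorm (G x) ^+ 2 * weight Gamma d x))) => //.
- apply: mfnM; last exact: weight_mfn.
  apply: mfn_enorm2 => // i; have mO : msb (~` Gamma) by apply: measurable_open; exact: closed_openC.
  have wO : weak_gradient (~` Gamma) glue dglue.
    by apply: wg_sub glue_wg => //; [exact: openT|exact: closed_openC].
  apply: (mfn_mkcond mO mT (fun x _ => I) _ (mfn_wg n0 G0 cG i wO)) => //.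
  by move=> x _ /contrapT /g0 ->; rewrite mxE.
- by apply: intgZ.
move=> x _; rewrite ger0_norm; last by rewrite mulr_ge0// sqr_ge0.
by rewrite mulrA; apply: ler_wpM2r.
Qed.

End glue.

(** The overlap with [O2] stands for the boundary of [O1]; [O1] may be unbounded, finite energy
    taking the place of decay at infinity. Testing with the glued [pos (k - t) ^ 3] kills the energy
    of [pos (k - t) ^ 2], and the trace inequality on a cube centred on Gamma makes the latter
    vanish. *)
Lemma comparison Gamma A t G (O1 O2 : set E) (M : R) : setting d C0 C1 Gamma A -> sol d Gamma A t G ->
  open O1 -> open O2 -> (forall x, O1 x \/ O2 x) -> (forall x, `|t x| <= M) ->
  (forall x, O1 x -> O2 x -> 0 <= t x) -> (forall x, Gamma x -> O1 x -> 0 <= t x) ->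
  forall x, O1 x -> 0 <= t x.
Proof.
move=> S st o1 o2 cover tM tO tG x O1x; have [G0 cG AR el] := S; have [ct _ GG eG test] := st.
(* The negative level [k] makes [t > k] strict on Gamma inside [O1], so the truncation vanishes in a
   neighbourhood of Gamma. *)
apply/ler_addgt0Pr => e e0; rewrite -lerBlDr sub0r; set k := - e.
have kt y : 0 <= t y -> k < t y by rewrite /k; lra.
have tO' y : O1 y -> O2 y -> k <= t y by move=> h1 h2; exact/ltW/kt/tO.
have tG' y : Gamma y -> O1 y -> k < t y by move=> h1 h2; exact/kt/tG.
pose F m (s : R) := pos (k - s) ^+ m.+2.
pose F' m (s : R) := m.+2%:R * pos (k - s) ^+ m.+1 * (-1).
have dF m (s : R) : is_derive s 1 (F m) (F' m s).
  apply: (is_derive_comp _ (is_derive_posX m _)).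
  by have := is_derive_affine k (-1) s; congr is_derive; apply/funext => b; rewrite mulN1r.
have cF' m : continuous (F' m).
  have cl : continuous (fun s : R => k - s).
    by move=> s; apply: (@continuousB R R^o R (fun=> k) id); [exact: cst_continuous|].
  have cp := cont_pos cl.
  rewrite /F'; apply: (contMR (f := fun s : R => m.+2%:R * pos (k - s) ^+ m.+1) (g := fun=> -1)); last exact: cst_continuous.
  apply: (contMR (f := fun=> m.+2%:R) (g := fun s : R => pos (k - s) ^+ m.+1)); first exact: cst_continuous.
  by apply: contXR; exact: cp.
have Fk m (s : R) : k <= s -> F m s = 0 /\ F' m s = 0.
  by move=> ks; rewrite /F /F' pos_le0 ?subr_le0// !expr0n/= mulr0 mul0r.
have cg m := glue_cont st o1 o2 cover tO' (dF m) (Fk m).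
have wg m := glue_wg S st o1 o2 cover tO' tG' (dF m) (cF' m) (Fk m).
have eg m := dglue_energy S st o1 o2 cover tM tO' tG' (dF m) (cF' m) (Fk m).
set f := glue t O1 (F 0%N); set g := dglue t G O1 (F' 0%N).
set v := glue t O1 (F 1%N); set gv := dglue t G O1 (F' 1%N).
pose w := weight Gamma d; have w0 y : 0 <= w y by exact: weight_ge0.
have oO : open (~` Gamma) by exact: closed_openC.
have mO : msb (~` Gamma) by exact: measurable_open.
have gz m y (Gy : Gamma y) : glue t O1 (F m) y = 0.
  by rewrite /glue; case: asboolP => // h; have [] := Fk m _ (ltW (tG' y Gy h)).
have v0 y : Gamma y -> v y = 0 by exact: gz.
have wv : weak_gradient (~` Gamma) v gv by apply: wg_sub (wg 1%N) => //; exact: openT.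
have egv : energy d Gamma gv (~` Gamma) by apply: intgS (eg 1%N) => //; exact: msbT.
have eg' : energy d Gamma g (~` Gamma) by apply: intgS (eg 0%N) => //; exact: msbT.
have eGO : energy d Gamma G (~` Gamma) by apply: intgS eG => //; exact: msbT.
have tv := test v gv (cg 1%N) v0 wv egv.
(* With [p = pos (k - t)], the squared gradient of [p^2] carries [4 p^2] and the test function
   yields [3 p^2 / C1]; the quotient is [3 / (4 * C1)]. *)
have key : Int (~` Gamma) (fun z => 3 / (4 * C1) * (enorm (g z) ^+ 2 * w z)) <= 0.
  rewrite -oppr0 -tv; have [_ wgG _ _ _] := st.
  have ii := intg_dotA C11 cG el (fun i => mfn_wg n0 G0 cG i wgG) (fun i => mfn_wg n0 G0 cG i wv) eGO egv.
  rewrite -mulN1r -(IntZ (-1) mO ii); apply: Int_le => //.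
  - by apply: intgZ.
  - by apply: intgZ.
  move=> z Oz; rewrite /g /gv /dglue; case: asboolP => _; last first.
    by rewrite -(scale0r (0 : E)) dotC dotZl mul0r mulr0 enormZ normr0 mul0r expr0n/= mul0r mulr0.
  have [_ _ el3] := el; have := el3 z (G z) Oz; rewrite -/w => eA.
  rewrite dotZr enormZ exprMn real_normK ?num_real// /F' expr1.
  set p := pos (k - t z); set D := dot _ _ in eA *; set N := enorm (G z) in eA *.
  have p2 : 0 <= p ^+ 2 by exact: sqr_ge0.
  have c1 : 0 < C1 by apply: lt_le_trans C11.
  have -> : 3 / (4 * C1) * ((2 * p * -1) ^+ 2 * N ^+ 2 * w z) = 3 * p ^+ 2 * (C1^-1 * w z * N ^+ 2).
    by field; rewrite gt_eqF.
  have -> : -1 * (3 * p ^+ 2 * -1 * D) = 3 * p ^+ 2 * D by ring.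
  by apply: ler_wpM2l => //; rewrite mulr_ge0.
have c3 : 0 < 3 / (4 * C1) by rewrite divr_gt0// mulr_gt0// (lt_le_trans ltr01).
rewrite (IntZ _ mO eg') pmulr_rle0// in key.
have [y Gy] := G0.
pose r := enorm (x - y) + 1; have r0 : 0 < r by rewrite ltr_pwDr// enorm_ge0.
have Er : Int (cub y r) (fun z => enorm (g z) ^+ 2 * w z) <= 0.
  have gG0 z : Gamma z -> enorm (g z) ^+ 2 * w z = 0 by move=> Gz; rewrite /w weight_Gamma// mulr0.
  have [eO _] := Omega_mkcond cG gG0; rewrite -[weight Gamma d]/w -eO in key.
  apply: le_trans key; apply: Int_subset => //; [exact: msb_box|exact: msbT|exact: (eg 0%N)|].
  by move=> z _; rewrite mulr_ge0// sqr_ge0.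
have f0 : exists2 d1 : R, 0 < d1 & forall z, ccub y r z -> dist_to Gamma z < d1 -> f z = 0.
  have oV : open ((O1 `&` [set z | k < t z]) `|` O2).
    apply: openU => //; apply: openI => //.
    by have /continuousP cc := ct; have h := cc _ (@open_gt R k); exact: h.
  have [|d1 d10 hd] := compact_near_gamma G0 cG (@compact_cbox R n (y - const_mx r) (const_mx (2 * r))) oV.
    move=> z _; have [Gz|] := pselect (Gamma z); [right|by left].
    by have [h|] := cover z; [left; split=> //; exact: tG'|right].
  exists d1 => // z cz dz; rewrite /f /glue; case: asboolP => // h.
  by have kz : k <= t z; [case: (hd z cz dz) => [[_ /ltW]|/(tO' z h)]|have [] := Fk 0%N _ kz].
have ie a s : cbox a s `<=` setT -> intg (box a s) (fun x => enorm (g x) ^+ 2 * weight Gamma d x).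
  by move=> _; apply: intgS (eg 0%N) => //; [exact: msb_box|exact: msbT].
have gG z : Gamma z -> g z = 0 by move=> /GG e1; rewrite /g /dglue; case: asboolP => //; rewrite e1 scaler0.
have [d1 d10 hf] := f0.
have cc0 : 0 < C0^-1 / (2 * n%:R) `^ d.
  by rewrite divr_gt0 ?powR_gt0 ?invr_gt0 ?mulr_gt0 ?ltr0n// (lt_le_trans ltr01).
have P := poincare2_trace n0 d0 dn C01 G0 cG AR openT (cg 0%N) (wg 0%N) gG ie (cub_good r0) (fun _ _ => I) d10 hf cc0 (sg_cub n0 C01 AR Gy r0).
have fx : f x ^+ 2 = 0.
  apply: (Int_zero n0 d0 dn C01 G0 cG AR (c := y) (r := r) (f := fun z => f z ^+ 2)).
  - exact: (contX (cg 0%N)).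
  - by move=> z; exact: sqr_ge0.
  - apply: le_trans P _; apply: mulr_ge0_le0; [exact: sqr_ge0|exact: Er].
  - by move=> i; have := coord_le_enorm (x - y) i; rewrite !mxE /r; lra.
move/eqP: fx; rewrite sqrf_eq0 /f /glue asboolT// /F => /eqP/eqP; rewrite expf_eq0/= => /eqP p0.
by have := le_pos (k - t x); rewrite p0; lra.
Qed.

End maxprinciple.

(** * Carleson estimate and boundary Harnack inequality *)

Lemma expr_small (R : realType) (q e : R) : 0 <= q < 1 -> 0 < e -> exists m, q ^+ m < e.
Proof.
move=> /andP[q0 q1] e0.
have h : (fun m : nat => q ^+ m) @ \oo --> (0 : R) by apply: cvg_expr; rewrite ger0_norm.
have /(_ _ e e0)[m _ hm] := @cvgr0_norm_lt _ _ _ _ _ _ h.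
by exists m; have := hm m (leqnn m); rewrite /= ger0_norm// exprn_ge0.
Qed.

Lemma dyadic_scale (R : realType) (s T : R) : 0 < s <= T -> exists J, 2 ^+ J * s <= T < 2 ^+ J.+1 * s.
Proof.
move=> /andP[s0 sT].
have ex : exists k, T < 2 ^+ k * s.
  have [|k hk] := @expr_small R 2^-1 (s / T) ltac:(lra); first by rewrite divr_gt0// (lt_le_trans s0).
  have T0 : 0 < T by exact: lt_le_trans sT.
  exists k; move: hk; rewrite exprVn ltr_pdivlMr// mulrC ltr_pdivrMr ?exprn_gt0//.
  by rewrite mulrC.
case: (ex_minnP ex) => [[|J] hJ mJ]; first by move: hJ; rewrite expr0 mul1r ltNge sT.
exists J; rewrite hJ andbT leNgt; apply/negP => /mJ; by rewrite ltnn.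
Qed.

Section boundary.
Context {R : realType} {n : nat}.
Variables (d C0 C1 eps : R).
Local Notation E := 'rV[R]_n.
Implicit Types (x y z p c X Y Z : E) (t u v f : E -> R) (G : E -> E) (K : set E) (Gamma : set E) (A : E -> 'M[R]_n).
Hypotheses (n0 : (0 < n)%N) (d0 : 0 < d) (dn : d < n%:R - 1) (C01 : 1 <= C0) (C11 : 1 <= C1)
  (hcs : corkscrew_constant n d C0 eps).

(** [growth_boundary] for [B - t], repeated: each passage to a cube 8 times smaller lowers the upper
    bound by the factor [1 - th]. *)
Lemma boundary_decay : exists2 th : R, 0 < th < 1 & forall Gamma A t G p (r B : R) m,
  setting d C0 C1 Gamma A -> sol d Gamma A t G -> Gamma p -> 0 < r -> 0 < B ->
  (forall x, ccub p r x -> t x <= B) -> (forall x, Gamma x -> ccub p r x -> t x <= 0) ->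
  forall x, ccub p (r / 8 ^+ m) x -> t x <= (1 - th) ^+ m * B.
Proof.
have [th th0 GB] := growth_boundary n0 d0 dn C01 C11.
(* Capped at 1/2 so that the contraction factor stays positive. *)
pose th' := Num.min th 2^-1.
have h0 : 0 < th' by rewrite lt_min th0/= invr_gt0.
have h1 : th' <= 2^-1 by rewrite ge_min lexx orbT.
have h2 : th' <= th by rewrite ge_min lexx.
exists th'; first by apply/andP; split=> //; lra.
move=> Gamma A t G p r B m S st Gp; have [G0 cG AR el] := S.
elim: m r B => [|m IH] r B r0 B0 tB tG x.
  by rewrite !expr0 divr1 mul1r; exact: tB.
have r8 : 0 < r / 8 by rewrite divr_gt0.
have q0 : 0 < 1 - th' by lra.
have sub : ccub p (r / 8) `<=` ccub p r by apply: ccub_sub; lra.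
have -> : r / 8 ^+ m.+1 = r / 8 / 8 ^+ m.
  have : 8 ^+ m != 0 :> R by rewrite expf_neq0// pnatr_eq0.
  by rewrite exprS; move: (8 ^+ m) => X X0; field.
have -> : (1 - th') ^+ m.+1 * B = (1 - th') ^+ m * ((1 - th') * B) by rewrite exprSr mulrA.
apply: (IH (r / 8) ((1 - th') * B) r8); first by rewrite mulr_gt0.
  move=> z cz; have e y : B + -1 * t y = B - t y by rewrite mulN1r.
  have h := GB Gamma A _ _ p (r / 2) B S (sol_affine n0 C11 G0 cG el B (-1) st) Gp ltac:(lra) B0.
  have r2 : 2 * (r / 2) = r by field.
  rewrite r2 in h.
  have := h _ _ z; rewrite e => h'.
  have : th * B <= B - t z.
    apply: h'.
    - by move=> y /tB; rewrite e; lra.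
    - by move=> y Gy cy; have := tG y Gy cy; rewrite e; lra.
    - by move=> i; have /ccubP/(_ i) := cz; lra.
  have : th' * B <= th * B by rewrite ler_pM2r.
  lra.
by move=> z Gz cz; apply: tG => //; exact: sub.
Qed.

Let eps0 : 0 < eps. Proof. by have [] := hcs. Qed.
(** If [X] is within [2 * s] of some [p] in Gamma, the corkscrew point of radius [2 * s / eps] about
    [p] has distance at least [2 * s] from Gamma and lies within [Kc * s] of [X]. *)
Let Kc : R := 2 + 2 / eps.
Let Kc0 : 0 <= Kc. Proof. by rewrite addr_ge0// divr_ge0// ltW. Qed.

Lemma away Gamma A X (s : R) : setting d C0 C1 Gamma A -> 0 < s -> s <= dist_to Gamma X ->
  exists2 X', 2 * s <= dist_to Gamma X' & enorm (X' - X) <= Kc * s.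
Proof.
move=> [G0 cG AR el] s0 sX; have [h|h] := leP (2 * s) (dist_to Gamma X).
  by exists X => //; rewrite subrr enorm0 mulr_ge0// ltW.
have [p Gp hp] := dist_lt G0 h; have [_ cs] := hcs.
have r0 : 0 < 2 * s / eps by rewrite divr_gt0// mulr_gt0.
have [X' [_ h1 h2]] := cs Gamma G0 cG AR p _ Gp r0.
exists X'; first by move: h2; rewrite mulrC divfK// gt_eqF.
have := enorm_trans X' p X; rewrite (enormB p X) /Kc.
have -> : (2 + 2 / eps) * s = 2 * s + 2 * s / eps by field; rewrite gt_eqF.
by lra.
Qed.

(** Climbs away from Gamma with [away], doubling the distance at every step, then joins [Y]. The
    slack [Kc * s] absorbs the displacement: one climb uses [Kc * s], and the slack doubles with the
    scale. *)
Lemma ladder (K : R) : 0 <= K -> exists2 C : R, 1 <= C & forall Gamma A t G J X Y (s : R),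
  setting d C0 C1 Gamma A -> sol d Gamma A t G -> (forall z, 0 <= t z) -> 0 < s ->
  s <= dist_to Gamma X -> 2 ^+ J * s <= dist_to Gamma Y -> enorm (Y - X) <= K * (2 ^+ J * s) + Kc * s ->
  t X <= C ^+ J.+1 * t Y.
Proof.
move=> K0; have KK : 0 <= K + Kc by rewrite addr_ge0.
have [C C1' CH] := chain_harnack n0 d0 dn C01 C11 KK.
exists C => // Gamma A t G J X Y s S st t0; elim: J X s => [|J IH] X s s0 sX sY XY.
  rewrite expr1; apply: (CH _ _ _ _ _ _ _ S st s0) => //; first by move: sY; rewrite expr0 mul1r.
  have -> : (K + Kc) * s = K * s + Kc * s by ring.
  by move: XY; rewrite expr0 mul1r.
have [X' h1 h2] := away S s0 sX.
have s2 : 0 < 2 * s by lra.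
have ss : s <= dist_to Gamma X' by lra.
apply: (@le_trans _ _ (C * t X')).
  apply: (CH _ _ _ _ _ _ _ S st s0) => //; apply: le_trans h2 _; rewrite ler_pM2r//; lra.
rewrite exprS -mulrA; apply: ler_wpM2l; first by lra.
have e : 2 ^+ J * (2 * s) = 2 ^+ J.+1 * s by rewrite exprS; ring.
apply: (IH X' (2 * s) s2) => //; rewrite e//.
have := enorm_trans Y X X'; rewrite (enormB X X').
have -> : Kc * (2 * s) = Kc * s + Kc * s by ring.
by lra.
Qed.

(* The point X given by weighted_max cannot be close to Gamma, by boundary_decay, and
   if it is far from Gamma then a chain compares t X with t Y. *)
Lemma carleson (K e : R) : 0 <= K -> 0 < e -> exists2 C : R, 0 < C & forall Gamma A t G y Y (rho : R),
  setting d C0 C1 Gamma A -> sol d Gamma A t G -> (forall z, 0 <= t z) -> Gamma y -> 0 < rho ->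
  (forall z, Gamma z -> enorm (z - y) < 4 * rho -> t z = 0) -> e * rho <= dist_to Gamma Y ->
  enorm (Y - y) <= K * rho -> forall x, enorm (x - y) <= rho -> t x <= C * t Y.
Proof.
move=> K0 e0; have K20 : 0 <= 2 * (K + 2) / e by rewrite divr_ge0 ?(ltW e0)//; lra.
have [CL CL1 LA] := ladder K20; have CL0 : 0 < CL by lra.
have [th /andP[th0 th1] BD] := boundary_decay.
(* A ladder of [J] rungs costs [CL ^ J], at most [(2 ^ J) ^ b]; the weight [D ^ b.+1] of
   [weighted_max] compensates this power of the distance. *)
have [b hb] : exists b : nat, CL <= 2 ^+ b.
  have CLi : 0 < CL^-1 by rewrite invr_gt0.
  have [|b hb] := @expr_small R 2^-1 CL^-1 ltac:(lra); first by [].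
  by exists b; move: hb; rewrite exprVn ltf_pV2 ?posrE ?exprn_gt0// => /ltW.
(* After [m] decay steps the contraction beats the bound [2 ^ b.+1 * t X] valid around the maximum
   point. *)
have [|m hm] := @expr_small R (1 - th) (2 ^+ b.+1)^-1 ltac:(lra); first by rewrite invr_gt0 exprn_gt0.
have np : 0 < n%:R :> R by rewrite ltr0n.
have n1 : 1 <= n%:R :> R by rewrite ler1n.
pose e2 := (4 * n%:R * 8 ^+ m)^-1 : R.
have p8 : 1 <= 8 ^+ m :> R by rewrite exprn_ege1//; lra.
have e20 : 0 < e2 by rewrite invr_gt0 !mulr_gt0// exprn_gt0.
have e24 : e2 <= 4^-1.
  rewrite lef_pV2 ?posrE//; last by rewrite !mulr_gt0// exprn_gt0.
  by rewrite -mulrA ler_peMr// -[leLHS]mulr1; apply: ler_pM.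
pose e1 := Num.min (e / 2) e2.
have e10 : 0 < e1 by rewrite lt_min e20 divr_gt0.
have e1e : e1 <= e / 2 by rewrite ge_min lexx.
have e12 : e1 <= e2 by rewrite ge_min lexx orbT.
have C0' : 0 < 2 * CL * (e / e1) ^+ b by rewrite mulr_gt0 ?mulr_gt0// exprn_gt0// divr_gt0.
exists (2 * CL * (e / e1) ^+ b) => // Gamma A t G y Y rho S st t0 Gy rho0 tz dY hY x hx.
have [G0 cG AR el] := S; have [ct _ _ _ _] := st.
have [tx|tx] := leP (t x) 0; first by apply: le_trans tx _; rewrite mulr_ge0// ltW.
have hx2 : enorm (x - y) <= (2 * rho) / 2 by have -> : 2 * rho / 2 = rho by field.
have [X [D [/andP[D0 D2] hX tX tx2 tall]]] := weighted_max n0 b ct hx2 ltac:(lra) tx.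
have s0 : 0 < e1 * D by rewrite mulr_gt0.
have hX2 : enorm (X - y) <= 2 * rho by lra.
have [far|near_] := leP (e1 * D) (dist_to Gamma X).
  have sT : e1 * D <= e * rho.
    apply: (@le_trans _ _ (e / 2 * (2 * rho))); last by apply: le_of_eq; field.
    by apply: ler_pM => //; exact: ltW.
  have [|J /andP[J1 J2]] := @dyadic_scale R (e1 * D) (e * rho); first by rewrite s0.
  have L : t X <= CL ^+ J.+1 * t Y.
    apply: (LA _ _ _ _ _ _ _ _ S st t0 s0 far); first by lra.
    have h1 := enorm_trans Y y X; rewrite (enormB y X) in h1.
    apply: (@le_trans _ _ ((K + 2) * rho)); first by lra.
    apply: (@le_trans _ _ (2 * (K + 2) / e * (2 ^+ J * (e1 * D)))).
      have -> : 2 * (K + 2) / e * (2 ^+ J * (e1 * D)) = (K + 2) / e * (2 ^+ J.+1 * (e1 * D)).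
        by rewrite exprS; field; rewrite gt_eqF.
      have -> : (K + 2) * rho = (K + 2) / e * (e * rho) by field; rewrite gt_eqF.
      by apply: ler_wpM2l; [rewrite divr_ge0 ?(ltW e0)//; lra|exact: ltW].
    by rewrite lerDl mulr_ge0// ltW.
  have r1 : 0 < rho ^+ b.+1 by rewrite exprn_gt0.
  rewrite -(ler_pM2r r1); apply: (@le_trans _ _ (t X * D ^+ b.+1)).
    by move: tx2; have -> : 2 * rho / 2 = rho by field.
  have tY0 := t0 Y.
  have a1 : CL ^+ J.+1 <= CL * (e * rho / (e1 * D)) ^+ b.
    rewrite exprS; apply: ler_wpM2l; first exact: ltW.
    apply: (@le_trans _ _ ((2 ^+ b) ^+ J)); first by rewrite lerXn2r ?nnegrE ?exprn_ge0// ltW.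
    rewrite -exprM mulnC exprM lerXn2r ?nnegrE ?exprn_ge0//; first by rewrite divr_ge0 ?mulr_ge0// ltW.
    by rewrite ler_pdivlMr.
  apply: (@le_trans _ _ (CL * (e * rho / (e1 * D)) ^+ b * t Y * D ^+ b.+1)).
    apply: ler_wpM2r; first by rewrite exprn_ge0// ltW.
    by apply: le_trans L _; apply: ler_wpM2r.
  have -> : CL * (e * rho / (e1 * D)) ^+ b * t Y * D ^+ b.+1 = CL * (e / e1) ^+ b * t Y * rho ^+ b * D.
    have -> : e * rho / (e1 * D) = (e / e1) * (rho / D) by field; rewrite !gt_eqF.
    rewrite [(e / e1 * _) ^+ b]exprMn [(rho / D) ^+ b]exprMn exprVn exprS.
    have : D ^+ b != 0 by rewrite gt_eqF// exprn_gt0.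
    by move: (D ^+ b) ((e / e1) ^+ b) (rho ^+ b) => Db eb rb Dn; field.
  have -> : 2 * CL * (e / e1) ^+ b * t Y * rho ^+ b.+1 = CL * (e / e1) ^+ b * t Y * rho ^+ b * (2 * rho).
    by rewrite exprS; ring.
  apply: ler_wpM2l => //; rewrite mulr_ge0 ?exprn_ge0 ?(ltW rho0)// mulr_ge0//.
  by rewrite mulr_ge0 ?(ltW CL0)// exprn_ge0// divr_ge0 ?(ltW e0) ?(ltW e10).
(* [X] lies in the cube of half-side [e2 * D] about a point [p] of Gamma, [m] decay steps inside a
   cube where [t <= 2 ^ b.+1 * t X]; this gives [t X < t X]. *)
exfalso.
have [p Gp hp] := dist_lt G0 near_.
have eD : e1 * D <= D / 4.
  by rewrite [leRHS]mulrC ler_pM2r//; exact: le_trans e12 e24.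
have r10 : 0 < D / (4 * n%:R) by rewrite divr_gt0// mulr_gt0.
have sub z : ccub p (D / (4 * n%:R)) z -> enorm (z - X) <= D / 2.
  move=> /ccubP/enorm_cub h; have := enorm_trans z p X; rewrite (enormB p X).
  have e' : n%:R * (D / (4 * n%:R)) = D / 4 by field; rewrite gt_eqF.
  by rewrite e' in h; lra.
have B0 : 0 < 2 ^+ b.+1 * t X by rewrite mulr_gt0// exprn_gt0.
have h := BD Gamma A t G p _ _ m S st Gp r10 B0 _ _ X.
have : t X <= (1 - th) ^+ m * (2 ^+ b.+1 * t X).
  apply: h.
  - by move=> z /sub; exact: tall.
  - by move=> z Gz /sub hz; rewrite tz//; have := enorm_trans z X y; lra.
  apply: cub_enorm; apply: le_trans (ltW hp) _.
  have -> : D / (4 * n%:R) / 8 ^+ m = e2 * D.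
    by rewrite /e2; move: (8 ^+ m) p8 => E8 hE8; field; rewrite !gt_eqF//; lra.
  by rewrite ler_pM2r.
rewrite mulrA leNgt => /negP; apply; rewrite gtr_pMl//.
by move: hm; rewrite -[X in _ < X]mul1r ltr_pdivlMr ?exprn_gt0.
Qed.

(* The hypotheses at scale rho imply those at scale rho / 2 with a multiplied by
   1 / (2 CH), the lower bound by boundary_decay and the bound away from Gamma by
   Harnack's inequality for w + a. *)
Lemma positivity : exists Ac, exists2 eta : R, 0 < Ac /\ 0 < eta <= 8^-1 & forall Gamma A w G y X k (rho a : R),
  setting d C0 C1 Gamma A -> sol d Gamma A w G -> Gamma y -> 0 < rho -> 0 < a ->
  (forall z, Gamma z -> enorm (z - y) < rho -> 0 <= w z) -> (forall z, enorm (z - y) < rho -> - a <= w z) ->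
  (forall z, enorm (z - y) < rho -> eta * rho <= dist_to Gamma z -> Ac * a <= w z) ->
  enorm (X - y) < rho -> enorm (X - y) <= 2 * dist_to Gamma X -> rho / 2 ^+ k.+1 <= enorm (X - y) -> 0 <= w X.
Proof.
have [CH CH1 CHP] := chain_harnack n0 d0 dn C01 C11 Kc0; have CH0 : 0 < CH by lra.
have [th /andP[th0 th1] BD] := boundary_decay.
(* The factor by which [a] shrinks per halving of the ball; with [Ac = 2 * CH] it satisfies
   [Ac * (tau * a) = a]. *)
pose tau := (2 * CH)^-1; have tau0 : 0 < tau by rewrite invr_gt0 mulr_gt0.
have [m hm] := @expr_small R (1 - th) tau ltac:(lra) tau0.
have np : 0 < n%:R :> R by rewrite ltr0n.
have n1 : 1 <= n%:R :> R by rewrite ler1n.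
pose e2 := (8 * n%:R * 8 ^+ m)^-1 : R.
have p8 : 1 <= 8 ^+ m :> R by rewrite exprn_ege1//; lra.
have e20 : 0 < e2 by rewrite invr_gt0 !mulr_gt0// exprn_gt0.
have e28 : e2 <= 8^-1.
  rewrite lef_pV2 ?posrE//; last by rewrite !mulr_gt0// exprn_gt0.
  by rewrite -mulrA ler_peMr// -[leLHS]mulr1; apply: ler_pM.
have K1 : 0 < 2 * (Kc + 1) by have := Kc0; lra.
(* The first bound keeps the Harnack chain inside the ball of radius [rho], the second lets [m]
   decay steps fit between a point close to Gamma and scale [rho]. *)
pose eta := Num.min (2 * (Kc + 1))^-1 e2.
have eta0 : 0 < eta by rewrite lt_min e20 andbT invr_gt0.
have etaK : eta <= (2 * (Kc + 1))^-1 by rewrite ge_min lexx.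
have eta2 : eta <= e2 by rewrite ge_min lexx orbT.
have eta8 : eta <= 8^-1 by exact: le_trans e28.
clear CH1 th0 th1 n1 e20 e28.
exists (2 * CH), eta; first by split; [lra|rewrite eta0].
move=> Gamma A w G y X k rho a S sw Gy; have [G0 cG AR el] := S.
elim: k rho a => [|k IH] rho a rho0 a0 wG wa wA Xr Xd Xk; last first.
(* In the outer half of the ball [X] has distance at least [rho / 4 >= eta * rho] from Gamma, so the
   lower bound [Ac * a] applies to it. *)
all: have direct : rho / 2 <= enorm (X - y) -> 0 <= w X by
  move=> h; apply: (@le_trans _ _ (2 * CH * a)); [rewrite !mulr_ge0 ?(ltW CH0) ?(ltW a0)//|apply: wA => //;
    have : eta * rho <= 8^-1 * rho by [rewrite ler_pM2r]; lra].
  2: by apply: direct; rewrite expr1 in Xk.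
have [h|h] := leP (rho / 2) (enorm (X - y)); first exact: direct.
have e1 : rho / 2 / 2 ^+ k.+1 = rho / 2 ^+ k.+2 by rewrite [in RHS]exprS invfM mulrA.
have er8 : eta * rho <= rho / 8 by rewrite [leRHS]mulrC ler_pM2r.
apply: (IH (rho / 2) (tau * a)) => //.
- by lra.
- by rewrite mulr_gt0.
- by move=> z Gz hz; apply: wG => //; lra.
- move=> z hz; have [hd|hd] := leP (eta * rho) (dist_to Gamma z).
    apply: (@le_trans _ _ 0); first by rewrite oppr_le0 mulr_ge0// ltW.
    by apply: le_trans (wA z _ hd); [rewrite mulr_ge0 ?mulr_ge0// ltW|lra].
  (* Near Gamma: [- w] is at most [a] and nonpositive on Gamma, and [boundary_decay] improves [a] to
     [tau * a]. *)
  have [p Gp hp] := dist_lt G0 hd.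
  have r0 : 0 < rho / (8 * n%:R) by rewrite divr_gt0// mulr_gt0.
  have sub x : ccub p (rho / (8 * n%:R)) x -> enorm (x - y) < rho.
    move=> /ccubP/enorm_cub hx; have e' : n%:R * (rho / (8 * n%:R)) = rho / 8 by field; rewrite gt_eqF.
    rewrite e' in hx; have := enorm_trans x p y; have := enorm_trans p z y; rewrite (enormB p z); lra.
  have e0 x : 0 + -1 * w x = - w x by rewrite add0r mulN1r.
  have hh := BD Gamma A _ _ p _ a m S (sol_affine n0 C11 G0 cG el 0 (-1) sw) Gp r0 a0 _ _ z.
  rewrite e0 in hh.
  have : - w z <= (1 - th) ^+ m * a.
    apply: hh.
    - by move=> x /sub/wa; rewrite e0; lra.
    - by move=> x Gx /sub/(wG x Gx); rewrite e0; lra.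
    apply: cub_enorm; apply: le_trans (ltW hp) _.
    have -> : rho / (8 * n%:R) / 8 ^+ m = e2 * rho.
      by rewrite /e2; move: (8 ^+ m) p8 => E8 hE8; field; rewrite !gt_eqF//; lra.
    by rewrite ler_pM2r.
  have : (1 - th) ^+ m * a <= tau * a by rewrite ler_pM2r// ltW.
  lra.
(* Away from Gamma at the new scale: [z'] has twice the distance, so [w z' + a >= 2 * CH * a], and
   Harnack for [w + a] gives [w z + a >= 2 * a]. *)
- move=> z hz hd; have s0 : 0 < eta * (rho / 2) by rewrite mulr_gt0//; lra.
  have [z' h1 h2] := away S s0 hd.
  have KS : (Kc + 1) * (eta * (rho / 2)) <= rho / 4.
    have -> : (Kc + 1) * (eta * (rho / 2)) = (2 * (Kc + 1)) * eta * (rho / 4) by field.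
    rewrite -[leRHS]mul1r ler_pM2r ?divr_gt0// mulrC -ler_pdivlMr// mul1r; exact: etaK.
  have e0 x : a + 1 * w x = w x + a by rewrite mul1r addrC.
  have hz' : enorm (z' - y) < rho by have := enorm_trans z' z y; lra.
  have := CHP _ _ _ _ z' z _ S (sol_affine n0 C11 G0 cG el a 1 sw) s0 _ hd _ _.
  rewrite !e0 => hh; have : w z' + a <= CH * (w z + a).
    apply: hh.
    - by lra.
    - by rewrite enormB.
    - move=> x hx; rewrite e0; have := enorm_trans x z' y; have := enorm_trans z' z y => q1 q2.
      have : - a <= w x by apply: wa; lra.
      lra.
  have : 2 * CH * a <= w z' by apply: wA => //; lra.
  move=> q1 q2; have -> : 2 * CH * (tau * a) = a by rewrite /tau; field; rewrite gt_eqF.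
  have q3 : CH * (2 * a) <= CH * (w z + a) by lra.
  by rewrite ler_pM2l// in q3; lra.
- by rewrite e1.
Qed.

Lemma shell_geometry Z y x0 X0 (r : R) : 0 < r -> 3 / 2 * r < enorm (Z - x0) -> enorm (Z - x0) < 5 / 2 * r ->
  enorm (Z - y) < r / 16 -> enorm (X0 - x0) <= r ->
  [/\ forall z, enorm (z - y) < 4 * (r / 16) -> r <= enorm (z - x0),
    forall z, enorm (z - y) < r / 16 -> enorm (z - x0) <= 3 * r & enorm (X0 - y) <= 64 * (r / 16)].
Proof.
move=> r0 h1 h2 h3 h4; have q1 := enorm_trans Z y x0; have q2 := enorm_trans y Z x0; rewrite (enormB y Z) in q2.
split=> [z hz|z hz|]; [have := enorm_trans y z x0; rewrite (enormB y z)|have := enorm_trans z y x0|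
  have := enorm_trans X0 x0 y; rewrite (enormB x0 y)]; lra.
Qed.

Lemma shell_radii (r : R) : 0 < r ->
  [/\ r < 3 / 2 * r, 3 / 2 * r < 2 * r, 3 / 2 * r < 5 / 2 * r & 5 / 2 * r < 3 * r].
Proof. by move=> r0; split; lra. Qed.

Lemma le_sub2 (p q a k : R) : a + k <= p -> q <= k -> a <= p - q.
Proof. by move=> h1 h2; lra. Qed.

(** That the combinations [c * v - u] are solutions is a hypothesis here; for [U] it follows from
    linearity. The common bound [B] provides the boundedness that [comparison] asks for. *)
Lemma boundary_harnack : exists2 C : R, 0 < C & forall Gamma A x0 X0 (r B : R) u v Gu Gv,
  setting d C0 C1 Gamma A -> sol d Gamma A u Gu -> sol d Gamma A v Gv ->
  (forall c : R, exists G, sol d Gamma A (fun z => c * v z - u z) G) ->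
  (forall z, 0 <= u z <= B) -> (forall z, 0 <= v z <= B) ->
  (forall z, Gamma z -> r <= enorm (z - x0) -> u z = 0 /\ v z = 0) ->
  Gamma x0 -> 0 < r -> corkscrew_point Gamma eps x0 r X0 ->
  forall X, 2 * r <= enorm (X - x0) -> u X * v X0 <= C * (u X0 * v X).
Proof.
have [Ac [eta [Ac0 /andP[eta0 eta8]] POS]] := positivity.
(* Carleson's estimate is used at scale [r / 16]: [X0] is within [64 * (r / 16)] of the centre and
   at distance at least [16 * eps * (r / 16)] from Gamma. *)
have [||C4 C40 CAR] := @carleson 64 (16 * eps); [by []|by rewrite mulr_gt0|].
pose e3 := Num.min eps (eta / 16).
have e30 : 0 < e3 by rewrite lt_min eps0 divr_gt0.
have [|C3 C31 CHP] := chain_harnack n0 d0 dn C01 C11 (K := 4 / e3); first by rewrite divr_ge0// ltW.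
have C30 : 0 < C3 by lra.
(* After division by [C3], the first summand leaves the margin [(Ac + 1) * C4] for [positivity], the
   second covers the points of the shell far from Gamma. *)
pose M := C3 * ((Ac + 1) * C4) + C3 * C3.
have M0 : 0 < M by rewrite addr_gt0// !mulr_gt0// addr_gt0.
exists M => // Gamma A x0 X0 r B u v Gu Gv S su sv sw u0 v0 z0 Gx0 r0 ck X hX.
have [G0 cG AR el] := S; have [nX0 hX0 dX0] := ck.
have s0 : 0 < e3 * r by rewrite mulr_gt0.
have e3e : e3 <= eps by rewrite ge_min lexx.
have e3h : e3 <= eta / 16 by rewrite ge_min lexx orbT.
have dX0' : e3 * r <= dist_to Gamma X0 by apply: le_trans dX0; rewrite ler_pM2r.
have K4 : 4 / e3 * (e3 * r) = 4 * r by field; rewrite gt_eqF.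
have chain t G (Z : E) : sol d Gamma A t G -> (forall z, 0 <= t z) -> enorm (Z - x0) <= 3 * r ->
    eta * (r / 16) <= dist_to Gamma Z -> t X0 <= C3 * t Z /\ t Z <= C3 * t X0.
  move=> st t0 hZ dZ; have dZ' : e3 * r <= dist_to Gamma Z.
    by apply: le_trans dZ; have : e3 * r <= eta / 16 * r by [rewrite ler_pM2r]; lra.
  have hh : enorm (Z - X0) <= 4 * r by have := enorm_trans Z x0 X0; rewrite (enormB x0); lra.
  by split; apply: (CHP _ _ _ _ _ _ _ S st s0) => //; rewrite K4// enormB.
have uv : 0 <= M * v X by rewrite mulr_ge0 ?(ltW M0)//; have /andP[] := v0 X.
have /andP[vX0 _] := v0 X0; have /andP[uX0 _] := u0 X0; have /andP[uX _] := u0 X.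
have /andP[vX _] := v0 X.
have [bz|bn] := eqVneq (v X0) 0.
  by rewrite bz mulr0 mulr_ge0 ?(ltW M0)// mulr_ge0.
have b0 : 0 < v X0 by rewrite lt_def bn.
(* A positive [a0 >= u X0] replaces [u X0], which may be 0, so that the constants passed to
   [positivity] are positive. *)
suff main (a0 : R) : 0 < a0 -> u X0 <= a0 -> u X * v X0 <= M * (a0 * v X).
  apply/ler_addgt0Pr => e e0.
  have Q0 : 0 < M * v X + 1 by rewrite ltr_wpDl.
  have e' : 0 < e / (M * v X + 1) by rewrite divr_gt0.
  apply: le_trans (main (u X0 + e / (M * v X + 1)) _ _) _; [by rewrite ltr_wpDl|by rewrite lerDl ltW|].
  have -> : M * ((u X0 + e / (M * v X + 1)) * v X) = M * (u X0 * v X) + (M * v X) / (M * v X + 1) * e.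
    by field; rewrite gt_eqF.
  by rewrite lerD2l ger_pMl// ler_pdivrMr// mul1r lerDl.
move=> a00 ua; pose c := M * a0 / v X0.
have c0 : 0 < c by rewrite divr_gt0// mulr_gt0.
have cv (Z : E) : v X0 <= C3 * v Z -> M * a0 / C3 <= c * v Z.
  move=> h; have -> : M * a0 / C3 = c * (v X0 / C3) by rewrite /c; field; rewrite bn gt_eqF.
  by rewrite ler_pM2l// ler_pdivrMr// mulrC.
have MC : M * a0 / C3 = (Ac + 1) * C4 * a0 + C3 * a0 by rewrite /M; field; rewrite gt_eqF.
have C3a : 0 < C3 * a0 by rewrite mulr_gt0.
have C4a : 0 < C4 * a0 by rewrite mulr_gt0.
have AC4a : 0 < (Ac + 1) * C4 * a0 by rewrite !mulr_gt0// addr_gt0.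
have [G sG] := sw c.
have upos z : 0 <= u z by have /andP[] := u0 z.
have vpos z : 0 <= v z by have /andP[] := v0 z.
have zero z : Gamma z -> r <= enorm (z - x0) -> c * v z - u z = 0.
  by move=> Gz hz; have [-> ->] := z0 z Gz hz; rewrite mulr0 subrr.
have [r31 r32 r35 r53] := shell_radii r0.
have shell (Z : E) : 3 / 2 * r < enorm (Z - x0) -> enorm (Z - x0) < 5 / 2 * r -> 0 <= c * v Z - u Z.
  move=> hZ1 hZ2; have hZr : r <= enorm (Z - x0) by exact: ltW (lt_trans r31 hZ1).
  have hZ3 : enorm (Z - x0) <= 3 * r by exact: ltW (lt_trans hZ2 r53).
  have [GZ|nZ] := pselect (Gamma Z); first by rewrite zero.
  have [far|near_] := leP (eta * (r / 16)) (dist_to Gamma Z).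
    have [|h1 _] := chain v Gv Z sv vpos _ far; first exact: hZ3.
    have [|_ h2] := chain u Gu Z su upos _ far; first exact: hZ3.
    have h3 : C3 * u X0 <= C3 * a0 by rewrite ler_pM2l.
    apply: (le_sub2 (k := C3 * a0)); last exact: le_trans h2 h3.
    by apply: le_trans (cv Z h1); rewrite MC add0r lerDr ltW.
  have dZ0 := dist_gt0 G0 cG nZ.
  have [y Gy hy] : exists2 y, Gamma y & enorm (Z - y) < 2 * dist_to Gamma Z.
    by apply: (dist_lt G0); rewrite ltr_pMl// ltr1n.
  have rho0 : 0 < r / 16 by rewrite divr_gt0.
  have er : eta * (r / 16) <= 8^-1 * (r / 16) by rewrite ler_pM2r.
  have Zy : enorm (Z - y) < r / 16 by lra.
  have Zy0 : 0 < enorm (Z - y).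
    exact: lt_le_trans dZ0 (dist_le G0 Z Gy).
  have [far_x0 near_x0 X0y] := shell_geometry r0 hZ1 hZ2 Zy hX0.
  have [J hJ] := @half_pow_small R (r / 16) _ Zy0.
  have uC z : enorm (z - y) <= r / 16 -> u z <= C4 * a0.
    move=> hz; apply: (@le_trans _ _ (C4 * u X0)); last by rewrite ler_pM2l.
    apply: (CAR _ _ _ _ y X0 (r / 16) S su upos Gy rho0 _ _ X0y _ hz).
    - by move=> z' Gz' hz'; have [] // := z0 z' Gz' (far_x0 _ hz').
    - by apply: le_trans dX0; apply: le_of_eq; field.
  (* Near Gamma [u <= C4 * a0], hence [c * v - u >= - C4 * a0] throughout the ball; away from Gamma
     [c * v >= (Ac + 1) * C4 * a0] leaves [Ac * C4 * a0]. *)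
  apply: (POS Gamma A _ _ y Z J (r / 16) (C4 * a0) S sG Gy rho0 C4a).
  - move=> z Gz hz; rewrite zero//; apply: far_x0; apply: lt_le_trans hz _.
    by rewrite ler_peMl ?(ltW rho0)// ler1n.
  - move=> z hz; apply: (le_sub2 (k := C4 * a0)); last exact: uC (ltW hz).
    by rewrite addNr mulr_ge0// ltW.
  - move=> z hz dz; have [h1 _] := chain v Gv z sv vpos (near_x0 _ hz) dz.
    apply: (le_sub2 (k := C4 * a0)); last exact: uC (ltW hz).
    apply: le_trans (cv z h1); rewrite MC.
    have -> : (Ac + 1) * C4 * a0 = Ac * (C4 * a0) + C4 * a0 by ring.
    by rewrite lerDl ltW.
  - exact: Zy.
  - exact: ltW.
  - by apply/ltW/hJ.
have ns : continuous (fun z : E => enorm (z - x0)) by exact: enorm_shift_cont.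
have o1 : open [set z : E | 3 / 2 * r < enorm (z - x0)].
  by have /continuousP h := ns; have := h _ (@open_gt R (3 / 2 * r)).
have o2 : open [set z : E | enorm (z - x0) < 5 / 2 * r].
  by have /continuousP h := ns; have := h _ (@open_lt R (5 / 2 * r)).
(* The two open sets are the exterior of the ball of radius [3 / 2 * r] and the ball of radius
   [5 / 2 * r]; they overlap in the shell. *)
have : 0 <= c * v X - u X.
  apply: (comparison n0 d0 dn C01 C11 (M := c * B + B) S sG o1 o2) => /=.
  - move=> z; have [h|h] := ltP (3 / 2 * r) (enorm (z - x0)); [by left|right; exact: le_lt_trans h r35].
  - move=> z; have /andP[h1 h2] := u0 z; have /andP[h3 h4] := v0 z.
    have cv0 : 0 <= c * v z by apply: mulr_ge0 => //; exact: ltW.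
    by apply: le_trans (ler_normB _ _) (lerD _ _); rewrite ger0_norm// ler_pM2l.
  - exact: shell.
  - by move=> z Gz hz; rewrite zero//; exact: le_trans (ltW r31) (ltW hz).
  - exact: lt_le_trans r32 hX.
rewrite subr_ge0 => h.
have e : M * (a0 * v X) = c * v X * v X0 by rewrite /c; field.
by rewrite e ler_pM2r.
Qed.

(** [growth_boundary] gives a lower bound at a corkscrew point of the small scale [q * r], and a
    Harnack chain carries it to [X0]. *)
Lemma mass_lower : exists2 c : R, 0 < c & forall Gamma A t G x0 X0 (r : R),
  setting d C0 C1 Gamma A -> sol d Gamma A t G -> (forall z, 0 <= t z) -> Gamma x0 -> 0 < r ->
  corkscrew_point Gamma eps x0 r X0 -> (forall z, Gamma z -> enorm (z - x0) < r / 2 -> 1 <= t z) -> c <= t X0.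
Proof.
have [th th0 GB] := growth_boundary n0 d0 dn C01 C11.
have np : 0 < n%:R :> R by rewrite ltr0n.
(* The cube of half-side [8 * q * r] about [x0] has Euclidean radius [r / 8], inside the ball where
   the boundary values are at least 1. *)
pose q := (64 * n%:R)^-1 : R; have q0 : 0 < q by rewrite invr_gt0 mulr_gt0.
have n1 : 1 <= n%:R :> R by rewrite ler1n.
have q64 : q <= 64^-1 by rewrite lef_pV2 ?posrE ?mulr_gt0// ler_peMr.
have qe0 : 0 < q * eps by rewrite mulr_gt0.
have [|C C1' CHP] := chain_harnack n0 d0 dn C01 C11 (K := 2 / (q * eps)); first by rewrite divr_ge0// ltW.
have Cp : 0 < C by lra.
exists (th / C); first by rewrite divr_gt0.
move=> Gamma A t G x0 X0 r S st t0 Gx0 r0 [nX0 hX0 dX0] t1; have [G0 cG AR el] := S.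
have qr : 0 < q * r by rewrite mulr_gt0.
have [_ cs] := hcs; have [Y [nY hY dY]] := cs Gamma G0 cG AR x0 (q * r) Gx0 qr.
have qr64 : q * r <= 64^-1 * r by rewrite ler_pM2r.
have tY : th <= t Y.
  rewrite -[leLHS]mulr1; apply: (GB Gamma A t G x0 (4 * (q * r)) 1 S st Gx0) => //; first by lra.
    move=> z Gz /ccubP/enorm_cub h; apply: t1 => //; apply: le_lt_trans h _.
    have -> : n%:R * (2 * (4 * (q * r))) = r / 8 by rewrite /q; field; rewrite gt_eqF.
    by lra.
  by move=> i; have := coord_le_enorm (Y - x0) i; rewrite !mxE; lra.
have s0 : 0 < q * eps * r by rewrite mulr_gt0.
rewrite ler_pdivrMr// mulrC; apply: le_trans tY _.
apply: (CHP _ _ _ _ _ _ _ S st s0) => //.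
- by apply: le_trans dY; apply: le_of_eq; ring.
- apply: le_trans dX0; rewrite ler_pM2r// ger_pMl//; lra.
- have -> : 2 / (q * eps) * (q * eps * r) = 2 * r by field; rewrite !gt_eqF.
  by have := enorm_trans X0 x0 Y; rewrite (enormB x0); lra.
Qed.

End boundary.

(** * Lipschitz boundary data *)

(** Both integrals are suprema over simple functions below the integrand, so the comparison covers
    nonmeasurable integrands, such as inner integrals. *)
Lemma nonneg_le_integral d (T : measurableType d) (R : realType) (mu : {measure set T -> \bar R})
    (D : set T) (f g : T -> \bar R) : (forall x, D x -> 0 <= f x)%E -> (forall x, D x -> f x <= g x)%E ->
  (\int[mu]_(x in D) f x <= \int[mu]_(x in D) g x)%E.
Proof.
move=> f0 fg; have g0 x : D x -> (0 <= g x)%E by move=> Dx; exact: le_trans (f0 x Dx) (fg x Dx).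
rewrite !ge0_integralE//; apply: ge_ereal_sup => _ [h hf <-]; apply: ereal_sup_ubound; exists h => // x.
apply: le_trans (hf x) _; rewrite /patch; case: ifPn => //; by rewrite inE => /fg.
Qed.

Section lipschitz.
Context {R : realType} {n : nat}.
Local Notation E := 'rV[R]_n.
Implicit Types (x y z c : E) (g h : E -> R).

Definition lipc g := (exists L : R, forall x y, `|g x - g y| <= L * enorm (x - y)) /\
  exists c, exists rho : R, forall x, rho <= enorm (x - c) -> g x = 0.

Lemma lipc_bounds g z : lipc g -> exists M rho : R, [/\ 0 < M, 0 < rho,
  forall x y, `|g x - g y| <= M * enorm (x - y), forall x, `|g x| <= M & forall x, rho <= enorm (x - z) -> g x = 0].
Proof.
move=> [[L hL] [c [r0 hc]]].
pose L' := `|L| + 1; pose r := `|r0| + enorm (c - z) + 1.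
have L'0 : 0 < L' by rewrite ltr_pwDr.
have r_0 : 0 < r by rewrite ltr_pwDr// addr_ge0// enorm_ge0.
have hL' x y : `|g x - g y| <= L' * enorm (x - y).
  by apply: le_trans (hL x y) _; rewrite ler_wpM2r ?enorm_ge0// (le_trans (ler_norm _))// lerDl.
have hz x : r <= enorm (x - z) -> g x = 0.
  move=> h; apply: hc; have := enorm_trans x c z; have := ler_norm r0; rewrite /r in h; lra.
exists (L' + (`|g z| + L' * r)), r; split => //.
- by rewrite ltr_wpDr// addr_ge0// mulr_ge0// ltW.
- move=> x y; apply: le_trans (hL' x y) _; by rewrite ler_wpM2r ?enorm_ge0// lerDl addr_ge0// mulr_ge0// ltW.
move=> x; have [/hz ->|h] := leP r (enorm (x - z)).
  by rewrite normr0 addr_ge0 ?addr_ge0 ?mulr_ge0// ltW.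
have := hL' x z; have : L' * enorm (x - z) <= L' * r by rewrite ler_pM2l// ltW.
have : `|g x| <= `|g x - g z| + `|g z| by rewrite -[in X in X <= _](subrK (g z) (g x)) ler_normD.
lra.
Qed.

Lemma lipc_comb g h (a b : R) : lipc g -> lipc h -> lipc (fun x => a * g x + b * h x).
Proof.
move=> lg lh; have [M [r [M0 r0 gL gM gz]]] := lipc_bounds 0 lg.
have [N [s [N0 s0 hL hN hz]]] := lipc_bounds 0 lh; split.
  exists (`|a| * M + `|b| * N) => x y.
  have -> : a * g x + b * h x - (a * g y + b * h y) = a * (g x - g y) + b * (h x - h y) by ring.
  apply: le_trans (ler_normD _ _) _; rewrite !normrM mulrDl -!mulrA.
  by apply: lerD; apply: ler_wpM2l.
exists 0, (r + s) => x hx; rewrite gz ?hz ?mulr0 ?addr0//; lra.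
Qed.

Lemma lipc_continuous g : (0 < n)%N -> lipc g -> continuous g.
Proof.
move=> n0 lg; have [M [r [M0 r0 gL gM gz]]] := lipc_bounds 0 lg.
apply: contI => x e e0; have eM : 0 < e / M by rewrite divr_gt0.
exists (e / M / (2 * n%:R)); first by rewrite divr_gt0// mulr_gt0// ltr0n.
by move=> y /(ball_eball n0 eM) h; apply: le_lt_trans (gL _ _) _; rewrite mulrC -ltr_pdivlMr.
Qed.

End lipschitz.

Section lipschitz_in_H.
Context {R : realType} {n : nat}.
Variables (d C0 : R) (Gamma : set 'rV[R]_n).
Local Notation E := 'rV[R]_n.
Implicit Types (x y z : E) (g : E -> R).
Local Notation hs := (hausdorff_om n d).
Hypotheses (n0 : (0 < n)%N) (d0 : 0 < d) (C01 : 1 <= C0) (G0 : Gamma !=set0) (cG : closed Gamma)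
  (AR : ahlfors_regular Gamma d C0).
Local Notation hmeas A := (measurable (A : set (hausT n d))).

Lemma haus_closed (F : set E) : closed F -> hmeas F.
Proof. by move=> cF; apply: (metric_closed n0 _ cF) => A B e; exact: hausdorff_metric. Qed.

Lemma haus_open (O : set E) : open O -> hmeas O.
Proof. by move=> oO; rewrite -(setCK O); apply: measurableC; apply: haus_closed; exact: open_closedC. Qed.

Lemma haus_continuous g : continuous g -> measurable_fun (Gamma : set (hausT n d)) (g : hausT n d -> R).
Proof.
move=> cg mD; apply: (measurability _ (RGenOInfty.measurableE R)) => //.
move=> /= _ [_ [x ->] <-]; apply: measurableI => //; rewrite preimage_itvoy; apply: haus_open.
have /continuousP cf' := cg; have h := cf' _ (@open_gt R x); exact: h.
Qed.

Definition ballfn z (r c : R) : E -> \bar R := fun y => (c%:E * (\1_(eball z r) y)%:E)%E.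

Lemma ballfn_ge0 z (r c : R) y : 0 <= c -> (0 <= ballfn z r c y)%E.
Proof. by move=> N0; rewrite /ballfn -EFinM lee_fin mulr_ge0. Qed.

Lemma ballfn_in z (r c : R) y : enorm (y - z) < r -> ballfn z r c y = c%:E.
Proof. by move=> h; rewrite /ballfn indicE mem_set ?mule1. Qed.

Lemma ballfn_mfn z (r c : R) :
  measurable_fun (Gamma : set (hausT n d)) (ballfn z r c : hausT n d -> \bar R).
Proof.
apply: measurable_funeM; apply/measurable_EFinP; apply: measurable_indic.
by apply: haus_open; exact: eball_open.
Qed.

Lemma ballfn_int z (r c : R) : Gamma z -> 0 < r -> 0 <= c ->
  (\int[haus n d]_(y in Gamma) ballfn z r c y <= (c * (C0 * r `^ d))%:E)%E.
Proof.
move=> Gz r0 c0; have mG := haus_closed cG; have mE := haus_open (@eball_open R n z r n0).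
have mi : measurable_fun (Gamma : set (hausT n d)) (fun y : hausT n d => (\1_(eball z r) y)%:E : \bar R).
  by apply/measurable_EFinP; apply: measurable_indic.
have i0 (x : hausT n d) : Gamma x -> (0 <= (\1_(eball z r) x)%:E :> \bar R)%E by rewrite lee_fin.
have c0' : (0 <= c%:E)%E by rewrite lee_fin.
have e := ge0_integralZl (haus n d) mG mi i0 c0'; rewrite /ballfn e.
rewrite (integral_indic (haus n d) mG mE) setIC EFinM.
by apply: lee_wpmul2l => //; exact: (ar_hi AR).
Qed.

Lemma int_ball z (F : E -> \bar R) (r c : R) : Gamma z -> 0 < r -> 0 <= c -> (forall y, Gamma y -> (0 <= F y)%E) ->
  (forall y, Gamma y -> enorm (y - z) < r -> (F y <= c%:E)%E) ->
  (forall y, Gamma y -> r <= enorm (y - z) -> F y = 0%E) ->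
  (\int[haus n d]_(y in Gamma) F y <= (c * (C0 * r `^ d))%:E)%E.
Proof.
move=> Gz r0 c0 F0 Fc Fz; apply: le_trans (ballfn_int Gz r0 c0).
apply: nonneg_le_integral => y Gy; first exact: F0.
have [h|h] := leP r (enorm (y - z)); first by rewrite Fz//; exact: ballfn_ge0.
by rewrite ballfn_in//; exact: Fc.
Qed.

(** On the dyadic shell between [rho] and [2 * rho] about [z] this dominates [N / |y - z|^(d+1)],
    and its integral over Gamma is at most a constant times [N / rho]. *)
Definition shellfn z (rho N : R) : E -> \bar R := ballfn z (2 * rho) (N / rho `^ (d + 1)).

Lemma shellfn_ge0 z (rho N : R) y : 0 <= N -> (0 <= shellfn z rho N y)%E.
Proof. by move=> N0; apply: ballfn_ge0; rewrite divr_ge0// powR_ge0. Qed.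

Lemma shellfn_in z (rho N : R) y : enorm (y - z) < 2 * rho -> shellfn z rho N y = (N / rho `^ (d + 1))%:E.
Proof. exact: ballfn_in. Qed.

Lemma shellfn_int z (rho N : R) : Gamma z -> 0 < rho -> 0 <= N ->
  (\int[haus n d]_(y in Gamma) shellfn z rho N y <= (N * C0 * 2 `^ d / rho)%:E)%E.
Proof.
move=> Gz r0 N0; have r2 : 0 < 2 * rho by rewrite mulr_gt0.
apply: le_trans (ballfn_int Gz r2 _) _; first by rewrite divr_ge0// powR_ge0.
rewrite lee_fin powRM ?(ltW r0)// powRD; last by rewrite (gt_eqF r0) implybT.
rewrite powRr1 ?(ltW r0)//; have : 0 < rho `^ d by rewrite powR_gt0.
by move: (rho `^ d) (2 `^ d) => X Y X0; apply: le_of_eq; field; rewrite !gt_eqF.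
Qed.

(** Two sequences, since the kernel is summed both over shells shrinking to [z] and over shells
    growing to infinity; each sequence has integrals bounded by a geometric series. *)
Lemma two_shells z (F : E -> \bar R) (rho N rho' N' : nat -> R) (b : R) : Gamma z -> 0 <= b ->
  (forall k, 0 < rho k) -> (forall k, 0 <= N k) -> (forall k, 0 < rho' k) -> (forall k, 0 <= N' k) ->
  (forall k, N k * C0 * 2 `^ d / rho k <= b / (2 ^ k.+1)%:R) ->
  (forall k, N' k * C0 * 2 `^ d / rho' k <= b / (2 ^ k.+1)%:R) ->
  (forall y, Gamma y -> (0 <= F y)%E /\ exists k,
    (enorm (y - z) < 2 * rho k /\ (F y <= (N k / rho k `^ (d + 1))%:E)%E) \/
    (enorm (y - z) < 2 * rho' k /\ (F y <= (N' k / rho' k `^ (d + 1))%:E)%E)) ->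
  (\int[haus n d]_(y in Gamma) F y <= (2 * b)%:E)%E.
Proof.
move=> Gz b0 r0 N0 r0' N0' hb hb' hF; have mG := haus_closed cG.
pose h k y := (shellfn z (rho k) (N k) y + shellfn z (rho' k) (N' k) y)%E.
have h0 k y : (0 <= h k y)%E by rewrite adde_ge0// shellfn_ge0.
have mh k : measurable_fun (Gamma : set (hausT n d)) (h k : hausT n d -> \bar R).
  by apply: emeasurable_funD; exact: ballfn_mfn.
apply: (@le_trans _ _ (\int[haus n d]_(y in Gamma) (\sum_(k <oo) h k y))%E).
  apply: nonneg_le_integral => y Gy; have [F0 [k hk]] := hF y Gy => //.
  apply: (@le_trans _ _ (h k y)); last exact: (nneseries_ge_term (u := fun k => h k y)).
  case: hk => [[q1 q2]|[q1 q2]]; apply: (le_trans q2).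
    by rewrite /h (shellfn_in _ q1) leeDl// shellfn_ge0.
  by rewrite /h (shellfn_in (N' k) q1) leeDr// shellfn_ge0.
rewrite integral_nneseries//.
have b20 : 0 <= 2 * b by rewrite mulr_ge0.
apply: le_trans (@epsilon_trick0 R (2 * b) xpredT b20); apply: lee_nneseries => k _.
  by move=> _; apply: integral_ge0.
rewrite ge0_integralD//; first last.
- exact: ballfn_mfn.
- by move=> y _; exact: shellfn_ge0.
- exact: ballfn_mfn.
- by move=> y _; exact: shellfn_ge0.
have -> : 2 * b / (2 ^ k.+1)%:R = b / (2 ^ k.+1)%:R + b / (2 ^ k.+1)%:R by lra.
by rewrite EFinD; apply: leeD; apply: le_trans (shellfn_int _ _ _) _ => //; rewrite lee_fin.
Qed.

Lemma dyadic_out (rho a : R) : 0 < rho -> rho <= a -> exists k, rho * 2 ^+ k <= a < rho * 2 ^+ k.+1.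
Proof.
move=> r0 ra; have [J hJ] := half_pow_small a r0.
have ex : exists k, a < rho * 2 ^+ k.
  by exists J; have := hJ J (leqnn J); rewrite ltr_pdivrMr ?exprn_gt0.
case: (ex_minnP ex) => [[|k] hk mk]; first by move: hk; rewrite expr0 mulr1 ltNge ra.
by exists k; rewrite hk andbT leNgt; apply/negP => /mk; rewrite ltnn.
Qed.

Lemma dyadic_in (a : R) : 0 < a < 1 -> exists k, 2 ^- k.+1 <= a < 2 * 2 ^- k.+1.
Proof.
move=> /andP[a0 a1]; have [J hJ] := half_pow_small 1 a0.
have ex : exists k, 2 ^- k <= a.
  by exists J; have := hJ J (leqnn J); rewrite div1r => /ltW.
case: (ex_minnP ex) => [[|k] hk mk]; first by move: hk; rewrite expr0 invr1 leNgt a1.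
exists k; rewrite hk/= ltNge; apply/negP => h; have : (k < k)%N; last by rewrite ltnn.
by apply: mk; move: h; rewrite exprS invfM mulrA mulfV ?mul1r// pnatr_eq0.
Qed.

(** The inner integral is bounded: the Lipschitz bound tames the diagonal, the bound on [g] the far
    shells. For [x] far from the support it decays like [|x - z0|^(-d-1)], which is integrable on a
    set of dimension [d]. *)
Lemma lipc_in_H g : lipc g -> in_H Gamma d g.
Proof.
move=> lg; split; first by apply: haus_continuous; exact: (lipc_continuous n0).
have [z0 Gz0] := G0; have [M [R0 [M0 R00 gL gM gz]]] := lipc_bounds z0 lg.
have D0 : 0 <= C0 * 2 `^ d by rewrite mulr_ge0 ?powR_ge0//; have := C01; lra.
pose F x y := `|g x - g y| ^+ 2 / enorm (x - y) `^ (d + 1).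
have F0 x y : 0 <= F x y by rewrite divr_ge0 ?sqr_ge0 ?powR_ge0.
have d1 : 0 < d + 1 by have := d0; lra.
have mono (a b N : R) : 0 < a <= b -> 0 <= N -> N / b `^ (d + 1) <= N / a `^ (d + 1).
  move=> /andP[a0 ab] N0; apply: ler_wpM2l => //; rewrite lef_pV2 ?posrE ?powR_gt0//; last exact: lt_le_trans ab.
  by apply: ge0_ler_powR; rewrite ?nnegrE ?(ltW d1) ?(ltW a0)// (le_trans (ltW a0)).
have g2 x y : `|g x - g y| <= 2 * M.
  by apply: le_trans (ler_normB _ _) _; have := gM x; have := gM y; lra.
pose b := 4 * M ^+ 2 * (C0 * 2 `^ d) * 2.
have b0 : 0 <= b by rewrite mulr_ge0// mulr_ge0// mulr_ge0// sqr_ge0.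
have inner x : Gamma x -> (\int[haus n d]_(y in Gamma) (F x y)%:E <= (2 * b)%:E)%E.
  move=> Gx; apply: (@two_shells x _ (fun k => 2 ^- k.+1) (fun k => 4 * M ^+ 2 * (2 ^- k.+1) ^+ 2)
    (fun k => 2 ^+ k) (fun k => 4 * M ^+ 2)) => //.
  - by move=> k; rewrite mulr_ge0 ?sqr_ge0// mulr_ge0// sqr_ge0.
  - by move=> k; rewrite mulr_ge0// sqr_ge0.
  - move=> k; rewrite natrX /b; have : 0 < 2 ^+ k.+1 :> R by rewrite exprn_gt0.
    move: (2 ^+ k.+1) => p p0.
    have -> : 4 * M ^+ 2 * p^-1 ^+ 2 * C0 * 2 `^ d / p^-1 = 4 * M ^+ 2 * (C0 * 2 `^ d) / p by field; rewrite gt_eqF.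
    rewrite ler_pM2r ?invr_gt0// ler_peMr//; last by lra.
    by rewrite mulr_ge0// mulr_ge0// sqr_ge0.
  - move=> k; rewrite natrX /b (exprS 2 k); have : 0 < 2 ^+ k :> R by rewrite exprn_gt0.
    by move: (2 ^+ k) (2 `^ d) => p D p0; apply: le_of_eq; field; rewrite gt_eqF.
  move=> y Gy; split; first by rewrite lee_fin.
  have [e0|en] := eqVneq (enorm (x - y)) 0.
    exists 0%N; right; rewrite enormB e0; split; first by rewrite mulr_gt0.
    by rewrite lee_fin /F e0 powR0 ?gt_eqF// invr0 mulr0 divr_ge0 ?powR_ge0// mulr_ge0// sqr_ge0.
  have ep : 0 < enorm (x - y) by rewrite lt_def en enorm_ge0.
  have [h|h] := ltP (enorm (x - y)) 1.
    have [|k /andP[k1 k2]] := @dyadic_in (enorm (x - y)); first by rewrite ep.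
    exists k; left; rewrite enormB; split=> //; rewrite lee_fin.
    have i0 : 0 < 2 ^- k.+1 :> R by rewrite invr_gt0 exprn_gt0.
    apply: (@le_trans _ _ (4 * M ^+ 2 * (2 ^- k.+1) ^+ 2 / enorm (x - y) `^ (d + 1))); last first.
      by apply: mono; [rewrite i0|rewrite mulr_ge0 ?sqr_ge0// mulr_ge0// sqr_ge0].
    apply: ler_wpM2r; first by rewrite invr_ge0 powR_ge0.
    have -> : 4 * M ^+ 2 * (2 ^- k.+1) ^+ 2 = (M * (2 * 2 ^- k.+1)) ^+ 2 by ring.
    rewrite ler_sqr ?nnegrE//; last by rewrite mulr_ge0 ?(ltW M0)// mulr_ge0// ltW.
    by apply: le_trans (gL x y) _; rewrite ler_pM2l// ltW.
  have [k /andP[k1 k2]] := dyadic_out ltr01 h; rewrite !mul1r in k1 k2.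
  exists k; right; rewrite enormB; split; first by rewrite -exprS.
  rewrite lee_fin; apply: (@le_trans _ _ (4 * M ^+ 2 / enorm (x - y) `^ (d + 1))); last first.
    by apply: mono; [rewrite k1 exprn_gt0|rewrite mulr_ge0// sqr_ge0].
  apply: ler_wpM2r; first by rewrite invr_ge0 powR_ge0.
  have -> : 4 * M ^+ 2 = (2 * M) ^+ 2 by ring.
  by rewrite ler_sqr ?nnegrE// mulr_ge0// ltW.
pose N1 := 2 * b * R0 `^ (d + 1).
have N10 : 0 <= N1 by rewrite mulr_ge0 ?powR_ge0// mulr_ge0.
pose N2 := M ^+ 2 * (2 `^ (d + 1)) * (C0 * R0 `^ d).
have N20 : 0 <= N2.
  by rewrite mulr_ge0//; [rewrite mulr_ge0 ?powR_ge0 ?sqr_ge0|rewrite mulr_ge0 ?powR_ge0//; have := C01; lra].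
have outer x : Gamma x -> 2 * R0 <= enorm (x - z0) ->
    (\int[haus n d]_(y in Gamma) (F x y)%:E <= (N2 / enorm (x - z0) `^ (d + 1))%:E)%E.
  move=> Gx hx; have a0 : 0 < enorm (x - z0) by lra.
  have gx : g x = 0 by apply: gz; lra.
  pose c := M ^+ 2 * 2 `^ (d + 1) / enorm (x - z0) `^ (d + 1).
  have c0 : 0 <= c by rewrite divr_ge0 ?powR_ge0// mulr_ge0 ?powR_ge0 ?sqr_ge0.
  have -> : N2 / enorm (x - z0) `^ (d + 1) = c * (C0 * R0 `^ d) by rewrite /N2 /c; ring.
  apply: (int_ball (F := fun y => (F x y)%:E) Gz0 R00 c0).
  - by move=> y _; rewrite lee_fin F0.
  - move=> y Gy h; rewrite lee_fin /F gx sub0r normrN.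
    have h2 : enorm (x - z0) / 2 <= enorm (x - y) by have := enorm_trans x y z0; lra.
    apply: (@le_trans _ _ (M ^+ 2 / enorm (x - y) `^ (d + 1))).
      apply: ler_wpM2r; first by rewrite invr_ge0 powR_ge0.
      by rewrite ler_sqr ?nnegrE ?(ltW M0).
    have -> : c = M ^+ 2 / (enorm (x - z0) / 2) `^ (d + 1).
      rewrite powR_div ?(ltW a0)// /c.
      have : 0 < enorm (x - z0) `^ (d + 1) by rewrite powR_gt0.
      have : 0 < 2 `^ (d + 1) :> R by rewrite powR_gt0.
      by move: (_ `^ (d + 1)) (2 `^ (d + 1)) => X Y X0 Y0; field; rewrite !gt_eqF.
    by apply: mono; [rewrite h2 andbT divr_gt0|exact: sqr_ge0].
  - by move=> y Gy h; rewrite /F gx (gz y h) subrr normr0 expr0n/= mul0r.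
pose b2 := (N1 + N2) * C0 * 2 `^ d / R0 * 2.
have b20 : 0 <= b2.
  by rewrite mulr_ge0// divr_ge0 ?(ltW R00)// -mulrA mulr_ge0// addr_ge0.
apply: (@le_lt_trans _ _ (2 * b2)%:E); last exact: ltry.
(* The first sequence serves [|x - z0| < 2 * R0] through its term [k = 0] alone; the factors
   [2 ^- k] only keep it summable. *)
apply: (@two_shells z0 _ (fun k => R0) (fun k => N1 * 2 ^- k) (fun k => 2 * R0 * 2 ^+ k) (fun k => N2)) => //.
- by move=> k; rewrite mulr_ge0// invr_ge0 exprn_ge0.
- by move=> k; rewrite mulr_gt0 ?exprn_gt0// mulr_gt0.
- move=> k; rewrite natrX /b2 (exprS 2 k); have : 0 < 2 ^+ k :> R by rewrite exprn_gt0.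
  move: (2 ^+ k) => p p0.
  have -> : (N1 + N2) * C0 * 2 `^ d / R0 * 2 / (2 * p) = (N1 + N2) * (C0 * 2 `^ d / R0 / p) by field; rewrite !gt_eqF.
  have -> : N1 / p * C0 * 2 `^ d / R0 = N1 * (C0 * 2 `^ d / R0 / p) by field; rewrite !gt_eqF.
  by apply: ler_wpM2r; [rewrite divr_ge0 ?(ltW p0)// divr_ge0// ltW|rewrite lerDl].
- move=> k; rewrite natrX /b2 (exprS 2 k); have : 0 < 2 ^+ k :> R by rewrite exprn_gt0.
  move: (2 ^+ k) => p p0.
  have -> : (N1 + N2) * C0 * 2 `^ d / R0 * 2 / (2 * p) = (N1 + N2) * (C0 * 2 `^ d / R0 / p) by field; rewrite !gt_eqF.
  have -> : N2 * C0 * 2 `^ d / (2 * R0 * p) = N2 / 2 * (C0 * 2 `^ d / R0 / p) by field; rewrite !gt_eqF.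
  apply: ler_wpM2r; first by rewrite divr_ge0 ?(ltW p0)// divr_ge0// ltW.
  by move: (N1) (N2) N10 N20 => a c; lra.
move=> x Gx; split.
  by apply: integral_ge0 => y _; rewrite lee_fin; exact: F0.
have [h|h] := ltP (enorm (x - z0)) (2 * R0).
  exists 0%N; left; split=> //; apply: le_trans (inner x Gx) _; rewrite lee_fin expr0 invr1 mulr1 /N1.
  by rewrite mulfK// gt_eqF// powR_gt0.
have R20 : 0 < 2 * R0 by rewrite mulr_gt0.
have [k /andP[k1 k2]] := dyadic_out R20 h; exists k; right; split.
  by rewrite mulrCA -exprS.
apply: le_trans (outer x Gx h) _; rewrite lee_fin; apply: mono => //.
by rewrite k1 mulr_gt0// exprn_gt0.
Qed.

End lipschitz_in_H.

(** * Harmonic measure *)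

Section cutoff.
Context {R : realType} {n : nat}.
Local Notation E := 'rV[R]_n.
Implicit Types (x y z c : E) (f g : E -> R) (K V : set E).
Hypothesis n0 : (0 < n)%N.

Lemma clamp_lip (a b : R) : `|Num.max 0 (Num.min 1 a) - Num.max 0 (Num.min 1 b)| <= `|a - b|.
Proof.
have h1 := ler_norm (a - b); have h2 := ler_norm (b - a); rewrite distrC in h2.
have h3 := normr_ge0 (a - b).
rewrite ler_norml; apply/andP; split; case: (leP 1 a) => ?; case: (leP 1 b) => ?; do ?case: (leP 0) => ?; lra.
Qed.

Lemma lip_cutoff K c (r : R) V : compact K -> open V -> K `<=` V -> V `<=` eball c r ->
  exists f, [/\ lipc f, forall x, 0 <= f x <= 1, forall x, K x -> f x = 1 & forall x, ~ V x -> f x = 0].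
Proof.
move=> cK oV KV Vr; have [[k0 Kk0]|K0] := pselect (K !=set0); last first.
  exists (fun=> 0); split => //.
  - by split; [exists 0 => x y; rewrite subrr normr0 mul0r|exists 0, 0].
  - by move=> x; rewrite lexx/=.
  - by move=> x Kx; exfalso; apply: K0; exists x.
have Kn : K !=set0 by exists k0.
have [N [Q [e [[_ KN _ QV e0] NQ]]]] := compact_nbhd cK oV KV.
pose f x := Num.max 0 (Num.min 1 (1 - dist_to K x / e)).
have f1 x : K x -> f x = 1.
  by move=> Kx; rewrite /f dist0// mul0r subr0 minxx max_r.
have f0 x : ~ V x -> f x = 0.
  move=> nV; have h : e <= dist_to K x.
    rewrite leNgt; apply/negP => /(dist_lt Kn)[y Ky hy]; apply: nV; apply: QV; apply: (NQ y); first exact: KN.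
    by apply: eball_ball; rewrite /eball/=.
  apply: max_l; rewrite ge_min subr_le0 ler_pdivlMr// mul1r h orbT//.
exists f; split => //; last by move=> x; rewrite /f le_max lexx/= ge_max ge_min lexx ler01.
split.
  exists e^-1 => x y; apply: le_trans (clamp_lip _ _) _.
  have -> : 1 - dist_to K x / e - (1 - dist_to K y / e) = e^-1 * (dist_to K y - dist_to K x) by ring.
  rewrite normrM ger0_norm ?invr_ge0 ?(ltW e0)//; apply: ler_wpM2l; first by rewrite invr_ge0 ltW.
  have h1 := dist_lip Kn x y; have h2 := dist_lip Kn y x; rewrite (enormB y) in h2.
  by rewrite ler_norml; apply/andP; split; lra.
by exists c, r => x hx; apply: f0 => /Vr; rewrite /eball/= ltNge hx.
Qed.

Lemma borel_open (O : set (borelT R n)) : open (O : set E) -> measurable O.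
Proof. by move=> oO; apply: sub_sigma_algebra. Qed.

Lemma borel_closed (F : set (borelT R n)) : closed (F : set E) -> measurable F.
Proof. by move=> cF; rewrite -(setCK F); apply: measurableC; apply: borel_open; exact: closed_openC. Qed.

Section one_set.
Variables (Gamma : set E) (c : E) (r : R) (mu1 mu2 : {measure set (borelT R n) -> \bar R}) (u1 u2 : (E -> R) -> R).
Hypotheses (cG : closed Gamma) (r1 : regular_measure mu1) (r2 : regular_measure mu2)
  (i1 : forall f, lipc f -> (\int[mu1]_(y in Gamma) (f y)%:E)%E = (u1 f)%:E)
  (i2 : forall f, lipc f -> (\int[mu2]_(y in Gamma) (f y)%:E)%E = (u2 f)%:E).

Let mG : measurable (Gamma : set (borelT R n)). Proof. exact: borel_closed. Qed.

Lemma le_u1 f (K : set (borelT R n)) : lipc f -> measurable K -> K `<=` Gamma -> (forall x, Gamma x -> 0 <= f x) ->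
  (forall x, K x -> 1 <= f x) -> (mu1 K <= (u1 f)%:E)%E.
Proof.
move=> lf mK KG f0 f1; rewrite -i1// -(setIidl KG) -(integral_indic mu1 mG mK).
apply: nonneg_le_integral => x Gx; first by rewrite lee_fin.
rewrite lee_fin indicE; case: (boolP (x \in K)) => [|_]; last exact: f0.
by rewrite inE; exact: f1.
Qed.

Lemma u2_le f (V : set (borelT R n)) : lipc f -> measurable V -> (forall x, Gamma x -> 0 <= f x <= 1) ->
  (forall x, Gamma x -> ~ V x -> f x = 0) -> ((u2 f)%:E <= mu2 V)%E.
Proof.
move=> lf mV f01 f0; rewrite -i2//; apply: (@le_trans _ _ (mu2 (V `&` Gamma))); last first.
  by apply: le_measure; rewrite ?inE//; exact: measurableI.
rewrite -(integral_indic mu2 mG mV).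
apply: nonneg_le_integral => x Gx; first by have /andP[] := f01 x Gx; rewrite lee_fin.
rewrite lee_fin indicE; case: (boolP (x \in V)) => [_|]; first by have /andP[] := f01 x Gx.
by rewrite notin_setE => /(f0 x Gx) ->.
Qed.

(** [f] is 1 on a compact [K] inside [D] that carries almost all of its [mu1] mass, and 0 off an
    open [V] around [D] of almost the same [mu2] mass. Each measure is approximated on the one side
    on which the product inequality uses it. *)
Lemma one_set (D : set (borelT R n)) (e : R) : measurable D -> D `<=` Gamma `&` eball c r ->
  mu1 D \is a fin_num -> mu2 D \is a fin_num -> 0 < e ->
  exists f, [/\ lipc f, forall x, 0 <= f x <= 1, forall x, ~ eball c r x -> f x = 0,
    fine (mu1 D) - e <= u1 f & u2 f <= fine (mu2 D) + e].
Proof.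
move=> mD DG fin1 fin2 e0.
have [E1 _] := r1 mD; have [_ E2] := r2 mD.
have [_ [K [cK KD] <-] hK] : exists2 y, [set mu1 K | K in [set K : set (borelT R n) | compact (K : set E) /\ K `<=` D]] y &
    (mu1 D - e%:E < y)%E.
  by apply: ereal_sup_gt; rewrite -E1 lteBlDr// lteDl.
have [_ [V [oV DV] <-] hV] : exists2 y, [set mu2 V | V in [set V : set (borelT R n) | open (V : set E) /\ D `<=` V]] y &
    (y < mu2 D + e%:E)%E.
  by apply: ereal_inf_lt; rewrite -E2 lteDl.
pose W := V `&` eball c r.
have oW : open W by apply: openI => //; exact: eball_open.
have KW : K `<=` W by move=> x /KD Dx; split; [exact: DV|case: (DG x Dx)].
have Wr : W `<=` eball c r by move=> x [].
have [f [lf f01 fK fW]] := lip_cutoff cK oW KW Wr.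
have mK : measurable (K : set (borelT R n)).
  by apply: borel_closed; apply: compact_closed cK; exact: norm_hausdorff.
exists f; split => //.
- by move=> x nx; apply: fW => -[].
- rewrite -lee_fin EFinB fineK//; apply: le_trans (ltW hK) _; apply: le_u1 => //.
  + by move=> x /KD/DG[].
  + by move=> x _; have /andP[] := f01 x.
  + by move=> x /fK ->.
rewrite -lee_fin EFinD fineK//; apply: le_trans (ltW hV); apply: u2_le => //.
- exact: borel_open.
- by move=> x _ nV; apply: fW => -[].
Qed.

End one_set.
End cutoff.

Lemma product_limit (R : realType) (a b a0 b0 C : R) : 0 <= a <= 1 -> 0 <= b <= 1 -> 0 <= a0 <= 1 -> 0 <= b0 <= 1 -> 0 < C ->
  (forall e, 0 < e -> exists x y x' y', [/\ 0 <= x <= 1, 0 <= y <= 1, 0 <= x' & 0 <= y'] /\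
     [/\ a - e <= x, x' <= a0 + e, b0 - e <= y, y' <= b + e & x * y <= C * (x' * y')]) ->
  a * b0 <= C * (a0 * b).
Proof.
move=> /andP[a_0 a1] /andP[b_0 b1] /andP[a00 a01] /andP[b00 b01] C0 h; apply/ler_addgt0Pr => e e0.
have D0 : 0 < e + 3 + 3 * C by lra.
(* Ensures [q <= 1], so that each product of two perturbed factors is off by at most [3 * q], and
   [(3 + 3 * C) * q <= e]. *)
pose q := e / (e + 3 + 3 * C).
have q0 : 0 < q by rewrite divr_gt0.
have q1 : q <= 1 by rewrite ler_pdivrMr// mul1r; lra.
have qe : (3 + 3 * C) * q <= e.
  by rewrite /q mulrA ler_pdivrMr// mulrC ler_pM2l//; lra.
have [x [y [x' [y' [[/andP[x0 x1] /andP[y0 y1] x'0 y'0] [h1 h2 h3 h4 h5]]]]]] := h q q0.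
have A : a * b0 <= (x + q) * (y + q) by apply: ler_pM => //; lra.
have B : x' * y' <= (a0 + q) * (b + q) by apply: ler_pM.
have A2 : (x + q) * (y + q) <= x * y + 3 * q.
  have : x * q <= q by rewrite ler_piMl// ltW.
  have : q * y <= q by rewrite ler_piMr// ltW.
  have : q * q <= q by rewrite ler_piMr// ltW.
  lra.
have B2 : (a0 + q) * (b + q) <= a0 * b + 3 * q.
  have : a0 * q <= q by rewrite ler_piMl// ltW.
  have : q * b <= q by rewrite ler_piMr// ltW.
  have : q * q <= q by rewrite ler_piMr// ltW.
  lra.
have : C * (x' * y') <= C * (a0 * b + 3 * q) by rewrite ler_pM2l//; lra.
lra.
Qed.

Lemma ratio_bounds (R : realType) (a b a0 b0 C : R) : 0 < b -> 0 < b0 -> 0 < C ->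
  a * b0 <= C * (a0 * b) -> b * a0 <= C * (b0 * a) -> C^-1 * (a0 / b0) <= a / b <= C * (a0 / b0).
Proof.
move=> b_0 b00 C_0 h1 h2; apply/andP; split; last first.
  rewrite ler_pdivrMr//; have -> : C * (a0 / b0) * b = C * (a0 * b) / b0 by ring.
  by rewrite ler_pdivlMr.
have -> : C^-1 * (a0 / b0) = a0 / (C * b0) by rewrite invfM; ring.
rewrite ler_pdivrMr ?mulr_gt0//; have -> : a / b * (C * b0) = C * (b0 * a) / b by ring.
by rewrite ler_pdivlMr// mulrC.
Qed.

(** * Maximum principle and linearity for Lipschitz data *)

Section extension.
Context {R : realType} {n : nat}.
Variables (d C0 C1 eps : R).
Local Notation E := 'rV[R]_n.
Hypotheses (n0 : (0 < n)%N) (d0 : 0 < d) (dn : d < n%:R - 1) (C01 : 1 <= C0) (C11 : 1 <= C1).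
Variables (Gamma : set E) (A : E -> 'M[R]_n) (U : (E -> R) -> E -> R).
Hypotheses (S : setting d C0 C1 Gamma A) (hU : harmonic_extension Gamma d A U).
Implicit Types (x y z X : E) (f g : E -> R).

Lemma lipc_C00 f : lipc f -> in_C00 Gamma f.
Proof.
move=> lf; split; first by apply: continuous_subspaceT; exact: lipc_continuous.
have [M [r [_ _ _ _ fz]]] := lipc_bounds 0 lf.
exists [set z | enorm (z - 0) <= r]; first exact: compact_eball.
by move=> x _ /= /negP; rewrite -ltNge => /ltW; exact: fz.
Qed.

Lemma lipc_sol f : lipc f -> exists G, sol d Gamma A (U f) G.
Proof.
have [G0 cG AR el] := S; move=> lf.
apply: (sol_U n0 dn G0 cG hU); [exact: lipc_C00|exact: (lipc_in_H n0 d0 C01 G0 cG AR)].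
Qed.

Lemma lipc_bdry f y : lipc f -> Gamma y -> U f y = f y.
Proof.
have [G0 cG AR el] := S; move=> lf; have [_ _ _ h] := hU.
have [_ _ _ hf] := h f (lipc_C00 lf) (lipc_in_H n0 d0 C01 G0 cG AR lf); exact: hf.
Qed.

Lemma lipc_bounded f : lipc f -> exists M, forall x, `|U f x| <= M.
Proof.
move=> lf; have [M [r [_ _ _ fM _]]] := lipc_bounds 0 lf; have [_ _ [K hK] _] := hU.
by exists (K * M) => x; apply: hK; [exact: lipc_C00|].
Qed.

(** [comparison] with [O1] the whole space and [O2] empty. *)
Lemma lipc_ge0 f : lipc f -> (forall y, Gamma y -> 0 <= f y) -> forall x, 0 <= U f x.
Proof.
move=> lf f0 x; have [G sG] := lipc_sol lf; have [M hM] := lipc_bounded lf.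
apply: (comparison n0 d0 dn C01 C11 S sG openT open0 _ hM) => //.
  by move=> z; left.
by move=> z Gz _; rewrite lipc_bdry//; exact: f0.
Qed.

Lemma lipc_le1 f : lipc f -> (forall y, Gamma y -> f y <= 1) -> forall x, U f x <= 1.
Proof.
move=> lf f1 x; have [G0 cG AR el] := S; have [G sG] := lipc_sol lf; have [M hM] := lipc_bounded lf.
have e y : 1 + -1 * U f y = 1 - U f y by rewrite mulN1r.
have := comparison n0 d0 dn C01 C11 S (sol_affine n0 C11 G0 cG el 1 (-1) sG) openT open0 (M := 1 + M) (x := x) _ _ _ _ I.
rewrite e subr_ge0; apply => //.
- by move=> z; left.
- by move=> z; rewrite e; apply: le_trans (ler_normB _ _) _; rewrite normr1 lerD2l.
- by move=> z Gz _; rewrite e lipc_bdry// subr_ge0; exact: f1.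
Qed.

(** Linearity is given for the form [a * g + h] alone, so [c * g] is written as
    [(c - 1) * g + g]. *)
Lemma lipc_sub_sol f g (c : R) : lipc f -> lipc g -> exists G, sol d Gamma A (fun z => c * U g z - U f z) G.
Proof.
move=> lf lg; have [_ lin _ _] := hU.
have lh : lipc (fun x => (c - 1) * g x + g x).
  rewrite (_ : (fun _ => _) = (fun x => (c - 1) * g x + 1 * g x)); first exact: lipc_comb.
  by apply/funext => x; rewrite mul1r.
have lk : lipc (fun x => -1 * f x + ((c - 1) * g x + g x)).
  rewrite (_ : (fun _ => _) = (fun x => -1 * f x + 1 * ((c - 1) * g x + g x))); first exact: lipc_comb.
  by apply/funext => x; rewrite mul1r.
have [G] := lipc_sol lk; rewrite lin; [|exact: lipc_C00|exact: lipc_C00].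
rewrite lin; [|exact: lipc_C00|exact: lipc_C00].
rewrite (_ : (fun _ => _) = (fun z => c * U g z - U f z)); first by exists G.
by apply/funext => z; ring.
Qed.

End extension.

Theorem lemma11p16 (R : realType) (n : nat) (d C0 C1 eps : R) :
  (2 <= n)%N -> 0 < d < n%:R - 1 -> 1 <= C0 -> 1 <= C1 ->
  corkscrew_constant n d C0 eps ->
  exists2 C : R, 0 < C &
  forall (Gamma : set 'rV[R]_n) (A : 'rV[R]_n -> 'M[R]_n)
    (U : ('rV[R]_n -> R) -> 'rV[R]_n -> R)
    (omega : 'rV[R]_n -> {measure set (borelT R n) -> \bar R})
    (x0 X0 : 'rV[R]_n) (r : R),
  Gamma !=set0 -> closed Gamma -> ahlfors_regular Gamma d C0 ->
  elliptic Gamma d C1 A ->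
  harmonic_extension Gamma d A U ->
  (forall X, ~ Gamma X -> harmonic_measure Gamma U X (omega X)) ->
  Gamma x0 -> 0 < r -> corkscrew_point Gamma eps x0 r X0 ->
  (forall E F : set (borelT R n), measurable E -> measurable F ->
    E `<=` Gamma `&` eball x0 r -> F `<=` Gamma `&` eball x0 r ->
    (0 < omega X0 E)%E -> (0 < omega X0 F)%E ->
    forall X, ~ Gamma X -> ~ eball x0 (2 * r) X ->
      C^-1 * (fine (omega X0 E) / fine (omega X0 F)) <=
        fine (omega X E) / fine (omega X F) <=
        C * (fine (omega X0 E) / fine (omega X0 F))) /\
  (forall E : set (borelT R n), measurable E ->
    E `<=` Gamma `&` eball x0 r ->
    (0 < omega X0 E)%E ->
    forall X, ~ Gamma X -> ~ eball x0 (2 * r) X ->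
      C^-1 * fine (omega X0 E) <=
        fine (omega X E) / fine (omega X (eball x0 r `&` Gamma)) <=
        C * fine (omega X0 E)).
Proof.
move=> n2 /andP[d0 dn] C01 C11 hcs.
have n0 : (0 < n)%N by exact: ltnW.
have [Cb Cb0 BH] := boundary_harnack n0 d0 dn C01 C11 hcs.
have [cm cm0 ML] := mass_lower n0 d0 dn C01 C11 hcs.
have Cc0 : 0 <= Cb / cm by rewrite divr_ge0// ltW.
(* [Cb] serves the first claim; the second loses in addition the lower bound [cm] of the harmonic
   measure of the surface ball. *)
exists (Cb + Cb / cm); first by rewrite ltr_wpDr.
move=> Gamma A U omega x0 X0 r G0 cG AR el hU hw Gx0 r0 ck.
have S : setting d C0 C1 Gamma A by [].
have [nX0 hX0 dX0] := ck.
have C00 f : lipc f -> in_C00 Gamma f by exact: lipc_C00.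
have Ige X f : ~ Gamma X -> lipc f -> (\int[omega X]_(y in Gamma) (f y)%:E)%E = (U f X)%:E.
  by move=> nX lf; have [_ _ h] := hw X nX; apply: h; exact: C00.
have reg X : ~ Gamma X -> regular_measure (omega X) by move=> nX; have [] := hw X nX.
pose Delta : set (borelT R n) := eball x0 r `&` Gamma.
have mD : measurable Delta.
  apply: measurableI; last exact: borel_closed.
  by apply: borel_open; exact: eball_open.
have cpt (s : R) : compact [set z : 'rV[R]_n | enorm (z - x0) <= s] by exact: compact_eball.
(* A cutoff equal to 1 on the ball and the maximum principle make the measures finite on the sets
   considered. *)
have le1 X (D : set (borelT R n)) : ~ Gamma X -> measurable D -> D `<=` Gamma `&` eball x0 r -> (omega X D <= 1)%E.
  move=> nX mDD sD; have sub : [set z : 'rV[R]_n | enorm (z - x0) <= r] `<=` eball x0 (2 * r).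
    by move=> z /= h; rewrite /eball/=; lra.
  have [f [lf f01 f1 _]] := lip_cutoff (cpt r) (@eball_open R n x0 (2 * r) n0) sub (fun _ h => h).
  apply: (@le_trans _ _ (U f X)%:E).
    apply: (le_u1 cG (u1 := fun f => U f X) (fun f => Ige X f nX) lf mDD) => //.
    - by move=> x /sD[].
    - by move=> x _; have /andP[] := f01 x.
    - by move=> x /sD[_ h]; rewrite f1//=; exact: ltW.
  rewrite lee_fin; apply: (lipc_le1 n0 d0 dn C01 C11 S hU lf).
  by move=> y _; have /andP[] := f01 y.
have fin X (D : set (borelT R n)) : ~ Gamma X -> measurable D -> D `<=` Gamma `&` eball x0 r ->
    omega X D \is a fin_num /\ 0 <= fine (omega X D) <= 1.
  move=> nX mDD sD; have h := le1 X D nX mDD sD.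
  have hf : omega X D \is a fin_num by rewrite ge0_fin_numE ?measure_ge0// (le_lt_trans h)// ltry.
  by split=> //; rewrite fine_ge0 ?measure_ge0//= -lee_fin fineK.
have appr X Y (D : set (borelT R n)) (e : R) : ~ Gamma X -> ~ Gamma Y -> measurable D -> D `<=` Gamma `&` eball x0 r -> 0 < e ->
    exists f, [/\ lipc f, forall x, 0 <= f x <= 1, forall x, ~ eball x0 r x -> f x = 0,
      fine (omega X D) - e <= U f X & U f Y <= fine (omega Y D) + e].
  move=> nX nY mDD sD e0; have [fX _] := fin X D nX mDD sD; have [fY _] := fin Y D nY mDD sD.
  by apply: (one_set n0 cG (reg X nX) (reg Y nY) (u1 := fun f => U f X) (u2 := fun f => U f Y)) => // f; exact: Ige.
have U01 f X : lipc f -> (forall x, 0 <= f x <= 1) -> 0 <= U f X <= 1.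
  move=> lf f01; rewrite (lipc_ge0 n0 d0 dn C01 C11 S hU lf) ?(lipc_le1 n0 d0 dn C01 C11 S hU lf)//.
    by move=> y _; have /andP[] := f01 y.
  by move=> y _; have /andP[] := f01 y.
(* [E] is approximated from below at [X] and from above at [X0], and [F] the other way round, as the
   two sides of the inequality require. *)
have key (E F : set (borelT R n)) X : measurable E -> measurable F ->
    E `<=` Gamma `&` eball x0 r -> F `<=` Gamma `&` eball x0 r -> ~ Gamma X -> ~ eball x0 (2 * r) X ->
    fine (omega X E) * fine (omega X0 F) <= Cb * (fine (omega X0 E) * fine (omega X F)).
  move=> mE mF sE sF nX hX.
  have [_ a1] := fin X E nX mE sE; have [_ a2] := fin X F nX mF sF.
  have [_ a3] := fin X0 E nX0 mE sE; have [_ a4] := fin X0 F nX0 mF sF.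
  apply: product_limit => // e e0.
  have [f [lf f01 fz f1 f2]] := appr X X0 E e nX nX0 mE sE e0.
  have [g [lg g01 gz g1 g2]] := appr X0 X F e nX0 nX mF sF e0.
  exists (U f X), (U g X0), (U f X0), (U g X); split.
    split; [exact: U01|exact: U01| |]; first by have /andP[] := U01 f X0 lf f01.
    by have /andP[] := U01 g X lg g01.
  split => //; have [Gf sf] := lipc_sol n0 d0 dn C01 S hU lf; have [Gg sg'] := lipc_sol n0 d0 dn C01 S hU lg.
  apply: (BH Gamma A x0 X0 r 1 _ _ _ _ S sf sg') => //.
  - by move=> c; exact: (lipc_sub_sol n0 d0 dn C01 S hU).
  - by move=> z; exact: U01.
  - by move=> z; exact: U01.
  - move=> z Gz hz; rewrite !(lipc_bdry n0 d0 C01 S hU)// fz ?gz//; by rewrite /eball/= ltNge hz.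
  - by rewrite leNgt; exact/negP.
(* The chain constant depends on [X] here; it only serves to show that the denominator is
   positive. *)
have posit (F : set (borelT R n)) X : measurable F -> F `<=` Gamma `&` eball x0 r -> ~ Gamma X ->
    0 < fine (omega X0 F) -> 0 < fine (omega X F).
  move=> mF sF nX b0; have [_ /andP[b_0 b1]] := fin X F nX mF sF.
  have s0 : 0 < Num.min (dist_to Gamma X0) (dist_to Gamma X) by rewrite lt_min !dist_gt0.
  set s := Num.min _ _ in s0.
  have K0 : 0 <= enorm (X - X0) / s by rewrite divr_ge0 ?enorm_ge0// ltW.
  have [C C1' CH] := chain_harnack n0 d0 dn C01 C11 K0.
  have Cp : 0 < C by lra.
  suff : fine (omega X0 F) <= C * fine (omega X F).
    by move=> h; rewrite lt_def b_0 andbT; apply/eqP => z; rewrite z mulr0 in h; lra.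
  apply/ler_addgt0Pr => e e0; have q0 : 0 < e / (1 + C) by rewrite divr_gt0// addr_gt0.
  have [g [lg g01 gz g1 g2]] := appr X0 X F _ nX0 nX mF sF q0.
  have [G sG] := lipc_sol n0 d0 dn C01 S hU lg.
  have : U g X0 <= C * U g X.
    apply: (CH _ _ _ _ _ _ _ S sG s0).
    - by rewrite ge_min lexx.
    - by rewrite ge_min lexx orbT.
    - by rewrite divfK// gt_eqF.
    - by move=> z _; have /andP[] := U01 g z lg g01.
  have : C * U g X <= C * (fine (omega X F) + e / (1 + C)) by rewrite ler_pM2l.
  have eq : e = e / (1 + C) + C * (e / (1 + C)) by field; rewrite gt_eqF// addr_gt0.
  by move: eq g1 g2; move: (e / (1 + C)) => q; lra.
have sD : Delta `<=` Gamma `&` eball x0 r by move=> x [].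
have massD : cm <= fine (omega X0 Delta).
  have sub : [set z : 'rV[R]_n | enorm (z - x0) <= r / 2] `<=` eball x0 r.
    by move=> z /= h; rewrite /eball/=; lra.
  have [f [lf f01 f1 fz]] := lip_cutoff (cpt (r / 2)) (@eball_open R n x0 r n0) sub (fun _ h => h).
  have [fD _] := fin X0 Delta nX0 mD sD; have [G sG] := lipc_sol n0 d0 dn C01 S hU lf.
  apply: (@le_trans _ _ (U f X0)).
    apply: (ML _ _ _ _ _ _ _ S sG _ Gx0 r0 ck); first by move=> z; have /andP[] := U01 f z lf f01.
    by move=> z Gz hz; rewrite (lipc_bdry n0 d0 C01 S hU)// f1//=; exact: ltW.
  rewrite -lee_fin fineK//.
  apply: (u2_le cG (u2 := fun f => U f X0) (fun f => Ige X0 f nX0) lf mD) => //.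
  by move=> x Gx nx; apply: fz => h; apply: nx.
have ratio (E F : set (borelT R n)) X : measurable E -> measurable F ->
    E `<=` Gamma `&` eball x0 r -> F `<=` Gamma `&` eball x0 r -> 0 < fine (omega X0 F) -> ~ Gamma X -> ~ eball x0 (2 * r) X ->
    Cb^-1 * (fine (omega X0 E) / fine (omega X0 F)) <= fine (omega X E) / fine (omega X F) <=
    Cb * (fine (omega X0 E) / fine (omega X0 F)).
  move=> mE mF sE sF F0 nX hX; have FX := posit F X mF sF nX F0.
  by apply: ratio_bounds => //; apply: key.
have fpos (D : set (borelT R n)) : (0 < omega X0 D)%E -> omega X0 D \is a fin_num -> 0 < fine (omega X0 D).
  by move=> D0 fD; rewrite -lte_fin fineK.
have CV : (Cb + Cb / cm)^-1 <= Cb^-1 by rewrite lef_pV2 ?posrE ?ltr_wpDr// lerDl.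
split.
  move=> E F mE mF sE sF E0 F0 X nX hX.
  have [fE _] := fin X0 E nX0 mE sE; have [fF _] := fin X0 F nX0 mF sF.
  have /andP[h1 h2] := ratio E F X mE mF sE sF (fpos F F0 fF) nX hX.
  have q0 : 0 <= fine (omega X0 E) / fine (omega X0 F) by rewrite divr_ge0 ?ltW ?fpos.
  apply/andP; split; first by apply: le_trans h1; apply: ler_wpM2r.
  by apply: le_trans h2 _; apply: ler_wpM2r => //; rewrite lerDl.
move=> E mE sE E0 X nX hX; have [fE _] := fin X0 E nX0 mE sE.
have [_ /andP[D0 D1]] := fin X0 Delta nX0 mD sD.
have Dp : 0 < fine (omega X0 Delta) by apply: lt_le_trans massD.
have /andP[h1 h2] := ratio E Delta X mE mD sE sD Dp nX hX.
have Ep := fpos E E0 fE.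
(* The measure of the surface ball at [X0] lies between [cm] and 1: the upper bound gives the left
   inequality, the lower bound the right one. *)
apply/andP; split.
  apply: le_trans h1; apply: ler_pM; rewrite ?invr_ge0 ?(ltW Ep)//.
    by rewrite addr_ge0// ltW.
  by rewrite ler_pdivlMr// ler_piMr// ltW.
apply: le_trans h2 _; rewrite mulrDl; apply: (@le_trans _ _ (Cb / cm * fine (omega X0 E))); last first.
  by rewrite lerDr mulr_ge0// ltW.
rewrite mulrA mulrAC; apply: ler_wpM2r; first exact: ltW.
by rewrite ler_pM2l// lef_pV2.
Qed.
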